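(* Let $M$ be a closed smooth Riemannian manifold and let $f : M \to \mathbb{R}$ be a bowl function on $M$. Let $C_f$ be the topological category whose objects are the critical points of $f$, whose space of morphisms from $p$ to $q$ is the compactified moduli space $\overline{M}(p,q)$ of gradient flow lines from $p$ to $q$, and whose composition is the inclusion $\overline{M}(p,r)\times\overline{M}(r,q)\hookrightarrow\overline{M}(p,q)$. Then the classifying space $BC_f$ is homeomorphic to $M$.
   Context: Setting. $f$ is a Morse function on the closed smooth Riemannian manifold $M$, $m=\dim M$; $\mathrm{Cri}(f)$ is its set of critical points, $\lambda(p)$ the Morse index of $p$; $\gamma_x$ is the flow line of the negative gradient $-\nabla f$ with $\gamma_x(0)=x$. $W^u(p)=\{x : \lim_{t\to-\infty}\gamma_x(t)=p\}$ and $W^s(p)=\{x : \lim_{t\to+\infty}\gamma_x(t)=p\}$ are the unstable and stable manifolds. Standing assumption: for each $p\in\mathrm{Cri}(f)$ there is a smooth chart $\alpha_p$ from an open ball around $0$ in $\mathbb{R}^{\lambda(p)}\times\mathbb{R}^{m-\lambda(p)}$ onto a neighborhood of $p$, with $\alpha_p(0)=p$, in which $f$ has the form $f(\alpha_p(x,y))=f(p)-|x|^2+|y|^2$ and $-\nabla f$ has the form $(2x,-2y)$. Bowl function. $f$ is a bowl function if for all $p,q\in\mathrm{Cri}(f)$: (1) $W^s(q)$ and $W^u(p)$ intersect transversally (Morse-Smale), and (2) either $W^u(q)\cap\overline{W^u(p)}=\emptyset$ or $W^u(q)\subset\overline{W^u(p)}$. Order. $p\geq q$ means $W^u(q)\subset\overline{W^u(p)}$;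 this is a partial order on $\mathrm{Cri}(f)$; $p>q$ means $p\ge q$ and $p\neq q$. Moduli spaces. For $p>q$, $M(p,q)$ is the space of (unparametrized) gradient flow lines from $p$ to $q$, i.e. flow lines in $W(p,q)=W^u(p)\cap W^s(q)$ modulo time translation; for any regular value $t$ with $f(q)<t<f(p)$ it is identified, as a topological space, with $W(p,q)\cap f^{-1}(t)$ via $x\mapsto\gamma_x$. Compactified moduli spaces. A critical sequence from $p$ to $q$ is a chain $I: p>p_1>\dots>p_{n-1}>q$ of critical points ($n\ge 1$); put $M_I=M(p,p_1)\times\dots\times M(p_{n-1},q)$. For $p>q$, $\overline{M}(p,q)=\coprod_I M_I$ as a set, over all critical sequences $I$ from $p$ to $q$. An element $\Gamma\in\overline{M}(p,q)$ determines a broken flow line $\overline\Gamma$ from $p$ to $q$ by concatenation. Let the critical values of $f$ divide $[f(q),f(p)]$ into intervals $[c_i,c_{i+1}]$, $i=0,\dots,\ell$, with $c_0=f(q)$, $c_{\ell+1}=f(p)$, and choose $a_i\in(c_i,c_{i+1})$. Then $\overline\Gamma$ meets $f^{-1}(a_i)$ in exactly one point $x_i(\Gamma)$, and $\overline{M}(p,q)$ carries the unique topology for which $E:\overline{M}(p,q)\to\prod_{i=0}^{\ell}f^{-1}(a_i)$, $E(\Gamma)=(x_0(\Gamma),\dots,x_\ell(\Gamma))$, is an embedding (this does not depend on the choice of the $a_i$). In the category $C_f$, the morphism space from $p$ to $p$ is a single point (the identity) and the morphism space from $p$ to $q$ is empty if $p\not\geq q$; the inclusion $\overline{M}(p,r)\times\overline{M}(r,q)\hookrightarrow\overline{M}(p,q)$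 is concatenation of sequences of flow lines. Topological category. It has a (discrete) set of objects, topological spaces of morphisms, and continuous composition. The classifying space $BC$ is the geometric realization of the nerve of $C$ (a simplicial space). *)

(* Defs.v *)
From HB Require Import structures.
From Stdlib Require Import Relation_Operators.
From mathcomp Require Import all_boot all_order all_algebra.
From mathcomp Require Import lra generic_quotient.
From mathcomp Require Import all_classical all_reals all_analysis.

Set Implicit Arguments.
Unset Strict Implicit.
Unset Printing Implicit Defensive.

Import Order.TTheory GRing.Theory Num.Theory.
Import numFieldNormedType.Exports.

Local Open Scope classical_set_scope.
Local Open Scope ring_scope.
Local Open Scope quotient_scope.

(* Meant for [U] open and finite-dimensional [V]: all iterated directional
   derivatives of order < k are Frechet differentiable on U, and those of order
   k are continuous there. *)
Fixpoint Ck (R : numFieldType) (V W : normedModType R) (U : set V) (k : nat)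
    (h : V -> W) : Prop :=
  if k is k'.+1 then
    (forall x, U x -> differentiable h x) /\ (forall v, Ck U k' ('D_v h))
  else forall x, U x -> {for x, continuous h}.

Definition smooth_on (R : numFieldType) (V W : normedModType R) (U : set V)
    (h : V -> W) : Prop :=
  forall k, Ck U k h.

(* A homeomorphism [crd] from the open set [dom] of T onto the open set [cod]
   of R^m, with inverse [par].  Both maps are total functions, meaningful only
   on [dom] and [cod]. *)
Record chart (R : realType) (m : nat) (T : topologicalType) := Chart {
  dom : set T;
  cod : set 'rV[R]_m;
  crd : T -> 'rV[R]_m;
  par : 'rV[R]_m -> T;
  dom_open : open dom;
  cod_open : open cod;
  crd_cod : forall x, dom x -> cod (crd x);
  par_dom : forall z, cod z -> dom (par z);
  crdK : forall x, dom x -> par (crd x) = x;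
  parK : forall z, cod z -> crd (par z) = z;
  crd_continuous : forall x, dom x -> {for x, continuous crd};
  par_continuous : forall z, cod z -> {for z, continuous par} }.

Definition transition (R : realType) (m : nat) (T : topologicalType)
    (c d : chart R m T) : 'rV[R]_m -> 'rV[R]_m :=
  crd d \o par c.

Definition compatible (R : realType) (m : nat) (T : topologicalType)
    (c d : chart R m T) : Prop :=
  smooth_on (cod c `&` par c @^-1` dom d) (transition c d) /\
  smooth_on (cod d `&` par d @^-1` dom c) (transition d c).

(* The Riemannian metric is given by its Gram matrices: [metric c z] is the
   matrix, in the coordinates of the chart [c], of the inner product on the
   tangent space at [par c z].  Tangent vectors are rows, so that
   ['d h z v = v *m 'J h z]. *)
Record riemannian_manifold (R : realType) (m : nat) := RiemannianManifold {
  carrier :> topologicalType;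
  carrier_hausdorff : hausdorff_space carrier;
  carrier_second_countable : @second_countable carrier;
  atlas : set (chart R m carrier);
  atlas_cover : forall x, exists2 c, atlas c & dom c x;
  atlas_compatible : forall c d, atlas c -> atlas d -> compatible c d;
  metric : chart R m carrier -> 'rV[R]_m -> 'M[R]_m;
  metric_smooth : forall c, atlas c -> smooth_on (cod c) (metric c);
  metric_sym : forall c z, atlas c -> cod c z -> (metric c z)^T = metric c z;
  metric_pos : forall c z (v : 'rV[R]_m), atlas c -> cod c z -> v != 0 ->
    0 < (v *m metric c z *m v^T) ord0 ord0;
  metric_change : forall c d x, atlas c -> atlas d -> dom c x -> dom d x ->
    metric c (crd c x) =
      'J (transition c d) (crd c x) *m metric d (crd d x)
        *m ('J (transition c d) (crd c x))^T }.

Section GradientFlow.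
Context (R : realType) (m : nat) (M : riemannian_manifold R m) (f : M -> R).

(* Membership in the maximal atlas. *)
Definition smooth_chart (a : chart R m M) : Prop :=
  forall c, atlas c -> compatible a c.

Definition smooth_function : Prop :=
  forall c, atlas c -> smooth_on (cod c) (f \o par c).

Definition partials (c : chart R m M) (z : 'rV[R]_m) : 'rV[R]_m :=
  \row_i 'D_(delta_mx ord0 i) (f \o par c) z.

Definition critical (p : M) : Prop :=
  forall c, atlas c -> dom c p -> partials c (crd c p) = 0.

(* The vector representing the differential of f for the inner product. *)
Definition gradient (c : chart R m M) (z : 'rV[R]_m) : 'rV[R]_m :=
  partials c z *m invmx (metric c z).

Definition flow_line (g : R -> M) : Prop :=
  continuous g /\
  forall t c, atlas c -> dom c (g t) ->
    is_derive t 1 (crd c \o g) (- gradient c (crd c (g t))).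

Definition Wu (p : M) : set M :=
  [set x | exists g, [/\ flow_line g, g 0 = x & g t @[t --> -oo] --> p]].

Definition Ws (p : M) : set M :=
  [set x | exists g, [/\ flow_line g, g 0 = x & g t @[t --> +oo] --> p]].

Definition hessian (c : chart R m M) (z : 'rV[R]_m) : 'M[R]_m :=
  \matrix_(i, j)
    'D_(delta_mx ord0 i) ('D_(delta_mx ord0 j) (f \o par c)) z.

Definition morse : Prop :=
  smooth_function /\
  forall p c, critical p -> atlas c -> dom c p ->
    hessian c (crd c p) \in unitmx.

(* [H] is negative definite on some subspace of dimension k. *)
Definition neg_definite_dim (H : 'M[R]_m) (k : nat) : Prop :=
  exists2 B : 'M[R]_(k, m), row_free B &
    forall u : 'rV[R]_m, (u <= B)%MS -> u != 0 ->
      (u *m H *m u^T) ord0 ord0 < 0.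

Definition morse_index (p : M) (k : nat) : Prop :=
  forall c, atlas c -> dom c p ->
    neg_definite_dim (hessian c (crd c p)) k /\
    forall k', neg_definite_dim (hessian c (crd c p)) k' -> (k' <= k)%N.

(* Points of R^k x R^(m-k) are rows z of length m: x consists of the entries of
   index < k, y of the other ones. *)
Definition standard_chart (p : M) (k : nat) (a : chart R m M) : Prop :=
  [/\ smooth_chart a,
      exists2 e : R, 0 < e & cod a = [set z | \sum_i z ord0 i ^+ 2 < e ^+ 2],
      par a 0 = p,
      forall z, cod a z ->
        f (par a z) = f p - \sum_(i < m | (i < k)%N) z ord0 i ^+ 2
                          + \sum_(i < m | (k <= i)%N) z ord0 i ^+ 2 &
      forall z c, cod a z -> atlas c -> dom c (par a z) ->
        (\row_(i < m) (if (i < k)%N then 2 * z ord0 i else - 2 * z ord0 i))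
          *m 'J (transition a c) z
        = - gradient c (crd c (par a z))].

Definition standard_near_critical : Prop :=
  forall p, critical p ->
    exists2 k, morse_index p k & exists a, standard_chart p k a.

(* Coordinates in [c] of the velocities at x of smooth curves lying in S; for
   an embedded submanifold S this is its tangent space at x. *)
Definition tangent (S : set M) (x : M) (c : chart R m M) : set 'rV[R]_m :=
  [set v | exists g : R -> M, exists2 e : R, 0 < e &
    [/\ forall t, `|t| < e -> (S `&` dom c) (g t),
        smooth_on [set t : R | `|t| < e] (crd c \o g),
        g 0 = x & 'D_1 (crd c \o g) 0 = v]].

Definition transversal (S T : set M) : Prop :=
  forall x c, (S `&` T) x -> atlas c -> dom c x ->
    forall v, exists u w, [/\ tangent S x c u, tangent T x c w & v = u + w].

Definition bowl : Prop :=
  [/\ morse,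
      forall p q, critical p -> critical q -> transversal (Ws q) (Wu p) &
      forall p q, critical p -> critical q ->
        Wu q `&` closure (Wu p) = set0 \/ Wu q `<=` closure (Wu p)].

Definition cri : set M := [set p | critical p].

Definition crit_ge (p q : M) : Prop := Wu q `<=` closure (Wu p).
Definition crit_gt (p q : M) : Prop := crit_ge p q /\ p <> q.

Definition flow_from_to (p q : M) : set (R -> M) :=
  [set g | [/\ flow_line g, g t @[t --> -oo] --> p & g t @[t --> +oo] --> q]].

Definition translates (g : R -> M) : set (R -> M) :=
  [set (fun t => g (t + s)) | s in [set: R]].

(* M(p, q): flow lines from p to q modulo time translation, an unparametrized
   flow line being the set of its parametrizations. *)
Definition moduli (p q : M) : Type :=
  [set translates g | g in flow_from_to p q].

(* Critical sequences from p to q together with an element of M_I.  The empty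
   sequence, allowed only from p to itself, is the identity morphism of p; see
   [broken_refl] and [broken_crit_ge] for the other degenerate cases. *)
Inductive broken : cri -> cri -> Type :=
| broken_nil p : broken p p
| broken_cons p r q :
    crit_gt (val p) (val r) -> moduli (val p) (val r) -> broken r q ->
    broken p q.

HB.instance Definition _ (p q : cri) := gen_eqMixin (broken p q).
HB.instance Definition _ (p q : cri) := gen_choiceMixin (broken p q).

Fixpoint broken_cat p r q (G : broken p r) : broken r q -> broken p q :=
  match G in broken p r return broken r q -> broken p q with
  | broken_nil _ => id
  | broken_cons _ _ _ pr g G' => fun H => broken_cons pr g (broken_cat G' H)
  end.

(* The broken flow line in M, as a set of points, critical points included. *)
Fixpoint points p q (G : broken p q) : set M :=
  match G with
  | broken_nil p => [set val p]
  | broken_cons p _ _ _ g G' =>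
      val p |` ([set x | exists2 h, (val g : set (R -> M)) h & exists t, h t = x]
                `|` points G')
  end.

Definition critical_value (c : R) : Prop := exists2 p, critical p & f p = c.

Definition consecutive (c c' : R) : Prop :=
  [/\ critical_value c, critical_value c', c < c' &
      forall b, c < b < c' -> ~ critical_value b].

(* [a c c'] is the level chosen between the consecutive critical values c, c'. *)
Definition level_choice (a : R -> R -> R) : Prop :=
  forall c c', consecutive c c' -> c < a c c' < c'.

Definition gaps (p q : M) : set (R * R) :=
  [set cc | [/\ consecutive cc.1 cc.2, f q <= cc.1 & cc.2 <= f p]].

(* The true codomain of the embedding, the product of the levels f^{-1}(a_i), is seen inside a
   power of M: it carries the topology induced from it.  The set below is
   never empty, see [points_meet_level]. *)
Definition evaluation (a : R -> R -> R) p q (G : broken p q) :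
    prod_topology (fun _ : gaps (val p) (val q) => M : topologicalType) :=
  fun cc => xget (val p) (points G `&` f @^-1` [set a (val cc).1 (val cc).2]).

Definition moduli_bar (a : R -> R -> R) (p q : cri) : topologicalType :=
  initial_topology (@evaluation a p q).

End GradientFlow.

Section FlowTheory.
Context (R : realType) (m : nat) (M : riemannian_manifold R m) (f : M -> R).
Hypothesis f_smooth : smooth_function f.

Lemma partialsE (c : chart R m M) z (v : 'rV[R]_m) : atlas c -> cod c z ->
  'd (f \o par c) z v = (v *m (partials f c z)^T) ord0 ord0.
Proof.
move=> ac cz; have [/(_ _ cz) df _] := f_smooth ac 1%N.
rewrite [v in LHS]row_sum_delta linear_sum mxE; apply: eq_bigr => i _.
by rewrite linearZ !mxE -deriveE.
Qed.

Lemma metric_unit (c : chart R m M) z : atlas c -> cod c z ->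
  metric c z \in unitmx.
Proof.
move=> ac cz; rewrite unitmxE unitfE; apply/negP => /det0P[v v0 vG].
by have := metric_pos ac cz v0; rewrite vG mul0mx mxE ltxx.
Qed.

Lemma metric_inv_pos (c : chart R m M) z (v : 'rV[R]_m) : atlas c -> cod c z -> v != 0 ->
  0 < (v *m invmx (metric c z) *m v^T) ord0 ord0.
Proof.
move=> ac cz v0; have Gu := metric_unit ac cz.
have w0 : v *m invmx (metric c z) != 0.
  by apply: contra_neq v0 => /(congr1 (mulmx^~ (metric c z))); rewrite mulmxKV// mul0mx.
have := metric_pos ac cz w0; rewrite mulmxKV//.
rewrite -[v *m (_)^T]trmxK trmx_mul trmxK => /lt_le_trans; apply.
by rewrite mxE.
Qed.

Lemma f_continuous : continuous f.
Proof.
move=> x; have [c ac cx] := atlas_cover x.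
have cont : {for x, continuous ((f \o par c) \o crd c)}.
  apply: continuous_comp; first exact: crd_continuous.
  by have /(_ (crd c x)) := f_smooth ac 0%N; apply; exact: crd_cod.
rewrite /prop_for /continuous_at /= crdK// in cont.
apply: cvg_trans cont; apply: near_eq_cvg.
have : nbhs x (dom c) by apply: open_nbhs_nbhs; split=> //; exact: dom_open.
by apply: filterS => y cy /=; rewrite crdK.
Qed.

Lemma flow_derive (g : R -> M) t (c : chart R m M) : flow_line f g -> atlas c ->
  dom c (g t) ->
  is_derive t 1 (f \o g)
    (- (partials f c (crd c (g t)) *m invmx (metric c (crd c (g t)))
        *m (partials f c (crd c (g t)))^T) ord0 ord0).
Proof.
move=> [gc gf] ac cgt; have gd := gf t c ac cgt.
have cz := crd_cod cgt.
have [/(_ _ cz) df _] := f_smooth ac 1%N.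
have dg : differentiable (crd c \o g) t.
  by apply/derivable1_diffP; exact: ex_derive.
apply: (@near_eq_is_derive _ _ _ ((f \o par c) \o (crd c \o g))).
  have : nbhs t (g @^-1` dom c).
    by apply: gc; apply: open_nbhs_nbhs; split=> //; exact: dom_open.
  by apply: filterS => s cs /=; rewrite crdK.
have dfg : differentiable ((f \o par c) \o (crd c \o g)) t.
  exact: differentiable_comp.
apply: DeriveDef; first exact/derivable1_diffP.
rewrite deriveE// diff_comp//= -(@deriveE _ _ _ _ _ (1 : R) dg) (@derive_val _ _ _ _ _ _ _ gd) partialsE//.
by rewrite mulNmx mxE.
Qed.

Lemma flow_nincr (g : R -> M) : flow_line f g ->
  {homo f \o g : s t /~ s <= t}.
Proof.
move=> gf.
have D t : derivable (f \o g) t 1 /\ (f \o g)^`()%classic t <= 0.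
  have [c ac cgt] := atlas_cover (g t).
  have d := flow_derive gf ac cgt; split; first exact: ex_derive.
  rewrite derive1E derive_val oppr_le0.
  have [->|n0] := eqVneq (partials f c (crd c (g t))) 0.
    by rewrite !mul0mx mxE.
  exact/ltW/metric_inv_pos/n0/crd_cod.
have fgc : continuous (f \o g).
  by move=> t; apply: continuous_comp; [exact: gf.1|exact: f_continuous].
move=> t s st; apply: (@ler0_derive1_nincr _ _ s t) => //.
- by move=> x _; exact: (D x).1.
- by move=> x _; exact: (D x).2.
- exact: continuous_subspaceT.
Qed.

Lemma flow_le_start p q (g : R -> M) t : flow_from_to f p q g -> f (g t) <= f p.
Proof.
move=> [gf gp _].
have fp : f (g s) @[s --> -oo] --> f p.
  by apply: (@cvg_comp _ _ _ g f) gp _; exact: f_continuous.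
apply: cvgr_to_ge fp _; near=> s.
by apply: (flow_nincr gf); near: s; apply: nbhs_ninfty_le; exact: num_real.
Unshelve. all: by end_near. Qed.

Lemma flow_ge_end p q (g : R -> M) t : flow_from_to f p q g -> f q <= f (g t).
Proof.
move=> [gf _ gq].
have fq : f (g s) @[s --> +oo] --> f q.
  by apply: (@cvg_comp _ _ _ g f) gq _; exact: f_continuous.
apply: cvgr_to_le fq _; near=> s.
by apply: (flow_nincr gf); near: s; apply: nbhs_pinfty_ge; exact: num_real.
Unshelve. all: by end_near. Qed.

Lemma flow_meets_level p q (g : R -> M) b : flow_from_to f p q g ->
  f q < b -> b < f p -> exists t, f (g t) = b.
Proof.
move=> [gf gp gq] qb bp.
have fp : f (g s) @[s --> -oo] --> f p.
  by apply: (@cvg_comp _ _ _ g f) gp _; exact: f_continuous.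
have fq : f (g s) @[s --> +oo] --> f q.
  by apply: (@cvg_comp _ _ _ g f) gq _; exact: f_continuous.
have [s bs] : exists s, b <= f (g s).
  have H : \forall s \near -oo, b <= f (g s) by move/cvgr_ge : fp; apply.
  by have [s] := filter_ex H; exists s.
have [t tb] : exists t, f (g t) <= b.
  have H : \forall s \near +oo, f (g s) <= b by move/cvgr_le : fq; apply.
  by have [t] := filter_ex H; exists t.
have fgc : continuous (f \o g).
  by move=> x; apply: continuous_comp; [exact: gf.1|exact: f_continuous].
have [st|/ltW ts] := leP s t; last first.
  exists t; apply/eqP; rewrite eq_le tb/=; apply: le_trans bs _.
  exact: (flow_nincr gf).
have [||x _ <-] := @IVT _ (f \o g) s t b st; last by exists x.
- exact: continuous_subspaceT.
- by rewrite ge_min le_max/= bs tb orbT.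
Qed.

Lemma flow_constant p q (g : R -> M) : flow_from_to f p q g -> f p = f q ->
  p = q.
Proof.
move=> gpq fpq; have [gf gp gq] := gpq.
have fgE t : f (g t) = f p.
  apply/eqP; rewrite eq_le (flow_le_start _ gpq)/= {1}fpq.
  exact: flow_ge_end gpq.
have gE t c : atlas c -> dom c (g t) -> is_derive t 1 (crd c \o g) 0.
  move=> ac cgt; have := gf.2 t c ac cgt; rewrite /gradient.
  have d := flow_derive gf ac cgt.
  suff -> : partials f c (crd c (g t)) = 0 by rewrite mul0mx oppr0.
  apply/eqP/negPn/negP => n0.
  have := metric_inv_pos ac (crd_cod cgt) n0.
  rewrite -oppr_lt0 -(@derive_val _ _ _ _ _ _ _ d).
  rewrite (_ : f \o g = cst (f p)) ?derive_cst ?ltxx//.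
  by apply/funext => s /=.
have loc t : \forall s \near t, g s = g t.
  have [c ac cgt] := atlas_cover (g t).
  have : nbhs t (g @^-1` dom c).
    by apply: gf.1; apply: open_nbhs_nbhs; split=> //; exact: dom_open.
  move=> [e /= e0 eB]; exists e => //= s /= ts.
  rewrite -[LHS](crdK (eB _ ts)) -[RHS](crdK cgt); congr (par c _).
  apply/matrixP => i j; rewrite ord1 {i}.
  have hd u : `|t - u| < e ->
      is_derive u 1 (fun x => crd c (g x) ord0 j : R) 0.
    move=> tu; have d := gE u c ac (eB _ tu).
    have dv := @ex_derive _ _ _ _ _ _ _ d.
    apply: DeriveDef.
      by have /derivable_mxP := dv; apply.
    have := derive_mx dv; rewrite (@derive_val _ _ _ _ _ _ _ d).
    by move=> /matrixP/(_ ord0 j); rewrite !mxE.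
  pose h (u : R) : R := crd c (g u) ord0 j.
  have hle a b : `|t - a| < e -> `|t - b| < e -> a <= b -> h a = h b.
    move=> ta tb ab.
    have tin u : u \in `[a, b] -> `|t - u| < e.
      rewrite in_itv/= => /andP[au ub]; move: ta tb; rewrite !ltr_distlC.
      by move=> /andP[? ?] /andP[? ?]; apply/andP; split; lra.
    have din u : u \in `]a, b[ -> is_derive u 1 h 0.
      by move=> /subset_itv_oo_cc/tin; exact: hd.
    have ch : {within `[a, b], continuous h}.
      apply: derivable_within_continuous => u /tin tu.
      by have := hd _ tu => du; exact: (@ex_derive _ _ _ _ _ _ _ du).
    apply/eqP; rewrite eq_le; apply/andP; split; last first.
      apply: (@ler0_derive1_nincr _ h a b) => //.
      - by move=> u /din du; exact: (@ex_derive _ _ _ _ _ _ _ du).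
      - by move=> u /din du; rewrite derive1E (@derive_val _ _ _ _ _ _ _ du).
    apply: (@ger0_derive1_ndecr _ h a b) => //.
    - by move=> u /din du; exact: (@ex_derive _ _ _ _ _ _ _ du).
    - by move=> u /din du; rewrite derive1E (@derive_val _ _ _ _ _ _ _ du).
  have tt : `|t - t| < e by rewrite subrr normr0.
  have [st|/ltW st] := leP s t; first exact: hle.
  by symmetry; exact: hle.
have gcst t : g t = g 0.
  have cR : connected [set: R] by apply/connected_intervalP.
  suff E : [set s | g s = g 0] = setT.
    by have : [set: R] t by []; rewrite -E.
  apply: cR; first by exists 0.
  - exists [set s | g s = g 0]; rewrite ?setTI//.
    rewrite openE => s /= gs; have := loc s; rewrite gs /interior/=; exact.
  - exists [set s | g s = g 0]; rewrite ?setTI//.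
    rewrite closure_id eqEsubset; split; first exact: subset_closure.
    move=> s cs; have [u [/= <- ->//]] := cs _ (loc s).
have gc0 : g = cst (g 0) by apply/funext.
have cl := @cvg_unique _ (@carrier_hausdorff _ _ M).
rewrite gc0 in gp gq.
transitivity (g 0); first by apply: (cl _ _ _ _ gp); exact: cvg_cst.
by apply: (cl _ _ _ _ _ gq); exact: cvg_cst.
Qed.

End FlowTheory.

Section BrokenTheory.
Context (R : realType) (m : nat) (M : riemannian_manifold R m) (f : M -> R).
Hypothesis f_smooth : smooth_function f.

Lemma broken_cats0 p q (G : broken p q) :
  broken_cat G (broken_nil q) = G :> broken (f := f) p q.
Proof. by elim: G => //= *; congr broken_cons. Qed.

Lemma broken_catA p q r s (G : broken (f := f) p q) (H : broken q r)
    (K : broken r s) :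
  broken_cat G (broken_cat H K) = broken_cat (broken_cat G H) K.
Proof. by elim: G H => //= *; congr broken_cons. Qed.

Lemma points_start p q (G : broken (f := f) p q) : points G (val p).
Proof. by case: G => //= *; left. Qed.

Lemma points_cat p q r (G : broken (f := f) p q) (H : broken q r) :
  points (broken_cat G H) = points G `|` points H.
Proof.
elim: G H => [{}p H|{}p s {}q ps g G IH H] /=.
  by rewrite setUidr// => _ ->; exact: points_start.
by rewrite IH !setUA.
Qed.

Lemma moduli_flow p q (g : moduli f p q) (h : R -> M) :
  (val g : set (R -> M)) h -> exists2 h0, flow_from_to f p q h0 &
    exists s, forall t, h t = h0 (t + s).
Proof.
case: g => /= L /[!inE] -[h0 fh0 <-] [s _ <-].
by exists h0 => //; exists s.
Qed.

Lemma moduli_lt p q (g : moduli f p q) : crit_gt f p q -> f q < f p.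
Proof.
case: g => /= L /[!inE] -[h0 fh0 _] [_ pq].
rewrite lt_neqAle; apply/andP; split.
  by apply/negP => /eqP/esym/(flow_constant f_smooth fh0).
exact: le_trans (flow_ge_end f_smooth 0 fh0) (flow_le_start f_smooth 0 fh0).
Qed.

Lemma broken_le p q (G : broken (f := f) p q) : f (val q) <= f (val p).
Proof.
elim: G => // {}p r {}q pr g G IH; apply: le_trans IH _.
exact/ltW/moduli_lt.
Qed.

Lemma points_bound p q (G : broken (f := f) p q) x :
  points G x -> f (val q) <= f x <= f (val p).
Proof.
elim: G => [{}p /= ->|{}p r {}q pr g G IH /=]; first by rewrite lexx.
have rp := moduli_lt g pr; have qr := broken_le G.
move=> [->|[[h gh [t <-]]|/IH /andP[-> xr]]] /=.
- by rewrite lexx (le_trans qr)// ltW.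
- have [h0 fh [s ->]] := moduli_flow gh.
  rewrite (flow_le_start f_smooth _ fh) andbT.
  exact: le_trans qr (flow_ge_end f_smooth _ fh).
- exact: le_trans xr (ltW rp).
Qed.

Lemma broken_refl p (G : broken (f := f) p p) : G = broken_nil p.
Proof.
have : forall q q' (H : broken (f := f) q q') (e : q' = q),
    ecast q' (broken q q') e H = broken_nil q.
  move=> q q' [{}q e|{}q r {}q' qr g H e] /=.
    by rewrite (Prop_irrelevance e erefl).
  exfalso; have := le_lt_trans (broken_le H) (moduli_lt g qr).
  by rewrite e ltxx.
by move=> /(_ p p G erefl).
Qed.

Lemma broken_crit_ge p q : broken (f := f) p q -> crit_ge f (val p) (val q).
Proof.
elim=> [{}p|{}p r {}q [pr _] _ _ rq]; first exact: subset_closure.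
apply: subset_trans rq _.
have /closure_id -> := @closed_closure M (Wu f (val p)).
exact: closure_subset.
Qed.

Lemma points_meet_level p q (G : broken (f := f) p q) b :
  ~ critical_value f b -> f (val q) < b -> b < f (val p) ->
  exists2 x, points G x & f x = b.
Proof.
move=> bcrit; elim: G => [{}p pb bp|{}p r {}q pr g G IH qb bp].
  by have := lt_trans pb bp; rewrite ltxx.
have [br|rb|rb] := ltgtP b (f (val r)).
- by have [x Gx fx] := IH qb br; exists x => //=; right; right.
- case: g => /= L LP; have [h0 fh0 Lh0] := set_mem LP.
  have [t ht] := flow_meets_level f_smooth fh0 rb bp.
  exists (h0 t) => //; right; left; exists h0 => //=; last by exists t.
  by rewrite -Lh0; exists 0 => //; apply/funext => s; rewrite addr0.
- by exfalso; apply: bcrit; rewrite rb; exists (val r) => //; exact: set_valP.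
Qed.

Variable a : R -> R -> R.
Hypothesis a_level : level_choice f a.

Lemma xget_default (T : choiceType) (x y : T) (P : set T) :
  P !=set0 -> xget x P = xget y P.
Proof. by rewrite /xget => -[z Pz]; case: pselect => // -[]; exists z; exact/asboolP. Qed.

Lemma initial_component (I : eqType) (T : choiceType) (K : I -> topologicalType)
    (e : T -> prod_topology K) (i : I) :
  continuous (fun x : initial_topology e => e x i).
Proof.
move=> x; apply: (@cvg_comp _ _ _ e (proj i)).
  exact: (@initial_continuous _ _ e x).
exact: (@proj_continuous I K i).
Qed.

Lemma prod_continuous (I : Type) (T : topologicalType) (K : I -> topologicalType)
    (e : T -> prod_topology K) :
  (forall i, continuous (fun x => e x i)) -> continuous e.
Proof.
move=> ec x; apply/cvg_sup => i; move: x.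
apply/(@continuousP _ (initial_topology (@^~ i))) => A [B oB <-].
by have /continuousP := ec i; exact.
Qed.

Lemma broken_cat_continuous (p r q : cri f) :
  continuous (fun GH : moduli_bar a p r * moduli_bar a r q =>
    broken_cat (GH.1 : broken p r) (GH.2 : broken r q) : moduli_bar a p q).
Proof.
apply: continuous_comp_initial; apply: prod_continuous => -[[c c'] ccP].
have [/= [cc' ccv ltcc' gap] qc c'p] := set_mem ccP.
have /andP[ca ac'] := a_level (And4 cc' ccv ltcc' gap).
set b := a c c' in ca ac'.
have bcrit : ~ critical_value f b by apply: gap; rewrite ca ac'.
have rcrit : critical_value f (f (val r)) by exists (val r) => //; exact: set_valP.
have [rc|cr] := leP (f (val r)) c.
  have ccP' : (c, c') \in gaps f (val p) (val r) by rewrite inE; split.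
  rewrite (_ : (fun _ => _) = (fun G : moduli_bar a p r =>
      evaluation a G (exist _ (c, c') ccP')) \o fst); last first.
    apply/funext => -[G H] /=; rewrite /evaluation/=; congr xget.
    rewrite points_cat; apply/seteqP; split=> x [Gx fx]; last by split=> //; left.
    case: Gx => [Gx|/points_bound /andP[_ xr]]; first by split.
    exfalso.
    by have := le_lt_trans rc ca; rewrite ltNge -[b]fx xr.
  by move=> GH; apply: continuous_comp; [exact: cvg_fst|exact: initial_component].
have c'r : c' <= f (val r).
  by rewrite leNgt; apply/negP => rc'; apply: (gap (f (val r))); rewrite ?cr.
have ccP' : (c, c') \in gaps f (val r) (val q) by rewrite inE; split.
rewrite (_ : (fun _ => _) = (fun H : moduli_bar a r q =>
    evaluation a H (exist _ (c, c') ccP')) \o snd); last first.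
  apply/funext => -[G H] /=; rewrite /evaluation/= -/b.
  have qb : f (val q) < b by exact: le_lt_trans ca.
  have br : b < f (val r) by exact: lt_le_trans c'r.
  have [y Hy fy] := points_meet_level H bcrit qb br.
  rewrite (@xget_default _ (val r) (val p)); last by exists y.
  congr xget; rewrite points_cat.
  apply/seteqP; split=> x [Gx fx]; last by split=> //; right.
  case: Gx => [/points_bound /andP[rx _]|Gx]; last by split.
  exfalso.
  by move: br; rewrite ltNge -[b]fx rx.
by move=> GH; apply: continuous_comp; [exact: cvg_snd|exact: initial_component].
Qed.

End BrokenTheory.

(* Composition is written in diagrammatic order. *)
Record topological_category := TopologicalCategory {
  object : choiceType;
  hom : object -> object -> topologicalType;
  idm : forall x, hom x x;
  cmp : forall x y z, hom x y -> hom y z -> hom x z;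
  cmp1m : forall x y (g : hom x y), cmp (idm x) g = g;
  cmpm1 : forall x y (g : hom x y), cmp g (idm y) = g;
  cmpA : forall x y z w (g : hom x y) (h : hom y z) (k : hom z w),
    cmp g (cmp h k) = cmp (cmp g h) k;
  cmp_continuous : forall x y z,
    continuous (fun gh : hom x y * hom y z => cmp gh.1 gh.2) }.

(* Morphisms [k] -> [n] of the simplex category. *)
Record monotone (k n : nat) := Monotone {
  mfun :> 'I_k.+1 -> 'I_n.+1;
  mfunP : {homo mfun : i j / (i <= j)%N} }.

Definition monotone_id n : monotone n n :=
  @Monotone n n id (fun _ _ => id).

Definition monotone_comp k n l (s : monotone n l) (t : monotone k n) :
    monotone k l :=
  @Monotone k l (s \o t) (fun i j ij => mfunP s (mfunP t ij)).

Record simplicial_space := SimplicialSpace {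
  level :> nat -> topologicalType;
  smap : forall k n, monotone k n -> level n -> level k;
  smap_continuous : forall k n (t : monotone k n), continuous (smap t);
  smap_id : forall n x, smap (monotone_id n) x = x;
  smap_comp : forall k n l (s : monotone n l) (t : monotone k n) x,
    smap (monotone_comp s t) x = smap t (smap s x) }.

Section Realization.
Context (R : realType) (X : simplicial_space).

Definition std_simplex (n : nat) : set 'rV[R]_n.+1 :=
  [set u | (forall i, 0 <= u ord0 i) /\ \sum_i u ord0 i = 1].
Arguments std_simplex : clear implicits.

Definition push_row k n (t : monotone k n) (u : 'rV[R]_k.+1) : 'rV[R]_n.+1 :=
  \row_j \sum_(i | t i == j) u ord0 i.

Lemma push_rowP k n (t : monotone k n) (u : std_simplex k) :
  push_row t (val u) \in std_simplex n.
Proof.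
case: u => u /= /[!inE] -[u0 u1]; split=> [j|].
  by rewrite mxE; exact: sumr_ge0.
under eq_bigr do rewrite mxE.
by rewrite -u1 [RHS](partition_big t xpredT).
Qed.

Definition push k n (t : monotone k n) (u : std_simplex k) : std_simplex n :=
  exist (fun w => w \in std_simplex n) _ (push_rowP t u).

Definition cells : topologicalType :=
  {n : nat & (X n * std_simplex n)%type}.

Definition cell n (x : X n) (u : std_simplex n) : cells :=
  existT (fun n => (X n * std_simplex n)%type) n (x, u).

Inductive glued : cells -> cells -> Prop :=
| Glued k n (t : monotone k n) (x : X n) (u : std_simplex k) :
    glued (cell x (push t u)) (cell (smap t x) u).

Definition glue_equiv (c d : cells) : bool :=
  `[< clos_refl_sym_trans cells glued c d >].

Lemma glue_equiv_class : equiv_class_of glue_equiv.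
Proof.
split.
- by move=> c; apply/asboolP; exact: rst_refl.
- by move=> c d; apply/asboolP/asboolP; exact: rst_sym.
- move=> d c e /asboolP cd /asboolP de; apply/asboolP; exact: rst_trans cd de.
Qed.

Canonical glue_equiv_rel := EquivRelPack glue_equiv_class.

Definition realization : topologicalType :=
  quotient_topology {eq_quot glue_equiv_rel}.

End Realization.

Arguments std_simplex : clear implicits.

Section Nerve.
Context (C : topological_category).

Definition arrow (n : nat) : Type :=
  {ij : 'I_n.+1 * 'I_n.+1 | (ij.1 <= ij.2)%N}.

Definition arr n (i j : 'I_n.+1) (ij : (i <= j)%N) : arrow n :=
  exist _ (i, j) ij.

(* An n-simplex of the nerve is a functor from the ordered set {0, .., n} to C,
   given by its vertices v and the morphisms v i -> v j for i <= j. *)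
Definition arrows n (v : 'I_n.+1 -> object C) : topologicalType :=
  prod_topology (fun e : arrow n =>
    hom (v (val e).1) (v (val e).2) : topologicalType).

Definition functors n (v : 'I_n.+1 -> object C) : set (arrows v) :=
  [set F : forall e : arrow n, hom (v (val e).1) (v (val e).2) |
    (forall (i : 'I_n.+1) (ii : (i <= i)%N), F (arr ii) = idm (v i)) /\
    (forall (i j k : 'I_n.+1)
        (ij : (i <= j)%N) (jk : (j <= k)%N) (ik : (i <= k)%N),
       cmp (F (arr ij)) (F (arr jk)) = F (arr ik))].
Arguments functors {n} v.

Definition nerve_level (n : nat) : topologicalType :=
  {v : 'I_n.+1 -> object C & functors v}.

Definition arrow_map k n (t : monotone k n) (e : arrow k) : arrow n :=
  arr (mfunP t (valP e)).

Lemma pullbackP k n (t : monotone k n) v (F : functors v) :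
  (fun e => (val F : forall e : arrow n, hom (v (val e).1) (v (val e).2))
     (arrow_map t e)) \in functors (v \o t).
Proof.
case: F => F /= /[!inE] -[F1 Fc]; split=> [i ii|i j l ij jl il].
  exact: F1.
exact: Fc.
Qed.

Definition nerve_map k n (t : monotone k n) (s : nerve_level n) :
    nerve_level k :=
  existT (fun v => functors v) (tag s \o t)
    (exist (fun F => F \in functors (tag s \o t)) _ (pullbackP t (tagged s))).

Lemma nerve_map_continuous k n (t : monotone k n) : continuous (nerve_map t).
Proof.
move=> [v F] U nU.
pose h (G : functors v) : functors (v \o t) :=
  exist (fun F => F \in functors (v \o t)) _ (pullbackP t G).
have hc : continuous h.
  apply: continuous_comp_initial; apply: prod_continuous => e.
  exact: (@initial_component _ _ _ (fun G : functors v => val G) (arrow_map t e)).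
exact: (hc F _ nU).
Qed.

Lemma nerve_map_id n (s : nerve_level n) : nerve_map (monotone_id n) s = s.
Proof.
case: s => v [F FP]; rewrite /nerve_map /=; congr existT.
apply: val_inj => /=; apply: functional_extensionality_dep => -[[i j] ij] /=.
rewrite /arrow_map /arr /=; move: (valP _) => /= ij'.
by rewrite (bool_irrelevance ij' ij).
Qed.

Lemma nerve_map_comp k n l (s : monotone n l) (t : monotone k n)
    (x : nerve_level l) :
  nerve_map (monotone_comp s t) x = nerve_map t (nerve_map s x).
Proof.
case: x => v [F FP]; rewrite /nerve_map /=; congr existT.
apply: val_inj => /=; apply: functional_extensionality_dep => -[[i j] ij] /=.
rewrite /arrow_map /arr /=.
move: (mfunP s (mfunP t _)) (mfunP s (valP _)) => /= p q.
by rewrite (bool_irrelevance p q).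
Qed.

Definition nerve : simplicial_space :=
  SimplicialSpace nerve_map_continuous nerve_map_id nerve_map_comp.

End Nerve.

Arguments functors {C n} v.

Definition classifying_space (R : realType) (C : topological_category) :
    topologicalType :=
  realization R (nerve C).

Definition homeomorphic (X Y : topologicalType) : Prop :=
  exists (h : X -> Y) (k : Y -> X),
    [/\ cancel h k, cancel k h, continuous h & continuous k].

Lemma bowl_smooth (R : realType) (m : nat) (M : riemannian_manifold R m)
    (f : M -> R) : bowl f -> smooth_function f.
Proof. by case=> -[]. Qed.

Definition flow_category (R : realType) (m : nat) (M : riemannian_manifold R m)
    (f : M -> R) (f_bowl : bowl f) (a : R -> R -> R)
    (a_level : level_choice f a) : topological_category :=
  @TopologicalCategory (cri f) (moduli_bar a)
    (@broken_nil _ _ _ f) (@broken_cat _ _ _ f)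
    (fun p q G => erefl G) (@broken_cats0 _ _ _ f) (@broken_catA _ _ _ f)
    (broken_cat_continuous (bowl_smooth f_bowl) a_level).

(* Main.v *)
(* Parametrized by height, broken flow lines from p to q form a compact space.
 Gluing (a contraction in the standard charts) gives its broken part a collar,
 hence a motion of the space that is injective and smooths all breaks at positive
 times. Iterating it, [tht] turns a broken line g with weights w on its breaks
 into a line broken exactly where w = 1, and each line arises once. A point of
 BC_f is a broken line g with masses t on its breaks and ends; send it to the
 point at height \sum_c t c * f c of the line got from g with weights [shr t].
 This is a continuous bijection from a compact space onto a Hausdorff one. *)
From HB Require Import structures.
Require Import Defs.
From Stdlib Require Import Relation_Operators.
From mathcomp Require Import all_boot all_order all_algebra.
From mathcomp Require Import ring lra.
From mathcomp Require Import all_classical all_reals all_analysis.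

Set Implicit Arguments.
Unset Strict Implicit.
Unset Printing Implicit Defensive.

Import Order.TTheory GRing.Theory Num.Theory.
Import numFieldNormedType.Exports.

Local Open Scope classical_set_scope.
Local Open Scope ring_scope.

(* [lra] is slow in a large context. *)
Ltac revert_cmp := repeat match goal with
 | H : is_true (@Order.lt _ _ _ _) |- _ => revert H
 | H : is_true (@Order.le _ _ _ _) |- _ => revert H
 | H : @eq (Real.sort _) _ _ |- _ => revert H end.
Ltac qlra := first [revert_cmp; clear; lra | lra].

(** The compactified moduli spaces get no smooth structure. Their topology rests on one
    equicontinuity estimate for lines, [line_near]: with Tychonoff's theorem it gives compactness
    and joint continuity of evaluation. Gluing only has to supply a collar near each broken line,
    and the local collars are merged by attaching an exterior collar and absorbing it in finitely
    many steps. The weight at r is t_r / (t_r + A B), where A and B are the masses above and below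
    r. It is 1 at the highest and the lowest point with mass, so the line breaks there and only the
    part in between matters; this is the invariance that the gluing relation of the realization
    demands. In between it is less than 1, so the point lands on a genuine orbit. Conversely, the
    weights and the mass at the top determine all masses, and the height increases with that top
    mass; this gives bijectivity. The obstacle is continuity: outside the range of the masses the
    weight has the form 0 / 0 and jumps. Therefore [evl_cts] handles all weights s with s (t_r + A
    B) = t_r at once, by compactness of the cube of weights. *)

Local Notation ccomp f g := (@continuous_comp _ _ _ f g).

(** * Calculus of matrix-valued curves and differential equations *)

Lemma entry_le (R : realType) (m n : nat) (x : 'M[R]_(m, n)) i j :
 `|x i j| <= `|x|.
Proof.
rewrite [leRHS]mx_normrE.
exact: (le_bigmax _ (fun ij : 'I_m * 'I_n => `|x ij.1 ij.2|) (i, j)).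
Qed.

Lemma mxn_le (R : realType) (m n : nat) (x : 'M[R]_(m, n)) (c : R) :
 0 <= c -> (forall i j, `|x i j| <= c) -> `|x| <= c.
Proof.
move=> c0 xc; rewrite [leLHS]mx_normrE.
by apply: bigmax_le => // -[i j] _; exact: xc.
Qed.

Lemma is_drv_mx (R : realType) (m n : nat) (w : R -> 'M[R]_(m, n)) (t : R) dw :
 is_derive t 1 w dw <-> forall i j, is_derive t 1 (fun s => w s i j) (dw i j).
Proof.
split=> [d i j|d].
 have dv := @ex_derive _ _ _ _ _ _ _ d.
 apply: DeriveDef; first by have /derivable_mxP := dv; apply.
 have := derive_mx dv; rewrite (@derive_val _ _ _ _ _ _ _ d).
 by move=> /matrixP/(_ i j); rewrite !mxE.
have dv : derivable w t 1.
 by apply/derivable_mxP => i j; exact: (@ex_derive _ _ _ _ _ _ _ (d i j)).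
apply: DeriveDef => //; rewrite derive_mx//; apply/matrixP => i j.
by rewrite !mxE (@derive_val _ _ _ _ _ _ _ (d i j)).
Qed.

(** The norm is the largest absolute value of an entry, so the real mean value theorem for each
    entry suffices. *)
Lemma mean_value_mx (R : realType) (m n : nat) (w w' : R -> 'M[R]_(m, n)) (a b K : R) :
 a <= b -> (forall t, a <= t <= b -> is_derive t 1 w (w' t)) ->
 (forall t, a <= t <= b -> `|w' t| <= K) -> `|w b - w a| <= K * (b - a).
Proof.
move=> ab dw wK; have K0 : 0 <= K by apply: le_trans (wK a _) => //; rewrite lexx.
apply: mxn_le => [|i j]; first by rewrite mulr_ge0// subr_ge0.
have d t : a <= t <= b -> is_derive t 1 (fun s => w s i j) (w' t i j).
 by move=> /dw /is_drv_mx; exact.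
have [||c cab e] := @MVT_segment _ (fun s => w s i j) (fun s => w' s i j) _ _ ab.
- by move=> t; rewrite in_itv/= => /andP[? ?]; apply: d; rewrite !ltW.
- apply: derivable_within_continuous => t; rewrite in_itv/= => /d dt.
 exact: (@ex_derive _ _ _ _ _ _ _ dt).
rewrite !mxE e normrM [`|b - a|]ger0_norm ?subr_ge0//.
rewrite ler_wpM2r ?subr_ge0//; apply: le_trans (entry_le _ _ _) (wK _ _).
by move: cab; rewrite in_itv.
Qed.

Lemma mean_value_mx_sym (R : realType) (m n : nat) (w w' : R -> 'M[R]_(m, n)) (T K : R) :
 (forall t : R, `|t| <= T -> is_derive t 1 w (w' t)) ->
 (forall t : R, `|t| <= T -> `|w' t| <= K) ->
 forall t : R, `|t| <= T -> `|w t - w 0| <= K * `|t|.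
Proof.
move=> dw wK t tT; have [t0|t0] := leP 0 t.
 have := @mean_value_mx _ _ _ w w' 0 t K t0; rewrite subr0 (ger0_norm t0).
 apply=> s /andP[s0 st].
  by apply: dw; rewrite (ger0_norm s0) (le_trans st)// (le_trans (ler_norm _) tT).
 by apply: wK; rewrite (ger0_norm s0) (le_trans st)// (le_trans (ler_norm _) tT).
have := @mean_value_mx _ _ _ w w' t 0 K (ltW t0).
rewrite sub0r distrC (ltr0_norm t0); apply=> s /andP[st s0].
 by apply: dw; move: tT; rewrite (ler0_norm s0) (ltr0_norm t0); lra.
by apply: wK; move: tT; rewrite (ler0_norm s0) (ltr0_norm t0); lra.
Qed.

(* Twice the time span at most 1/L, the growth is absorbed by the supremum, so
 no exponential is needed. *)
Lemma gronwall_short (R : realType) (m n : nat) (w w' : R -> 'M[R]_(m, n)) (T L e : R) :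
 0 <= T -> 0 <= L -> L * T <= 2^-1 -> 0 <= e ->
 (forall t : R, `|t| <= T -> is_derive t 1 w (w' t)) ->
 (forall t : R, `|t| <= T -> `|w' t| <= L * `|w t| + e) ->
 forall t : R, `|t| <= T -> `|w t| <= 2 * `|w 0| + 2 * T * e.
Proof.
move=> T0 L0 LT e0 dw wL.
have TT : - T <= T by lra.
have [|c cT cmax] := @EVT_max _ (fun t => `|w t|) _ _ TT.
 apply: (@continuous_in_subspaceT _ _ _ (fun t => `|w t|)) => t.
 rewrite inE/= in_itv/= => tT.
 have {}tT : `|t| <= T by rewrite ler_norml.
 apply: (ccomp w (fun x => `|x|)); last exact: norm_continuous.
 apply: differentiable_continuous; apply/derivable1_diffP.
 exact: (@ex_derive _ _ _ _ _ _ _ (dw _ tT)).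
have c' t : `|t| <= T -> `|w t| <= `|w c|.
 by move=> tT; apply: cmax; rewrite in_itv/= -ler_norml.
have {}cT : `|c| <= T by rewrite ler_norml; move: cT; rewrite in_itv.
have : `|w c - w 0| <= (L * `|w c| + e) * `|c|.
 apply: (mean_value_mx_sym dw) => // t tT.
 by apply: le_trans (wL _ tT) _; rewrite lerD2r ler_wpM2l// c'.
have : `|w c| <= `|w c - w 0| + `|w 0|.
 by rewrite -{1}(subrK (w 0) (w c)) ler_normD.
have : (L * `|w c| + e) * `|c| <= (L * `|w c| + e) * T.
 by rewrite ler_wpM2l// addr_ge0// mulr_ge0.
have : L * T * `|w c| <= 2^-1 * `|w c| by rewrite ler_wpM2r.
move=> h1 h2 h3 h4 t /c' h5; apply: le_trans h5 _; nra.
Qed.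

Lemma antiderivative (R : realType) (g : R -> R) (T : R) : continuous g -> 0 < T ->
 exists2 G : R -> R, G 0 = 0 & forall t : R, `|t| < T -> is_derive t 1 G (g t).
Proof.
move=> gc T0; pose F x := (\int[lebesgue_measure]_(t in `[- T, x]) g t)%R.
exists (fun x => F x - F 0); first by rewrite subrr.
move=> t; rewrite ltr_norml => /andP[Tt tT].
have gi : lebesgue_measure.-integrable `[- T, T] (EFin \o g).
 apply: continuous_compact_integrable; first exact: segment_compact.
 exact: continuous_subspaceT.
have [dF eF] := @continuous_FTC1_closed _ g (- T) t T tT gi Tt (gc t).
have -> : g t = g t - 0 by rewrite subr0.
have dF' : is_derive t 1 F (g t) by apply: DeriveDef; rewrite -?derive1E.
exact: is_deriveB.
Qed.

Lemma antiderivative_mx (R : realType) (m n : nat) (g : R -> 'M[R]_(m, n)) (T : R) :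
 continuous g -> 0 < T ->
 exists2 G : R -> 'M[R]_(m, n), G 0 = 0 &
  forall t : R, `|t| < T -> is_derive t 1 G (g t).
Proof.
move=> gc T0.
have H (ij : 'I_m * 'I_n) : exists G : R -> R, G 0 = 0 /\
  forall t : R, `|t| < T -> is_derive t 1 G (g t ij.1 ij.2).
 have [|G G0 dG] := @antiderivative _ (fun t => g t ij.1 ij.2) T _ T0; last by exists G.
 move=> t; apply: (ccomp g (fun x : 'M[R]_(m, n) => x ij.1 ij.2)).
  exact: gc.
 exact: coord_continuous.
have [G HG] := choice H.
exists (fun t => \matrix_(i, j) G (i, j) t).
 by apply/matrixP => i j; rewrite !mxE (HG (i, j)).1.
move=> t tT; apply/is_drv_mx => i j.
under eq_fun do rewrite mxE.
exact: (HG (i, j)).2.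
Qed.
HB.instance Definition _ (R : realType) (m n : nat) := Complete.on 'M[R]_(m, n).

Lemma geometric_cauchy (R : realType) (V : completeNormedModType R) (u : nat -> V) (C : R) :
 (forall k, `|u k.+1 - u k| <= C / 2 ^+ k) ->
 exists l : V, forall k, `|l - u k| <= 2 * C / 2 ^+ k.
Proof.
move=> uC.
have C0 : 0 <= C.
 by have := uC 0; rewrite expr0 divr1; apply: le_trans; exact: normr_ge0.
have tail k j : `|u (k + j)%N - u k| <= 2 * C / 2 ^+ k - 2 * C / 2 ^+ (k + j).
 elim: j => [|j IH]; first by rewrite addn0 !subrr normr0.
 rewrite addnS -(subrK (u (k + j)%N) (u _.+1)) -addrA.
 apply: le_trans (ler_normD _ _) _; apply: le_trans (lerD (uC _) IH) _.
 rewrite exprS invfM; set a := (2 ^+ (k + j))^-1; set b := (2 ^+ k)^-1.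
 by have a0 : 0 <= a; [rewrite invr_ge0 exprn_ge0|nra].
have tail2 k j : `|u (k + j)%N - u k| <= 2 * C / 2 ^+ k.
 apply: le_trans (tail k j) _; rewrite lerBlDr lerDl.
 by rewrite divr_ge0 ?exprn_ge0 ?mulr_ge0.
have geo0 : (fun k => 2 * C / 2 ^+ k) @ \oo --> (0 : R).
 rewrite (_ : (fun k => _) = geometric (2 * C) 2^-1).
  by apply: cvg_geometric; rewrite ger0_norm ?invf_lt1 ?ltr1n.
 by apply/funext => k; rewrite /geometric /= exprVn.
have uc : cvgn u.
 apply: cauchy_cvg; apply: cauchy_exP => e e0.
 have [N _ HN] : \forall k \near \oo, `|2 * C / 2 ^+ k| < e.
  by move/cvgr0_norm_lt : geo0; apply.
 exists (u N); exists N => // k /= Nk; rewrite -ball_normE /= distrC.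
 rewrite -(subnKC Nk); apply: le_lt_trans (tail2 N _) _.
 by have := HN N (leqnn N); exact/le_lt_trans/ler_norm.
exists (lim (u @ \oo)) => k.
have : (fun j => `|u (k + j)%N - u k|) @ \oo --> `|lim (u @ \oo) - u k|.
 apply: cvg_norm; apply: cvgB; last exact: cvg_cst.
 rewrite (_ : (fun j => u (k + j)%N) = (fun j => u (j + k)%N)).
  by rewrite cvg_shiftn.
 by apply/funext => j; rewrite addnC.
by move=> /cvgr_to_le; apply; apply: nearW => j; exact: tail2.
Qed.

(** For T >= 0 this is the 1-Lipschitz retraction onto [-T, T]. It turns data given on an interval,
    or entry by entry on a cube, into globally defined data with the same Lipschitz constant. *)
Definition clamp (R : realType) (T t : R) : R := Num.max (- T) (Num.min T t).

Lemma clamp_norm (R : realType) (T t : R) : 0 <= T -> `|clamp T t| <= T.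
Proof.
move=> T0; rewrite /clamp ler_norml le_max lexx/= ge_max ge_min lexx/= andbT.
by rewrite (le_trans _ T0)// oppr_le0.
Qed.

Lemma clamp_id (R : realType) (T t : R) : `|t| <= T -> clamp T t = t.
Proof.
rewrite ler_norml => /andP[Tt tT]; rewrite /clamp.
by rewrite min_r// max_r.
Qed.

Lemma max_min_lip (R : realType) (a b s t : R) :
 `|Num.max a (Num.min b s) - Num.max a (Num.min b t)| <= `|s - t|.
Proof.
rewrite /Num.max /Num.min; do ![case: ifPn];
 rewrite -?leNgt => *; rewrite ler_norml; apply/andP;
 have := ler_norm (s - t); have := ler_norm (t - s); rewrite [`|t - s|]distrC;
 have := normr_ge0 (s - t); split; lra.
Qed.

Lemma clamp_lip (R : realType) (T s t : R) : `|clamp T s - clamp T t| <= `|s - t|.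
Proof. exact: max_min_lip. Qed.

Lemma clamp_cts (R : realType) (T : R) : continuous (clamp T).
Proof.
move=> t; apply/cvgrPdist_lt => e e0; near=> s.
by apply: le_lt_trans (clamp_lip _ _ _) _; near: s; apply: cvgr_dist_lt.
Unshelve. all: by end_near. Qed.

Lemma drv_cts (R : realType) (m n : nat) (w : R -> 'M[R]_(m, n)) (t : R) dw :
 is_derive t 1 w dw -> {for t, continuous w}.
Proof.
move=> d; apply: differentiable_continuous; apply/derivable1_diffP.
exact: (@ex_derive _ _ _ _ _ _ _ d).
Qed.

(** The integral operator halves uniform distances because L * T <= 1/2, so its iterates from the
    constant curve x converge uniformly at a geometric rate. Time is clamped to [-T, T], which lets
    the operator act on continuous curves defined on all of [R] instead of a function space on an
    interval. *)
Lemma picard (R : realType) (m n : nat) (F : R -> 'M[R]_(m, n) -> 'M[R]_(m, n)) (T L : R) :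
 0 < T -> 0 <= L -> L * T <= 2^-1 ->
 (forall t x y, `|F t x - F t y| <= L * `|x - y|) ->
 (forall y, continuous y -> continuous (fun t => F t (y t))) ->
 forall x, exists y, [/\ continuous y, y 0 = x &
  forall t : R, `|t| < T -> is_derive t 1 y (F t (y t))].
Proof.
move=> T0 L0 LT FL Fc x.
(* The integrals are taken on a longer interval, in order to be differentiable also at -T and T,
   where clamped times land. *)
have T1 : 0 < T + 1 by lra.
have /choice[G GP] (y : R -> 'M[R]_(m, n)) : exists G, continuous y ->
  G 0 = 0 /\ forall t : R, `|t| < T + 1 -> is_derive t 1 G (F t (y t)).
 have [yc|ny] := pselect (continuous y); last by exists (cst 0).
 by have [G ? ?] := antiderivative_mx (Fc y yc) T1; exists G.
pose P y t := x + G y (clamp T t).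
have cT t : `|clamp T t| <= T by apply/clamp_norm/ltW.
have cT1 (t : R) : `|t| <= T -> `|t| < T + 1 by move=> tT; apply: le_lt_trans tT _; lra.
have Pc y : continuous y -> continuous (P y).
 move=> yc t; apply: cvgD; first exact: cvg_cst.
 apply: (ccomp (clamp T) (G y)); first exact: clamp_cts.
 exact: drv_cts ((GP y yc).2 _ (cT1 _ (cT t))).
have Plip y z c : continuous y -> continuous z -> (forall t, `|y t - z t| <= c) ->
  forall t, `|P y t - P z t| <= c / 2.
 move=> yc zc yz t; rewrite /P opprD addrACA subrr add0r.
 have [y0 yd] := GP y yc; have [z0 zd] := GP z zc.
 have := @mean_value_mx_sym _ _ _ (fun t => G y t - G z t)
  (fun t => F t (y t) - F t (z t)) T (L * c) _ _ _ (cT t).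
 rewrite y0 z0 subr0 subr0 => h.
 have c0 : 0 <= c by apply: le_trans (yz 0).
 have : `|G y (clamp T t) - G z (clamp T t)| <= L * c * `|clamp T t|.
  apply: h => s sT; first by apply: is_deriveB; [exact/yd/cT1|exact/zd/cT1].
  by apply: le_trans (FL _ _ _) _; rewrite ler_wpM2l.
 move=> h1; apply: le_trans h1 _.
 have : L * c * `|clamp T t| <= L * c * T by rewrite ler_wpM2l// mulr_ge0.
 have := ler_wpM2r c0 LT; qlra.
pose u k := iter k P (cst x).
have uc k : continuous (u k).
 by elim: k => [|k IH] /=; [move=> ?; exact: cvg_cst|exact: Pc].
(* The first two iterates depend on t only through the clamped time, so their distance is bounded by
   its maximum on [-T, T]. *)
have [C HC] : exists C, forall t, `|u 1 t - u 0 t| <= C.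
 have TT : - T <= T by qlra.
 have [|c cT' cmax] := @EVT_max _ (fun t => `|u 1 t - u 0 t|) _ _ TT.
  apply: continuous_subspaceT => t.
  apply: (ccomp (fun t => u 1 t - u 0 t) (fun x => `|x|)).
   by apply: cvgB; exact: uc.
  exact: norm_continuous.
 exists `|u 1 c - u 0 c| => t.
 have -> : u 1 t - u 0 t = u 1 (clamp T t) - u 0 (clamp T t).
  by rewrite /u /= /P [in RHS](@clamp_id _ T (clamp T t)).
 by apply: cmax; rewrite in_itv/= -ler_norml.
have uC k t : `|u k.+1 t - u k t| <= C / 2 ^+ k.
 elim: k t => [t|k IH t]; first by rewrite expr0 divr1.
 rewrite exprSr invfM mulrA.
 by apply: Plip IH _; exact: uc.
have /choice[y yP] t := @geometric_cauchy _ _ (fun k => u k t) C (fun k => uC k t).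
have geo0 (e : R) : 0 < e -> exists k, 2 * C / 2 ^+ k < e.
 move=> e0; have : geometric (2 * C) 2^-1 @ \oo --> (0 : R).
  by apply: cvg_geometric; rewrite ger0_norm ?invf_lt1 ?ltr1n.
 move=> /cvgr0_norm_lt/(_ _ e0)[N _ HN]; exists N.
 have := HN N (leqnn N); rewrite /geometric /= exprVn.
 exact/le_lt_trans/ler_norm.
have yc : continuous y.
 move=> t; apply/cvgrPdist_lt => e e0.
 have e3 : 0 < e / 3 by qlra.
 have [k ke] := geo0 _ e3.
 have /cvgrPdist_lt/(_ _ e3) := uc k t; apply: filterS => s us.
 have h1 := yP t k; have h2 := yP s k; rewrite distrC in h2.
 have := ler_distD (u k t) (y t) (y s).
 have := ler_distD (u k s) (u k t) (y s); qlra.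
have yE : y = P y.
 apply/funext => t; apply/eqP; rewrite -subr_eq0 -normr_le0; apply/ler_addgt0Pl => e e0.
 have [k ke] := geo0 _ e0; rewrite addr0.
 apply: le_trans (ler_distD (u k.+1 t) _ _) _.
 have : `|u k.+1 t - P y t| <= 2 * C / 2 ^+ k / 2.
  by apply: (Plip (u k) y) => // s; rewrite distrC; exact: yP.
 have := yP t k.+1; rewrite exprS invfM; set a := (2 ^+ k)^-1.
 rewrite -/a in ke; nra.
exists y; split => //.
 by rewrite yE /P clamp_id ?normr0 ?(ltW T0)// (GP y yc).1 addr0.
move=> t tT; rewrite {1}yE.
apply: (@near_eq_is_derive _ _ _ (fun t => x + G y t)).
 near=> s; rewrite /P clamp_id//; near: s.
 exists (T - `|t|) => /=; first by rewrite subr_gt0.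
 move=> s /= st; have := ler_normD (s - t) t; rewrite subrK distrC; qlra.
rewrite -[F t (y t)]add0r; apply: is_deriveD.
by apply: (GP y yc).2; qlra.
Unshelve. all: by end_near. Qed.

Lemma mulmxn (R : realType) (m n p : nat) (A : 'M[R]_(m, n)) (B : 'M[R]_(n, p)) :
 `|A *m B| <= n%:R * `|A| * `|B|.
Proof.
apply: mxn_le => [|i j]; first by rewrite !mulr_ge0.
rewrite mxE; apply: le_trans (ler_norm_sum _ _ _) _.
have -> : n%:R * `|A| * `|B| = \sum_(k < n) `|A| * `|B|.
 by rewrite sumr_const card_ord -mulrA mulr_natl.
apply: ler_sum => k _.
by rewrite normrM ler_pM// entry_le.
Qed.

(** * Strict differentiability *)

Section StrictDifferentiability.
Context (R : realType).

(** Both points of the increment vary. This condition at one point implies a Lipschitz bound nearby,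
    is stable under composition, and is exactly what the contraction in [glue_fixed] asks for.
    Linearity and boundedness are conditions on a plain function [D], so that derivatives can be
    written down without packaging linear maps. *)
Definition sdf (V W : normedModType R) (h : V -> W) (x : V) (D : V -> W) : Prop :=
 [/\ linear D, (exists C : R, forall v, `|D v| <= C * `|v|) &
  forall e : R, 0 < e -> exists2 d : R, 0 < d & forall y z, `|y - x| < d -> `|z - x| < d ->
   `|h y - h z - D (y - z)| <= e * `|y - z|].

Lemma sdf_lip (V W : normedModType R) (h : V -> W) x D : sdf h x D ->
 exists2 C : R, 0 < C & exists2 d : R, 0 < d & forall y z, `|y - x| < d -> `|z - x| < d ->
  `|h y - h z| <= C * `|y - z|.
Proof.
move=> [_ [C DC] /(_ 1 ltr01)[d d0 hd]].
exists (1 + `|C|); first by rewrite ltr_pwDl.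
exists d => // y z yx zx; rewrite -(subrK (D (y - z)) (h y - h z)).
apply: le_trans (ler_normD _ _) _; rewrite mulrDl; apply: lerD; first exact: hd.
by apply: le_trans (DC _) _; rewrite ler_wpM2r// ler_norm.
Qed.

Lemma lip_cts (V W : normedModType R) (h : V -> W) x (C d : R) : 0 < C -> 0 < d ->
 (forall y z, `|y - x| < d -> `|z - x| < d -> `|h y - h z| <= C * `|y - z|) ->
 {for x, continuous h}.
Proof.
move=> C0 d0 hd; apply/cvgrPdist_lt => e e0.
near=> y.
have yx : `|x - y| < Num.min d (e / C).
 by near: y; apply: cvgr_dist_lt; rewrite // lt_min d0 divr_gt0.
move: yx; rewrite lt_min => /andP[yd ye].
apply: le_lt_trans (hd _ _ _ _) _; rewrite ?subrr ?normr0// 1?distrC//.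
by rewrite mulrC distrC -ltr_pdivlMr.
Unshelve. all: by end_near. Qed.

Lemma sdf_cts (V W : normedModType R) (h : V -> W) x D :
 sdf h x D -> {for x, continuous h}.
Proof. by move=> /sdf_lip[C C0 [d d0 /lip_cts]]; apply. Qed.

Lemma sdf_near_eq (V W : normedModType R) (h k : V -> W) x D :
 (\forall y \near x, h y = k y) -> sdf h x D -> sdf k x D.
Proof.
move=> /nbhs_normP[r /= r0 hk] [lD bD hD]; split=> // e e0.
have [d d0 {}hD] := hD e e0; exists (Num.min d r); first by rewrite lt_min d0.
move=> y z; rewrite !lt_min => /andP[yd yr] /andP[zd zr].
by rewrite -!hk /ball_ /= ?[`|x - _|]distrC//; exact: hD.
Qed.

Lemma sdf_comp (V W X : normedModType R) (h : V -> W) (g : W -> X) x D E :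
 sdf h x D -> sdf g (h x) E -> sdf (g \o h) x (E \o D).
Proof.
move=> hD gE; have [C C0 [r r0 hC]] := sdf_lip hD.
case: hD => lD [CD bD] hD; case: gE => lE [CE bE] gE; split.
- by move=> a u v /=; rewrite lD lE.
- exists (`|CE| * `|CD|) => v /=; apply: le_trans (bE _) _.
 apply: (@le_trans _ _ (`|CE| * `|D v|)); first by rewrite ler_wpM2r// ler_norm.
 rewrite -mulrA ler_wpM2l//; apply: le_trans (bD _) _.
 by rewrite ler_wpM2r// ler_norm.
move=> e e0; have K0 : 0 < `|CE| + 1 by rewrite ltr_wpDl.
have [|d1 d10 h1] := gE (e / (2 * C)); first by rewrite divr_gt0// mulr_gt0.
have [|d2 d20 h2] := hD (e / (2 * (`|CE| + 1))); first by rewrite divr_gt0// mulr_gt0.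
exists (Num.min (Num.min d2 r) (d1 / C)); first by rewrite !lt_min d20 r0 divr_gt0.
move=> y z; rewrite !lt_min => /andP[/andP[y2 yr] y1] /andP[/andP[z2 zr] z1] /=.
have xx : `|x - x| < r by rewrite subrr normr0.
have hy u : `|u - x| < r -> `|u - x| < d1 / C -> `|h u - h x| < d1.
 move=> ur ud; apply: le_lt_trans (hC _ _ ur xx) _.
 by rewrite mulrC -ltr_pdivlMr.
have a1 := h1 _ _ (hy _ yr y1) (hy _ zr z1).
have a2 := h2 _ _ y2 z2.
have a3 := hC _ _ yr zr.
have EB u v : E (u - v) = E u - E v.
 by have := lE (-1) v u; rewrite !scaleN1r ![- _ + _]addrC.
rewrite -(subrK (E (h y - h z)) (g _ - _)) -addrA -EB.
apply: le_trans (ler_normD _ _) _.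
have a4 : `|E (h y - h z - D (y - z))| <= (`|CE| + 1) * `|h y - h z - D (y - z)|.
 apply: le_trans (bE _) _; rewrite ler_wpM2r//.
 by apply: le_trans (ler_norm _) _; rewrite lerDl.
have a5 : e / (2 * C) * `|h y - h z| <= e / 2 * `|y - z|.
 apply: (@le_trans _ _ (e / (2 * C) * (C * `|y - z|))).
  by rewrite ler_wpM2l// divr_ge0// ltW// mulr_gt0.
 by rewrite le_eqVlt; apply/orP; left; apply/eqP; field; rewrite ?gt_eqF.
have a6 : (`|CE| + 1) * `|h y - h z - D (y - z)| <= e / 2 * `|y - z|.
 apply: (@le_trans _ _ ((`|CE| + 1) * (e / (2 * (`|CE| + 1)) * `|y - z|))).
  by rewrite ler_wpM2l// ltW.
 by rewrite le_eqVlt; apply/orP; left; apply/eqP; field; qlra.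
qlra.
Qed.

Lemma sdf_opp (V W : normedModType R) (h : V -> W) x D :
 sdf h x D -> sdf (fun y => - h y) x (fun v => - D v).
Proof.
move=> [lD [C bD] hD]; split.
- by move=> a u v; rewrite lD scalerN opprD.
- by exists C => v; rewrite normrN.
- move=> e /hD[d d0 hd]; exists d => // y z yx zx.
 by rewrite -!opprD normrN; exact: hd.
Qed.

Lemma sdf_mulmx (V : normedModType R) (m n p : nat) (h : V -> 'M[R]_(m, n))
  (k : V -> 'M[R]_(n, p)) x D E : sdf h x D -> sdf k x E ->
 sdf (fun y => h y *m k y) x (fun v => D v *m k x + h x *m E v).
Proof.
move=> hD kE; have [C C0 [r r0 hC]] := sdf_lip hD.
have [C' C'0 [r' r'0 kC]] := sdf_lip kE.
case: hD => lD [CD bD] hD; case: kE => lE [CE bE] kE.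
pose N : R := n%:R; have N0 : 0 <= N by [].
split.
- move=> a u v; rewrite lD lE mulmxDl mulmxDr -scalemxAl -scalemxAr scalerDr.
 by rewrite addrACA.
- exists (N * `|CD| * `|k x| + N * `|h x| * `|CE|) => v.
 apply: le_trans (ler_normD _ _) _; rewrite mulrDl; apply: lerD.
  apply: le_trans (mulmxn _ _) _; rewrite [leRHS]mulrAC ler_wpM2r//.
  rewrite -!mulrA ler_wpM2l//; apply: le_trans (bD _) _.
  by rewrite ler_wpM2r// ler_norm.
 apply: le_trans (mulmxn _ _) _; rewrite -[leRHS]mulrA ler_wpM2l ?mulr_ge0//.
 by apply: le_trans (bE _) _; rewrite ler_wpM2r// ler_norm.
move=> e e0; pose K := (N + 1) * (`|h x| + `|k x| + C + C' + 1).
have K0 : 0 < K by rewrite mulr_gt0// ltr_wpDl// ?addr_ge0// ltW.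
pose e' := e / (4 * K); have e'0 : 0 < e' by rewrite divr_gt0// mulr_gt0.
have [d1 d10 h1] := hD _ e'0; have [d2 d20 h2] := kE _ e'0.
pose q := e / (4 * K * (C + C')).
have q0 : 0 < q by rewrite divr_gt0// mulr_gt0 ?addr_gt0// mulr_gt0.
exists (Num.min (Num.min (Num.min d1 d2) (Num.min r r')) (Num.min 1 q)).
 by rewrite !lt_min d10 d20 r0 r'0 ltr01 q0.
move=> y z; rewrite !lt_min => /andP[/andP[/andP[y1 y2] /andP[yr yr']] /andP[y3 y4]].
move=> /andP[/andP[/andP[z1 z2] /andP[zr zr']] /andP[z3 z4]].
have xx s : 0 < s -> `|x - x| < s by rewrite subrr normr0.
(* The first two terms are small by strict differentiability of one factor. In the last two, one
   factor is Lipschitz in y - z and the other one is small because y and z are close to x. *)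
have -> : h y *m k y - h z *m k z - (D (y - z) *m k x + h x *m E (y - z)) =
  ((h y - h z - D (y - z)) *m k x + h x *m (k y - k z - E (y - z))) +
  ((h y - h z) *m (k y - k x) + (h z - h x) *m (k y - k z)).
 rewrite !mulmxBl !mulmxBr.
 move: (h y *m k y) (h z *m k z) (D _ *m _) (h x *m E _) (h y *m k x) (h z *m k x)
  (h x *m k y) (h x *m k z) (h z *m k y) => a b c d' e1 f g i j.
 by apply/matrixP => ? ?; rewrite !mxE; ring.
have hyz := hC _ _ yr zr; have kyz := kC _ _ yr' zr'.
have hzx := hC _ _ zr (xx _ r0); have kyx := kC _ _ yr' (xx _ r'0).
have b1 := h1 _ _ y1 z1; have b2 := h2 _ _ y2 z2.
set s := `|y - z| in hyz kyz b1 b2 *; have s0 : 0 <= s by exact: normr_ge0.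
have Kq : 4 * K * (C + C') * q = e by rewrite /q; field; qlra.
have Ke : 4 * K * e' = e by rewrite /e'; field; qlra.
have n1 : `|(h y - h z - D (y - z)) *m k x| <= N * (e' * s) * `|k x|.
 apply: le_trans (mulmxn _ _) _.
 by rewrite ler_wpM2r// ler_wpM2l.
have n2 : `|h x *m (k y - k z - E (y - z))| <= N * `|h x| * (e' * s).
 by apply: le_trans (mulmxn _ _) _; rewrite ler_wpM2l// mulr_ge0.
have n3 : `|(h y - h z) *m (k y - k x)| <= N * (C * s) * (C' * q).
 apply: le_trans (mulmxn _ _) _; rewrite ler_pM// ?mulr_ge0 ?ler_wpM2l//.
 by apply: le_trans kyx _; rewrite ler_wpM2l// ltW.
have n4 : `|(h z - h x) *m (k y - k z)| <= N * (C * q) * (C' * s).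
 apply: le_trans (mulmxn _ _) _; rewrite ler_pM// ?mulr_ge0// ler_wpM2l//.
 by apply: le_trans hzx _; rewrite ler_wpM2l// ltW.
apply: le_trans (ler_normD _ _) _.
apply: le_trans (lerD (ler_normD _ _) (ler_normD _ _)) _.
apply: le_trans (lerD (lerD n1 n2) (lerD n3 n4)) _.
have hx0 : 0 <= `|h x| by []; have kx0 : 0 <= `|k x| by [].
have e1 : N * (e' * s) * `|k x| + N * `|h x| * (e' * s) <= K * e' * s.
 have -> : N * (e' * s) * `|k x| + N * `|h x| * (e' * s) = (N * (`|k x| + `|h x|)) * (e' * s).
  by ring.
 rewrite -[leRHS]mulrA; apply: ler_wpM2r; first exact: mulr_ge0 (ltW e'0) s0.
 clear -N0 hx0 kx0 C0 C'0; rewrite /K; nra.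
have e2 : N * (C * s) * (C' * q) + N * (C * q) * (C' * s) <= 2 * K * (C + C') * q * s.
 have -> : N * (C * s) * (C' * q) + N * (C * q) * (C' * s) = 2 * (N * C') * C * (q * s).
  by ring.
 rewrite -[leRHS]mulrA; apply: ler_wpM2r; first exact: mulr_ge0 (ltW q0) s0.
 apply: ler_pM; rewrite ?mulr_ge0 ?(ltW C0) ?(ltW C'0)//; last by rewrite lerDl ltW.
 clear -N0 hx0 kx0 C0 C'0; rewrite /K; nra.
have := ler_wpM2r s0 (lexx e); nra.
Qed.

End StrictDifferentiability.
Section StrictDifferentiability2.
Context (R : realType).

(** Everything comes from A(y)^-1 - A(z)^-1 = A(y)^-1 (A(z) - A(y)) A(z)^-1: it first bounds the
    inverse near x, then makes it Lipschitz, and finally gives the derivative. *)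
Lemma sdf_invmx (V : normedModType R) (m : nat) (A : V -> 'M[R]_m) x D :
 (\forall y \near x, A y \in unitmx) -> sdf A x D ->
 sdf (fun y => invmx (A y)) x (fun v => - (invmx (A x) *m D v *m invmx (A x))).
Proof.
move=> /nbhs_normP[r0 /= r00 Au] AD; have [C C0 [r r_gt0 AC]] := sdf_lip AD.
case: AD => lD [CD bD] hD.
pose B y := invmx (A y); pose N : R := m%:R + 1; pose b := `|B x| + 1.
have N1 : 1 <= N by rewrite /N lerDr.
have N0 : 0 < N by exact: lt_le_trans N1.
have b0 : 0 < b by rewrite /b ltr_pwDr.
have Bb : `|B x| <= b by rewrite /b lerDl.
have nmul (X Y : 'M[R]_m) : `|X *m Y| <= N * `|X| * `|Y|.
 apply: le_trans (mulmxn _ _) _.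
 by rewrite ler_wpM2r// ler_wpM2r// /N lerDl.
have nmul3 (X Y Z : 'M[R]_m) (x1 y1 z1 : R) : `|X| <= x1 -> `|Y| <= y1 -> `|Z| <= z1 ->
  `|X *m Y *m Z| <= N ^+ 2 * x1 * y1 * z1.
 move=> Xx Yy Zz.
 have x10 : 0 <= x1 by exact: le_trans Xx.
 have y10 : 0 <= y1 by exact: le_trans Yy.
 apply: le_trans (nmul _ _) _.
 have -> : N ^+ 2 * x1 * y1 * z1 = N * (N * x1 * y1) * z1 by ring.
 apply: ler_pM => //; first by rewrite mulr_ge0// ltW.
 rewrite ler_pM2l//; apply: le_trans (nmul _ _) _.
 apply: ler_pM => //; first by rewrite mulr_ge0// ltW.
 by rewrite ler_pM2l.
have Bsub y z : `|x - y| < r0 -> `|x - z| < r0 -> B y - B z = B y *m (A z - A y) *m B z.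
 move=> /Au yu /Au zu; rewrite mulmxBr mulmxBl mulVmx//.
 by rewrite -mulmxA mulmxV// mulmx1 mul1mx.
have xx s : 0 < s -> `|x - x| < s by rewrite subrr normr0.
(* This radius makes the difference of the inverses at most half of the norm of [B y], which can
   then be absorbed to bound that norm itself. *)
pose d0 := (2 * N ^+ 2 * b * C)^-1.
have d00 : 0 < d0 by rewrite invr_gt0 !mulr_gt0// exprn_gt0.
pose ok y := [/\ `|x - y| < r0, `|y - x| < r & `|y - x| < d0].
have Bbd y : ok y -> `|B y| <= 2 * b.
 move=> [y1 y2 y3].
 have e1 : `|B y - B x| <= N ^+ 2 * `|B y| * (C * d0) * b.
  rewrite Bsub// ?xx//; apply: nmul3 => //.
  rewrite distrC; apply: le_trans (AC _ _ y2 (xx _ r_gt0)) _.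
  by rewrite ler_pM2l// ltW.
 have e2 : N ^+ 2 * `|B y| * (C * d0) * b = `|B y| / 2.
  by rewrite /d0; field; rewrite !gt_eqF.
 have := ler_distD (B x) (B y) 0; rewrite !subr0; qlra.
have Blip y : ok y -> `|B y - B x| <= 2 * N ^+ 2 * b ^+ 2 * C * `|y - x|.
 move=> yok; have := Bbd y yok; case: yok => y1 y2 y3 By.
 rewrite Bsub// ?xx//.
 have -> : 2 * N ^+ 2 * b ^+ 2 * C * `|y - x| = N ^+ 2 * (2 * b) * (C * `|y - x|) * b by ring.
 apply: nmul3 => //; rewrite distrC; exact: (AC _ _ y2 (xx _ r_gt0)).
split.
- move=> a u v; rewrite lD mulmxDr mulmxDl -scalemxAr -scalemxAl opprD scalerN //.
- exists (N ^+ 2 * b * `|CD| * b) => v; rewrite normrN.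
 have -> : N ^+ 2 * b * `|CD| * b * `|v| = N ^+ 2 * b * (`|CD| * `|v|) * b by ring.
 apply: nmul3 => //; apply: le_trans (bD _) _.
 by rewrite ler_wpM2r// ler_norm.
move=> e e0; pose K := 6 * N ^+ 4 * b ^+ 3 * C ^+ 2.
have K0 : 0 < K by rewrite /K !mulr_gt0// exprn_gt0.
have [|d1 d10 h1] := hD (e / (2 * N ^+ 2 * b ^+ 2)).
 by rewrite divr_gt0// !mulr_gt0// exprn_gt0.
exists (Num.min (Num.min d1 r0) (Num.min (Num.min r d0) (e / (2 * K)))).
 by rewrite !lt_min d10 r00 r_gt0 d00 divr_gt0// mulr_gt0.
move=> y z; rewrite !lt_min => /andP[/andP[y1 y2] /andP[/andP[y3 y4] y5]].
move=> /andP[/andP[z1 z2] /andP[/andP[z3 z4] z5]].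
have oky : ok y by split=> //; rewrite distrC.
have okz : ok z by split=> //; rewrite distrC.
rewrite opprK Bsub ?[`|x - _|]distrC//.
have -> : B y *m (A z - A y) *m B z + B x *m D (y - z) *m B x =
  (B y - B x) *m (A z - A y) *m B z + B x *m (A z - A y) *m (B z - B x)
  - B x *m (A y - A z - D (y - z)) *m B x.
 move: (B y) (B x) (B z) (A z) (A y) (D (y - z)) => b1 b2 b3 a1 a2 d.
 rewrite !mulmxBl !mulmxBr !mulmxBl.
 by apply/matrixP => i j; rewrite !mxE; ring.
have AA : `|A z - A y| <= C * `|y - z| by rewrite distrC; exact: AC.
set s := `|y - z| in AA *; have s0 : 0 <= s by exact: normr_ge0.
pose q := e / (2 * K).
have t1 : `|(B y - B x) *m (A z - A y) *m B z| <=
  N ^+ 2 * (2 * N ^+ 2 * b ^+ 2 * C * q) * (C * s) * (2 * b).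
 apply: nmul3 => //; last exact: Bbd.
 apply: le_trans (Blip _ oky) _; rewrite ler_pM2l ?(ltW y5)//.
 by rewrite !mulr_gt0// exprn_gt0.
have t2 : `|B x *m (A z - A y) *m (B z - B x)| <=
  N ^+ 2 * b * (C * s) * (2 * N ^+ 2 * b ^+ 2 * C * q).
 apply: nmul3 => //; apply: le_trans (Blip _ okz) _; rewrite ler_pM2l ?(ltW z5)//.
 by rewrite !mulr_gt0// exprn_gt0.
have t3 : `|B x *m (A y - A z - D (y - z)) *m B x| <=
  N ^+ 2 * b * (e / (2 * N ^+ 2 * b ^+ 2) * s) * b.
 by apply: nmul3 => //; exact: h1.
apply: le_trans (ler_normB _ _) _.
apply: le_trans (lerD (ler_normD _ _) (lexx _)) _.
apply: le_trans (lerD (lerD t1 t2) t3) _.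
rewrite le_eqVlt; apply/orP; left; apply/eqP.
by rewrite /q /K; field; rewrite !gt_eqF.
Qed.

Lemma deriv_comp (V W : normedModType R) (g : R -> V) (h : V -> W) (t : R) dg :
 is_derive t 1 g dg -> differentiable h (g t) ->
 is_derive t 1 (h \o g) ('d h (g t) dg).
Proof.
move=> gd dh.
have dg' : differentiable g t by apply/derivable1_diffP; exact: ex_derive.
have dhg : differentiable (h \o g) t by exact: differentiable_comp.
apply: DeriveDef; first exact/derivable1_diffP.
rewrite deriveE// diff_comp//= -(@deriveE _ _ _ _ _ (1 : R) dg').
by rewrite (@derive_val _ _ _ _ _ _ _ gd).
Qed.

Lemma sdf_diff (V W : normedModType R) (h : V -> W) x D :
 sdf h x D -> differentiable h x /\ 'd h x =1 D.
Proof.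
move=> hD; have [lD [C bD] hd] := hD.
pose D' : {linear V -> W} := HB.pack D (GRing.isLinear.Build R V W _ D lD).
have cD : continuous D'.
 move=> y; apply: (@lip_cts _ _ _ D' y (`|C| + 1) 1) => //.
 move=> u v _ _; rewrite -linearB; apply: le_trans (bD _) _.
 by rewrite ler_wpM2r// (le_trans (ler_norm _))// lerDl.
have hE : h \o shift x = cst (h x) + D' +o_ 0 id.
 apply/eqaddoP => e e0; have [d d0 {}hd] := hd e e0.
 apply/nbhs_normP; exists d => //= y; rewrite /ball_ /= sub0r normrN => yd.
 rewrite !fctE /= opprD addrA /shift /=.
 by have := hd (y + x) x; rewrite addrK subrr normr0; apply.
have dE := diff_unique cD hE.
split; last by move=> v; rewrite dE.
by apply/diff_locallyP; rewrite dE.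
Qed.

Lemma diff_entries (m : nat) (W : normedModType R) (h : 'rV[R]_m -> W) x v :
 differentiable h x -> 'd h x v = \sum_i v ord0 i *: 'D_(delta_mx ord0 i) h x.
Proof.
move=> dh; rewrite [v in LHS]row_sum_delta linear_sum; apply: eq_bigr => i _.
by rewrite linearZ /= -deriveE.
Qed.

Lemma diff_sub_le (m : nat) (W : normedModType R) (h : 'rV[R]_m -> W) a b v (c : R) :
 differentiable h a -> differentiable h b ->
 (forall i, `|'D_(delta_mx ord0 i) h a - 'D_(delta_mx ord0 i) h b| <= c) ->
 `|'d h a v - 'd h b v| <= m%:R * c * `|v|.
Proof.
move=> da db hc.
have -> : 'd h a v - 'd h b v =
  \sum_i v ord0 i *: ('D_(delta_mx ord0 i) h a - 'D_(delta_mx ord0 i) h b).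
 under eq_bigr do rewrite scalerBr.
 rewrite sumrB.
 congr (_ - _).
 exact: diff_entries.
 exact: diff_entries.
apply: le_trans (ler_norm_sum _ _ _) _.
have -> : m%:R * c * `|v| = \sum_(i < m) c * `|v|.
 by rewrite sumr_const card_ord -mulrA mulr_natl.
apply: ler_sum => i _; rewrite normrZ mulrC.
by apply: ler_pM; rewrite ?entry_le.
Qed.

Lemma is_drv_scalel (W : normedModType R) (w : W) (t : R) :
 is_derive t 1 (fun s : R => s *: w) w.
Proof.
have [|df e] := @sdf_diff R W (fun s : R => s *: w) t (fun s => s *: w).
 split.
 - by move=> a u v; rewrite scalerDl scalerA.
 - by exists `|w| => v; rewrite normrZ mulrC.
 - move=> e e0; exists 1 => // y z _ _.
  by rewrite scalerBl subrr normr0 mulr_ge0// ltW.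
apply: DeriveDef; first exact/derivable1_diffP.
by rewrite deriveE// e scale1r.
Qed.

(** The mean value inequality as a property of the target space: it is proved separately for [R] and
    for matrices, and [C1_sdf] is applied to both. *)
Definition mvp (W : normedModType R) := forall (w w' : R -> W) (a b K : R),
 a <= b -> (forall t, a <= t <= b -> is_derive t 1 w (w' t)) ->
 (forall t, a <= t <= b -> `|w' t| <= K) -> `|w b - w a| <= K * (b - a).

Lemma mvp_real : mvp R.
Proof.
move=> w w' a b K ab dw wK.
have K0 : 0 <= K by apply: le_trans (wK a _) => //; rewrite lexx.
have [||c cab e] := @MVT_segment _ w w' _ _ ab.
- by move=> t; rewrite in_itv/= => /andP[? ?]; apply: dw; rewrite !ltW.
- apply: derivable_within_continuous => t; rewrite in_itv/= => /dw dt.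
 exact: (@ex_derive _ _ _ _ _ _ _ dt).
rewrite e normrM [`|b - a|]ger0_norm ?subr_ge0//.
by rewrite ler_wpM2r ?subr_ge0//; apply: wK; move: cab; rewrite in_itv.
Qed.

(** The mean value inequality is applied on the segment from z to y to [h] minus its linear part at
    x; continuity of the finitely many partial derivatives makes the derivative of this difference
    small. *)
Lemma C1_sdf (m : nat) (W : normedModType R) (h : 'rV[R]_m -> W) x :
 mvp W ->
 (\forall y \near x, differentiable h y) ->
 (forall v, {for x, continuous ('D_v h)}) -> sdf h x ('d h x).
Proof.
move=> MV dh ch.
have bd y v c : differentiable h y -> (forall i, `|'D_(delta_mx ord0 i) h y| <= c) ->
  `|'d h y v| <= m%:R * c * `|v|.
 move=> dy hc; rewrite diff_entries//; apply: le_trans (ler_norm_sum _ _ _) _.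
 have -> : m%:R * c * `|v| = \sum_(i < m) c * `|v|.
  by rewrite sumr_const card_ord -mulrA mulr_natl.
 apply: ler_sum => i _; rewrite normrZ mulrC.
 by apply: ler_pM; rewrite ?entry_le.
split.
- by move=> a u v; rewrite linearP.
- exists (m%:R * \big[Num.max/0]_i `|'D_(delta_mx ord0 i) h x|) => v.
 apply: bd; first exact: nbhs_singleton dh.
 by move=> i; exact: (le_bigmax _ (fun i : 'I_m => `|'D_(delta_mx ord0 i) h x|) i).
move=> e e0; pose e' := e / (m%:R + 1).
have e'0 : 0 < e' by rewrite divr_gt0// ltr_wpDl.
have : \forall y \near x, differentiable h y /\
  forall i, `|'D_(delta_mx ord0 i) h x - 'D_(delta_mx ord0 i) h y| < e'.
 apply: filterI => //.
 apply: (@filter_forall _ _ (fun (i : 'I_m) y =>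
  `|'D_(delta_mx ord0 i) h x - 'D_(delta_mx ord0 i) h y| < e') (nbhs x) _) => i.
 by move/cvgrPdist_lt : (ch (delta_mx ord0 i)); apply.
move=> /nbhs_normP[d /= d0 hd]; exists d => // y z yx zx.
pose u (t : R) := z + t *: (y - z).
have ux t : 0 <= t <= 1 -> `|x - u t| < d.
 move=> /andP[t0 t1].
 have -> : x - u t = (1 - t) *: (x - z) + t *: (x - y).
  by apply/matrixP => i j; rewrite !mxE; ring.
 apply: le_lt_trans (ler_normD _ _) _; rewrite !normrZ ger0_norm ?subr_ge0//.
 rewrite ger0_norm// ![`|x - _|]distrC.
 have [->|tp] := eqVneq t 0; first by rewrite mul0r addr0 subr0 mul1r.
 have t_gt0 : 0 < t by rewrite lt_neqAle eq_sym tp.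
 have : t * `|y - x| < t * d by rewrite ltr_pM2l.
 have : (1 - t) * `|z - x| <= (1 - t) * d by rewrite ler_wpM2l ?subr_ge0// ltW.
 qlra.
have du (t : R) : is_derive t 1 u (y - z).
 rewrite -[y - z]add0r; apply: is_deriveD; exact: is_drv_scalel.
have u1 : u 1 = y by rewrite /u scale1r addrC subrK.
have u0 : u 0 = z by rewrite /u scale0r addr0.
have := MV (fun t => h (u t) - t *: 'd h x (y - z))
 (fun t => 'd h (u t) (y - z) - 'd h x (y - z)) 0 1 (e * `|y - z|) ler01.
rewrite u1 u0 scale1r scale0r !subr0 mulr1 addrAC => H.
apply: H => t t01.
 have dhu : differentiable h (u t) by exact: (hd _ (ux _ t01)).1.
 apply: is_deriveB; first exact: (deriv_comp (du t) dhu).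
 exact: is_drv_scalel.
have hdx : differentiable h x by exact: nbhs_singleton dh.
have dhu : differentiable h (u t) by exact: (hd _ (ux _ t01)).1.
apply: (@le_trans _ _ (m%:R * e' * `|y - z|)); last first.
 rewrite ler_wpM2r// /e' mulrCA ler_piMr ?(ltW e0)// ler_pdivrMr ?mul1r ?lerDl// ltr_wpDl.
apply: diff_sub_le => // i; rewrite distrC ltW//.
exact: (hd _ (ux _ t01)).2.
Qed.

Lemma sdf_entries (V : normedModType R) (p q : nat) (h : V -> 'M[R]_(p, q)) x :
 (forall i j, exists D, sdf (fun y => h y i j : R) x D) -> exists D, sdf h x D.
Proof.
move=> hD; have /choice[D DP] (ij : 'I_p * 'I_q) : exists D, sdf (fun y => h y ij.1 ij.2 : R) x D.
 exact: hD.
exists (fun v => \matrix_(i, j) D (i, j) v); split.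
- move=> a u v; apply/matrixP => i j; rewrite !mxE.
 by have [lD _ _] := DP (i, j); rewrite lD.
- have /choice[C CP] (ij : 'I_p * 'I_q) : exists C : R, forall v, `|D ij v| <= C * `|v|.
  by have [_] := DP ij.
 exists (\big[Num.max/0]_ij `|C ij|) => v.
 apply: mxn_le => [|i j].
  by rewrite mulr_ge0//; elim/big_ind : _ => // a b a0 b0; rewrite le_max a0.
 rewrite mxE; apply: le_trans (CP _ _) _; rewrite ler_wpM2r//.
 by apply: le_trans (ler_norm _) _; exact: (le_bigmax _ (fun ij => `|C ij|) (i, j)).
- move=> e e0; have /choice[d dP] (ij : 'I_p * 'I_q) : exists d : R, 0 < d /\
   forall y z, `|y - x| < d -> `|z - x| < d ->
   `|h y ij.1 ij.2 - h z ij.1 ij.2 - D ij (y - z)| <= e * `|y - z|.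
  by have [_ _ /(_ _ e0)[d d0 dP]] := DP ij; exists d.
 exists (\big[Num.min/1]_ij d ij).
  by elim/big_ind : _ => [//|a b a0 b0|ij _]; [rewrite lt_min a0|exact: (dP _).1].
 move=> y z yx zx; apply: mxn_le => [|i j]; first by rewrite mulr_ge0// ltW.
 rewrite !mxE; apply: (dP (i, j)).2.
  by apply: lt_le_trans yx _; exact: (bigmin_le _ (i, j) d).
 by apply: lt_le_trans zx _; exact: (bigmin_le _ (i, j) d).
Qed.

End StrictDifferentiability2.

Lemma mvp_mx (R : realType) (p q : nat) : mvp 'M[R]_(p, q).
Proof. by move=> w w' a b K; exact: mean_value_mx. Qed.

Lemma cvg_mx (R : realType) (T : Type) (F : set_system T) (m n : nat)
  (f : T -> 'M[R]_(m, n)) (l : 'M[R]_(m, n)) : Filter F ->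
 (forall i j, f x i j @[x --> F] --> l i j) -> f x @[x --> F] --> l.
Proof.
move=> FF fl; apply/cvgrPdist_le => e e0.
have : \forall x \near F, forall ij : 'I_m * 'I_n, `|l ij.1 ij.2 - f x ij.1 ij.2| <= e.
 apply: (@filter_forall _ _ (fun ij x => `|l ij.1 ij.2 - f x ij.1 ij.2| <= e) F _) => -[i j] /=.
 by move/cvgrPdist_le : (fl i j); apply.
apply: filterS => x H; apply: mxn_le => [|i j]; first exact: ltW.
by rewrite !mxE; exact: (H (i, j)).
Qed.

Lemma cvg_coord (R : realType) (T : Type) (F : set_system T) (m n : nat)
  (f : T -> 'M[R]_(m, n)) (l : 'M[R]_(m, n)) i j : Filter F ->
 f x @[x --> F] --> l -> f x i j @[x --> F] --> l i j.
Proof.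
move=> FF fl.
apply: (@cvg_comp _ _ _ f (fun x : 'M[R]_(m, n) => x i j)) fl _; exact: coord_continuous.
Qed.

Lemma cvg_mulmx (R : realType) (T : Type) (F : set_system T) (m n p : nat)
  (f : T -> 'M[R]_(m, n)) (g : T -> 'M[R]_(n, p)) (a : 'M[R]_(m, n)) (b : 'M[R]_(n, p)) : Filter F ->
 f x @[x --> F] --> a -> g x @[x --> F] --> b -> f x *m g x @[x --> F] --> a *m b.
Proof.
move=> FF fa gb; apply: cvg_mx => i j.
under eq_fun do rewrite mxE.
rewrite mxE; apply: (@cvg_big _ _ _ _ _ _ _ _ _ (fun k x => f x i k * g x k j)) => [|k _].
 exact: add_continuous.
by apply: cvgM; exact: cvg_coord.
Qed.

Lemma sdf_linear (R : realType) (V W : normedModType R) (D : V -> W) x (C : R) :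
 linear D -> (forall v, `|D v| <= C * `|v|) -> sdf D x D.
Proof.
move=> lD bD; split => //; first by exists C.
move=> e e0; exists 1 => // y z _ _.
have -> : D (y - z) = D y - D z.
 by have := lD (-1) z y; rewrite !scaleN1r ![- _ + _]addrC.
by rewrite subrr normr0 mulr_ge0// ltW.
Qed.

Lemma sdf_mulmxr (R : realType) (m n p : nat) (A : 'M[R]_(n, p)) x :
 sdf (fun v : 'M[R]_(m, n) => v *m A) x (fun v => v *m A).
Proof.
apply: (@sdf_linear _ _ _ _ _ (n%:R * `|A|)).
 by move=> a u v; rewrite mulmxDl scalemxAl.
by move=> v; apply: le_trans (mulmxn _ _) _; rewrite mulrAC.
Qed.

Lemma sdf_mulmxl (R : realType) (m n p : nat) (A : 'M[R]_(m, n)) x :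
 sdf (fun v : 'M[R]_(n, p) => A *m v) x (fun v => A *m v).
Proof.
apply: (@sdf_linear _ _ _ _ _ (n%:R * `|A|)).
 by move=> a u v; rewrite mulmxDr scalemxAr.
by move=> v; exact: mulmxn.
Qed.

Lemma sdf_deriv (R : realType) (V W : normedModType R) (g : R -> V) (h : V -> W)
  (t : R) dg D : is_derive t 1 g dg -> sdf h (g t) D -> is_derive t 1 (h \o g) (D dg).
Proof.
move=> gd /sdf_diff[dh <-]; exact: deriv_comp.
Qed.

(** * The local flow of a vector field and its dependence on the initial point *)

Section LocalFlow.
Context (R : realType) (m : nat).
Notation V := 'rV[R]_m.

Definition linear_mx (D : V -> V) : 'M[R]_m := \matrix_(i, j) D (delta_mx ord0 i) ord0 j.

Lemma linear_mxE (D : V -> V) v : linear D -> v *m linear_mx D = D v.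
Proof.
move=> lD; pose D' : {linear V -> V} := HB.pack D (GRing.isLinear.Build R V V _ D lD).
rewrite -[D]/(D' : V -> V) [v in RHS]row_sum_delta linear_sum.
apply/rowP => j; rewrite mxE summxE; apply: eq_bigr => i _.
by rewrite linearZ /= !mxE.
Qed.

(** Both derivatives approximate the same increment of [h] from x' along a tiny multiple of v, so
    they nearly agree on v. This takes the place of continuity of the derivative. *)
Lemma sdf_close (W : normedModType R) (h : V -> W) x D (e : R) : 0 < e -> sdf h x D ->
 exists2 d : R, 0 < d & forall x' D', `|x' - x| < d -> sdf h x' D' ->
  forall v, `|D v - D' v| <= e * `|v|.
Proof.
move=> e0 [lD _ hD]; have e20 : 0 < e / 2 by rewrite divr_gt0.
have [d d0 {}hD] := hD _ e20; exists (d / 2); first by rewrite divr_gt0.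
move=> x' D' x'x [lD' _ /(_ _ e20)[d' d'0 hD']] v.
have lin0 (f : V -> W) : linear f -> f 0 = 0.
 by move=> lf; have := lf (-1) 0 0; rewrite scaler0 addr0 scaleN1r addNr.
have [->|v0] := eqVneq v 0; first by rewrite (lin0 _ lD) (lin0 _ lD') subrr !normr0 mulr0.
have nv0 : 0 < `|v| by rewrite normr_gt0.
pose t := Num.min (d / 2) d' / (2 * `|v|).
have mn : 0 < Num.min (d / 2) d' by rewrite lt_min divr_gt0.
have t0 : 0 < t by rewrite divr_gt0// mulr_gt0.
have tv : `|t *: v| < Num.min (d / 2) d'.
 rewrite normrZ (gtr0_norm t0) /t invfM -!mulrA mulVf ?gt_eqF// mulr1.
 by rewrite ltr_pdivrMr// ltr_pMr// ltr1n.
move: tv; rewrite lt_min => /andP[tv1 tv2].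
have h1 := hD (x' + t *: v) x'; have h2 := hD' (x' + t *: v) x'.
have Dt (f : V -> W) : linear f -> f (t *: v) = t *: f v.
 by move=> lf; rewrite -[t *: v]addr0 lf (lin0 _ lf) addr0.
have ex : x' + t *: v - x' = t *: v by rewrite addrAC subrr add0r.
rewrite ex Dt// in h1; rewrite ex Dt// in h2.
have {}h1 : `|h (x' + t *: v) - h x' - t *: D v| <= e / 2 * `|t *: v|.
 apply: h1; last lra.
 by rewrite addrAC; apply: le_lt_trans (ler_normD _ _) _; lra.
have {}h2 : `|h (x' + t *: v) - h x' - t *: D' v| <= e / 2 * `|t *: v|.
 by apply: h2; rewrite ?subrr ?normr0.
have : `|t *: (D v - D' v)| <= e * `|t *: v|.
 have -> : t *: (D v - D' v) = (h (x' + t *: v) - h x' - t *: D' v) -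
   (h (x' + t *: v) - h x' - t *: D v).
  by rewrite scalerBr opprB [RHS]addrC addrA subrK.
 by apply: le_trans (ler_normB _ _) _; lra.
by rewrite !(normrZ t) (gtr0_norm t0) mulrCA ler_pM2l.
Qed.

Lemma sdf_bound (W : normedModType R) (h : V -> W) x D (L : R) :
 (forall y z, `|h y - h z| <= L * `|y - z|) -> sdf h x D -> forall v, `|D v| <= L * `|v|.
Proof.
move=> hL [lD _ hD] v; apply/ler_addgt0Pl => e e0.
have lin0 : D 0 = 0.
 by have := lD (-1) 0 0; rewrite scaler0 addr0 scaleN1r addNr.
have [->|v0] := eqVneq v 0; first by rewrite lin0 !normr0 mulr0 addr0 ltW.
have nv0 : 0 < `|v| by rewrite normr_gt0.
have [|d d0 {}hD] := hD (e / `|v|); first by rewrite divr_gt0.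
pose t := d / (2 * `|v|).
have t0 : 0 < t by rewrite divr_gt0// mulr_gt0.
have tv : `|t *: v| < d.
 rewrite normrZ (gtr0_norm t0) /t invfM -!mulrA mulVf ?gt_eqF// mulr1.
 by rewrite ltr_pdivrMr// ltr_pMr// ltr1n.
have := hD (x + t *: v) x; rewrite addrAC subrr add0r normr0 => /(_ tv d0) h1.
have h2 := hL (x + t *: v) x; rewrite addrAC subrr add0r in h2.
have Dt : D (t *: v) = t *: D v by rewrite -[t *: v]addr0 lD lin0 addr0.
have : `|D (t *: v)| <= L * `|t *: v| + e / `|v| * `|t *: v|.
 rewrite -[D _]opprK normrN -[- D _](addKr (h (x + t *: v) - h x)) addrC.
 by rewrite addrC; apply: le_trans (ler_normD _ _) _; rewrite normrN lerD.
rewrite Dt !(normrZ t) (gtr0_norm t0) => h3.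
have e3 : e / `|v| * (t * `|v|) = t * e by field; rewrite gt_eqF.
by rewrite -(ler_pM2l t0) mulrDr -e3 addrC [t * (_ * _)]mulrCA.
Qed.

Context (F : V -> V) (L T : R) (psi : V -> R -> V) (L0 : 0 <= L) (T0 : 0 < T)
 (FL : forall x y, `|F x - F y| <= L * `|x - y|) (LT : (m%:R + 1) * L * T <= 2^-1) (psi0 : forall z, psi z 0 = z)
 (psi_drv : forall z (t : R), `|t| < T -> is_derive t 1 (psi z) (F (psi z t))).

(** The factor m + 1 in [LT] serves twice: it gives L * T <= 1/2 for the flow and m * L * T <= 1/2
    for the linearized equation, since products of m by m matrices cost a factor m in the entrywise
    norm. *)
Let LT1 : L * T <= 2^-1.
Proof.
have m0 : 0 <= (m%:R : R) by [].
by apply: le_trans LT; rewrite ler_wpM2r ?(ltW T0)// ler_peMl// lerDr.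
Qed.

Lemma local_flow_lip y z (t : R) : `|t| < T -> `|psi y t - psi z t| <= 2 * `|y - z|.
Proof.
move=> tT; have := @gronwall_short _ _ _ (fun t => psi y t - psi z t)
 (fun t => F (psi y t) - F (psi z t)) `|t| L 0 (normr_ge0 _) L0 _ (lexx _) _ _ t (lexx _).
rewrite !psi0 mulr0 addr0; apply.
- by apply: le_trans LT1; rewrite ler_wpM2l// ltW.
- by move=> s st; apply: is_deriveB; apply: psi_drv; exact: le_lt_trans st tT.
- by move=> s st; rewrite addr0.
Qed.

(** By compactness of [-S, S]: near each time [sdf_close] and continuity of [c] provide a common
    radius for all nearby times. *)
Lemma uniform_sdf (c : R -> V) (D : R -> V -> V) (S e : R) : 0 < e ->
 (forall s : R, `|s| <= S -> {for s, continuous c}) ->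
 (forall s : R, `|s| <= S -> sdf F (c s) (D s)) ->
 exists2 d : R, 0 < d & forall s y z, `|s| <= S -> `|y - c s| < d -> `|z - c s| < d ->
  `|F y - F z - D s (y - z)| <= e * `|y - z|.
Proof.
move=> e0 cc cD; have e20 : 0 < e / 2 by rewrite divr_gt0.
have K : compact [set s : R | `|s| <= S].
 rewrite (_ : [set _ | _] = [set` `[- S, S]]); first exact: segment_compact.
 by apply/seteqP; split => s /=; rewrite in_itv/= ler_norml.
have := (compact_near_coveringP [set s : R | `|s| <= S]).1 K R (0^'+)
 (fun d s => `|s| <= S -> forall y z, `|y - c s| < d -> `|z - c s| < d ->
  `|F y - F z - D s (y - z)| <= e * `|y - z|) _.
move=> H.
have {H} : \forall d \near 0^'+, [set s | `|s| <= S] `<=` (fun s => `|s| <= S -> forall y z, `|y - c s| < d -> `|z - c s| < d ->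
  `|F y - F z - D s (y - z)| <= e * `|y - z|).
 apply: H => s sS.
 have [d1 d10 h1] := sdf_close e20 (cD s sS).
 have [_ _ /(_ _ e20)[d2 d20 h2]] := cD s sS.
 have dd0 : 0 < Num.min d1 d2 / 2 by rewrite divr_gt0// lt_min d10.
 exists ([set s' | `|c s' - c s| < Num.min d1 d2 / 2], [set d | d < Num.min d1 d2 / 2]).
  split => /=; last by apply: nbhs_right_lt.
  have /cvgrPdist_lt/(_ _ dd0) := cc s sS.
  by apply: filterS => s'; rewrite distrC.
 move=> [s' d] [/= cs' dd] s'S y z ys zs.
 have m12 : Num.min d1 d2 <= d1 /\ Num.min d1 d2 <= d2 by rewrite !ge_min !lexx orbT.
 have a1 := h1 _ _ (_ : `|c s' - c s| < d1) (cD s' s'S).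
 have {}a1 := a1 (ltac:(lra)) (y - z).
 have yc : `|y - c s| < d2 by have := ler_distD (c s') y (c s); lra.
 have zc : `|z - c s| < d2 by have := ler_distD (c s') z (c s); lra.
 have a2 := h2 _ _ yc zc.
 have -> : F y - F z - D s' (y - z) = (F y - F z - D s (y - z)) + (D s (y - z) - D s' (y - z)).
  by rewrite addrA subrK.
 by apply: le_trans (ler_normD _ _) _; lra.
move=> H; have [d [hd d0]] := filter_ex (filterI H (nbhs_right_gt 0)).
by exists d => // s y z sS; exact: (hd s sS sS).
Qed.

(** The derivative is v *m Y t, where Y solves the linearized equation Y' = Y *m A along the
    trajectory of [z0] with Y 0 = 1; vectors are rows, so Y acts on the right. Gronwall's inequality
    for psi y - psi z - (y - z) *m Y gives the estimate, because by [uniform_sdf] this difference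
    satisfies the linear equation up to a small error. *)
Lemma local_flow_sdf z0 (DF : V -> V -> V) :
 (forall t : R, `|t| < T -> sdf F (psi z0 t) (DF (psi z0 t))) ->
 forall t : R, `|t| < T -> exists D, sdf (psi^~ t) z0 D.
Proof.
move=> FD t tT; pose S := `|t|; pose c s := psi z0 s; pose D s := DF (c s).
have cc (s : R) : `|s| <= S -> {for s, continuous c}.
 by move=> sS; apply: drv_cts (psi_drv _ _); exact: le_lt_trans sS tT.
have cD (s : R) : `|s| <= S -> sdf F (c s) (D s).
 by move=> sS; apply: FD; exact: le_lt_trans sS tT.
pose A s := linear_mx (D s).
have AE (s : R) v : `|s| <= S -> v *m A s = D s v.
 by move=> /cD[lD _ _]; exact: linear_mxE.
have AL (s : R) : `|s| <= S -> `|A s| <= L.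
 move=> sS; apply: mxn_le => // i j; rewrite mxE.
 apply: le_trans (entry_le _ _ _) _.
 apply: le_trans (sdf_bound FL (cD s sS) _) _.
 rewrite ler_piMr//; apply: mxn_le => // i' j'; rewrite mxE.
 by case: (_ && _); rewrite ?normr1 ?normr0.
have S0 : 0 <= S by exact: normr_ge0.
have cS s : `|clamp S s| <= S by exact: clamp_norm.
have Ac (s : R) : {for s, continuous (A \o clamp S)}.
 apply/cvgrPdist_lt => e e0.
 have e20 : 0 < e / 2 by rewrite divr_gt0.
 have [d d0 hd] := sdf_close e20 (cD _ (cS s)).
 have : \forall s' \near s, `|c (clamp S s) - c (clamp S s')| < d.
  have cc' : {for s, continuous (c \o clamp S)}.
   by apply: continuous_comp; [exact: clamp_cts|exact: cc].
  by move/cvgrPdist_lt : cc'; apply.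
 apply: filterS => s' ss'; apply: le_lt_trans (_ : _ <= e / 2) _; last lra.
 apply: mxn_le => [|i j]; first lra.
 rewrite !mxE; have := hd _ _ _ (cD _ (cS s')) (delta_mx ord0 i).
 rewrite distrC => /(_ ss') h; have := entry_le (D (clamp S s) (delta_mx ord0 i) -
  D (clamp S s') (delta_mx ord0 i)) ord0 j.
 rewrite !mxE => h'; apply: le_trans h' _; apply: le_trans h _.
 rewrite ler_piMr ?(ltW e20)//; apply: mxn_le => // i' j'; rewrite mxE.
 by case: (_ && _); rewrite ?normr1 ?normr0.
pose G (s : R) (Y : 'M[R]_m) := Y *m A (clamp S s).
have mL : m%:R * L * T <= 2^-1.
 apply: le_trans LT; rewrite ler_wpM2r ?(ltW T0)// ler_wpM2r//.
 by rewrite lerDl.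
have mul_c (X Y : 'M[R]_m) (s : R) : `|s| <= S -> `|X *m A s - Y *m A s| <= m%:R * L * `|X - Y|.
 move=> sS; rewrite -mulmxBl; apply: le_trans (mulmxn _ _) _.
 rewrite [leRHS]mulrAC ler_pM ?mulr_ge0//; exact: AL.
have [|s X Y|Y Yc s|Y [Yc Y0 dY]] := @picard _ _ _ G T (m%:R * L) T0 _ mL _ _ 1%:M.
- by rewrite mulr_ge0.
- exact: mul_c.
- by apply: cvg_mulmx; [exact: Yc|exact: Ac].
exists (fun v => v *m Y t); split.
- by move=> a u v; rewrite mulmxDl scalemxAl.
- by exists (m%:R * `|Y t|) => v; apply: le_trans (mulmxn _ _) _; rewrite mulrAC.
(* Gronwall's inequality will return 4 * S * e1 * |y - z|, and S < T. *)
move=> e e0; pose e1 := e / (4 * T).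
have e10 : 0 < e1 by rewrite divr_gt0// mulr_gt0.
have [d d0 hd] := uniform_sdf e10 cc cD.
exists (d / 2); first by rewrite divr_gt0.
move=> y z yz0 zz0.
have := @gronwall_short _ _ _ (fun s => psi y s - psi z s - (y - z) *m Y s)
 (fun s => F (psi y s) - F (psi z s) - (y - z) *m (Y s *m A s)) S (m%:R * L)
 (e1 * (2 * `|y - z|)) S0 _ _ _ _ _ t (lexx _).
rewrite !psi0 Y0 mulmx1 subrr normr0 mulr0 add0r => H.
apply: le_trans (H _ _ _ _ _) _.
- by rewrite mulr_ge0.
- by apply: le_trans mL; rewrite ler_wpM2l ?mulr_ge0// ltW.
- by apply: mulr_ge0; [exact: ltW e10|rewrite mulr_ge0].
- move=> s sS; have sT : `|s| < T by exact: le_lt_trans sS tT.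
 apply: is_deriveB; first by apply: is_deriveB; exact: psi_drv.
 have dYs := dY s sT; rewrite /G clamp_id// in dYs.
 exact: (sdf_deriv dYs (sdf_mulmxl _ _)).
- move=> s sS; have sT : `|s| < T by exact: le_lt_trans sS tT.
 have ys : `|psi y s - c s| < d by apply: le_lt_trans (local_flow_lip _ _ sT) _; lra.
 have zs : `|psi z s - c s| < d by apply: le_lt_trans (local_flow_lip _ _ sT) _; lra.
 have a1 := hd s _ _ sS ys zs; rewrite -AE// in a1.
 rewrite mulmxA -(subrK (psi y s *m A s - psi z s *m A s) (F _ - F _ - _)).
 rewrite addrC; apply: le_trans (_ : _ <= `|(psi y s - psi z s - (y - z) *m Y s) *m A s| +
  `|F (psi y s) - F (psi z s) - (psi y s - psi z s) *m A s|) _.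
  apply: le_trans (ler_normD _ _); rewrite le_eqVlt; apply/orP; left; apply/eqP.
  congr (`| _ |); rewrite !mulmxBl.
  by apply/matrixP => i j; rewrite !mxE; ring.
 apply: lerD.
  apply: le_trans (mulmxn _ _) _; rewrite mulrAC ler_wpM2r//.
  by rewrite ler_wpM2l// AL.
 apply: le_trans a1 _; rewrite ler_pM2l//; exact: local_flow_lip.
have ST : S / T <= 1 by rewrite ler_pdivrMr// mul1r ltW.
have -> : 2 * S * (e1 * (2 * `|y - z|)) = (S / T) * (e * `|y - z|).
 by rewrite /e1; field; rewrite gt_eqF.
by rewrite ler_piMl// mulr_ge0// ltW.
Qed.
End LocalFlow.

Lemma clamp_mx_lip (R : realType) (m n : nat) (d : R) (y z : 'M[R]_(m, n)) :
 `|map_mx (clamp d) y - map_mx (clamp d) z| <= `|y - z|.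
Proof.
apply: mxn_le => // i j; rewrite !mxE; apply: le_trans (clamp_lip _ _ _) _.
by have := entry_le (y - z) i j; rewrite !mxE.
Qed.

(** The field becomes globally Lipschitz after composition with the retraction [clip] onto a cube of
    radius d / 2 around [z0]. The speed is at most K and K * T <= d / 8, so trajectories that start
    within d / 4 stay in the cube, where [clip] is the identity. *)
Lemma local_flow (R : realType) (m : nat) (G : 'rV[R]_m -> 'rV[R]_m) (U : set 'rV[R]_m) z0 :
 open U -> U z0 -> (forall z, U z -> exists D, sdf G z D) ->
 exists (r T C : R) (psi : 'rV[R]_m -> R -> 'rV[R]_m),
  [/\ 0 < r, 0 < T, 0 < C,
   forall z (t : R), `|z - z0| < r -> `|t| < T ->
   [/\ psi z 0 = z, U (psi z t), is_derive t 1 (psi z) (G (psi z t)),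
     `|psi z t - z| <= C * `|t| & exists D, sdf (psi^~ t) z D] &
   forall y z (t : R), `|y - z0| < r -> `|z - z0| < r -> `|t| < T ->
    `|psi y t - psi z t| <= 2 * `|y - z|].
Proof.
move=> oU Uz0 GD; have [D0 /sdf_lip[L L0 [d1 d10 GL]]] := GD _ Uz0.
have /nbhs_normP[d2 /= d20 Ud] : nbhs z0 U by exact: open_nbhs_nbhs.
pose d := Num.min d1 d2; have d0 : 0 < d by rewrite lt_min d10.
have dd1 : d <= d1 by rewrite ge_min lexx.
have dd2 : d <= d2 by rewrite ge_min lexx orbT.
move: d d0 dd1 dd2 => d d0 dd1 dd2.
pose clip (z : 'rV[R]_m) := z0 + map_mx (clamp (d / 2)) (z - z0).
have d20' : 0 <= d / 2 by rewrite divr_ge0// ltW.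
have clipd z : `|clip z - z0| <= d / 2.
 rewrite /clip addrAC subrr add0r; apply: mxn_le => // i j.
 by rewrite mxE; exact: clamp_norm.
have clip_lip y z : `|clip y - clip z| <= `|y - z|.
 rewrite /clip opprD addrACA subrr add0r.
 apply: le_trans (clamp_mx_lip _ _ _) _.
 by rewrite opprB addrA subrK.
have clip_id z : `|z - z0| <= d / 2 -> clip z = z.
 move=> zz0; rewrite /clip -[RHS](subrK z0) addrC; congr (_ + _).
 apply/matrixP => i j; rewrite mxE clamp_id//.
 exact: le_trans (entry_le _ _ _) zz0.
pose F := G \o clip.
have FL y z : `|F y - F z| <= L * `|y - z|.
 apply: (@le_trans _ _ (L * `|clip y - clip z|)); last by rewrite ler_pM2l.
 by apply: GL; apply: le_lt_trans (clipd _) _; qlra.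
pose K := `|G z0| + L * d + 1.
have K0 : 0 < K by rewrite ltr_wpDl// addr_ge0// mulr_ge0// ltW.
have FK z : `|F z| <= K.
 have := GL (clip z) z0; rewrite subrr normr0 => h.
 have {}h : `|G (clip z) - G z0| <= L * `|clip z - z0|.
  by apply: h => //; apply: le_lt_trans (clipd _) _; qlra.
 have := ler_distD (G z0) (G (clip z)) 0; rewrite !subr0 => h2.
 have : L * `|clip z - z0| <= L * d.
  by rewrite ler_pM2l//; apply: le_trans (clipd _) _; qlra.
 rewrite /F /K /=; qlra.
pose M : R := (m%:R + 1) * L.
have M0 : 0 < M by rewrite mulr_gt0// ltr_wpDl.
pose T := Num.min ((2 * M)^-1) (d / (8 * K)).
have T0 : 0 < T by rewrite lt_min invr_gt0 mulr_gt0//= divr_gt0// mulr_gt0.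
have MT : M * T <= 2^-1.
 apply: (@le_trans _ _ (M * (2 * M)^-1)); first by rewrite ler_pM2l// ge_min lexx.
 by rewrite invfM mulrCA divff ?gt_eqF// mulr1.
have KT : K * T <= d / 8.
 apply: (@le_trans _ _ (K * (d / (8 * K)))); first by rewrite ler_pM2l// ge_min lexx orbT.
 by rewrite le_eqVlt; apply/orP; left; apply/eqP; field; rewrite gt_eqF.
have LT : L * T <= 2^-1.
 apply: le_trans MT; rewrite ler_pM2r// /M ler_peMl ?(ltW L0)// lerDr.
 exact: ler0n.
move: T T0 MT KT LT => T T0 MT KT LT.
have /choice[psi psiP] z : exists y : R -> 'rV[R]_m, [/\ continuous y, y 0 = z &
  forall t : R, `|t| < T -> is_derive t 1 y (F (y t))].
 apply: (@picard _ _ _ (fun _ => F) T L) => //; first exact: ltW.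
 move=> y yc t; apply: (ccomp y F); first exact: yc.
 exact: (@lip_cts _ _ _ F _ L 1).
have psi0 z : psi z 0 = z by have [] := psiP z.
have psid z (t : R) : `|t| < T -> is_derive t 1 (psi z) (F (psi z t)) by have [_ _] := psiP z; exact.
have psiK z (t : R) : `|t| < T -> `|psi z t - z| <= K * `|t|.
 move=> tT; rewrite -[X in _ - X]psi0.
 apply: (@mean_value_mx_sym _ _ _ _ (fun t => F (psi z t)) `|t|) => // s st.
 by apply: psid; exact: le_lt_trans st tT.
have psin z (t : R) : `|z - z0| < d / 4 -> `|t| < T -> `|psi z t - z0| < d / 2.
 move=> zz tT; apply: le_lt_trans (ler_distD z _ _) _.
 have := psiK z t tT; have : K * `|t| <= K * T by rewrite ler_pM2l// ltW.
 qlra.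
have Fnear y : `|y - z0| < d / 2 -> \forall x \near y, G x = F x.
 move=> yz; apply/nbhs_normP; exists (d / 2 - `|y - z0|) => /=; first by rewrite subr_gt0.
 move=> x; rewrite /ball_ /= => yx; rewrite /F /= clip_id//.
 by have := ler_distD y x z0; rewrite [`|x - y|]distrC; qlra.
have Uy y : `|y - z0| < d / 2 -> U y.
 by move=> yz; apply: Ud; rewrite /ball_ /= distrC; qlra.
exists (d / 4), T, K, psi; split => //; first by rewrite divr_gt0.
 move=> z t zr tT; have zt := psin _ _ zr tT; split => //.
 - exact: Uy.
 - by rewrite (nbhs_singleton (Fnear _ zt)); exact: psid.
 - exact: psiK.
 - have /choice[DF DFP] y : exists D, `|y - z0| < d / 2 -> sdf F y D.
   have [yz|] := boolP (`|y - z0| < d / 2); last by move=> _; exists (fun=> 0).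
   have [D yD] := GD _ (Uy _ yz); exists D => _.
   by apply: sdf_near_eq yD; exact: Fnear.
  apply: (@local_flow_sdf _ _ F L T psi _ _ FL _ psi0 psid z DF) => //.
   exact: ltW.
  by move=> s sT; apply: DFP; exact: psin.
by move=> y z t yr zr tT; apply: (@local_flow_lip _ _ F L T psi) => //; exact: ltW.
Qed.

Lemma is_drv_comp_shift (R : realType) (W : normedModType R) (w : R -> W) (s a : R) dw :
 is_derive (s + a) 1 w dw -> is_derive s 1 (fun x => w (x + a)) dw.
Proof.
move=> d; have dv : differentiable w (s + a) by apply/derivable1_diffP; exact: ex_derive.
have da : is_derive s 1 (fun x : R => x + a) 1 by exact: is_derive_shift.
have := deriv_comp da dv.
by rewrite -deriveE// (@derive_val _ _ _ _ _ _ _ d).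
Qed.

(** Gronwall's inequality with zero initial difference and zero error. *)
Lemma local_uniq (R : realType) (m : nat) (G : 'rV[R]_m -> 'rV[R]_m) D (g h : R -> 'rV[R]_m) (t0 : R) :
 sdf G (g t0) D -> g t0 = h t0 ->
 (\forall t \near t0, is_derive (t : R) 1 g (G (g t))) ->
 (\forall t \near t0, is_derive (t : R) 1 h (G (h t))) -> \forall t \near t0, g t = h t.
Proof.
move=> /sdf_lip[L L0 [d d0 GL]] gh0 dg dh.
have gc : {for t0, continuous g} by exact: drv_cts (nbhs_singleton dg).
have hc : {for t0, continuous h} by exact: drv_cts (nbhs_singleton dh).
have : \forall t \near t0, [/\ is_derive (t : R) 1 g (G (g t)), is_derive (t : R) 1 h (G (h t)),
  `|g t0 - g t| < d & `|h t0 - h t| < d].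
 near=> t; split; near: t => //.
  by move/cvgrPdist_lt : gc; apply.
 by move/cvgrPdist_lt : hc; apply.
move=> /nbhs_normP[e /= e0 H].
pose S := Num.min (e / 2) (2 * L)^-1.
have S0 : 0 < S by rewrite lt_min divr_gt0//= invr_gt0 mulr_gt0.
have Se : S < e by rewrite gt_min; apply/orP; left; lra.
have LS : L * S <= 2^-1.
 apply: (@le_trans _ _ (L * (2 * L)^-1)); first by rewrite ler_pM2l// ge_min lexx orbT.
 by rewrite invfM mulrCA divff ?gt_eqF// mulr1.
apply/nbhs_normP; exists S => //= t; rewrite /ball_ /= distrC => tS.
have := @gronwall_short _ _ _ (fun s => g (s + t0) - h (s + t0))
 (fun s => G (g (s + t0)) - G (h (s + t0))) S L 0 (ltW S0) (ltW L0) LS (lexx _) _ _ (t - t0) (ltW tS).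
rewrite add0r gh0 subrr normr0 !mulr0 addr0 subrK => H1.
apply/eqP; rewrite -subr_eq0 -normr_le0; apply: H1 => s sS.
 have [|a b _ _] := H (s + t0); first by rewrite /ball_ /= distrC addrK; exact: le_lt_trans sS Se.
 by apply: is_deriveB; exact: is_drv_comp_shift.
rewrite addr0; have [|a b a1 b1] := H (s + t0).
 by rewrite /ball_ /= distrC addrK; exact: le_lt_trans sS Se.
by apply: GL; rewrite distrC// gh0.
Unshelve. all: by end_near. Qed.

(** * Charts and the gradient flow of a closed manifold *)

Section Charts.
Context (R : realType) (m : nat) (T : topologicalType).
Implicit Types a c : chart R m T.

Definition ovl a c : set 'rV[R]_m := cod a `&` par a @^-1` dom c.

Lemma nbhs_dom c x : dom c x -> nbhs x (dom c).
Proof. by move=> cx; apply: open_nbhs_nbhs; split=> //; exact: dom_open. Qed.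
Lemma nbhs_cod c z : cod c z -> nbhs z (cod c).
Proof. by move=> cz; apply: open_nbhs_nbhs; split=> //; exact: cod_open. Qed.

Lemma nbhs_ovl a c z : ovl a c z -> nbhs z (ovl a c).
Proof.
move=> [az cz]; apply: filterI; first exact: nbhs_cod.
by apply: (par_continuous az); exact: nbhs_dom.
Qed.

Lemma ovl_crd a c x : dom a x -> dom c x -> ovl a c (crd a x).
Proof. by move=> ax cx; split; [exact: crd_cod|rewrite /= crdK]. Qed.

Lemma C1_on_sdf (W : normedModType R) (U : set 'rV[R]_m) (h : 'rV[R]_m -> W) k z :
 mvp W -> open U -> Ck U k.+1 h -> U z -> sdf h z ('d h z).
Proof.
move=> MV oU [dh ch] Uz; apply: C1_sdf => //.
 by apply: filterS (open_nbhs_nbhs (conj oU Uz)) => y; exact: dh.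
by move=> v; case: k ch => [|k] /(_ v) => [|[d _]]; [exact|exact/differentiable_continuous/d].
Qed.

Lemma ovl_open a c : open (ovl a c).
Proof. by rewrite openE => z; exact: nbhs_ovl. Qed.

Lemma trans_sdf a c x : compatible a c -> dom a x -> dom c x ->
 sdf (transition a c) (crd a x) ('d (transition a c) (crd a x)).
Proof.
move=> [s _] ax cx; apply: (@C1_on_sdf _ (ovl a c) _ 0).
- exact: mvp_mx.
- exact: ovl_open.
- exact: s.
- exact: ovl_crd.
Qed.

Lemma jacobianE (p q : nat) (h : 'rV[R]_p -> 'rV[R]_q) z v : v *m 'J h z = 'd h z v.
Proof. by rewrite /jacobian mul_rV_lin1. Qed.

Lemma transitionK a c x : dom a x -> dom c x ->
 \forall z \near crd a x, (transition c a \o transition a c) z = z.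
Proof.
move=> ax cx; have := nbhs_ovl (ovl_crd ax cx).
by apply: filterS => z [az cz]; rewrite /transition /= crdK ?parK.
Qed.

Lemma transition_inv a c x : compatible a c -> dom a x -> dom c x ->
 'J (transition a c) (crd a x) *m 'J (transition c a) (crd c x) = 1%:M.
Proof.
move=> ac ax cx; have ca : compatible c a by case: ac.
have e : transition a c (crd a x) = crd c x by rewrite /transition /= crdK.
have d1 := trans_sdf ac ax cx; have d2 := trans_sdf ca cx ax.
rewrite -e in d2; have d12 := sdf_comp d1 d2.
have [_ e1] := sdf_diff (sdf_near_eq (transitionK ax cx) d12).
have d3 : sdf (fun z : 'rV[R]_m => z) (crd a x) id.
 by apply: (@sdf_linear _ _ _ _ _ 1) => // v; rewrite mul1r.
have [_ e2] := sdf_diff d3.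
apply/row_matrixP => i; rewrite !rowE -e mulmxA !jacobianE mulmx1.
exact: (etrans (esym (e1 (delta_mx ord0 i))) (e2 (delta_mx ord0 i))).
Qed.

End Charts.

(** The matrix identity behind the change of charts for gradients: partial derivatives transform by
    the transposed Jacobian and Gram matrices by congruence. *)
Lemma congruence_gradient (R : realType) (m : nat) (J K G : 'M[R]_m) (p : 'rV[R]_m) :
 J *m K = 1%:M -> G \in unitmx ->
 p *m J^T *m invmx (J *m G *m J^T) *m J = p *m invmx G.
Proof.
move=> JK Gu; have [Ju _] := mulmx1_unit JK.
have JTu : J^T \in unitmx by rewrite unitmx_tr.
have u : J *m G *m J^T \in unitmx by rewrite !unitmx_mul Ju Gu JTu.
apply: (can_inj (mulmxK Gu)); rewrite mulmxKV//.
have -> : p *m J^T *m invmx (J *m G *m J^T) *m J *m G =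
  p *m J^T *m invmx (J *m G *m J^T) *m (J *m G *m J^T) *m invmx J^T.
 by rewrite !mulmxA mulmxK.
by rewrite mulmxKV// mulmxK.
Qed.

Section ManifoldFlow.
Context (R : realType) (m : nat) (M : riemannian_manifold R m) (f : M -> R) (fS : smooth_function f).

Definition velocity (c : chart R m M) (z : 'rV[R]_m) := - gradient f c z.

Lemma velocity_sdf (c : chart R m M) z : atlas c -> cod c z -> exists D, sdf (velocity c) z D.
Proof.
move=> ac cz; have oc := @cod_open _ _ _ c.
have [P PD] : exists D, sdf (partials f c) z D.
 apply: sdf_entries => i j; exists ('d ('D_(delta_mx ord0 j) (f \o par c)) z).
 have := @C1_on_sdf _ _ R (cod c) ('D_(delta_mx ord0 j) (f \o par c)) 0 z
  (@mvp_real R) oc.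
 rewrite (_ : (fun y => partials f c y i j) = 'D_(delta_mx ord0 j) (f \o par c)); last first.
  by apply/funext => y; rewrite mxE.
 by apply => //; have [_] := fS ac 2%N; exact.
have GD := C1_on_sdf (@mvp_mx R _ _) oc (metric_smooth ac 1%N) cz.
have u : \forall y \near z, metric c y \in unitmx.
 by apply: filterS (nbhs_cod cz) => y; exact: metric_unit.
eexists; exact: sdf_opp (sdf_mulmx PD (sdf_invmx u GD)).
Qed.

Lemma gradient_change (c d : chart R m M) x : atlas c -> atlas d -> dom c x -> dom d x ->
 gradient f c (crd c x) *m 'J (transition c d) (crd c x) = gradient f d (crd d x).
Proof.
move=> ac ad cx dx; have cd := atlas_compatible ac ad.
have JI := transition_inv cd cx dx.
set J := 'J (transition c d) (crd c x) in JI *.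
have P : partials f c (crd c x) = partials f d (crd d x) *m J^T.
 apply/rowP => i; rewrite /partials [LHS]mxE.
 have dtr := sdf_diff (trans_sdf cd cx dx).
 have e : transition c d (crd c x) = crd d x by rewrite /transition /= crdK.
 have df : differentiable (f \o par d) (transition c d (crd c x)).
  by rewrite e; have [df _] := fS ad 1%N; exact/df/crd_cod.
 have ne : \forall z \near crd c x, ((f \o par d) \o transition c d) z = (f \o par c) z.
  have := nbhs_ovl (ovl_crd cx dx).
  by apply: filterS => z [az cz]; rewrite /transition /= crdK.
 rewrite -(near_eq_derive _ ne) deriveE; last exact: differentiable_comp dtr.1 df.
 rewrite diff_comp//=; last exact: dtr.1.
 rewrite -jacobianE -/J e partialsE//; last exact: crd_cod.
 rewrite -rowE !mxE; apply: eq_bigr => k _; rewrite !mxE mulrC; congr (_ * _).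
rewrite /gradient P (metric_change ac ad cx dx) -/J.
exact: (congruence_gradient _ JI (metric_unit ad (crd_cod dx))).
Qed.

(** The flow line condition at a single time. Local existence, prolongation and uniqueness on
    intervals concern curves that solve the equation on a part of [R] only. *)
Definition slv (g : R -> M) (t : R) : Prop := {for t, continuous g} /\
 forall c, atlas c -> dom c (g t) ->
  is_derive t 1 (crd c \o g) (velocity c (crd c (g t))).

Lemma slv_near_eq (g h : R -> M) t :
 (\forall s \near t, g s = h s) -> slv g t -> slv h t.
Proof.
move=> gh [gc gd]; have e := nbhs_singleton gh; split.
 rewrite /prop_for /continuous_at -e; apply: cvg_trans gc; apply: near_eq_cvg.
 by apply: filterS gh => s ->.
move=> c ac ch; rewrite -e in ch *.
apply: (near_eq_is_derive _ (gd c ac ch)) => //.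
by apply: filterS gh => s /= ->.
Qed.

Lemma slv_shift (g : R -> M) t a : slv g (t + a) -> slv (fun s => g (s + a)) t.
Proof.
move=> [gc gd]; split.
 apply: (ccomp (fun s : R => s + a) g) => //.
 by apply: cvgD; [exact: cvg_id|exact: cvg_cst].
by move=> c ac cg; exact: (@is_drv_comp_shift _ _ (crd c \o g) t a _ (gd c ac cg)).
Qed.

Lemma chart_change_drv (g : R -> M) t (c d : chart R m M) v : {for t, continuous g} ->
 compatible c d -> dom c (g t) -> dom d (g t) -> is_derive t 1 (crd c \o g) v ->
 is_derive t 1 (crd d \o g) (v *m 'J (transition c d) (crd c (g t))).
Proof.
move=> gc cd cg dg gv; have := sdf_deriv gv (trans_sdf cd cg dg).
rewrite jacobianE; apply: near_eq_is_derive => //.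
have : nbhs t (g @^-1` dom c) by apply: gc; exact: nbhs_dom.
by apply: filterS => s cs; rewrite /transition /= crdK.
Qed.

Lemma slv_chart (g : R -> M) t c : {for t, continuous g} -> atlas c -> dom c (g t) ->
 is_derive t 1 (crd c \o g) (velocity c (crd c (g t))) -> slv g t.
Proof.
move=> gc ac cg gv; split=> // d ad dg.
have := chart_change_drv gc (atlas_compatible ac ad) cg dg gv.
by rewrite /velocity mulNmx gradient_change.
Qed.

Definition msdf (phi : M -> M) (x : M) : Prop := {for x, continuous phi} /\
 forall c d, atlas c -> atlas d -> dom c x -> dom d (phi x) ->
  exists D, sdf (crd d \o phi \o par c) (crd c x) D.

Lemma msdf_comp (phi psi : M -> M) x : msdf phi x -> msdf psi (phi x) -> msdf (psi \o phi) x.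
Proof.
move=> [c1 d1] [c2 d2]; split; first exact: continuous_comp.
move=> c e ac ae cx ex; have [d ad dx] := atlas_cover (phi x).
have [D1 s1] := d1 _ _ ac ad cx dx; have [D2 s2] := d2 _ _ ad ae dx ex.
exists (D2 \o D1); have := sdf_comp s1.
rewrite /= crdK// => /(_ _ _ _ s2); apply: sdf_near_eq.
have : nbhs (crd c x) (par c @^-1` (phi @^-1` dom d)).
 apply: (par_continuous (crd_cod cx)); rewrite crdK//.
 by apply: c1; exact: nbhs_dom.
by apply: filterS => z dz; rewrite /= crdK.
Qed.

Lemma msdf_id x : msdf id x.
Proof.
split=> // c d ac ad cx dx; eexists.
exact: (trans_sdf (atlas_compatible ac ad) cx dx).
Qed.

End ManifoldFlow.

Lemma clopen_interval (R : realType) (a b s : R) (P : R -> Prop) : a < s < b -> P s ->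
 (forall t, a < t < b -> P t -> \forall u \near t, P u) ->
 (forall t, a < t < b -> ~ P t -> \forall u \near t, ~ P u) -> forall t, a < t < b -> P t.
Proof.
move=> sab Ps oP cP t tab.
have cI : connected [set` `]a, b[].
 by apply/connected_intervalP => x y /=; exact: interval_is_interval.
suff E : [set u | a < u < b /\ P u] = [set` `]a, b[].
 by have : [set` `]a, b[] t by []; rewrite -E => -[].
apply: cI; first by exists s.
- exists [set u | \forall v \near u, P v].
  rewrite openE => u /= /nbhs_interior; apply: filterS => v; exact.
 apply/seteqP; split => u /=; rewrite in_itv/=.
  by move=> [uab Pu]; split=> //; exact: oP.
 by move=> [uab /nbhs_singleton].
- exists (~` [set u | \forall v \near u, ~ P v]).
  apply: open_closedC; rewrite openE => u /= /nbhs_interior; apply: filterS => v; exact.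
 apply/seteqP; split => u /=; rewrite in_itv/=.
  by move=> [uab Pu]; split=> //; move/nbhs_singleton.
 by move=> [uab nP]; split=> //; apply: contrapT => nPu; apply: nP; exact: cP.
Qed.

Lemma nbhs_mxP (R : realType) (m n : nat) (z : 'M[R]_(m, n)) (P : set 'M[R]_(m, n)) :
 nbhs z P <-> exists2 e : R, 0 < e & forall y, `|z - y| < e -> P y.
Proof.
split=> [/(@nbhs_normP R 'M[R]_(m, n) z)[e /= e0 eP]|[e e0 eP]].
 by exists e => // y; exact: eP.
by apply/(@nbhs_normP R 'M[R]_(m, n) z); exists e => //= y; exact: eP.
Qed.

Section ManifoldFlow.
Context (R : realType) (m : nat) (M : riemannian_manifold R m) (f : M -> R) (fS : smooth_function f).
Notation slv := (slv f).

Lemma msdf_chart (phi : M -> M) x (c0 d0 : chart R m M) D : {for x, continuous phi} ->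
 atlas c0 -> atlas d0 -> dom c0 x -> dom d0 (phi x) ->
 sdf (crd d0 \o phi \o par c0) (crd c0 x) D -> msdf phi x.
Proof.
move=> phic ac0 ad0 c0x d0x sD; split=> // c d ac ad cx dx.
have t1 := trans_sdf (atlas_compatible ac ac0) cx c0x.
have t2 := trans_sdf (atlas_compatible ad0 ad) d0x dx.
have e : transition c c0 (crd c x) = crd c0 x by rewrite /transition /= crdK.
rewrite -e in sD; have s1 := sdf_comp t1 sD.
have e2 : (crd d0 \o phi \o par c0 \o transition c c0) (crd c x) = crd d0 (phi x).
 by rewrite /= /transition /= !crdK.
rewrite -e2 in t2; have s2 := sdf_comp s1 t2.
eexists; apply: sdf_near_eq s2.
have n1 : nbhs (crd c x) (par c @^-1` (phi @^-1` dom d0)).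
 apply: (par_continuous (crd_cod cx)); rewrite crdK//; apply: phic; exact: nbhs_dom.
apply: filterS2 n1 (nbhs_ovl (ovl_crd cx c0x)) => z d0z [cz c0z].
by rewrite /transition /= (crdK c0z) crdK.
Qed.

Ltac slra := first [revert_cmp; clear -R m M f fS; lra | lra].

(** The last clause is continuity at time 0, jointly in the point and the time; [flow_cts] spreads
    it to all times. *)
Lemma slv_local (x0 : M) : exists (V : set M) (T : R) (Psi : M -> R -> M),
 [/\ nbhs x0 V, 0 < T,
  forall x (t : R), V x -> `|t| < T ->
   [/\ Psi x 0 = x, slv (Psi x) t & msdf (fun y => Psi y t) x] &
  forall x W, V x -> nbhs x W -> \forall y \near x & t \near (0 : R), W (Psi y t)].
Proof.
have [c ac cx0] := atlas_cover x0.
have [r [T [C [psi [r0 T0 C0 psiP psiL]]]]] := local_flow (@cod_open _ _ _ c) (crd_cod cx0)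
 (fun z => @velocity_sdf _ _ _ _ fS c z ac).
pose V := [set x | dom c x /\ `|crd c x - crd c x0| < r].
have nV x : V x -> nbhs x V.
 move=> [cx xr]; apply: filterI; first exact: nbhs_dom.
 have : nbhs (crd c x) [set z | `|z - crd c x0| < r].
  apply/nbhs_mxP; exists (r - `|crd c x - crd c x0|) => [|z xz /=]; first by rewrite subr_gt0.
  by have := ler_distD (crd c x) z (crd c x0); rewrite [`|z - crd c x|]distrC; slra.
 exact: (crd_continuous cx).
pose Psi x t := par c (psi (crd c x) t).
exists V, T, Psi; split => //.
- by apply: nV; split=> //; rewrite subrr normr0.
- move=> x t [cx xr] tT; have [p0 pU pd pC [D pD]] := psiP _ _ xr tT.
 have e0 : Psi x 0 = x by rewrite /Psi p0 crdK.
 have cPsi : dom c (Psi x t) by exact: par_dom.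
 split=> //.
  apply: (slv_chart fS _ ac cPsi).
   apply: (ccomp (psi (crd c x)) (par c)).
    exact: drv_cts pd.
   exact: par_continuous.
  rewrite /Psi parK//; apply: near_eq_is_derive pd.
  apply/nbhs_normP; exists (T - `|t|) => /=; first by rewrite subr_gt0.
  move=> s; rewrite /ball_ /= => ts; rewrite parK//.
  have [|//] := psiP _ s xr; have := ler_distD t s 0; rewrite !subr0 [`|s - t|]distrC; slra.
 have cont : {for x, continuous (fun y => Psi y t)}.
  apply: (ccomp (crd c) (fun z => par c (psi z t))).
   exact: crd_continuous.
  apply: (ccomp (fun z => psi z t) (par c)); last exact: par_continuous.
  exact: sdf_cts pD.
 apply: (msdf_chart cont ac ac cx cPsi (D := D)).
 apply: sdf_near_eq pD; have := nV x (conj cx xr) => nVx.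
 have : nbhs (crd c x) (par c @^-1` V).
  by apply: (par_continuous (crd_cod cx)); rewrite crdK.
 apply: filterS2 (nbhs_cod (crd_cod cx)) => z cz [dz zr].
 rewrite parK// in zr; have [_ Uz _ _ _] := psiP _ _ zr tT.
 by rewrite /= /Psi !parK.
- move=> x W [cx xr] xW.
 have : nbhs (crd c x) (par c @^-1` W) by apply: (par_continuous (crd_cod cx)); rewrite crdK.
 move=> /nbhs_mxP[e e0 eW].
 have e20 : 0 < e / 2 by rewrite divr_gt0.
 exists ([set y | V y /\ `|crd c x - crd c y| < e / 2],
     [set t : R | `|t| < Num.min T (e / (2 * C))]).
  split => /=.
   apply: filterI; first exact: nV.
   by have /cvgrPdist_lt/(_ _ e20) := @crd_continuous _ _ _ c _ cx.
  apply/nbhs_normP; exists (Num.min T (e / (2 * C))).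
   by rewrite /= lt_min T0 divr_gt0// mulr_gt0.
  by move=> t; rewrite /ball_ /= sub0r normrN.
 move=> [y t] [/= [[cy yr] xy]]; rewrite lt_min => /andP[tT tC].
 apply: eW; have [_ _ _ pC _] := psiP _ _ yr tT.
 have : C * `|t| < e / 2 by rewrite mulrC -ltr_pdivlMr// -mulrA -invfM.
 by have := ler_distD (crd c y) (crd c x) (psi (crd c y) t); rewrite [`|crd c y - psi _ _|]distrC; slra.
Qed.

Lemma slv_near_uniq (g h : R -> M) (t : R) : g t = h t ->
 (\forall s \near t, slv g s) -> (\forall s \near t, slv h s) ->
 \forall s \near t, g s = h s.
Proof.
move=> gh sg sh; have [c ac cg] := atlas_cover (g t).
have [D vD] := velocity_sdf fS ac (crd_cod cg).
have dn (k : R -> M) : dom c (k t) -> (\forall s \near t, slv k s) -> \forall s \near t, dom c (k s).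
 move=> ck /nbhs_singleton[kc _]; apply: kc; exact: nbhs_dom.
have cg' := dn g cg sg; have ch' : \forall s \near t, dom c (h s) by apply: dn => //; rewrite -gh.
have dd (k : R -> M) : (\forall s \near t, dom c (k s)) -> (\forall s \near t, slv k s) ->
  \forall s \near t, is_derive (s : R) 1 (crd c \o k) (velocity f c ((crd c \o k) s)).
 by move=> k1 k2; apply: filterS2 k1 k2 => s cs [_ ks]; exact: ks.
have := @local_uniq R m (velocity f c) D (crd c \o g) (crd c \o h) t vD (congr1 _ gh) (dd _ cg' sg) (dd _ ch' sh).
move=> H; near=> s; rewrite -[LHS](@crdK _ _ _ c) -1?[RHS](@crdK _ _ _ c).
- by congr (par c _); near: s.
- by near: s.
- by near: s.
Unshelve. all: by end_near. Qed.

(** The times of agreement form an open set by local uniqueness and a closed one because [M] is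
    Hausdorff. *)
Lemma slv_uniq (a b s : R) (g h : R -> M) : a < s < b -> g s = h s ->
 (forall t, a < t < b -> slv g t) -> (forall t, a < t < b -> slv h t) ->
 forall t, a < t < b -> g t = h t.
Proof.
move=> sab gh sg sh.
have nab t : a < t < b -> \forall u \near t, a < u < b.
 by move=> tab; apply: (near_in_itvoo (a := a) (b := b)); rewrite in_itv.
apply: (clopen_interval sab gh).
 move=> t tab ght; apply: slv_near_uniq => //; apply: filterS (nab t tab) => u.
  exact: sg.
 exact: sh.
move=> t tab /eqP ght.
have := @carrier_hausdorff _ _ M; rewrite open_hausdorff => /(_ _ _ ght)[[A B] /= [tA tB] [oA oB AB]].
rewrite !inE in tA tB.
have nA : \forall u \near t, A (g u) by apply: (sg t tab).1; exact: open_nbhs_nbhs.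
have nB : \forall u \near t, B (h u) by apply: (sh t tab).1; exact: open_nbhs_nbhs.
apply: filterS2 nA nB => u Au Bu e.
have : (A `&` B) (g u) by split=> //; rewrite e.
by rewrite (eqP AB).
Qed.


Lemma msdf_near_eq (phi psi : M -> M) x :
 (\forall y \near x, phi y = psi y) -> msdf phi x -> msdf psi x.
Proof.
move=> pp [pc pd]; have e := nbhs_singleton pp; split.
 rewrite /prop_for /continuous_at -e; apply: cvg_trans pc; apply: near_eq_cvg.
 by apply: filterS pp => s ->.
move=> c d ac ad cx dx; rewrite -e in dx.
have [D sD] := pd c d ac ad cx dx; exists D; apply: sdf_near_eq sD.
have : nbhs (crd c x) (par c @^-1` [set y | phi y = psi y]).
 by apply: (par_continuous (crd_cod cx)); rewrite crdK.
by apply: filterS => z /= ->.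
Qed.

Hypothesis cM : compact [set: M].

(** Compactness turns positive times that work near each point into a single one. It is used for the
    existence of solutions and again for the differentiability of the flow. *)
Lemma uniform_time (P : R -> M -> Prop) :
 (forall x : M, exists2 T, 0 < T & \forall y \near x, P T y) ->
 (forall S T x, S <= T -> P T x -> P S x) -> exists2 T, 0 < T & forall x, P T x.
Proof.
move=> loc mono.
have := (compact_near_coveringP [set: M]).1 cM R (0^'+) (fun T x => P T x) _ => H.
have {}H : \forall T \near 0^'+, [set: M] `<=` P T.
 apply: H => x _; have [T T0 TP] := loc x.
 exists ([set y | P T y], [set S | S < T]); first by split=> //=; exact: nbhs_right_lt.
 by move=> [y S] [/= PT /ltW ST]; exact: mono PT.
have [T [TP T0]] := @filter_ex _ (0^'+ : set_system R) _ _ (filterI H (nbhs_right_gt 0)).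
by exists T => // x; exact: TP.
Qed.

(** Solutions of length T start at every point, so the given one can be restarted near both ends.
    Restarting at distance T / 2 before an end gains T / 2 and leaves an overlap on which [slv_uniq]
    identifies the old and the new curve. *)
Lemma slv_extend (T S : R) (g : R -> M) : 0 < T -> T <= S ->
 (forall x, exists2 h : R -> M, h 0 = x & forall t : R, `|t| < T -> slv h t) ->
 (forall t : R, `|t| < S -> slv g t) ->
 exists2 h : R -> M, h 0 = g 0 & forall t : R, `|t| < S + T / 2 -> slv h t.
Proof.
move=> T0 TS loc gS; pose a := S - T / 2.
have [hp hp0 hpT] := loc (g a); have [hm hm0 hmT] := loc (g (- a)).
have a0 : 0 < a by rewrite /a; lra.
pose h t := if a <= t then hp (t - a) else if t <= - a then hm (t + a) else g t.
have ep t : a - T < t < S -> hp (t - a) = g t.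
 move=> tI; apply: (@slv_uniq (a - T) S a (fun t => hp (t - a)) g _ _ _ _ t tI).
 - by rewrite /a; slra.
 - by rewrite subrr hp0.
 - move=> u /andP[u1 u2]; apply: slv_shift; apply: hpT.
  by rewrite ltr_norml; move: u1 u2; rewrite /a => *; apply/andP; split; slra.
 - move=> u /andP[u1 u2]; apply: gS.
  by rewrite ltr_norml; move: u1 u2; rewrite /a => *; apply/andP; split; slra.
have em t : - S < t < T - a -> hm (t + a) = g t.
 move=> tI; apply: (@slv_uniq (- S) (T - a) (- a) (fun t => hm (t + a)) g _ _ _ _ t tI).
 - by rewrite /a; apply/andP; split; slra.
 - by rewrite addNr hm0.
 - move=> u /andP[u1 u2]; apply: slv_shift; apply: hmT.
  by rewrite ltr_norml; move: u1 u2; rewrite /a => *; apply/andP; split; slra.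
 - move=> u /andP[u1 u2]; apply: gS.
  by rewrite ltr_norml; move: u1 u2; rewrite /a => *; apply/andP; split; slra.
have aS : a < S by rewrite /a; lra.
have hg t : `|t| < S -> h t = g t.
 rewrite ltr_norml => /andP[t1 t2]; rewrite /h; case: ifPn => at1.
  by apply: ep; rewrite t2 andbT; slra.
 by case: ifPn => // at2; apply: em; rewrite t1 /=; move: at2; rewrite /a => *; slra.
exists h; first by apply: hg; rewrite normr0; lra.
move=> t; rewrite ltr_norml => /andP[t1 t2].
have [tS|St] := ltP `|t| S.
 apply: slv_near_eq (gS t tS); apply/nbhs_normP; exists (S - `|t|); first by rewrite /= subr_gt0.
 move=> s; rewrite /ball_ /= => ts; apply/esym/hg.
 by have := ler_distD t s 0; rewrite !subr0 [`|s - t|]distrC; slra.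
have [tp|tn] := leP 0 t.
 rewrite ger0_norm// in St.
 apply: (@slv_near_eq _ _ _ _ (fun s => hp (s - a))).
  have : \forall s \near t, a < s by apply: lt_nbhsr; slra.
  by apply: filterS => s as1; rewrite /h ltW.
 apply: slv_shift; apply: hpT; rewrite ltr_norml.
 by move: t2 St; rewrite /a => *; apply/andP; split; slra.
rewrite ltr0_norm// in St.
apply: (@slv_near_eq _ _ _ _ (fun s => hm (s + a))).
 have : \forall s \near t, s < - a by apply: lt_nbhsl; slra.
 apply: filterS => s as1; rewrite /h; case: ifPn => [as2|_]; last by rewrite ltW.
 exfalso; slra.
apply: slv_shift; apply: hmT; rewrite ltr_norml.
by move: t1 St; rewrite /a => *; apply/andP; split; slra.
Qed.

Lemma flow_ex x : exists2 g, flow_line f g & g 0 = x.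
Proof.
have [T T0 loc] : exists2 T : R, 0 < T & forall x, exists2 h : R -> M, h 0 = x & forall t : R, `|t| < T -> slv h t.
 apply: (@uniform_time (fun T x => exists2 h : R -> M, h 0 = x & forall t : R, `|t| < T -> slv h t)).
  move=> y; have [V [T [Psi [yV T0 PsiP _]]]] := slv_local y.
  exists T => //; apply: filterS yV => z Vz; exists (Psi z).
   by have [|] := PsiP z 0 Vz; rewrite ?normr0.
  by move=> t tT; have [] := PsiP z t Vz tT.
 move=> S T y ST [h h0 hT]; exists h => // t tS; apply: hT; exact: lt_le_trans tS ST.
have ext n : exists2 h : R -> M, h 0 = x & forall t : R, `|t| < T + T / 2 *+ n -> slv h t.
 elim: n => [|n [h h0 hS]]; first by have [h] := loc x; rewrite mulr0n addr0; exists h.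
 have [|k k0 kS] := @slv_extend T (T + T / 2 *+ n) h T0 _ loc hS.
  by rewrite lerDl mulrn_wge0// divr_ge0// ltW.
 by exists k; rewrite ?k0// mulrSr addrA.
have /choice[h hP] n : exists h : R -> M, h 0 = x /\ forall t : R, `|t| < T + T / 2 *+ n -> slv h t.
 by have [h] := ext n; exists h.
have big (t : R) : exists n, `|t| < T + T / 2 *+ n.
 exists (Num.bound (`|t| / (T / 2))).
 have T20 : 0 < T / 2 by rewrite divr_gt0.
 have := archi_boundP (divr_ge0 (normr_ge0 t) (ltW T20)).
 rewrite ltr_pdivrMr// mulrC mulr_natr; lra.
have /choice[N NP] := big.
have hh k n (t : R) : `|t| < T + T / 2 *+ k -> `|t| < T + T / 2 *+ n -> h k t = h n t.
 wlog kn : k n / (k <= n)%N => [H|].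
  by have [/H|/ltnW/H] := leqP k n; [exact|move=> H1 a b; rewrite H1].
 have le : T / 2 *+ k <= T / 2 *+ n by rewrite ler_wpMn2l// divr_ge0// ltW.
 have T2 : 0 <= T / 2 *+ k by rewrite mulrn_wge0// divr_ge0// ltW.
 move=> tk _; apply: (@slv_uniq (- (T + T / 2 *+ k)) (T + T / 2 *+ k) 0).
 - by apply/andP; split; slra.
 - by rewrite (hP k).1 (hP n).1.
 - by move=> u; rewrite -ltr_norml => /(hP k).2.
 - by move=> u; rewrite -ltr_norml => uk; apply: (hP n).2; slra.
 - by rewrite -ltr_norml.
(* The solutions on growing intervals agree wherever both are defined, so any index whose interval
   contains t may be used. *)
pose g t := h (N t) t.
have gS t : slv g t.
 apply: slv_near_eq ((hP (N t)).2 t (NP t)).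
 apply/nbhs_normP; exists (T + T / 2 *+ N t - `|t|); first by rewrite /= subr_gt0.
 move=> s; rewrite /ball_ /= => ts; apply: hh => //.
 by have := ler_distD t s 0; rewrite !subr0 [`|s - t|]distrC; lra.
exists g; last by rewrite /g (hP _).1.
by split=> [t|t]; [exact: (gS t).1|exact: (gS t).2].
Qed.

Lemma flow_lineP g : flow_line f g <-> forall t, slv g t.
Proof. split=> [[gc gd] t|gS]; first by split; [exact: gc|exact: gd].
by split=> t; [exact: (gS t).1|exact: (gS t).2]. Qed.

Lemma flow_uniq g h s : flow_line f g -> flow_line f h -> g s = h s -> g = h.
Proof.
move=> /flow_lineP gS /flow_lineP hS gh; apply/funext => t.
apply: (@slv_uniq (- (`|s| + `|t| + 1)) (`|s| + `|t| + 1) s) => //.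
 by rewrite -ltr_norml; have := normr_ge0 t; lra.
by rewrite -ltr_norml; have := normr_ge0 s; lra.
Qed.

Definition flow (t : R) (x : M) : M := sval (cid2 (flow_ex x)) t.

Lemma flowP x : flow_line f (flow^~ x).
Proof. by rewrite /flow; case: cid2. Qed.
Lemma flow0 x : flow 0 x = x.
Proof. by rewrite /flow; case: cid2. Qed.
Lemma flow_shift_line g a : flow_line f g -> flow_line f (fun t => g (t + a)).
Proof. by move=> /flow_lineP gS; apply/flow_lineP => t; exact/slv_shift/gS. Qed.

Lemma flowD s t x : flow (s + t) x = flow s (flow t x).
Proof.
have := @flow_uniq (fun u => flow (u + t) x) (flow^~ (flow t x)) 0
 (flow_shift_line t (flowP x)) (flowP _).
by rewrite add0r flow0 => /(_ erefl)/(congr1 (@^~ s)).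
Qed.

Lemma flow_lineE g t : flow_line f g -> g t = flow t (g 0).
Proof.
move=> gf; have := @flow_uniq g (flow^~ (g 0)) 0 gf (flowP _).
by rewrite flow0 => /(_ erefl)/(congr1 (@^~ t)).
Qed.

Lemma flow_local (x : M) : exists (V : set M) (T : R), [/\ nbhs x V, 0 < T,
  forall y (t : R), V y -> `|t| < T -> msdf (flow t) y &
  forall W : set M, nbhs x W -> \forall y \near x & t \near (0 : R), W (flow t y)].
Proof.
have [V [T [Psi [xV T0 PsiP PsiC]]]] := slv_local x.
have E y (t : R) : V y -> `|t| < T -> Psi y t = flow t y.
 move=> Vy tT; apply: (@slv_uniq (- T) T 0 (Psi y) (flow^~ y)) => //.
 - by rewrite oppr_lt0 T0.
 - by rewrite flow0; have [] := PsiP y 0 Vy; rewrite ?normr0.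
 - by move=> u; rewrite -ltr_norml => uT; have [] := PsiP y u Vy uT.
 - by move=> u _; move: u; apply/flow_lineP; exact: flowP.
 - by rewrite -ltr_norml.
have nV : nbhs x V by [].
exists (interior V), T; split => //; first exact: nbhs_interior.
 move=> y t Vy tT; have [_ _] := PsiP y t (nbhs_singleton Vy) tT.
 by apply: msdf_near_eq; apply: filterS Vy => z Vz; exact: E.
move=> W xW; have [[A B] /= [xA B0] AB] := PsiC x W (nbhs_singleton xV) xW.
have nT : nbhs (0 : R) [set t : R | `|t| < T].
 by apply/nbhs_normP; exists T => //= t; rewrite /ball_ /= sub0r normrN.
exists (A `&` V, B `&` [set t : R | `|t| < T]); first by split=> /=; exact: filterI.
move=> [y t] [/= [Ay Vy] [Bt tT]]; rewrite -E//.
exact: (AB (y, t)).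
Qed.

(** By the group law the map for time t is an iterate of the map for t / n.+1, which is below the
    uniform time T. *)
Lemma flow_msdf t x : msdf (flow t) x.
Proof.
have [T T0 TP] : exists2 T : R, 0 < T & forall x, forall t : R, `|t| < T -> msdf (flow t) x.
 apply: (@uniform_time (fun T x => forall t : R, `|t| < T -> msdf (flow t) x)).
  move=> y; have [V [T [yV T0 VT _]]] := flow_local y; exists T => //.
  by apply: filterS yV => z Vz s; exact: VT.
 by move=> S T y ST TP s sS; apply: TP; exact: lt_le_trans sS ST.
have T20 : 0 < T / 2 by rewrite divr_gt0.
have [n nt] : exists n : nat, `|t| < T *+ n.+1.
 exists (Num.bound (`|t| / T)).
 have := archi_boundP (divr_ge0 (normr_ge0 t) (ltW T0)).
 rewrite ltr_pdivrMr// mulrC mulr_natr => /lt_le_trans; apply.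
 by rewrite ler_wpMn2l// ltW.
have : `|t / n.+1%:R| < T.
 by rewrite normrM normfV [`|_%:R|]ger0_norm// ltr_pdivrMr// mulr_natr.
have -> : flow t = flow (t / n.+1%:R *+ n.+1).
 by rewrite -mulr_natr divfK// pnatr_eq0.
move: (t / n.+1%:R) => s sT; elim: (n.+1) => [|k IH].
 by rewrite mulr0n; apply: (@msdf_near_eq id); [apply: nearW => y; rewrite flow0|exact: msdf_id].
rewrite mulrS (_ : flow _ = flow s \o flow (s *+ k)); last by apply/funext => y /=; rewrite flowD.
by apply: msdf_comp IH _; exact: TP.
Qed.

(** As flow s y = flow t (flow (s - t) y), continuity of the map for the fixed time t and joint
    continuity at time 0 suffice. *)
Lemma flow_cts : continuous (fun tx : R * M => flow tx.1 tx.2).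
Proof.
move=> [t x] W /= tW; have := (flow_msdf t x).1 W tW => xW.
have [_ [_ [_ _ _ /(_ _ xW)[[A B] /= [xA B0] AB]]]] := flow_local x.
exists ([set s | B (s - t)], A); first split => //=.
 have st : (s - t) @[s --> (t : R)] --> (0 : R).
  by rewrite -(subrr (t : R)); apply: cvgB; [exact: cvg_id|exact: cvg_cst].
 exact: (st _ B0).
move=> [s y] [/= Bs Ay]; have := AB (y, s - t) (conj Ay Bs).
by rewrite /= -flowD subrKC.
Qed.

End ManifoldFlow.

(** * Gradient-like flows and their limit points *)

Lemma pair_cts (T U V : topologicalType) (f : T -> U) (g : T -> V) x :
 {for x, continuous f} -> {for x, continuous g} -> {for x, continuous (fun y => (f y, g y))}.
Proof. by move=> fc gc; exact: (cvg_pair fc gc). Qed.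

(** The filter of finite lists directed by inclusion turns the near-covering form of compactness
    into a finite subcover. *)
Lemma cpt_finite_cover (T : topologicalType) (A : set T) (U : T -> set T) :
 compact A -> (forall x, A x -> nbhs x (U x)) ->
 exists2 s : seq T, (forall x, x \in s -> A x) & forall y, A y -> exists2 x, x \in s & U x y.
Proof.
move=> K AU; pose F : set_system (seq T) := [set P : set (seq T) | exists s0 : seq T, forall s : seq T, {subset s0 <= s} -> P s].
have FF : Filter F.
 split.
 - by exists [::].
 - move=> P Q [s1 P1] [s2 Q2]; exists (s1 ++ s2) => s ss; split.
   by apply: P1 => x xs; apply: ss; rewrite mem_cat xs.
  by apply: Q2 => x xs; apply: ss; rewrite mem_cat xs orbT.
 - by move=> P Q PQ [s1 P1]; exists s1 => s ss; exact/PQ/P1.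
have [|s0 /(_ s0 (fun _ => id)) cov] := (compact_near_coveringP A).1 K (seq T) F
 (fun s y => exists2 x, x \in [seq x <- s | `[< A x >]] & U x y) FF.
 move=> x Ax; exists (U x, [set s : seq T | x \in s]).
  by split=> /=; [exact: AU|exists [:: x] => s; apply; rewrite mem_head].
 by move=> [y s] [/= Uxy xs]; exists x => //; rewrite mem_filter xs andbT; exact/asboolP.
by exists [seq x <- s0 | `[< A x >]] => // x; rewrite mem_filter => /andP[/asboolP].
Qed.

(* A sdl point p of the flow phi, as seen in a standard chart: [nx] and [ny]
 are the squared norms of the unstable and of the stable coordinates. *)
Record sdl (R : realType) (M : topologicalType) (f : M -> R) (phi : R -> M -> M) (p : M) := Saddle {
 s_dom : set M;
 nx : M -> R;
 ny : M -> R;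
 s_rho : R;
 s_rho_gt0 : 0 < s_rho;
 s_dom_center : s_dom p;
 nx_ge0 : forall x, s_dom x -> 0 <= nx x;
 ny_ge0 : forall x, s_dom x -> 0 <= ny x;
 s_nbhs : forall r, 0 < r -> nbhs p [set x | [/\ s_dom x, nx x < r & ny x < r]];
 s_basis : forall W, nbhs p W -> exists2 r, 0 < r &
  [set x | [/\ s_dom x, nx x < r & ny x < r]] `<=` W;
 s_hgt : forall x, s_dom x -> nx x < s_rho -> ny x < s_rho -> f x = f p - nx x + ny x;
 s_fwd : forall x t, s_dom x -> ny x < s_rho -> 0 <= t -> expR (4 * t) * nx x < s_rho ->
  [/\ s_dom (phi t x), nx (phi t x) = expR (4 * t) * nx x & ny (phi t x) = expR (- (4 * t)) * ny x];
 s_bwd : forall x t, s_dom x -> nx x < s_rho -> 0 <= t -> expR (4 * t) * ny x < s_rho ->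
  [/\ s_dom (phi (- t) x), ny (phi (- t) x) = expR (4 * t) * ny x & nx (phi (- t) x) = expR (- (4 * t)) * nx x] }.

(** What the topological arguments use of a negative gradient flow. The axioms are invariant under
    reversal of height and time ([rvs]), so each statement about forward limits and lower ends
    yields one about backward limits and upper ends. *)
Record gradlike (R : realType) (M : topologicalType) := Gradlike {
 hgt : M -> R;
 gfl : R -> M -> M;
 crit : set M;
 hgt_cts : continuous hgt;
 gfl_cts : continuous (fun tx : R * M => gfl tx.1 tx.2);
 gfl0 : forall x, gfl 0 x = x;
 gflowD : forall s t x, gfl (s + t) x = gfl s (gfl t x);
 gfl_crit : forall t p, crit p -> gfl t p = p;
 hgt_decr : forall x s t, ~ crit x -> s < t -> hgt (gfl t x) < hgt (gfl s x);
 gsaddle : forall p, crit p -> sdl hgt gfl p }.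

Section Reversal.
Context (R : realType) (M : topologicalType).

Definition rvs_sdl (f : M -> R) phi p (S : sdl f phi p) :
 sdl (fun x => - f x) (fun t x => phi (- t) x) p.
Proof.
refine (@Saddle R M (fun x => - f x) (fun t x => phi (- t) x) p (s_dom S) (ny S) (nx S) (s_rho S) (s_rho_gt0 S)
 (s_dom_center S) (@ny_ge0 _ _ _ _ _ S) (@nx_ge0 _ _ _ _ _ S) _ _ _ _ _).
- by move=> r /(s_nbhs S); apply: filterS => x [].
- by move=> W /(s_basis S)[r r0 rW]; exists r => // x [] *; exact: rW.
- by move=> x Sx y1 x1; rewrite (s_hgt Sx x1 y1); ring.
- by move=> x t Sx x1 t0 y1; have [] := s_bwd Sx x1 t0 y1.
- by move=> x t Sx y1 t0 x1; rewrite opprK; have [] := s_fwd Sx y1 t0 x1.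
Defined.

Definition rvs (G : gradlike R M) : gradlike R M.
Proof.
refine (@Gradlike R M (fun x => - hgt G x) (fun t x => gfl G (- t) x) (crit G) _ _ _ _ _ _ _).
- by move=> x; apply: cvgN; exact: hgt_cts.
- move=> tx; apply: (ccomp (fun tx : R * M => (- tx.1, tx.2))
  (fun tx : R * M => gfl G tx.1 tx.2)); last exact: gfl_cts.
 by apply: pair_cts; [apply: cvgN; exact: cvg_fst|exact: cvg_snd].
- by move=> x; rewrite oppr0 gfl0.
- by move=> s t x; rewrite opprD gflowD.
- by move=> t p; exact: gfl_crit.
- by move=> x s t xc st; rewrite ltrN2; apply: hgt_decr => //; rewrite ltrN2.
- by move=> p pc; exact: rvs_sdl (gsaddle pc).
Defined.

End Reversal.

Section Gradlike.
Context (R : realType) (M : topologicalType) (hM : hausdorff_space M) (cM : compact [set: M]).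
Implicit Type G : gradlike R M.

Definition sbox (f : M -> R) phi p (S : sdl f phi p) (r : R) : set M :=
 [set x | [/\ s_dom S x, nx S x < r & ny S x < r]].

Lemma sbox_sub G p (S : sdl (hgt G) (gfl G) p) r r' : r <= r' -> sbox S r `<=` sbox S r'.
Proof. by move=> rr x [? ? ?]; split=> //; exact: lt_le_trans rr. Qed.
Lemma gflowK G t x : gfl G (- t) (gfl G t x) = x.
Proof. by rewrite -gflowD addNr gfl0. Qed.

Lemma crit_gfl G t x : crit G (gfl G t x) <-> crit G x.
Proof.
split=> [c|c]; last by rewrite gfl_crit.
by rewrite -(gflowK G t x) gfl_crit.
Qed.

Lemma hgt_nincr G x s t : s <= t -> hgt G (gfl G t x) <= hgt G (gfl G s x).
Proof.
rewrite le_eqVlt => /orP[/eqP->//|st].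
have [c|nc] := pselect (crit G x); first by rewrite !gfl_crit.
exact/ltW/hgt_decr.
Qed.

Lemma gfl_cts_x G t : continuous (gfl G t).
Proof.
move=> x; apply: (ccomp (fun x => (t, x)) (fun tx : R * M => gfl G tx.1 tx.2)).
 by apply: pair_cts; [exact: cvg_cst|exact: cvg_id].
exact: gfl_cts.
Qed.

Lemma gfl_cts_t G x : continuous (gfl G ^~ x).
Proof.
move=> t; apply: (ccomp (fun t => (t, x)) (fun tx : R * M => gfl G tx.1 tx.2)).
 by apply: pair_cts; [exact: cvg_id|exact: cvg_cst].
exact: gfl_cts.
Qed.

(* The orbit leaves the box through the face [nx = r], where the height has
 dropped by at least r / 2. *)
Ltac slra := first [revert_cmp; clear -R M hM cM; lra | lra].

Lemma sbox_fwd G p (S : sdl (hgt G) (gfl G) p) r x t : 0 < r -> r <= s_rho S ->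
 sbox S (r / 4) x -> 0 <= t -> hgt G p - r / 2 < hgt G (gfl G t x) ->
 sbox S r (gfl G t x).
Proof.
move=> r0 rS [Sx xr yr] t0 ht.
have x0 := nx_ge0 Sx; have y0 := ny_ge0 Sx.
have yS : ny S x < s_rho S by lra.
have e1 u : 0 <= u -> expR (- (4 * u)) * ny S x <= ny S x.
 by move=> u0; rewrite ler_piMl// -expR0 ler_expR oppr_le0 mulr_ge0.
have [lt|ge] := ltP (expR (4 * t) * nx S x) r.
 have [] := s_fwd Sx yS t0 (lt_le_trans lt rS) => d1 d2 d3; split=> //.
  by rewrite d2.
 by rewrite d3; have := e1 t t0; slra.
exfalso.
have xp : 0 < nx S x.
 by rewrite lt_neqAle x0 andbT; apply/eqP => x00; move: ge; rewrite -x00 mulr0; lra.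
pose r' := 3 / 4 * r.
have rx : 1 <= r' / nx S x by rewrite ler_pdivlMr// mul1r /r'; slra.
pose u := ln (r' / nx S x) / 4.
have e4 : expR (4 * u) * nx S x = r'.
 rewrite /u mulrCA divff// mulr1 lnK; first by rewrite divfK// gt_eqF.
 by rewrite posrE; exact: lt_le_trans ltr01 rx.
have u0 : 0 <= u by rewrite divr_ge0// ln_ge0.
have ut : u <= t.
 have : expR (4 * u) <= expR (4 * t).
  by rewrite -(ler_pM2r xp) e4; apply: le_trans ge; rewrite /r'; slra.
 by rewrite ler_expR ler_pM2l.
have [|d1 d2 d3] := s_fwd Sx yS u0 _; first by rewrite e4 /r'; slra.
have hh := s_hgt d1; rewrite d2 d3 e4 in hh.
have e1u := e1 u u0; have rr : r' = 3 / 4 * r by [].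
have {}hh := hh (ltac:(lra)) (ltac:(lra)).
by have := hgt_nincr G x ut; rewrite hh; slra.
Qed.

(** The orbit of y is constant, while a positive [nx] would grow like expR (4 * t) forwards and a
    positive [ny] backwards. So both vanish, and y lies in every neighbourhood of p. *)
Lemma sbox_crit G p (S : sdl (hgt G) (gfl G) p) y : sbox S (s_rho S) y -> crit G y -> y = p.
Proof.
move=> [Sy xS yS] yc; have x0 := nx_ge0 Sy; have y0 := ny_ge0 Sy.
have small (a : R) : 0 <= a -> a < s_rho S -> (forall t, 0 <= t -> expR (4 * t) * a < s_rho S -> expR (4 * t) * a = a) -> a = 0.
 move=> a0 aS H; apply/eqP; apply: contraT => an0.
 have ap : 0 < a by rewrite lt_neqAle eq_sym an0.
 pose b := (a + s_rho S) / 2.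
 have ab : a < b by rewrite /b; lra.
 have b0 : 0 < b / a by rewrite divr_gt0//; exact: lt_trans ab.
 have := H (ln (b / a) / 4); rewrite mulrCA divff// mulr1 lnK// divfK//.
 move=> H'; have : b = a.
  apply: H'; last by rewrite /b; slra.
  by rewrite divr_ge0// ln_ge0// ler_pdivlMr// mul1r ltW.
 by move=> ba; move: ab; rewrite ba ltxx.
have nx0 : nx S y = 0.
 apply: small => // t t0 lt; have [_ e _] := s_fwd Sy yS t0 lt.
 by rewrite -e gfl_crit.
have ny0 : ny S y = 0.
 apply: small => // t t0 lt; have [_ e _] := s_bwd Sy xS t0 lt.
 by rewrite -e gfl_crit.
apply: contrapT => yp; have := hM; rewrite open_hausdorff => /(_ p y).
case; first by apply/eqP => e; apply: yp.
move=> [A B] /= [pA yB] [oA oB /eqP AB]; rewrite !inE in pA yB.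
have [r r0 rA] := s_basis S (open_nbhs_nbhs (conj oA pA)).
have : (A `&` B) y by split=> //; apply: rA; rewrite /= nx0 ny0.
by rewrite AB.
Qed.

(** Compactness gives a cluster point y of the orbit, and the height along the orbit stays at least
    that of y. Were y not critical, the flow near y would drop below this bound. Near the critical
    y, [sbox_fwd] traps the orbit in arbitrarily small boxes, so y is its limit. *)
Lemma omg_ex G x : exists2 p, crit G p & gfl G t x @[t --> +oo] --> p.
Proof.
have [y _ xy] : exists2 y, [set: M] y & cluster (gfl G t x @[t --> +oo]) y.
 by have [y [_ ?]] := @cM (gfl G t x @[t --> +oo]) _ filterT; exists y.
have fy t : hgt G y <= hgt G (gfl G t x).
 have cl : closed [set z | hgt G z <= hgt G (gfl G t x)].
  have := @closed_comp _ _ (hgt G) [set u | u <= hgt G (gfl G t x)].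
  by apply => [? _|]; [exact: hgt_cts|exact: closed_le].
 apply: (cl y); move=> B yB.
 have [||z [/= z1 z2]] := xy [set gfl G s x | s in [set s | t <= s]] B => //.
  by exists t; split; [exact: num_real|move=> s ts /=; exists s => //; exact: ltW].
 by exists z; split => //; case: z1 => s ts <-; exact: hgt_nincr.
have yc : crit G y.
 apply: contrapT => ync.
 have lt : hgt G (gfl G 1 y) < hgt G y.
  by have := hgt_decr ync (@ltr01 R); rewrite gfl0.
 have nb : nbhs y [set z | hgt G (gfl G 1 z) < hgt G y].
  have : nbhs (hgt G (gfl G 1 y)) [set u | u < hgt G y] by exact: lt_nbhsl.
  apply: (ccomp (gfl G 1) (hgt G)).
   exact: gfl_cts_x.
  exact: hgt_cts.
 have [|z [/= [s _ <-] sz]] := xy [set gfl G s x | s in setT] _ _ nb.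
  by exists 0; split; [exact: num_real|move=> s _ /=; exists s].
 by have := fy (1 + s); rewrite gflowD leNgt sz.
exists y => // W yW; have S := gsaddle yc.
have [r r0 rW] := s_basis S yW.
pose q := Num.min r (s_rho S).
have q0 : 0 < q by rewrite lt_min r0 s_rho_gt0.
have qr : q <= r by rewrite ge_min lexx.
have qS : q <= s_rho S by rewrite ge_min lexx orbT.
have [|z [/= [s _ <-] sz]] := xy [set gfl G s x | s in setT] _ _ (s_nbhs S (divr_gt0 q0 (@ltr0n R 4))).
 by exists 0; split; [exact: num_real|move=> s _ /=; exists s].
exists s; split; first exact: num_real.
move=> t /ltW st; apply: rW; apply: (sbox_sub qr).
have -> : gfl G t x = gfl G (t - s) (gfl G s x) by rewrite -gflowD subrK.
apply: sbox_fwd => //; first by rewrite subr_ge0.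
by rewrite -gflowD subrK; have := fy t; lra.
Qed.


Definition omg G x : M := sval (cid2 (omg_ex G x)).

Lemma omg_crit G x : crit G (omg G x).
Proof. by rewrite /omg; case: cid2. Qed.
Lemma omg_cvg G x : gfl G t x @[t --> +oo] --> omg G x.
Proof. by rewrite /omg; case: cid2. Qed.
Lemma omg_uniq G x p : gfl G t x @[t --> +oo] --> p -> omg G x = p.
Proof. exact: (cvg_unique hM (@omg_cvg G x)). Qed.

Lemma omgE G t x : omg G (gfl G t x) = omg G x.
Proof.
apply: omg_uniq => W /omg_cvg[A [Ar AW]]; exists (A - t); split; first exact: num_real.
by move=> s As; rewrite /= -gflowD; apply: AW; rewrite -ltrBlDr.
Qed.

Lemma omg_of_crit G p : crit G p -> omg G p = p.
Proof.
move=> pc; apply: omg_uniq; rewrite (_ : (fun _ => _) = cst p); first exact: cvg_cst.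
by apply/funext => t; rewrite gfl_crit.
Qed.

Lemma hgt_omg_cvg G x : hgt G (gfl G t x) @[t --> +oo] --> hgt G (omg G x).
Proof.
by apply: (@cvg_comp _ _ _ (gfl G ^~ x) (hgt G)) (@omg_cvg G x) _; exact: hgt_cts.
Qed.

Lemma hgt_omg_le G x t : hgt G (omg G x) <= hgt G (gfl G t x).
Proof.
apply: cvgr_to_le (@hgt_omg_cvg G x) _.
by exists t; split; [exact: num_real|move=> s /ltW ts; exact: hgt_nincr].
Qed.

Lemma hgt_omg_lt G x t : ~ crit G x -> hgt G (omg G x) < hgt G (gfl G t x).
Proof.
move=> xc; apply: le_lt_trans (hgt_omg_le G x (t + 1)) _.
by apply: hgt_decr => //; rewrite ltrDl.
Qed.

(** A positive [nx] grows until it exceeds [ny]; the height is then below that of p, so the orbit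
    cannot tend to p. If [nx] is 0, only the decaying [ny] is left. *)
Lemma sbox_stable G p (S : sdl (hgt G) (gfl G) p) x : sbox S (s_rho S) x ->
 omg G x = p <-> nx S x = 0.
Proof.
move=> [Sx xS yS]; have x0 := nx_ge0 Sx; have y0 := ny_ge0 Sx; split => [xp|nx0].
 apply/eqP; apply: contraT => nxn0.
 have np : 0 < nx S x by rewrite lt_neqAle eq_sym nxn0.
 (* Any level will do that [nx] reaches inside the box and that exceeds [ny S x]. *)
 pose r' := Num.max (nx S x) ((ny S x + s_rho S) / 2).
 have r'S : r' < s_rho S by rewrite gt_max xS /=; lra.
 have r'x : nx S x <= r' by rewrite le_max lexx.
 have r'y : ny S x < r' by rewrite lt_max; apply/orP; right; lra.
 move: r' r'S r'x r'y => r' r'S r'x r'y.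
 have rx : 1 <= r' / nx S x by rewrite ler_pdivlMr// mul1r.
 pose u := ln (r' / nx S x) / 4.
 have e4 : expR (4 * u) * nx S x = r'.
  rewrite /u mulrCA divff// mulr1 lnK; first by rewrite divfK// gt_eqF.
  by rewrite posrE; exact: lt_le_trans ltr01 rx.
 have u0 : 0 <= u by rewrite divr_ge0// ln_ge0.
 have e1 : expR (- (4 * u)) * ny S x <= ny S x.
  by rewrite ler_piMl// -expR0 ler_expR oppr_le0 mulr_ge0.
 have [|d1 d2 d3] := s_fwd Sx yS u0 _; first by rewrite e4.
 have hh := s_hgt d1; rewrite d2 d3 e4 in hh.
 have {}hh := hh (ltac:(lra)) (ltac:(lra)).
 by have := hgt_omg_le G x u; rewrite hh xp; slra.
apply: omg_uniq => W /(s_basis S)[r r0 rW].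
(* Since 1 + 4 t <= expR (4 t), the stable part is below r from this time on. *)
pose t0 := ny S x / r; exists t0; split; first exact: num_real.
move=> t t0t; apply: rW.
have t0_ge0 : 0 <= t0 by rewrite divr_ge0// ltW.
have tp : 0 <= t by apply: le_trans t0_ge0 (ltW t0t).
have [|d1 d2 d3] := s_fwd Sx yS tp _; first by rewrite nx0 mulr0 s_rho_gt0.
split=> //; first by rewrite d2 nx0 mulr0.
rewrite d3 expRN mulrC ltr_pdivrMr ?expR_gt0//.
have : ny S x <= t * r by rewrite -ler_pdivrMr// ltW.
have : 1 + 4 * t <= expR (4 * t) by exact: expR_ge1Dx.
move=> h1 h2; apply: le_lt_trans h2 _; rewrite mulrC ltr_pM2l//; slra.
Qed.

(** Critical points are those whose height does not decrease in unit time. They form a closed, hence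
    compact set, and the boxes isolate them. *)
Lemma crit_finite G : finite_set (crit G).
Proof.
have cl : closed (crit G).
 rewrite (_ : crit G = [set x | hgt G (gfl G 1 x) >= hgt G x]); last first.
  apply/seteqP; split=> x /=; first by move=> xc; rewrite gfl_crit.
  move=> le; apply: contrapT => xc; have := hgt_decr xc (@ltr01 R).
  by rewrite gfl0 ltNge le.
 have := @closed_comp _ _ (fun x => hgt G (gfl G 1 x) - hgt G x) [set u | 0 <= u].
 rewrite (_ : _ @^-1` _ = [set x | hgt G (gfl G 1 x) >= hgt G x]).
  apply => [x _|]; last exact: closed_ge.
  apply: cvgB; last exact: hgt_cts.
  apply: (ccomp (gfl G 1) (hgt G)); first exact: gfl_cts_x.
  exact: hgt_cts.
 by apply/seteqP; split=> x /=; rewrite subr_ge0.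
have K : compact (crit G) by exact: subclosed_compact cl cM _.
have /choice[U UP] (p : M) : exists U : set M, crit G p -> nbhs p U /\ U `&` crit G `<=` [set p].
 have [pc|] := pselect (crit G p); last by exists set0.
 exists (sbox (gsaddle pc) (s_rho (gsaddle pc))) => _; split.
 - by apply: (s_nbhs (gsaddle pc)); exact: s_rho_gt0.
 - by move=> y [yb yc]; exact: sbox_crit yb yc.
have [|s sG cov] := @cpt_finite_cover M (crit G) U K; first by move=> p /UP[].
apply: (@sub_finite_set _ _ [set` s]); last exact: finite_seq.
move=> p pc; have [q qs qp] := cov p pc.
by have [_ /(_ p)] := UP q (sG q qs); move=> ->.
Qed.

Definition alf G : M -> M := omg (rvs G).

Lemma alf_crit G x : crit G (alf G x).
Proof. exact: (@omg_crit (rvs G)). Qed.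

Lemma alf_cvg G x : gfl G t x @[t --> -oo] --> alf G x.
Proof.
have := @omg_cvg (rvs G) x; rewrite /= => h.
rewrite (_ : (fun t => gfl G t x) = (fun t => gfl G (- t) x) \o (fun t => - t)).
 apply: (@cvg_comp _ _ _ (fun t : R => - t) (fun t => gfl G (- t) x)) h.
 by apply/cvgNry; exact: cvg_id.
by apply/funext => t /=; rewrite opprK.
Qed.

Lemma alf_uniq G x p : gfl G t x @[t --> -oo] --> p -> alf G x = p.
Proof. exact: (cvg_unique hM (@alf_cvg G x)). Qed.
Lemma alphaE G t x : alf G (gfl G t x) = alf G x.
Proof. by have := @omgE (rvs G) (- t) x; rewrite /= opprK. Qed.
Lemma alf_of_crit G p : crit G p -> alf G p = p.
Proof. exact: (@omg_of_crit (rvs G)). Qed.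
Lemma hgt_alf_ge G x t : hgt G (gfl G t x) <= hgt G (alf G x).
Proof. by have := @hgt_omg_le (rvs G) x (- t); rewrite /= opprK lerN2. Qed.
Lemma hgt_alf_gt G x t : ~ crit G x -> hgt G (gfl G t x) < hgt G (alf G x).
Proof. by move=> xc; have := @hgt_omg_lt (rvs G) x (- t) xc; rewrite /= opprK ltrN2. Qed.

Lemma hgt_alf_cvg G x : hgt G (gfl G t x) @[t --> -oo] --> hgt G (alf G x).
Proof.
by apply: (@cvg_comp _ _ _ (gfl G ^~ x) (hgt G)) (@alf_cvg G x) _; exact: hgt_cts.
Qed.

Lemma sbox_unstable G p (S : sdl (hgt G) (gfl G) p) x : sbox S (s_rho S) x ->
 alf G x = p <-> ny S x = 0.
Proof.
move=> [Sx xS yS]; exact: (@sbox_stable (rvs G) p (rvs_sdl S) x).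
Qed.

Lemma hits_hgt G x h : hgt G (omg G x) < h < hgt G (alf G x) ->
 exists t, hgt G (gfl G t x) = h.
Proof.
move=> /andP[h1 h2].
have [s hs] : exists s, h <= hgt G (gfl G s x).
 have : \forall s \near -oo, h <= hgt G (gfl G s x).
  by move/cvgr_ge : (@hgt_alf_cvg G x); apply.
 by move/filter_ex => [s]; exists s.
have [t ht] : exists t, hgt G (gfl G t x) <= h.
 have : \forall s \near +oo, hgt G (gfl G s x) <= h.
  by move/cvgr_le : (@hgt_omg_cvg G x); apply.
 by move/filter_ex => [t]; exists t.
have fc : continuous (fun s => hgt G (gfl G s x)).
 move=> u; apply: (ccomp (gfl G ^~ x) (hgt G)).
  exact: gfl_cts_t.
 exact: hgt_cts.
have [st|ts] := leP s t; last first.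
 exists s; apply/eqP; rewrite eq_le hs andbT; apply: le_trans ht.
 exact/hgt_nincr/ltW.
have [||u _ <-] := @IVT _ (fun s => hgt G (gfl G s x)) s t h st; last by exists u.
 exact: continuous_subspaceT.
by rewrite ge_min ht orbT /= le_max hs.
Qed.

Lemma gfl_inj_hgt G x s t : ~ crit G x ->
 hgt G (gfl G s x) = hgt G (gfl G t x) -> s = t.
Proof.
move=> xc e; apply/eqP; apply: contraT; rewrite neq_lt => /orP[] /(hgt_decr xc);
by rewrite e ltxx.
Qed.

End Gradlike.

(** * Broken flow lines parametrized by height: compactness, cutting and joining *)

Section Lines.
Context (R : realType) (M : topologicalType) (hM : hausdorff_space M) (cM : compact [set: M]).
Implicit Type G : gradlike R M.
Notation omg := (omg cM).
Notation alf := (alf cM).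

(* A broken flow line from p to q, parametrized by height and extended by
 constants. *)
Record line G (p q : M) (g : R -> M) : Prop := Line {
 line0 : forall h, h <= hgt G q -> g h = q;
 line1 : forall h, hgt G p <= h -> g h = p;
 line_hgt : forall h, hgt G q <= h <= hgt G p -> hgt G (g h) = h;
 line_flow : forall h t, g (hgt G (gfl G t (g h))) = gfl G t (g h);
 line_omg : forall h, g (hgt G (omg G (g h))) = omg G (g h);
 line_alpha : forall h, g (hgt G (alf G (g h))) = alf G (g h) }.

Lemma line_rvs G p q g : line G p q g -> line (rvs G) q p (fun h => g (- h)).
Proof.
move=> gl; split => /=.
- by move=> h hp; apply: (line1 gl); rewrite lerNr.
- by move=> h hq; apply: (line0 gl); rewrite lerNl.
- by move=> h /andP[h1 h2]; rewrite (line_hgt gl) ?opprK// lerNr h2 lerNl.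
- by move=> h t; rewrite opprK (line_flow gl).
- by move=> h; rewrite opprK; exact: (line_alpha gl).
- move=> h; rewrite opprK -[RHS]/(alf (rvs G) (g (- h))).
 suff -> : alf (rvs G) (g (- h)) = omg G (g (- h)) by rewrite (line_omg gl).
 apply/esym/(omg_uniq hM); have := @alf_cvg _ _ cM (rvs G) (g (- h)).
 move=> H; rewrite (_ : (fun t => gfl G t (g (- h))) = (fun t => gfl (rvs G) t (g (- h))) \o (fun t => - t)).
  apply: (@cvg_comp _ _ _ (fun t : R => - t) (fun t => gfl (rvs G) t (g (- h)))) H.
  by apply/cvgNrNy; exact: cvg_id.
 by apply/funext => t /=; rewrite opprK.
Qed.

Lemma line_le G p q g : line G p q g -> hgt G q <= hgt G p.
Proof.
move=> gl; rewrite leNgt; apply/negP => pq.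
have := line0 gl (ltW pq); rewrite (line1 gl (lexx _)) => e.
by move: pq; rewrite e ltxx.
Qed.

Definition hclamp G (p q : M) (h : R) : R := Num.max (hgt G q) (Num.min (hgt G p) h).

Lemma hclamp_rg G p q h : hgt G q <= hgt G p ->
 hgt G q <= hclamp G p q h <= hgt G p.
Proof. by move=> qp; rewrite le_max lexx ge_max qp ge_min lexx. Qed.

Ltac slra := first [revert_cmp; clear -R M hM cM; lra | lra].

Lemma hclamp_lip G p q h h' : `|hclamp G p q h - hclamp G p q h'| <= `|h - h'|.
Proof. exact: max_min_lip. Qed.

Lemma line_clamp G p q g h : line G p q g -> g (hclamp G p q h) = g h.
Proof.
move=> gl; have qp := line_le gl; rewrite /hclamp.
have [ph|hp] := leP (hgt G p) h.
 by rewrite max_r// !(line1 gl).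
by have [qh|hq] := leP (hgt G q) h => //; rewrite !(line0 gl)// ltW.
Qed.

Lemma line_hgt_clamp G p q g h : line G p q g -> hgt G (g h) = hclamp G p q h.
Proof.
move=> gl; rewrite -(line_clamp h gl) (line_hgt gl)//.
by apply: hclamp_rg; exact: line_le gl.
Qed.

Lemma line_self G p q g h : line G p q g -> g (hgt G (g h)) = g h.
Proof. by move=> gl; have := line_flow gl h 0; rewrite gfl0. Qed.

Lemma line_hit G p q g h h' : line G p q g -> ~ crit G (g h) ->
 hgt G (omg G (g h)) < h' < hgt G (alf G (g h)) ->
 exists2 t, g h' = gfl G t (g h) & hgt G (gfl G t (g h)) = h'.
Proof.
move=> gl _ /hits_hgt[t e]; exists t => //.
by rewrite -{1}e (line_flow gl).
Qed.

(** If the limit were another point, [nx] would be positive by [sbox_stable] and would reach r. *)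
Lemma sbox_trapped G p (S : sdl (hgt G) (gfl G) p) r x : 0 < r -> r < s_rho S ->
 s_dom S x -> ny S x < s_rho S -> (forall t, 0 <= t -> nx S (gfl G t x) < r) -> omg G x = p.
Proof.
move=> r0 rS Sx yS H.
have xr : nx S x < r by have := H 0 (lexx _); rewrite gfl0.
have xb : sbox S (s_rho S) x by split=> //; exact: lt_trans rS.
apply: (sbox_stable hM cM xb).2.
have x0 := nx_ge0 Sx; apply/eqP; apply: contraT => nxn0.
have np : 0 < nx S x by rewrite lt_neqAle eq_sym nxn0.
have rx : 1 <= r / nx S x by rewrite ler_pdivlMr// mul1r ltW.
pose u := ln (r / nx S x) / 4.
have e4 : expR (4 * u) * nx S x = r.
 rewrite /u mulrCA divff// mulr1 lnK; first by rewrite divfK// gt_eqF.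
 by rewrite posrE; exact: lt_le_trans ltr01 rx.
have u0 : 0 <= u by rewrite divr_ge0// ln_ge0.
have [|_ d2 _] := s_fwd Sx yS u0 _; first by rewrite e4.
by have := H u u0; rewrite d2 e4 ltxx.
Qed.

(** There are only finitely many critical values. *)
Lemma isolated_value G r : exists2 e : R, 0 < e &
 forall p, crit G p -> `|hgt G p - hgt G r| < e -> hgt G p = hgt G r.
Proof.
have fin := @crit_finite _ _ hM cM G.
have /finite_seqP[s sE] : finite_set (hgt G @` crit G) by exact: finite_image.
exists (\big[Num.min/1]_(v <- s | v != hgt G r) `|v - hgt G r|).
 elim/big_ind : _ => // [a b a0 b0|v vr]; first by rewrite lt_min a0.
 by rewrite normr_gt0 subr_eq0.
move=> p pc; apply: contraPP => /eqP pr; apply/negP; rewrite -leNgt.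
have ps : hgt G p \in s.
 have : [set hgt G x | x in crit G] (hgt G p) by exists p.
 by rewrite sE.
elim: s ps {sE} => // v s IH; rewrite inE big_cons => /orP[/eqP <-|/IH{}IH].
 by rewrite pr ge_min lexx.
by case: ifPn => // _; rewrite ge_min IH orbT.
Qed.

(** Equicontinuity in the downward direction: V and e depend neither on the line nor on its ends.
    Near a regular y a small loss of height takes little time. Near a critical y orbits may linger,
    but by [sbox_fwd] they stay in the box until the height has dropped by a definite amount; a part
    of the line below y is treated in the same way, starting from points of its orbit close to y. *)
Lemma line_near_down G (y : M) (U : set M) : nbhs y U -> exists2 V : set M, nbhs y V & exists2 e : R, 0 < e &
 forall p q g h h', line G p q g -> V (g h) -> hgt G q <= h' -> h' <= h -> h <= hgt G p ->
  h - h' < e -> U (g h').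
Proof.
move=> yU; have [yc|ync] := pselect (crit G y); last first.
 have : nbhs (gfl G 0 y) U by rewrite gfl0.
 move=> /(@gfl_cts _ _ G (0, y))[[A B] /= [A0 By] AB].
 have /nbhs_normP[s0 /= s00 sA] := A0.
 pose s := s0 / 2; have sp : 0 < s by rewrite divr_gt0.
 have fs : hgt G (gfl G s y) < hgt G y.
  by have := hgt_decr ync sp; rewrite gfl0.
 pose e := (hgt G y - hgt G (gfl G s y)) / 3.
 have e0 : 0 < e by rewrite divr_gt0// subr_gt0.
 exists (B `&` [set x | hgt G (gfl G s x) < hgt G (gfl G s y) + e /\ hgt G y - e < hgt G x]).
  apply: filterI => //; apply: filterI.
   have : nbhs (hgt G (gfl G s y)) [set u | u < hgt G (gfl G s y) + e].
    by apply: lt_nbhsl; rewrite ltrDl.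
   apply: (ccomp (gfl G s) (hgt G)).
    exact: gfl_cts_x.
   exact: hgt_cts.
  have : nbhs (hgt G y) [set u | hgt G y - e < u].
   by apply: lt_nbhsr; rewrite ltrBlDr ltrDl.
  exact: (@hgt_cts _ _ G y).
 exists e => // p q g h h' gl [Bx [x1 x2]] qh' h'h hp hh'.
 have fh : hgt G (g h) = h by rewrite (line_hgt gl)// hp (le_trans qh').
 have fc : continuous (fun u => hgt G (gfl G u (g h))).
  move=> u; apply: (ccomp (gfl G ^~ (g h)) (hgt G)).
   exact: gfl_cts_t.
  exact: hgt_cts.
 have [||u us uh] := @IVT _ (fun u => hgt G (gfl G u (g h))) 0 s h' (ltW sp).
 - exact: continuous_subspaceT.
 - rewrite gfl0 fh ge_min le_max h'h /= orbC; apply/andP; split=> //.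
  by apply/orP; left; move: x1 x2 hh'; rewrite fh /e; slra.
 rewrite -uh (line_flow gl); apply: (AB (u, g h)); split => //=.
 apply: sA; rewrite /ball_ /= sub0r normrN; move: us; rewrite in_itv/= => /andP[u0 us].
 by rewrite ger0_norm//; apply: le_lt_trans us _; rewrite /s; slra.
have S := gsaddle yc; have [r1 r10 r1U] := s_basis S yU.
have [e0 e00 iso] := isolated_value G y.
pose r := Num.min r1 (s_rho S / 2); have Sr := s_rho_gt0 S.
have r0 : 0 < r by rewrite lt_min r10 divr_gt0.
have rr1 : r <= r1 by rewrite ge_min lexx.
have rS : r < s_rho S by rewrite gt_min; apply/orP; right; lra.
have {r1U r10}rU : sbox S r `<=` U by move=> x xr; apply: r1U; exact: sbox_sub rr1 _ xr.
move: r r0 rS rU {rr1} => r r0 rS rU.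
pose e := Num.min (r / 4) (e0 / 2).
have ep : 0 < e by rewrite lt_min !divr_gt0.
have e1 : e <= r / 4 by rewrite ge_min lexx.
have er : 2 * e <= r / 2 by clear -e1; lra.
have e2 : e <= e0 / 2 by rewrite ge_min lexx orbT.
have ee0 : 2 * e <= e0 by clear -e2; lra.
clear e1 e2; move: e ep er ee0 => e ep er ee0.
exists (sbox S (r / 4) `&` [set x | `|hgt G y - hgt G x| < e]).
 apply: filterI; first by apply: s_nbhs; rewrite divr_gt0.
 by have /cvgrPdist_lt/(_ _ ep) := @hgt_cts _ _ G y.
exists e => // p q g h h' gl [xb /=] xe qh' h'h hp hh'.
have fh : hgt G (g h) = h by rewrite (line_hgt gl)// hp (le_trans qh').
rewrite fh ltr_distlC in xe; case/andP: xe => xe1 xe2.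
have fwd t : 0 <= t -> h' <= hgt G (gfl G t (g h)) -> sbox S r (gfl G t (g h)).
 by move=> t0 ht; apply: sbox_fwd => //; [exact: ltW|slra].
have omy : h' <= hgt G (omg G (g h)) -> omg G (g h) = y.
 move=> h'o; apply: (sbox_trapped (S := S) (r := r)) => //.
 - by case: xb.
 - by case: xb => _ _ /lt_trans; apply; slra.
 - move=> t t0; have [] := fwd t t0 _ => //; apply: le_trans h'o _; exact: hgt_omg_le.
have yU' : U y by exact: nbhs_singleton.
(* either h' is reached by the orbit of g h, or the line passes through y *)
have [ho|oh] := ltP (hgt G (omg G (g h))) h'.
 have xnc : ~ crit G (g h).
  by move=> xc; move: ho; rewrite omg_of_crit// fh ltNge h'h.
 have [|t gt ht] := @line_hit _ _ _ _ _ h' gl xnc.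
  by rewrite ho /=; have := @hgt_alf_gt _ _ cM G (g h) 0 xnc; rewrite gfl0 fh; slra.
 rewrite gt; apply/rU/fwd; last by rewrite ht.
 rewrite leNgt; apply/negP => t0; have := hgt_decr xnc t0.
 by rewrite ht gfl0 fh ltNge h'h.
have gy : g (hgt G y) = y by have := line_omg gl h; rewrite omy.
have [hy|yh'] := ltP h' (hgt G y); last first.
 have h1 : h' <= hgt G y by rewrite -(omy oh).
 by rewrite (_ : h' = hgt G y) ?gy//; apply/eqP; rewrite eq_le h1.
have fh' : hgt G (g h') = h' by rewrite (line_hgt gl)// qh' /= (le_trans h'h).
(* Heights just below that of y are not critical values. *)
have xnc : ~ crit G (g h').
 move=> xc; have := iso _ xc; rewrite fh' => H; move: hy; rewrite H ?ltxx// ltr_distlC.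
 apply/andP; split; slra.
have oh' : hgt G (omg G (g h')) < h'.
 by have := @hgt_omg_lt _ _ cM G (g h') 0 xnc; rewrite gfl0 fh'.
have ha' : h' < hgt G (alf G (g h')).
 by have := @hgt_alf_gt _ _ cM G (g h') 0 xnc; rewrite gfl0 fh'.
(* An orbit crossing the height of y would meet the line there, that is, it would contain the
   critical point y. *)
have [ya|ay] := ltP (hgt G y) (hgt G (alf G (g h'))).
 have [|t e1 _] := @line_hit _ _ _ _ _ (hgt G y) gl xnc; first by rewrite ya (lt_trans oh').
 by exfalso; apply: xnc; apply/(crit_gfl G t); rewrite -e1 gy.
have aE : hgt G (alf G (g h')) = hgt G y.
 apply: iso; first exact: alf_crit.
 by rewrite ltr_distlC; apply/andP; split; slra.
have ay' : alf G (g h') = y by have := line_alpha gl h'; rewrite aE gy.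
(* Far back in time the orbit of g h' is in the quarter box around y; forward trapping from there
   reaches g h'. *)
have := @alf_cvg _ _ cM G (g h'); rewrite ay' => /(_ _ (s_nbhs S (divr_gt0 r0 (@ltr0n R 4)))).
move=> [A [_ HA]]; pose u := Num.min (A - 1) 0.
have uA : u < A by rewrite gt_min ltrBlDr ltrDl ltr01.
have u0 : u <= 0 by rewrite ge_min lexx orbT.
apply: rU; rewrite -(gflowK G u (g h')); apply: sbox_fwd => //; first exact: ltW.
- exact: HA uA.
- by rewrite oppr_ge0.
- by rewrite gflowK fh'; slra.
Qed.

(** The reversed flow gives the upward estimate, and clamping of heights removes the conditions on h
    and h'. *)
Lemma line_near G (y : M) (U : set M) : nbhs y U -> exists2 V : set M, nbhs y V & exists2 e : R, 0 < e &
 forall p q g h h', line G p q g -> V (g h) -> `|h - h'| < e -> U (g h').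
Proof.
move=> yU; have [V1 yV1 [e1 e10 H1]] := line_near_down G yU.
have [V2 yV2 [e2 e20 H2]] := line_near_down (rvs G) yU.
exists (V1 `&` V2); first exact: filterI.
exists (Num.min e1 e2); first by rewrite lt_min e10.
move=> p q g h h' gl [V1x V2x]; rewrite lt_min => /andP[hh1 hh2].
rewrite -(line_clamp h' gl); rewrite -(line_clamp h gl) in V1x V2x.
have qp := line_le gl; have := hclamp_lip G p q h h'.
have /andP[a1 a2] := hclamp_rg h qp; have /andP[b1 b2] := hclamp_rg h' qp.
move: (hclamp G p q h) (hclamp G p q h') a1 a2 b1 b2 V1x V2x => k k' a1 a2 b1 b2 V1x V2x kk.
have [k'k|kk'] := leP k' k.
 apply: (H1 p q g k k') => //; apply: le_lt_trans hh1; apply: le_trans kk; exact: ler_norm.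
have := H2 q p (fun h => g (- h)) (- k) (- k') (line_rvs gl); rewrite /= !opprK !lerN2.
apply => //; first exact: ltW.
apply: le_lt_trans hh2; apply: le_trans kk; rewrite addrC distrC; exact: ler_norm.
Qed.


Notation crv := (prod_topology (fun _ : R => M)).

Lemma curve_eval (h : R) : continuous (fun g : crv => g h).
Proof. exact: (@proj_continuous R (fun _ => M) h). Qed.

(** The clauses of [line] about orbits and their limits all have the form g (hgt G y) = y with y a
    limit of points of the orbit of g h. A line k close to g passes near y at a height close to that
    of y, and equicontinuity moves this to the height of y itself. *)
Lemma line_approx G p q (g : crv) (h : R) (y : M) : closure (line G p q : set crv) g ->
 (forall (V : set M) (e : R), nbhs y V -> 0 < e -> exists t, V (gfl G t (g h)) /\
  `|hgt G (gfl G t (g h)) - hgt G y| < e) -> g (hgt G y) = y.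
Proof.
move=> cg H; apply: contrapT => gy.
have := hM; rewrite open_hausdorff => /(_ (g (hgt G y)) y).
case; first exact/eqP.
move=> [A B] /= [gA yB] [oA oB /eqP AB]; rewrite !inE in gA yB.
have [V yV [e e0 HV]] := line_near G (open_nbhs_nbhs (conj oB yB)).
have oV : nbhs y (interior V) by exact: nbhs_interior.
have [t [Vt te]] := H _ _ oV e0.
have n1 : nbhs (g : crv) [set k : crv | A (k (hgt G y))].
 by apply: (@curve_eval (hgt G y) g); exact: open_nbhs_nbhs.
have n2 : nbhs (g : crv) [set k : crv | V (gfl G t (k h))].
 apply: (ccomp (fun k : crv => k h) (gfl G t)).
 - exact: curve_eval.
 - exact: gfl_cts_x.
 - exact: Vt.
have n3 : nbhs (g : crv) [set k : crv | `|hgt G (gfl G t (k h)) - hgt G y| < e].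
 apply: (@continuous_comp _ _ _ (fun k : crv => gfl G t (k h)) (hgt G) (g : crv)
  _ _ [set u : R | `|u - hgt G y| < e]).
 - apply: (ccomp (fun k : crv => k h) (gfl G t)); first exact: curve_eval.
  exact: gfl_cts_x.
 - exact: hgt_cts.
 - have : {for hgt G (gfl G t (g h)), continuous (fun u : R => u - hgt G y)}.
   by apply: cvgB; [exact: cvg_id|exact: cvg_cst].
  by move=> /cvgr_norm_lt; apply.
have [k [kl [[/= kA kV] ke]]] := cg _ (filterI (filterI n1 n2) n3).
have : B (k (hgt G y)).
 apply: (HV p q k (hgt G (gfl G t (k h)))) => //.
 by rewrite (line_flow kl).
by move=> kB; have : (A `&` B) (k (hgt G y)) by []; rewrite AB.
Qed.

Lemma line_closed G p q : closed (line G p q : set crv).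
Proof.
move=> g cg.
have sep (h : R) (C : set M) : closed C -> (forall k, line G p q k -> C (k h)) -> C (g h).
 move=> cC H; apply: contrapT => nC.
 have [|k [/H kC]] := cg [set k : crv | (~` C) (k h)]; last by [].
 apply: (@curve_eval h g); apply: open_nbhs_nbhs; split=> //; exact: closed_openC.
have cl1 (z : M) : closed [set z].
 exact: (accessible_closed_set1 (hausdorff_accessible hM)).
split.
- by move=> h hq; apply: (sep h [set q]) => // k kl; exact: (line0 kl).
- by move=> h hp; apply: (sep h [set p]) => // k kl; exact: (line1 kl).
- move=> h hh; apply: (sep h [set x | hgt G x = h]) => [|k kl]; last exact: (line_hgt kl).
 rewrite (_ : [set _ | _] = hgt G @^-1` [set h])//.
 by apply: closed_comp => [x _|]; [exact: hgt_cts|exact: closed_eq].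
- move=> h t; apply: (line_approx (h := h) cg) => V e yV e0; exists t; split.
  exact: nbhs_singleton.
 by rewrite subrr normr0.
- move=> h; apply: (line_approx (h := h) cg) => V e yV e0.
 have c1 : \forall t \near +oo, V (gfl G t (g h)) := @omg_cvg _ _ cM G (g h) V yV.
 have := @hgt_omg_cvg _ _ cM G (g h); move/cvgrPdist_lt => /(_ _ e0) c2.
 have [t [tV te]] := filter_ex (filterI c1 c2).
 by exists t; split=> //; rewrite distrC.
- move=> h; apply: (line_approx (h := h) cg) => V e yV e0.
 have c1 : \forall t \near -oo, V (gfl G t (g h)) := @alf_cvg _ _ cM G (g h) V yV.
 have := @hgt_alf_cvg _ _ cM G (g h); move/cvgrPdist_lt => /(_ _ e0) c2.
 have [t [tV te]] := filter_ex (filterI c1 c2).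
 by exists t; split=> //; rewrite distrC.
Qed.

Lemma line_cpt G p q : compact (line G p q : set crv).
Proof.
apply: (subclosed_compact (@line_closed G p q) _ (fun _ _ => I) : compact _).
have := @tychonoff R (fun _ => M) (fun _ => setT) (fun _ => cM).
by congr compact; apply/seteqP; split.
Qed.

(** Curves carry the topology of pointwise convergence, so joint continuity of evaluation comes from
    equicontinuity on lines. *)
Lemma line_eval_cts G p q (g : crv) h (U : set M) : nbhs (g h) U ->
 \forall k \near g & h' \near h, line G p q k -> U (k h').
Proof.
move=> gU; have [V gV [e e0 H]] := line_near G gU.
exists ([set k : crv | V (k h)], [set h' | `|h - h'| < e]).
 split; first exact: (@curve_eval h g _ gV).
 by apply/nbhs_normP; exists e.
by move=> [k h'] [/= kV hh'] kl; exact: (H p q k h h').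
Qed.

(** The parts are extended by constants, so that they are again lines, in the same space of curves,
    with r as one end. *)
Definition above G (r : M) (g : R -> M) : R -> M := fun h => g (Num.max h (hgt G r)).
Definition below G (r : M) (g : R -> M) : R -> M := fun h => g (Num.min h (hgt G r)).
Definition join G (r : M) (g k : R -> M) : R -> M := fun h => if hgt G r <= h then g h else k h.

(** A line has one point at each height, so an orbit on it that crosses the height of r would have
    to pass through the critical point r. *)
Lemma line_no_cross G p q g r h t : line G p q g -> crit G r -> g (hgt G r) = r ->
 hgt G r < hgt G (g h) -> hgt G r < hgt G (gfl G t (g h)).
Proof.
move=> gl rc gr rh; have [c|nc] := pselect (crit G (g h)); first by rewrite gfl_crit.
rewrite ltNge; apply/negP => tr.
have [u e] : exists u, hgt G (gfl G u (g h)) = hgt G r.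
 apply: (@hits_hgt _ _ cM); apply/andP; split.
  by apply: lt_le_trans tr; exact: hgt_omg_lt.
 apply: lt_le_trans rh _; have := @hgt_alf_ge _ _ cM G (g h) 0.
 by rewrite gfl0.
by apply: nc; apply/(crit_gfl G u); rewrite -(line_flow gl) e gr.
Qed.

Lemma line_no_cross_omg G p q g r h : line G p q g -> crit G r -> g (hgt G r) = r ->
 hgt G r <= hgt G (g h) -> hgt G r <= hgt G (omg G (g h)).
Proof.
move=> gl rc gr; rewrite le_eqVlt => /orP[/eqP e|rh].
 by move: (line_self h gl); rewrite -e gr => <-; rewrite omg_of_crit.
apply: cvgr_to_ge (@hgt_omg_cvg _ _ cM G (g h)) _.
by apply: nearW => t; apply/ltW/(line_no_cross t gl).
Qed.

Lemma line_above G p q r g : crit G r -> line G p q g -> g (hgt G r) = r ->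
 hgt G q <= hgt G r <= hgt G p -> line G p r (above G r g).
Proof.
move=> rc gl gr /andP[qr rp].
have hmax h : hgt G r <= Num.max h (hgt G r) by rewrite le_max lexx orbT.
have ge h : hgt G r <= hgt G (above G r g h).
 rewrite /above (line_hgt_clamp _ gl) /hclamp le_max le_min rp hmax orbT.
 by [].
split.
- by move=> h hr; rewrite /above max_r.
- by move=> h hp; rewrite /above (line1 gl)// le_max hp.
- by move=> h /andP[rh hp]; rewrite /above max_l// (line_hgt gl)// hp (le_trans qr).
- move=> h t; rewrite {1}/above max_l; first by rewrite /above (line_flow gl).
 have [rh|e] := ltP (hgt G r) (hgt G (above G r g h)).
  by apply/ltW; exact: (line_no_cross t gl rc gr rh).
 have {}e : hgt G r = hgt G (above G r g h) by apply/eqP; rewrite eq_le ge e.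
  have : crit G (above G r g h) by move: (line_self (Num.max h (hgt G r)) gl); rewrite -/(above G r g h) -e gr => <-.
  by move=> c; rewrite gfl_crit.
- move=> h; rewrite {1}/above max_l; first by rewrite /above (line_omg gl).
 exact: (line_no_cross_omg gl rc gr (ge h)).
- move=> h; rewrite {1}/above max_l; first by rewrite /above (line_alpha gl).
 apply: le_trans (ge h) _; have := @hgt_alf_ge _ _ cM G (above G r g h) 0.
 by rewrite gfl0.
Qed.

Lemma rvs_omg G x : omg (rvs (rvs G)) x = omg G x.
Proof.
apply: (omg_uniq hM) => /=.
rewrite (_ : (fun t => gfl G (- - t) x) = (fun t => gfl G t x)); first exact: omg_cvg.
by apply/funext => t; rewrite opprK.
Qed.

Lemma line_unreverse G p q g : line (rvs G) p q g -> line G q p (fun h => g (- h)).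
Proof.
move=> /line_rvs[/= h1 h2 h3 h4 h5 h6]; split => //.
- by move=> h; have := h1 h; rewrite opprK.
- by move=> h; have := h2 h; rewrite opprK.
- by move=> h hh; have := h3 h; rewrite !opprK; exact.
- by move=> h t; have := h4 h t; rewrite !opprK.
- by move=> h; have := h5 h; rewrite rvs_omg !opprK.
- move=> h; have := h6 h; rewrite !opprK /alf.
 rewrite (_ : omg (rvs (rvs (rvs G))) (g (- h)) = omg (rvs G) (g (- h)))//.
 exact: rvs_omg.
Qed.

Lemma line_below G p q r g : crit G r -> line G p q g -> g (hgt G r) = r ->
 hgt G q <= hgt G r <= hgt G p -> line G r q (below G r g).
Proof.
move=> rc gl gr /andP[qr rp].
have := @line_above (rvs G) q p r _ rc (line_rvs gl).
rewrite /= opprK !lerN2 => /(_ gr); rewrite rp qr => /(_ erefl)/line_unreverse.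
rewrite (_ : (fun h => _) = below G r g)//; apply/funext => h.
by rewrite /above /below /= oppr_max opprK opprK.
Qed.

Lemma line_join G p q r g k : line G p r g -> line G r q k -> line G p q (join G r g k).
Proof.
move=> gl kl; have rp := line_le gl; have qr := line_le kl.
have gr : g (hgt G r) = r by exact: (line0 gl).
have kr : k (hgt G r) = r by exact: (line1 kl).
have gE h : hgt G r <= h -> join G r g k h = g h by rewrite /join => ->.
have kE h : h <= hgt G r -> join G r g k h = k h.
 rewrite /join; case: ifPn => // rh hr.
 by rewrite (_ : h = hgt G r) ?gr ?kr//; apply/eqP; rewrite eq_le hr.
have gge h : hgt G r <= hgt G (g h).
 by rewrite (line_hgt_clamp _ gl) le_max lexx.
have kle h : hgt G (k h) <= hgt G r.
 by rewrite (line_hgt_clamp _ kl) /hclamp ge_max qr ge_min lexx.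
split.
- by move=> h hq; rewrite kE ?(line0 kl)//; exact: le_trans qr.
- by move=> h hp; rewrite gE ?(line1 gl)//; exact: le_trans hp.
- move=> h /andP[qh hp]; have [rh|/ltW hr] := leP (hgt G r) h.
  by rewrite gE// (line_hgt gl)// rh.
 by rewrite kE// (line_hgt kl)// qh.
- move=> h t; have [rh|/ltW hr] := leP (hgt G r) h.
  by rewrite !(gE h)// gE ?(line_flow gl)// -(line_flow gl).
 by rewrite !(kE h)// kE ?(line_flow kl)// -(line_flow kl).
- move=> h; have [rh|/ltW hr] := leP (hgt G r) h.
  by rewrite !(gE h)// gE ?(line_omg gl)// -(line_omg gl).
 by rewrite !(kE h)// kE ?(line_omg kl)// -(line_omg kl).
- move=> h; have [rh|/ltW hr] := leP (hgt G r) h.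
  by rewrite !(gE h)// gE ?(line_alpha gl)// -(line_alpha gl).
 by rewrite !(kE h)// kE ?(line_alpha kl)// -(line_alpha kl).
Qed.

Lemma join_break G p r g k : line G p r g -> join G r g k (hgt G r) = r.
Proof. by move=> gl; rewrite /join lexx (line0 gl). Qed.

Lemma above_join G p r g k : line G p r g -> above G r (join G r g k) = g.
Proof.
move=> gl; apply/funext => h; rewrite /above /join le_max lexx orbT.
by have [//|/ltW hr] := leP (hgt G r) h; rewrite !(line0 gl).
Qed.

Lemma below_join G p q r g k : line G p r g -> line G r q k -> below G r (join G r g k) = k.
Proof.
move=> gl kl; apply/funext => h; rewrite /below /join.
have [rh|hr] := leP (hgt G r) h; last by rewrite leNgt hr.
by rewrite lexx (line0 gl)// (line1 kl).
Qed.

Lemma join_above_below G r g : join G r (above G r g) (below G r g) = g.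
Proof.
apply/funext => h; rewrite /join /above /below.
by have [rh|hr] := leP (hgt G r) h.
Qed.

End Lines.

(** Continuity of the restriction to A, for total functions that are meaningful only on A. Without
    subspaces, domains can be intersected and functions composed freely. *)
Definition cts (T U : topologicalType) (A : set T) (f : T -> U) : Prop :=
 forall x W, A x -> nbhs (f x) W -> \forall y \near x, A y -> W (f y).

Section ContOn.
Context (T U V : topologicalType).
Implicit Types (A B : set T).

Lemma cts_sub A B (f : T -> U) : A `<=` B -> cts B f -> cts A f.
Proof. by move=> AB fB x W /AB Bx /(fB x _ Bx); apply: filterS => y H /AB. Qed.

Lemma cts_eq A (f g : T -> U) : (forall x, A x -> f x = g x) -> cts A f -> cts A g.
Proof.
move=> fg fA x W Ax; rewrite -fg// => /(fA x _ Ax); apply: filterS => y H Ay.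
by rewrite -fg//; exact: H.
Qed.

Lemma ctsT A (f : T -> U) : continuous f -> cts A f.
Proof. by move=> fc x W _ fW; have h : nbhs x (f @^-1` W) := fc x W fW; apply: filterS h => y. Qed.
Lemma cts_id A : cts A (fun x : T => x).
Proof. by move=> x W _; apply: filterS. Qed.
Lemma cts_cst A (c : U) : cts A (fun _ : T => c).
Proof. by move=> x W _ cW; apply: nearW => y _; exact: nbhs_singleton. Qed.

Lemma cts_comp A (C : set U) (f : T -> U) (g : U -> V) :
 cts A f -> (forall x, A x -> C (f x)) -> cts C g -> cts A (g \o f).
Proof.
move=> fA fAC gC x W Ax gW; have := fA x _ Ax (gC (f x) W (fAC _ Ax) gW).
by apply: filterS => y H Ay; apply: H => //; exact: fAC.
Qed.

Lemma cts_pair A (f : T -> U) (g : T -> V) :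
 cts A f -> cts A g -> cts A (fun x => (f x, g x)).
Proof.
move=> fA gA x W Ax [[P Q] /= [fP gQ] PQ].
by apply: filterS2 (fA x P Ax fP) (gA x Q Ax gQ) => y H1 H2 Ay; apply: PQ; split; [exact: H1|exact: H2].
Qed.

Lemma cts_op A (f : T -> U) (g : U -> V) : cts A f ->
 (forall x, A x -> {for f x, continuous g}) -> cts A (fun x => g (f x)).
Proof. by move=> fA gc x W Ax /(gc x Ax) /(fA x _ Ax). Qed.

(** The pasting lemma: the hypotheses on complements say that [E1] and [E2] are closed relative to
    A. *)
Lemma cts_paste A (E1 E2 : set T) (f : T -> U) :
 (forall x, A x -> E1 x \/ E2 x) ->
 (forall x, A x -> ~ E1 x -> \forall y \near x, A y -> ~ E1 y) ->
 (forall x, A x -> ~ E2 x -> \forall y \near x, A y -> ~ E2 y) ->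
 cts (A `&` E1) f -> cts (A `&` E2) f -> cts A f.
Proof.
move=> AE cE1 cE2 f1 f2 x W Ax fW.
have h (E : set T) : (forall x, A x -> ~ E x -> \forall y \near x, A y -> ~ E y) ->
  cts (A `&` E) f -> \forall y \near x, A y -> E y -> W (f y).
 move=> cE fE; have [Ex|nEx] := pselect (E x).
  by apply: filterS (fE x W (conj Ax Ex) fW) => y H Ay Ey; exact: H.
 by apply: filterS (cE x Ax nEx) => y H Ay Ey; case: (H Ay).
apply: filterS2 (h E1 cE1 f1) (h E2 cE2 f2) => y H1 H2 Ay.
by have [/(H1 Ay)|/(H2 Ay)] := AE y Ay.
Qed.

Lemma cts_open A (f : T -> U) (W : set U) : cts A f -> open W ->
 forall x, A x -> W (f x) -> \forall y \near x, A y -> W (f y).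
Proof. by move=> fA oW x Ax fW; apply: fA => //; exact: open_nbhs_nbhs. Qed.

(** The principle that an injective continuous map from a compact to a Hausdorff space has a
    continuous inverse. If it failed at f x, the points of A outside W with images ever closer to f
    x would cluster at some z; the Hausdorff property gives f z = f x, so z = x, a point of W. *)
Lemma inv_cts A (f : T -> U) (g : U -> T) : hausdorff_space U ->
 compact A -> cts A f -> (forall x, A x -> g (f x) = x) -> cts (f @` A) g.
Proof.
move=> hU K fA gf u W [x Ax <-]; rewrite gf// => xW.
apply: contrapT => nW.
pose F : set_system T := [set P | \forall v \near f x, forall y, A y -> f y = v -> ~ W y -> P y].
have FF : ProperFilter F.
 split.
  rewrite /F /= => F0; apply: nW; apply: filterS F0 => v H [y Ay yv]; rewrite -yv gf//.
  by apply: contrapT => nWy; exact: (H y Ay yv nWy).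
 split.
 - exact: nearW.
 - by move=> P Q; rewrite /F /=; apply: filterS2 => v H1 H2 y Ay e nWy; split; [exact: H1|exact: H2].
 - by move=> P Q PQ; rewrite /F /=; apply: filterS => v H y Ay e nWy; exact/PQ/(H y).
have [|z [Az Fz]] := K F FF; first by apply: nearW => v y.
have [zx|/eqP zx] := eqVneq (f z) (f x).
 have zx' : z = x by rewrite -(gf z Az) zx gf.
 have [||y [nWy Wy]] := Fz [set y | ~ W y] W; [by apply: nearW|by rewrite zx'|exact: nWy].
have := hU; rewrite open_hausdorff => /(_ (f z) (f x)); case; first exact/eqP.
move=> [P Q] /= [zP xQ] [oP oQ /eqP PQ]; rewrite !inE in zP xQ.
have [||y [yQ yP]] := Fz [set y | A y /\ Q (f y)] [set y | A y -> P (f y)].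
- by apply: filterS (open_nbhs_nbhs (conj oQ xQ)) => v Qv y Ay e _; rewrite /= e.
- exact: cts_open fA oP _ Az zP.
suff : (P `&` Q) (f y) by rewrite PQ.
by split; [apply: yP; exact: yQ.1|exact: yQ.2].
Qed.

End ContOn.

Lemma hausdorff_pair (T U : topologicalType) : hausdorff_space T -> hausdorff_space U ->
 hausdorff_space (T * U)%type.
Proof.
move=> hT hU; rewrite open_hausdorff => -[x y] [x' y'] /eqP ne.
have open_fst (P : set T) : open P -> open [set u : T * U | P u.1].
 by move=> oP; apply: (@open_comp _ _ fst) => // u _; exact: cvg_fst.
have open_snd (P : set U) : open P -> open [set u : T * U | P u.2].
 by move=> oP; apply: (@open_comp _ _ snd) => // u _; exact: cvg_snd.
have [xx|xx] := eqVneq x x'.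
 have yy : y != y' by apply: contra_notN ne => /eqP->; rewrite xx.
 have := hU; rewrite open_hausdorff => /(_ y y' yy)[[P Q] /=]; rewrite !inE => -[yP yQ] [oP oQ PQ].
 exists ([set u : T * U | P u.2], [set u : T * U | Q u.2]); rewrite /= ?inE//; split; [exact: open_snd..|].
 apply/seteqP; split=> // -[u v] [/= Pv Qv].
 have : (P `&` Q) v by []; by rewrite PQ.
have := hT; rewrite open_hausdorff => /(_ x x' xx)[[P Q] /=]; rewrite !inE => -[xP xQ] [oP oQ PQ].
exists ([set u : T * U | P u.1], [set u : T * U | Q u.1]); rewrite /= ?inE//; split; [exact: open_fst..|].
apply/seteqP; split=> // -[u v] [/= Pv Qv].
have : (P `&` Q) u by []; by rewrite PQ.
Qed.

Section RealContOn.
Context (R : realType) (T : topologicalType) (A : set T).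
Implicit Types f g : T -> R.

Lemma ctsD f g : cts A f -> cts A g -> cts A (fun x => f x + g x).
Proof.
move=> fA gA; apply: (@cts_op _ _ _ _ _ (fun p : R * R => p.1 + p.2) (cts_pair fA gA)) => x _.
exact: add_continuous.
Qed.

Lemma ctsN f : cts A f -> cts A (fun x => - f x).
Proof. by move=> fA; apply: (@cts_op _ _ _ _ _ (fun p : R => - p) fA) => x _; exact: opp_continuous. Qed.
Lemma ctsB f g : cts A f -> cts A g -> cts A (fun x => f x - g x).
Proof. by move=> fA gA; apply: ctsD => //; exact: ctsN. Qed.

Lemma ctsM f g : cts A f -> cts A g -> cts A (fun x => f x * g x).
Proof.
move=> fA gA; apply: (@cts_op _ _ _ _ _ (fun p : R * R => p.1 * p.2) (cts_pair fA gA)) => x _.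
exact: mul_continuous.
Qed.

Lemma ctsV f : cts A f -> (forall x, A x -> f x != 0) -> cts A (fun x => (f x)^-1).
Proof. by move=> fA f0; apply: (@cts_op _ _ _ _ _ (fun p : R => p^-1) fA) => x /f0; exact: inv_continuous. Qed.

Lemma cts_max f g : cts A f -> cts A g -> cts A (fun x => Num.max (f x) (g x)).
Proof.
move=> fA gA; apply: (@cts_op _ _ _ _ _ (fun p : R * R => Num.max p.1 p.2) (cts_pair fA gA)) => x _.
by apply: continuous_max; [exact: cvg_fst|exact: cvg_snd].
Qed.

Lemma cts_min f g : cts A f -> cts A g -> cts A (fun x => Num.min (f x) (g x)).
Proof.
move=> fA gA; apply: (@cts_op _ _ _ _ _ (fun p : R * R => Num.min p.1 p.2) (cts_pair fA gA)) => x _.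
by apply: continuous_min; [exact: cvg_fst|exact: cvg_snd].
Qed.

End RealContOn.

(** * Brown's collaring theorem: local collars absorb an exterior collar *)

Section Collar.
Context (R : realType) (T : topologicalType) (X B : set T) (T_hausdorff : hausdorff_space T) (X_cpt : compact X)
 (B_closed : closed B) (BX : B `<=` X).

(* A collar of B in X on the closed set N, with coordinates [base] and [depth]
 and parametrization [push]; [bump] is a function on B whose support lies
 inside N. *)
Record lcollar := LocalCollar {
 lc_dom : set T;
 base : T -> T;
 depth : T -> R;
 push : T -> R -> T;
 bump : T -> R;
 lc_closed : closed lc_dom;
 lc_sub : lc_dom `<=` X;
 base_cont : cts lc_dom base;
 depth_cont : cts lc_dom depth;
 base_in : forall x, lc_dom x -> (lc_dom `&` B) (base x);
 depth_in : forall x, lc_dom x -> 0 <= depth x <= 1;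
 push_cont : cts [set vs : T * R | (lc_dom `&` B) vs.1 /\ 0 <= vs.2 <= 1] (fun vs => push vs.1 vs.2);
 push_in : forall v (s : R), (lc_dom `&` B) v -> 0 <= s <= 1 -> lc_dom (push v s);
 base_push : forall v (s : R), (lc_dom `&` B) v -> 0 <= s <= 1 -> base (push v s) = v;
 depth_push : forall v (s : R), (lc_dom `&` B) v -> 0 <= s <= 1 -> depth (push v s) = s;
 push_base : forall x, lc_dom x -> push (base x) (depth x) = x;
 push0 : forall v, (lc_dom `&` B) v -> push v 0 = v;
 bump_cont : cts (lc_dom `&` B) bump;
 bump_in : forall v, (lc_dom `&` B) v -> 0 <= bump v <= 1;
 lc_open : forall x, lc_dom x -> 0 < bump (base x) -> depth x < 1 ->
  \forall y \near x, X y -> lc_dom y }.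

(** X with an exterior collar attached along B, of height f b over b; X itself is at height 0. *)
Definition clrd (f : T -> R) : set (T * R) :=
 [set xt | X xt.1 /\ (xt.2 = 0 \/ B xt.1 /\ 0 <= xt.2 <= f xt.1)].

Lemma depth0P (L : lcollar) x : lc_dom L x -> depth L x = 0 <-> B x.
Proof.
move=> Nx; split=> [d0|Bx].
 by rewrite -(push_base Nx) d0 push0; have [] := base_in Nx.
by rewrite -(push0 (conj Nx Bx)) depth_push// lexx ler01.
Qed.

Lemma base_on (L : lcollar) x : lc_dom L x -> B x -> base L x = x.
Proof. by move=> Nx Bx; rewrite -{1}(push0 (conj Nx Bx)) base_push// lexx ler01. Qed.

(** The affine map that takes [-a, 1] onto [-b, 1] and fixes 1. *)
Definition str (a b s : R) : R := 1 - (1 - s) * ((1 + b) / (1 + a)).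

(** On a local collar, interior depth minus exterior height is a single coordinate, running from - f
    to 1 along each fibre. Stretching the fibres changes the exterior height from f to g. *)
Definition regrow (L : lcollar) (f g : T -> R) (xt : T * R) : T * R :=
 if pselect (lc_dom L xt.1) then
  let v := base L xt.1 in
  let s := str (f v) (g v) (depth L xt.1 - xt.2) in
  (push L v (Num.max s 0), Num.max (- s) 0)
 else xt.

Lemma regrow_in (L : lcollar) f g (x : T) (t : R) : lc_dom L x -> regrow L f g (x, t) =
 (push L (base L x) (Num.max (str (f (base L x)) (g (base L x)) (depth L x - t)) 0),
  Num.max (- str (f (base L x)) (g (base L x)) (depth L x - t)) 0).
Proof. by move=> Nx; rewrite /regrow /=; case: pselect. Qed.

Lemma regrow_out (L : lcollar) f g (x : T) (t : R) : ~ lc_dom L x -> regrow L f g (x, t) = (x, t).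
Proof. by move=> Nx; rewrite /regrow /=; case: pselect. Qed.

Lemma str_rg a b s : 0 <= a -> 0 <= b -> - a <= s <= 1 -> - b <= str a b s <= 1.
Proof.
move=> a0 b0 /andP[s1 s2]; rewrite /str.
have a1 : 0 < 1 + a by lra.
have q0 : 0 <= (1 + b) / (1 + a) by rewrite divr_ge0; lra.
apply/andP; split; last by rewrite gerBl mulr_ge0// subr_ge0.
have : (1 - s) * ((1 + b) / (1 + a)) <= (1 + a) * ((1 + b) / (1 + a)) by rewrite ler_wpM2r//; lra.
have -> : (1 + a) * ((1 + b) / (1 + a)) = 1 + b by field; rewrite gt_eqF.
lra.
Qed.

Lemma stretchK a b s : 0 <= a -> 0 <= b -> str b a (str a b s) = s.
Proof. by move=> a0 b0; rewrite /str; field; rewrite !gt_eqF//; lra. Qed.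

Section Regrow.
Context (L : lcollar) (f g : T -> R) (f01 : forall b, B b -> 0 <= f b <= 1) (g01 : forall b, B b -> 0 <= g b <= 1)
 (fg : forall b, B b -> (lc_dom L b -> bump L b = 0) -> f b = g b) (f_cont : cts B f) (g_cont : cts B g).

Let N := lc_dom L.

Lemma signed_depth x t : clrd f (x, t) -> N x ->
 - f (base L x) <= depth L x - t <= 1 /\
 (x = push L (base L x) (Num.max (depth L x - t) 0) /\ t = Num.max (- (depth L x - t)) 0).
Proof.
move=> [/= Xx [->|[Bx /andP[t0 tf]]]] Nx; have /andP[d0 d1] := depth_in Nx.
 have [_ /f01/andP[fb0 _]] := base_in Nx.
 rewrite subr0; split; first by rewrite d1 andbT; lra.
 by rewrite max_l// push_base// max_r//; lra.
have dx : depth L x = 0 by exact/depth0P.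
rewrite dx base_on// sub0r opprK; split; first by rewrite lerN2 tf; lra.
by rewrite max_r ?push0 ?max_l//; lra.
Qed.

Lemma regrow_clrd xt : clrd f xt -> clrd g (regrow L f g xt).
Proof.
move: xt => [x t] xt; have [/= Xx xt'] := xt; rewrite /regrow /=; case: pselect => Nx; last first.
 split=> //=; case: xt' => [->|[Bx tf]]; [by left|right; split=> //].
 by rewrite -fg//.
have [r1 _] := signed_depth xt Nx; have [bN bB] := base_in Nx.
have /andP[fb0 fb1] := f01 bB; have /andP[gb0 gb1] := g01 bB.
have /andP[s1 s2] := str_rg fb0 gb0 r1.
move: (str _ _ _) s1 s2 => s s1 s2.
have m1 : 0 <= Num.max s 0 <= 1 by rewrite le_max lexx orbT ge_max s2 ler01.
split=> /=; first exact/lc_sub/push_in.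
have [s0|s0] := leP 0 s; first by left; rewrite max_r//; lra.
right; rewrite push0//; split => //; rewrite max_l; lra.
Qed.

End Regrow.

Lemma regrowK (L : lcollar) (f g : T -> R) :
 (forall b, B b -> 0 <= f b <= 1) -> (forall b, B b -> 0 <= g b <= 1) ->
 forall xt, clrd f xt -> regrow L g f (regrow L f g xt) = xt.
Proof.
move=> f01 g01 [x t] xt; have [Nx|Nx] := pselect (lc_dom L x); last by rewrite !regrow_out.
have [r1 [ex et]] := signed_depth f01 xt Nx; have [bN bB] := base_in Nx.
have /andP[fb0 fb1] := f01 _ bB; have /andP[gb0 gb1] := g01 _ bB.
have /andP[s1 s2] := str_rg fb0 gb0 r1.
have m1 (s : R) : s <= 1 -> 0 <= Num.max s 0 <= 1 by move=> s1'; rewrite le_max lexx orbT ge_max s1' ler01.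
rewrite (regrow_in _ _ _ Nx) regrow_in; last by apply: push_in => //; exact: m1.
rewrite !base_push ?depth_push//; [|exact: m1..].
have -> (s : R) : Num.max s 0 - Num.max (- s) 0 = s.
 by have [s0|s0] := leP 0 s; [rewrite max_r|rewrite max_l]; lra.
by rewrite stretchK// -ex -et.
Qed.

Lemma regrow_cont (L : lcollar) (f g : T -> R) :
 (forall b, B b -> 0 <= f b <= 1) -> (forall b, B b -> 0 <= g b <= 1) ->
 (forall b, B b -> (lc_dom L b -> bump L b = 0) -> f b = g b) ->
 cts B f -> cts B g -> cts (clrd f) (regrow L f g).
Proof.
move=> f01 g01 fg fc gc; pose N := lc_dom L.
(* Outside [E2] the collar is a neighbourhood in X of the point. On [E2] the map is the identity:
   off the collar by definition, where the bump vanishes because f = g, and at depth 1 because [str]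
   fixes 1. *)
pose E2 := [set xt : T * R | ~ (N xt.1 /\ 0 < bump L (base L xt.1) /\ depth L xt.1 < 1)].
have bc : cts N (fun x => bump L (base L x)).
 apply: (@cts_comp _ _ _ N (N `&` B) (base L) (bump L)); [exact: base_cont|exact: base_in|exact: bump_cont].
apply: (@cts_paste _ _ (clrd f) [set xt : T * R | N xt.1] E2).
- by move=> xt _; have [Nx|nN] := pselect (N xt.1); [left|right => -[]].
- move=> [x t] _ /= nN; exists (~` N, setT) => /=.
  split; last exact: filterT.
  by apply: open_nbhs_nbhs; split=> //; apply: closed_openC; exact: lc_closed.
 by move=> [y s] [/= Ny _] _.
- move=> [x t] [/= Xx _] /contrapT[Nx [b0 d1]].
 have n1 := lc_open Nx b0 d1.
 have n2 := cts_open bc (@open_gt R 0) Nx b0.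
 have n3 := cts_open (@depth_cont L) (@open_lt R 1) Nx d1.
 exists ([set y | X y -> [/\ N y, 0 < bump L (base L y) & depth L y < 1]], setT) => /=.
  split; last exact: filterT.
  near=> y => Xy; have Ny : N y by move: Xy; near: y.
  by split=> //; move: Ny; near: y.
 by move=> [y s] [/= H _] [/= Xy _]; apply; have [] := H Xy.
- apply: (@cts_eq _ _ _ (fun xt => let s := str (f (base L xt.1)) (g (base L xt.1)) (depth L xt.1 - xt.2) in
  (push L (base L xt.1) (Num.max s 0), Num.max (- s) 0))).
  by move=> [x t] [_ /= Nx]; rewrite regrow_in.
 pose A := clrd f `&` [set xt : T * R | N xt.1].
 have fstc : cts A (fun xt : T * R => xt.1) by apply: (@ctsT _ _ A fst) => ?; exact: cvg_fst.
 have sndc : cts A (fun xt : T * R => xt.2) by apply: (@ctsT _ _ A snd) => ?; exact: cvg_snd.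
 have basec : cts A (fun xt : T * R => base L xt.1).
  by apply: (cts_comp fstc (C := N)) => [? []|]//; exact: base_cont.
 have depc : cts A (fun xt : T * R => depth L xt.1).
  by apply: (cts_comp fstc (C := N)) => [? []|]//; exact: depth_cont.
 have baseB xt : A xt -> B (base L xt.1) by move=> [_ /base_in[]].
 have fbc : cts A (fun xt : T * R => f (base L xt.1)).
  exact: (cts_comp basec (C := B)).
 have gbc : cts A (fun xt : T * R => g (base L xt.1)).
  exact: (cts_comp basec (C := B)).
 have sc : cts A (fun xt : T * R => str (f (base L xt.1)) (g (base L xt.1)) (depth L xt.1 - xt.2)).
  apply: ctsB; first exact: cts_cst.
  apply: ctsM; first by apply: ctsB; [exact: cts_cst|exact: ctsB].
  apply: ctsM; first by apply: ctsD => //; exact: cts_cst.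
  apply: ctsV; first by apply: ctsD => //; exact: cts_cst.
  by move=> xt /baseB/f01/andP[f0 _]; rewrite gt_eqF//; lra.
 apply: cts_pair; last by apply: cts_max; [exact: ctsN|exact: cts_cst].
 have pc : cts A (fun xt => (base L xt.1,
   Num.max (str (f (base L xt.1)) (g (base L xt.1)) (depth L xt.1 - xt.2)) 0)).
  by apply: cts_pair => //; apply: cts_max => //; exact: cts_cst.
 refine (cts_comp pc _ (@push_cont L)).
 move=> [x t] [xt /= Nx] /=; split; first exact: base_in.
 have [r1 _] := signed_depth f01 xt Nx; have [bN bB] := base_in Nx.
 have /andP[fb0 fb1] := f01 _ bB; have /andP[gb0 gb1] := g01 _ bB.
 have /andP[s1 s2] := str_rg fb0 gb0 r1.
 by rewrite le_max lexx orbT ge_max s2 ler01.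
- apply: (@cts_eq _ _ _ (fun xt => xt)); last exact: cts_id.
 move=> [x t] [xt /= E]; have [Nx|Nx] := pselect (lc_dom L x); last by rewrite regrow_out.
 rewrite regrow_in//.
 have [r1 [ex et]] := signed_depth f01 xt Nx; have [bN bB] := base_in Nx.
 have /andP[fb0 fb1] := f01 _ bB.
 suff -> : str (f (base L x)) (g (base L x)) (depth L x - t) = depth L x - t by rewrite -ex -et.
 have [/eqP b0|bn0] := boolP (bump L (base L x) == 0).
  rewrite -(fg _ bB) => [|_//]; rewrite /str divff ?mulr1 ?gt_eqF//; lra.
 have /andP[bm0 _] := bump_in (conj bN bB).
 have [d1|d1] := ltP (depth L x) 1.
  by exfalso; apply: E; split=> //; rewrite lt_neqAle eq_sym bn0.
 have /andP[_ d2] := depth_in Nx.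
 have d : depth L x = 1 by apply/eqP; rewrite eq_le d2.
 have t0 : t = 0.
  case: xt => _ [//|[/= Bx _]]; have := (depth0P Nx).2 Bx; rewrite d => /eqP.
  by rewrite oner_eq0.
 by rewrite d t0 /str !subr0 subrr mul0r subr0.
Unshelve. all: by end_near. Qed.

(** The truncation at 1 makes the height exactly 1 at every b where some bump equals 1. *)
Definition grow (L : lcollar) (f : T -> R) (b : T) : R :=
 if pselect (lc_dom L b) then Num.min 1 (f b + bump L b) else f b.

Lemma grow_in L (f : T -> R) b : lc_dom L b -> grow L f b = Num.min 1 (f b + bump L b).
Proof. by rewrite /grow; case: pselect. Qed.
Lemma grow_out L (f : T -> R) b : ~ lc_dom L b -> grow L f b = f b.
Proof. by rewrite /grow; case: pselect. Qed.

Lemma grow_rg L (f : T -> R) b : B b -> 0 <= f b <= 1 -> f b <= grow L f b <= 1.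
Proof.
move=> Bb /andP[f0 f1]; have [Nb|Nb] := pselect (lc_dom L b); last by rewrite grow_out// lexx.
have /andP[b0 b1] := bump_in (conj Nb Bb).
by rewrite grow_in// le_min ge_min lexx f1 lerDl b0.
Qed.

Lemma grow_cont L (f : T -> R) : (forall b, B b -> 0 <= f b <= 1) -> cts B f -> cts B (grow L f).
Proof.
move=> f01 fc.
apply: (@cts_paste _ _ B (lc_dom L) [set b | ~ (lc_dom L b /\ 0 < bump L b)]).
- by move=> b _; have [Nb|Nb] := pselect (lc_dom L b); [left|right => -[]].
- move=> b _ nN; have : nbhs b (~` lc_dom L).
  by apply: open_nbhs_nbhs; split=> //; apply: closed_openC; exact: lc_closed.
 by apply: filterS.
- move=> b Bb /contrapT[Nb b0].
 have n1 : \forall y \near b, X y -> lc_dom L y.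
  apply: lc_open => //; first by rewrite base_on.
  by rewrite (depth0P Nb).2// ltr01.
 have n2 := cts_open (@bump_cont L) (@open_gt R 0) (conj Nb Bb) b0.
 by near=> y => By; apply; split; [move: (BX By); near: y|apply: (near n2 y)] => //; split=> //; move: (BX By); near: y.
- apply: (@cts_eq _ _ _ (fun b => Num.min 1 (f b + bump L b))) => [b [Bb Nb]|]; first by rewrite grow_in.
 apply: cts_min; first exact: cts_cst.
 apply: ctsD; first by apply: (cts_sub _ fc) => b [].
 by apply: (cts_sub _ (@bump_cont L)) => b [].
- apply: (@cts_eq _ _ _ f) => [b [Bb /= nb]|]; last by apply: (cts_sub _ fc) => b [].
 have [Nb|Nb] := pselect (lc_dom L b); last by rewrite grow_out.
 have /andP[b0 _] := bump_in (conj Nb Bb); have /andP[_ f1] := f01 _ Bb.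
 have -> : grow L f b = Num.min 1 (f b + 0).
  rewrite grow_in//; congr (Num.min _ (_ + _)); apply/eqP; rewrite eq_le b0 andbT leNgt.
  by apply/negP => b1; apply: nb.
 by rewrite addr0 min_r.
Unshelve. all: by end_near. Qed.

(** The induction invariant: X is homeomorphic to itself with the exterior collar of height f, by a
    map that sends b to the outer end of its segment. It holds trivially for f = 0, and each local
    collar raises f by its bump. *)
Definition collarable (f : T -> R) := exists H : T -> T * R,
 [/\ cts X H, (forall x y, X x -> X y -> H x = H y -> x = y),
   (forall x, X x -> clrd f (H x)), (forall xt, clrd f xt -> exists2 x, X x & H x = xt) &
   forall b, B b -> H b = (b, f b)].

Lemma collarable0 : collarable (fun _ => 0).
Proof.
exists (fun x => (x, 0)); split=> //.
- by apply: cts_pair; [exact: cts_id|exact: cts_cst].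
- by move=> x y _ _ [].
- by move=> x Xx; split=> //; left.
- move=> [x t] [/= Xx xt]; exists x => //; case: xt => [->//|[_]].
 by rewrite -eq_le => /eqP->.
Qed.

Lemma collarable_grow L (f : T -> R) : (forall b, B b -> 0 <= f b <= 1) -> cts B f -> collarable f ->
 collarable (grow L f).
Proof.
move=> f01 fc [H [Hc Hi Hin Hon Hb]]; set g := grow L f.
have g01 b : B b -> 0 <= g b <= 1.
 move=> Bb; have /andP[f0 _] := f01 b Bb; have /andP[fg g1] := grow_rg L Bb (f01 b Bb).
 by rewrite g1 (le_trans f0).
have fg b : B b -> (lc_dom L b -> bump L b = 0) -> f b = g b.
 move=> Bb b0; have [Nb|Nb] := pselect (lc_dom L b); last by rewrite /g grow_out.
 by rewrite /g grow_in// b0// addr0 min_r//; have /andP[] := f01 b Bb.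
have gf b : B b -> (lc_dom L b -> bump L b = 0) -> g b = f b by move=> Bb b0; rewrite fg.
have gc : cts B g by exact: grow_cont.
exists (regrow L f g \o H); split.
- exact: (cts_comp Hc Hin (regrow_cont f01 g01 fg fc gc)).
- move=> x y Xx Xy /= /(congr1 (regrow L g f)); rewrite !regrowK//; [exact: Hi|exact: Hin..].
- by move=> x Xx; apply: (regrow_clrd f01 g01 fg); exact: Hin.
- move=> xt gxt; have [x Xx xE] := Hon _ (regrow_clrd g01 f01 gf gxt).
 by exists x => //=; rewrite xE regrowK.
- move=> b Bb /=; rewrite Hb//; have [Nb|Nb] := pselect (lc_dom L b); last by rewrite regrow_out// /g grow_out.
 have /andP[f0 f1] := f01 b Bb; have /andP[g0 g1] := g01 b Bb.
 rewrite regrow_in// base_on// (depth0P Nb).2//.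
 have -> : str (f b) (g b) (0 - f b) = - g b by rewrite /str; field; rewrite gt_eqF//; lra.
 by rewrite max_r ?oppr_le0// push0// opprK max_l.
Qed.

(** Finitely many local collars raise the exterior height to 1 on the compact set B. The motion
    multiplies the exterior height by 1 - e: it is the identity at e = 0, and for e > 0 nothing
    reaches the outer end, which represents B. The image at time e consists of the points of
    exterior height at most 1 - e; the other points are positions of points of B at earlier times.
    This gives the last two clauses. *)
Lemma clr : (forall b, B b -> exists L, \forall y \near b, B y -> lc_dom L y /\ bump L y = 1) ->
 exists m : T -> R -> T,
 [/\ cts [set xe : T * R | X xe.1 /\ 0 <= xe.2 <= 1] (fun xe => m xe.1 xe.2),
   (forall x (e : R), X x -> 0 <= e <= 1 -> X (m x e)),
   (forall x, X x -> m x 0 = x),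
   (forall x (e : R), X x -> 0 < e < 1 -> ~ B (m x e)) &
   (forall x x' (e e' : R), X x -> X x' -> 0 <= e -> e <= e' -> e' < 1 -> B x \/ e = e' ->
    m x e = m x' e' -> x = x' /\ e = e') /\
   (forall y (e : R), X y -> 0 <= e -> e < 1 -> (exists2 x, X x & y = m x e) \/
    (exists b (e' : R), [/\ B b, 0 <= e', e' < e & y = m b e']))].
Proof.
move=> loc.
have [Lb Lbnear] : exists Lb : T -> lcollar, forall b, B b -> \forall y \near b, B y -> lc_dom (Lb b) y /\ bump (Lb b) y = 1.
 have [[b0 Bb0]|nB] := pselect (B !=set0).
  have [L0 _] := loc b0 Bb0.
  have ch b : exists L, B b -> \forall y \near b, B y -> lc_dom L y /\ bump L y = 1.
   by have [Bb|nb] := pselect (B b); [have [L ?] := loc b Bb; exists L|exists L0].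
  by have [F FP] := choice ch; exists F.
 (* When B is empty the hypothesis offers no collar, and the empty one serves as a default. *)
 have L0 : lcollar.
  refine (@LocalCollar set0 id (fun=> 0) (fun x _ => x) (fun=> 0) _ _ _ _ _ _ _ _ _ _ _ _ _ _ _) => //; first exact: closed0.
  - by move=> x W [[]].
  - by move=> v s0 [].
  - by move=> v s0 [].
  - by move=> x W [].
  - by move=> v [].
 by exists (fun=> L0) => b Bb; case: nB; exists b.
have B_compact : compact B by exact: (subclosed_compact B_closed X_cpt BX).
have [s sB scov] := cpt_finite_cover B_compact Lbnear.
have [f [f01 fc fs fP]] : exists f : T -> R, [/\ (forall b, B b -> 0 <= f b <= 1), cts B f,
  (forall b c, B b -> c \in s -> lc_dom (Lb c) b /\ bump (Lb c) b = 1 -> f b = 1) & collarable f].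
 elim: s {sB scov} => [|c s [f [f01 fc fs fP]]].
  exists (fun=> 0); split=> //; [by move=> b _; rewrite lexx ler01|exact: cts_cst|exact: collarable0].
 exists (grow (Lb c) f); split; [|exact: grow_cont| |exact: collarable_grow].
  move=> b Bb; have /andP[f0 _] := f01 b Bb; have /andP[fg ->] := grow_rg (Lb c) Bb (f01 b Bb).
  by rewrite (le_trans f0).
 move=> b d Bb; rewrite inE => /orP[/eqP->[Nb b1]|ds db].
  by rewrite grow_in// b1 min_l// lerDr; have /andP[] := f01 b Bb.
 have fb := fs b d Bb ds db; have /andP[] := grow_rg (Lb c) Bb (f01 b Bb).
 by rewrite fb => ? ?; apply/eqP; rewrite eq_le; apply/andP.
have f1 b : B b -> f b = 1 by move=> Bb; have [c cs H] := scov b Bb; exact: (fs b c Bb cs (H Bb)).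
have {fP} [H [Hc Hinj Hin Hon Hb]] := fP.
have Hb1 b : B b -> H b = (b, 1) by move=> Bb; rewrite Hb// f1.
have Hr x : X x -> 0 <= (H x).2 <= 1.
 move=> /Hin[_ [->|[/f1 ->//]]]; by rewrite lexx ler01.
pose Hi (xt : T * R) : T := xget xt.1 [set x | X x /\ H x = xt].
have HiK x : X x -> Hi (H x) = x.
 by move=> Xx; rewrite /Hi; case: xgetP => [y -> [Xy yx]|/(_ x)[]//]; exact: Hinj.
have HK xt : clrd f xt -> H (Hi xt) = xt /\ X (Hi xt).
 by move=> /Hon[x Xx <-]; rewrite HiK.
have TR_hausdorff : hausdorff_space (T * R)%type by exact: hausdorff_pair.
have Hic : cts (H @` X) Hi by exact: inv_cts.
have Hsh x e : X x -> 0 <= e <= 1 -> clrd f ((H x).1, (1 - e) * (H x).2).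
 move=> Xx /andP[e0 e1]; have [/= X1 xt] := Hin x Xx; split=> //=; case: xt => [->|[Bx /andP[t0 t1]]].
  by left; rewrite mulr0.
 right; split=> //; rewrite mulr_ge0//=; last by lra.
 by apply: le_trans t1; rewrite ler_piMl//; lra.
exists (fun x e => Hi ((H x).1, (1 - e) * (H x).2)); split.
- pose A := [set xe : T * R | X xe.1 /\ 0 <= xe.2 <= 1].
 have c1 : cts A (fun xe : T * R => xe.1) by apply: (@ctsT _ _ A fst) => ?; exact: cvg_fst.
 have c2 : cts A (fun xe : T * R => xe.2) by apply: (@ctsT _ _ A snd) => ?; exact: cvg_snd.
 have c3 : cts A (fun xe : T * R => H xe.1) by apply: (cts_comp c1 (C := X)) => // -[? ?] [].
 have c4 : cts A (fun xe : T * R => ((H xe.1).1, (1 - xe.2) * (H xe.1).2)).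
  apply: cts_pair; first by apply: (@cts_op _ _ _ _ _ fst c3) => x _; exact: cvg_fst.
  apply: ctsM; first by apply: ctsB => //; exact: cts_cst.
  by apply: (@cts_op _ _ _ _ _ snd c3) => x _; exact: cvg_snd.
 refine (cts_comp c4 _ Hic) => -[x e] [/= Xx e01].
 by have [y Xy <-] := Hon _ (Hsh _ _ Xx e01); exists y.
- by move=> x e Xx e01; have [] := HK _ (Hsh _ _ Xx e01).
- by move=> x Xx; rewrite subr0 mul1r -surjective_pairing HiK.
- move=> x e Xx /andP[e0 e1] Bm; have e01 : 0 <= e <= 1 by rewrite !ltW.
 have [] := HK _ (Hsh _ _ Xx e01); rewrite Hb1// => -[_ E] _.
 have /andP[t0 t1] := Hr x Xx; nra.
- split=> [x x' e e' Xx Xx' e0 ee e1 h /(congr1 H)|y e Xy e0 e1].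
  rewrite !(HK _ (Hsh _ _ _ _)).1//; [|lra..] => -[h1 h2].
  have /andP[t0 t1] := Hr x Xx; have /andP[t'0 t'1] := Hr x' Xx'.
  have E : e = e'.
   case: h => [Bx|//]; move: h2; rewrite Hb1//= mulr1; nra.
  split=> //; apply: Hinj => //; rewrite [LHS]surjective_pairing [RHS]surjective_pairing h1; congr pair.
  by apply: (@mulfI _ (1 - e)); [rewrite gt_eqF//; lra|rewrite {2}E].
 have /andP[t0 t1] := Hr y Xy.
 have [te|te] := leP (H y).2 (1 - e).
  left; have c : clrd f ((H y).1, (H y).2 / (1 - e)).
   have [/= X1 yt] := Hin y Xy; split=> //=; case: yt => [->|[By _]]; first by left; rewrite mul0r.
   right; split=> //; rewrite f1// divr_ge0//=; last by lra.
   by rewrite ler_pdivrMr ?mul1r//; lra.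
  have [Hc1 Xc] := HK _ c; exists (Hi ((H y).1, (H y).2 / (1 - e))) => //.
  by rewrite Hc1/= mulrCA divff ?mulr1 -?surjective_pairing ?HiK// gt_eqF//; lra.
 right; have [_ [y0|[By _]]] := Hin y Xy; first by move: te; rewrite y0; lra.
 exists (H y).1, (1 - (H y).2); split=> //; [lra|lra|].
 by rewrite Hb1//= mulr1 opprB addrC subrK -surjective_pairing HiK.
Qed.

End Collar.

(** * The standard quadratic model, and [M] as a gradient-like flow *)

Section Quadratic.
Context (R : realType) (m k : nat).
Notation V := 'rV[R]_m.

Definition qx (z : V) : R := \sum_(i < m | (i < k)%N) z ord0 i ^+ 2.
Definition qy (z : V) : R := \sum_(i < m | (k <= i)%N) z ord0 i ^+ 2.

(** The flow of the linear field (2x, -2y), which is [hypv]. *)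
Definition hyp (t : R) (z : V) : V :=
 \row_i (if (i < k)%N then expR (2 * t) * z ord0 i else expR (- (2 * t)) * z ord0 i).

Definition hypv (z : V) : V := \row_i (if (i < k)%N then 2 * z ord0 i else - 2 * z ord0 i).

Lemma qx_ge0 z : 0 <= qx z. Proof. by apply: sumr_ge0 => i _; exact: sqr_ge0. Qed.
Lemma qy_ge0 z : 0 <= qy z. Proof. by apply: sumr_ge0 => i _; exact: sqr_ge0. Qed.

Lemma qxD z : qx z + qy z = \sum_i z ord0 i ^+ 2.
Proof.
rewrite [RHS](bigID (fun i : 'I_m => (i < k)%N)) /=; congr (_ + _).
by apply: eq_bigl => i; rewrite -leqNgt.
Qed.

Lemma qx0 : qx 0 = 0. Proof. by rewrite /qx big1// => i _; rewrite mxE expr0n. Qed.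
Lemma qy0 : qy 0 = 0. Proof. by rewrite /qy big1// => i _; rewrite mxE expr0n. Qed.

Lemma qx_hyp t z : qx (hyp t z) = expR (4 * t) * qx z.
Proof.
rewrite /qx mulr_sumr; apply: eq_bigr => i ik; rewrite mxE ik exprMn; congr (_ * _).
by rewrite -expRM_natl; congr expR; rewrite mulr_natl; ring.
Qed.

Lemma qy_hyp t z : qy (hyp t z) = expR (- (4 * t)) * qy z.
Proof.
rewrite /qy mulr_sumr; apply: eq_bigr => i ik; rewrite mxE ltnNge ik /= exprMn; congr (_ * _).
by rewrite -expRM_natl; congr expR; rewrite mulr_natl; ring.
Qed.

Lemma sq_sum_cts (P : pred 'I_m) : continuous (fun z : V => \sum_(i < m | P i) z ord0 i ^+ 2).
Proof.
apply: (@continuous_big R _ +%R 0 P (@add_continuous R) V _ (fun i (z : V) => z ord0 i ^+ 2)) => i _ z.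
have c : {for z, continuous (fun z : V => z ord0 i)} by exact: coord_continuous.
exact: (continuousM c c).
Qed.

Lemma qx_cts : continuous qx. Proof. exact: sq_sum_cts. Qed.
Lemma qy_cts : continuous qy. Proof. exact: sq_sum_cts. Qed.

Lemma norm_lt_q (z : V) (d : R) : 0 < d -> qx z < d ^+ 2 -> qy z < d ^+ 2 -> `|z| < d.
Proof.
move=> d0 zx zy.
have zi i : `|z ord0 i| < d.
 suff : `|z ord0 i| ^+ 2 < d ^+ 2 by rewrite ltr_pXn2r ?nnegrE// ltW.
 rewrite real_normK ?num_real//; have [ik|ki] := ltnP i k.
  apply: le_lt_trans zx; rewrite /qx (bigD1 i)//= lerDl.
  by apply: sumr_ge0 => *; exact: sqr_ge0.
 apply: le_lt_trans zy; rewrite /qy (bigD1 i)//= lerDl.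
 by apply: sumr_ge0 => *; exact: sqr_ge0.
rewrite [ltLHS]mx_normrE; apply: bigmax_lt => // -[i j] _ /=.
by rewrite (ord1 i).
Qed.

Lemma is_drv_expRM (c w t : R) :
 is_derive t 1 (fun s : R => expR (c * s) * w) (c * (expR (c * t) * w)).
Proof.
have h1 : is_derive t 1 (fun s : R => c * s) c.
 rewrite (_ : (fun s : R => c * s) = fun s : R => s *: (c : R^o)); first exact: is_drv_scalel.
 by apply/funext => s; rewrite mulrC.
have h2 := @is_derive1_comp R expR (fun s : R => c * s) t _ _ (is_derive_expR _) h1.
have h3 := is_deriveZ w h2.
rewrite (_ : (fun s : R => _) = w \*: (expR \o (fun s : R => c * s))).
 by apply: (is_derive_eq h3); rewrite /GRing.scale /=; ring.
by apply/funext => s; rewrite /= mulrC.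
Qed.

Lemma is_drv_hyp (t : R) z : is_derive t 1 (hyp^~ z) (hypv (hyp t z)).
Proof.
apply/is_drv_mx => i j; rewrite ord1 !mxE.
rewrite (_ : (fun s : R => _) = fun s : R => expR ((if (j < k)%N then 2 else - 2) * s) * z ord0 j); last first.
 by apply/funext => s; rewrite mxE; case: ifP => // _; rewrite mulNr.
by apply: (is_derive_eq (is_drv_expRM _ _ _)); case: (j < k)%N; rewrite ?mulNr.
Qed.

Lemma hyp0 z : hyp 0 z = z.
Proof. by apply/rowP => i; rewrite mxE mulr0 oppr0 expR0 !mul1r if_same. Qed.
Lemma hyp_cts z : continuous (hyp^~ z).
Proof. by move=> t; exact: drv_cts (is_drv_hyp t z). Qed.

End Quadratic.

Section StandardChart.
Context (R : realType) (m : nat) (M : riemannian_manifold R m) (f : M -> R) (fS : smooth_function f)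
 (cM : compact [set: M]).
Notation flow := (flow fS cM).
Context (p : M) (k : nat) (a : chart R m M) (Sa : standard_chart f p k a).

Lemma std_cmp c : atlas c -> compatible a c.
Proof. by case: Sa => + _ _ _ _ ac; exact. Qed.

Lemma std_slv z t : cod a (hyp k t z) -> slv f (fun s => par a (hyp k s z)) t.
Proof.
move=> az; have [sm _ _ _ vel] := Sa.
have gc : {for t, continuous (fun s => par a (hyp k s z))}.
 by apply: (ccomp (hyp k ^~ z) (par a)); [exact: hyp_cts|exact: par_continuous].
split=> // c ac cgt.
have [/(_ _ (conj az cgt)) dt _] := (sm c ac).1 1%N.
have := @deriv_comp _ _ _ (hyp k ^~ z) (transition a c) t _ (is_drv_hyp k t z) dt.
move/is_derive_eq; apply; rewrite -jacobianE; exact: vel.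
Qed.

(** The model curve is a solution on an open interval slightly larger than the one between 0 and t,
    so uniqueness of solutions applies. *)
Lemma std_flow z t : (forall s, Num.min 0 t <= s <= Num.max 0 t -> cod a (hyp k s z)) ->
 flow t (par a z) = par a (hyp k t z).
Proof.
move=> az.
have opn s : cod a (hyp k s z) -> \forall s' \near s, cod a (hyp k s' z).
 by move=> as'; apply: (hyp_cts (z := z)); apply: open_nbhs_nbhs; split=> //; exact: cod_open.
have [|d1 /= d10 H1] := (nbhs_normP _ _).1 (opn (Num.min 0 t) _); first by apply: az; rewrite lexx ge_min le_max lexx.
have [|d2 /= d20 H2] := (nbhs_normP _ _).1 (opn (Num.max 0 t) _); first by apply: az; rewrite lexx ge_min le_max lexx.
have sol s : Num.min 0 t - d1 < s < Num.max 0 t + d2 -> cod a (hyp k s z).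
 move=> /andP[s1 s2]; have [sl|sl] := ltP s (Num.min 0 t).
  by apply: H1; rewrite /= ger0_norm; lra.
 have [sr|sr] := ltP (Num.max 0 t) s; last by apply: az; rewrite sl.
 by apply: H2; rewrite /= ler0_norm; lra.
have m0 : Num.min 0 t <= 0 by rewrite ge_min lexx.
have m1 : 0 <= Num.max 0 t by rewrite le_max lexx.
have m2 : Num.min 0 t <= t by rewrite ge_min lexx orbT.
have m3 : t <= Num.max 0 t by rewrite le_max lexx orbT.
apply: (@slv_uniq _ _ _ _ fS (Num.min 0 t - d1) (Num.max 0 t + d2) 0 (fun t => flow t (par a z)) (fun s => par a (hyp k s z))).
- by apply/andP; split; lra.
- by rewrite flow0 hyp0.
- by move=> s _; exact: ((flow_lineP f _).1 (flowP fS cM _)).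
- by move=> s /sol; exact: std_slv.
- by apply/andP; split; lra.
Qed.

Context (e : R) (e0 : 0 < e) (cod_ball : cod a = [set z | \sum_i z ord0 i ^+ 2 < e ^+ 2]).

(** Two squared norms below this bound add up to less than e ^+ 2, so the point is in the coordinate
    ball. *)
Let rho := e ^+ 2 / 2.

Lemma std_rho : 0 < rho. Proof. by rewrite divr_gt0// exprn_gt0. Qed.

Lemma std_cod z : cod a z <-> qx k z + qy k z < e ^+ 2.
Proof. by rewrite cod_ball qxD. Qed.
Lemma std_cod_box z : qx k z < rho -> qy k z < rho -> cod a z.
Proof. by move=> zx zy; apply/std_cod; move: zx zy; rewrite /rho; lra. Qed.
Lemma std_cod0 : cod a 0.
Proof. by rewrite std_cod qx0 qy0 addr0 exprn_gt0. Qed.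
Lemma std_center : dom a p /\ crd a p = 0.
Proof. by have [_ _ <- _ _] := Sa; rewrite parK; [split=> //; exact/par_dom/std_cod0|exact: std_cod0]. Qed.

Lemma std_flow_box z t : qx k z < rho -> qy k z < rho ->
  expR (4 * t) * qx k z < rho -> expR (- (4 * t)) * qy k z < rho ->
 cod a (hyp k t z) /\ flow t (par a z) = par a (hyp k t z).
Proof.
move=> zx zy tx ty.
suff box s : Num.min 0 t <= s <= Num.max 0 t -> cod a (hyp k s z).
 by split; [apply: box; rewrite ge_min le_max lexx !orbT|exact: std_flow].
move=> /andP[s1 s2]; apply: std_cod_box; rewrite ?qx_hyp ?qy_hyp.
 have mono (u v w q : R) : 0 <= q -> u <= v \/ u <= w -> expR v * q < rho -> expR w * q < rho -> expR u * q < rho.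
  by move=> q0 [uv|uw] hv hw; [apply: le_lt_trans hv|apply: le_lt_trans hw]; rewrite ler_wpM2r// ler_expR.
 apply: (mono _ 0 (4 * t)) => //; [exact: qx_ge0| |by rewrite expR0 mul1r].
 by move: s2; rewrite le_max => /orP[?|?]; [left|right]; lra.
have mono (u v w q : R) : 0 <= q -> u <= v \/ u <= w -> expR v * q < rho -> expR w * q < rho -> expR u * q < rho.
 by move=> q0 [uv|uw] hv hw; [apply: le_lt_trans hv|apply: le_lt_trans hw]; rewrite ler_wpM2r// ler_expR.
apply: (mono _ 0 (- (4 * t))) => //; [exact: qy_ge0| |by rewrite expR0 mul1r].
by move: s1; rewrite ge_min => /orP[?|?]; [left|right]; lra.
Qed.

Lemma std_fwd x t : dom a x -> qy k (crd a x) < rho -> 0 <= t -> expR (4 * t) * qx k (crd a x) < rho ->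
 dom a (flow t x) /\ crd a (flow t x) = hyp k t (crd a x).
Proof.
move=> dx xy t0 xt.
have xx : qx k (crd a x) < rho.
 by apply: le_lt_trans xt; rewrite ler_peMl ?qx_ge0// -expR0 ler_expR mulr_ge0.
have yt : expR (- (4 * t)) * qy k (crd a x) < rho.
 by apply: le_lt_trans xy; rewrite ler_piMl ?qy_ge0// -expR0 ler_expR oppr_le0 mulr_ge0.
have [ct] := std_flow_box xx xy xt yt; rewrite crdK// => ->.
by rewrite parK//; split=> //; exact: par_dom.
Qed.

Lemma std_bwd x t : dom a x -> qx k (crd a x) < rho -> 0 <= t -> expR (4 * t) * qy k (crd a x) < rho ->
 dom a (flow (- t) x) /\ crd a (flow (- t) x) = hyp k (- t) (crd a x).
Proof.
move=> dx xx t0 yt.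
have xy : qy k (crd a x) < rho.
 by apply: le_lt_trans yt; rewrite ler_peMl ?qy_ge0// -expR0 ler_expR mulr_ge0.
have xt : expR (- (4 * t)) * qx k (crd a x) < rho.
 by apply: le_lt_trans xx; rewrite ler_piMl ?qx_ge0// -expR0 ler_expR oppr_le0 mulr_ge0.
have [||ct] := @std_flow_box (crd a x) (- t) xx xy; [by rewrite mulrN|by rewrite mulrN opprK|].
rewrite crdK// => ->.
by rewrite parK//; split=> //; exact: par_dom.
Qed.

Lemma std_nbhs r : 0 < r -> nbhs p [set x | [/\ dom a x, qx k (crd a x) < r & qy k (crd a x) < r]].
Proof.
move=> r0; have [dp crdp] := std_center; have cc := crd_continuous dp.
have h1 : \forall x \near p, qx k (crd a x) < r.
 have : {for p, continuous (qx k \o crd a)} by apply: continuous_comp => //; exact: qx_cts.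
 by move=> /(_ [set u | u < r]); apply; apply: open_nbhs_nbhs; split; [exact: open_lt|rewrite /= crdp qx0].
have h2 : \forall x \near p, qy k (crd a x) < r.
 have : {for p, continuous (qy k \o crd a)} by apply: continuous_comp => //; exact: qy_cts.
 by move=> /(_ [set u | u < r]); apply; apply: open_nbhs_nbhs; split; [exact: open_lt|rewrite /= crdp qy0].
by apply: filterS3 h1 h2 (nbhs_dom dp) => x ? ? ?; split.
Qed.

Lemma std_basis W : nbhs p W -> exists2 r : R, 0 < r & [set x | [/\ dom a x, qx k (crd a x) < r & qy k (crd a x) < r]] `<=` W.
Proof.
have [_ _ pa _ _] := Sa.
move=> pW; have := par_continuous std_cod0; rewrite /prop_for /continuous_at pa => /(_ W pW) /nbhs_mxP[d d0 dW].
exists (d ^+ 2); first by rewrite exprn_gt0.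
move=> x [dx xx xy]; rewrite -(crdK dx); apply: dW.
by rewrite sub0r normrN; exact: norm_lt_q xx xy.
Qed.

Lemma std_hgt x : dom a x -> f x = f p - qx k (crd a x) + qy k (crd a x).
Proof. by have [_ _ _ fa _] := Sa; move=> dx; rewrite -{1}(crdK dx) fa//; exact: crd_cod. Qed.

Definition std_sdl : sdl f flow p.
Proof.
refine (@Saddle R M f flow p (dom a) (fun x => qx k (crd a x)) (fun x => qy k (crd a x)) rho std_rho std_center.1
 (fun x _ => qx_ge0 k (crd a x)) (fun x _ => qy_ge0 k (crd a x)) std_nbhs std_basis (fun x dx _ _ => std_hgt dx) _ _).
- by move=> x t dx xy t0 xt; have [d ->] := std_fwd dx xy t0 xt; rewrite qx_hyp qy_hyp.
- by move=> x t dx xx t0 yt; have [d ->] := std_bwd dx xx t0 yt; rewrite qx_hyp qy_hyp mulrN opprK.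
Defined.

End StandardChart.

Section Instance.
Context (R : realType) (m : nat) (M : riemannian_manifold R m) (f : M -> R) (fS : smooth_function f)
 (cM : compact [set: M]) (fN : standard_near_critical f).
Notation flow := (flow fS cM).

Lemma critical_flow t p : critical f p -> flow t p = p.
Proof.
move=> cp; have cl : flow_line f (fun _ : R => p).
 split=> [t0|t0 c ac dp]; first exact: cvg_cst.
 rewrite /gradient cp// mul0mx oppr0.
 exact: (is_derive_cst (crd c p)).
by rewrite -(flow_lineE fS cM t cl).
Qed.

(** Along the flow the derivative of f is minus the squared norm of the gradient, and regular points
    stay regular. *)
Lemma flow_decr x s t : ~ critical f x -> s < t -> f (flow t x) < f (flow s x).
Proof.
move=> nx st.
have D u : derivable (fun u => f (flow u x)) u 1 /\ (fun u => f (flow u x))^`()%classic u < 0.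
 have nu : ~ critical f (flow u x).
  move=> cu; apply: nx; have := critical_flow (- u) cu; rewrite -flowD addNr flow0 => E.
  by rewrite E.
 have [c ac [dc pc]] : exists2 c, atlas c & dom c (flow u x) /\ partials f c (crd c (flow u x)) <> 0.
  apply: contrapT => no; apply: nu => c ac dc; apply: contrapT => pc; apply: no.
  by exists c.
 have d := flow_derive fS (flowP fS cM x) ac dc; split; first exact: ex_derive.
 rewrite derive1E derive_val oppr_lt0; apply: metric_inv_pos => //; [exact: crd_cod|exact/eqP].
have fc : continuous (fun u => f (flow u x)).
 move=> u; apply: (ccomp (flow^~ x) f); last exact: f_continuous.
 by have [c _] := flowP fS cM x; exact: c.
apply: (@ltr0_derive1_decr _ (fun u => f (flow u x)) s t) => //; rewrite ?lexx ?ltW//.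
- by move=> u _; exact: (D u).1.
- by move=> u _; exact: (D u).2.
- exact: continuous_subspaceT.
Qed.

Definition mgrad : gradlike R M.
Proof.
refine (@Gradlike R M f flow (critical f) _ _ _ _ _ _ _).
- exact: f_continuous.
- exact: flow_cts.
- exact: flow0.
- exact: flowD.
- exact: critical_flow.
- exact: flow_decr.
- move=> p cp; have [k _ ea] := cid2 (fN cp); have [a Sa] := cid ea.
 have [e e0 ce] : {e : R | 0 < e & cod a = [set z | \sum_i z ord0 i ^+ 2 < e ^+ 2]}.
  by apply: cid2; case: Sa.
 exact: (std_sdl fS cM Sa e0 ce).
Defined.

End Instance.

Lemma fin_radius (R : realType) (n : nat) (P : 'I_n -> R -> Prop) :
 (forall i, exists2 d : R, 0 < d & P i d) -> (forall i (d d' : R), 0 < d' -> d' <= d -> P i d -> P i d') ->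
 exists2 d : R, 0 < d & forall i, P i d.
Proof.
move=> ex mono; have ch i : exists d : R, 0 < d /\ P i d by have [d ? ?] := ex i; exists d.
have [d dP] := choice ch.
have d0 : 0 < \big[Num.min/1]_(i < n) d i by apply: lt_bigmin => // i _; have [] := dP i.
exists (\big[Num.min/1]_(i < n) d i) => // i.
apply: (mono i (d i)) => //; [exact: bigmin_le_cond|by have [] := dP i].
Qed.

(** * The contraction behind gluing *)

Section Fixed.
Context (R : realType) (n m w N : nat) (F : 'I_n -> 'rV[R]_m -> 'rV[R]_w) (A : 'I_n -> 'M[R]_(m, w))
 (g : 'I_n -> 'rV[R]_N -> 'M[R]_(n, m) -> 'rV[R]_w).

(** Row by row, the part of v in the kernel of A i that is complementary to the image of the
    pseudo-inverse. *)
Definition kap (v : 'M[R]_(n, m)) : 'M[R]_(n, m) :=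
 \matrix_i (row i v - row i v *m A i *m pinvmx (A i)).

Lemma kap_ker v i : row i (kap v) *m A i = 0.
Proof. by rewrite rowK mulmxBl mulmxKpV ?submxMl// subrr. Qed.
Lemma normr_row (v : 'M[R]_(n, m)) i : `|row i v| <= `|v|.
Proof. by apply: mxn_le => // i0 j; rewrite mxE entry_le. Qed.

Lemma normr_rows (u : 'I_n -> 'rV[R]_m) (c : R) : 0 <= c -> (forall i, `|u i| <= c) -> `|\matrix_i u i| <= c.
Proof.
move=> c0 uc; apply: mxn_le => // i j; rewrite mxE.
exact: le_trans (entry_le _ _ _) (uc i).
Qed.

Context (F0 : forall i, F i 0 = 0)
 (FA : forall i (e : R), 0 < e -> exists2 d : R, 0 < d & forall y z, `|y| < d -> `|z| < d ->
 `|F i y - F i z - (y - z) *m A i| <= e * `|y - z|)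
 (C d0 : R) (C0 : 0 < C) (d00 : 0 < d0) (gC : forall i t v, `|v| < d0 -> `|g i t v| <= C * `|t|)
 (gL : forall i t v v', `|v| < d0 -> `|v'| < d0 -> `|g i t v - g i t v'| <= C * `|t| * `|v - v'|)
 (Fim : forall i v, `|v| < d0 -> (F i v <= A i)%MS) (gim : forall i t v, `|v| < d0 -> (g i t v <= A i)%MS).

Let step (k : 'M[R]_(n, m)) (t : 'rV[R]_N) (v : 'M[R]_(n, m)) : 'M[R]_(n, m) :=
 k + \matrix_i ((g i t v - (F i (row i v) - row i v *m A i)) *m pinvmx (A i)).

Let K := 1 + \sum_i w%:R * `|pinvmx (A i)|.

Let K1 : 1 <= K.
Proof. by rewrite lerDl sumr_ge0. Qed.

Let KP i (u : 'rV_w) : `|u *m pinvmx (A i)| <= K * `|u|.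
Proof.
apply: le_trans (mulmxn _ _) _; rewrite mulrAC ler_wpM2r//.
by rewrite /K (bigD1 i)//= addrCA lerDl addr_ge0// sumr_ge0.
Qed.

(** The equations F i (row i v) = g i t v become a fixed point problem for [step]: v is a prescribed
    kernel part k plus the pseudo-inverse of g minus the nonlinear part of F. Strict
    differentiability at 0 and the factor |t| in the bounds on g make this a contraction.
    Surjectivity enters through [Fim] and [gim]: both sides lie in the row space of A i, where the
    pseudo-inverse provides preimages. So the small solutions are parametrized by (k, t). *)
Lemma glue_fixed (e0 : R) : 0 < e0 -> exists d e : R, [/\ 0 < d < e0, 0 < e,
 (forall k t, (forall i, row i k *m A i = 0) -> `|k| <= e -> `|t| <= e ->
  exists v, [/\ `|v| < d, forall i, F i (row i v) = g i t v & kap v = k]) &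
 forall v v' t, `|v| <= d -> `|v'| <= d -> `|t| <= e -> (forall i, F i (row i v) = g i t v) ->
  (forall i, F i (row i v') = g i t v') -> kap v = kap v' -> v = v'].
Proof.
move=> e00; have K0 : 0 < K := lt_le_trans ltr01 K1.
have q0 : 0 < (8 * K)^-1 by rewrite invr_gt0 mulr_gt0.
have [d1 d10 Fd] : exists2 d : R, 0 < d & forall i y z, `|y| < d -> `|z| < d ->
  `|F i y - F i z - (y - z) *m A i| <= (8 * K)^-1 * `|y - z|.
 apply: (@fin_radius R n (fun i d => forall y z, `|y| < d -> `|z| < d ->
  `|F i y - F i z - (y - z) *m A i| <= (8 * K)^-1 * `|y - z|)) => [i|i d d' _ dd H y z yd zd]; first exact: FA.
 by apply: H; [apply: lt_le_trans yd _|apply: lt_le_trans zd _].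
pose d := Num.min (Num.min e0 d0) d1 / 2.
have dm : 0 < Num.min (Num.min e0 d0) d1 by rewrite !lt_min e00 d00.
have dpos : 0 < d by rewrite divr_gt0.
have [de dd0 dd1] : [/\ d < e0, d < d0 & d < d1].
 have : d < Num.min (Num.min e0 d0) d1 by rewrite /d; move: dm; set x := Num.min _ _; lra.
 by rewrite !lt_min => /andP[/andP[? ?] ?].
(* K * C * e is to be at most 1/8, for the contraction factor 1/8 + 1/8, and at most d / 8, for the
   iterates to stay within radius d. *)
pose e := Num.min (d / 8) (Num.min 1 d / (8 * K * C)).
have epos : 0 < e by rewrite lt_min !divr_gt0// ?lt_min ?ltr01 ?mulr_gt0.
have e1 : e <= d / 8 by rewrite ge_min lexx.
have e2 : K * (C * e) <= Num.min 1 d / 8.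
 have : e <= Num.min 1 d / (8 * K * C) by rewrite ge_min lexx orbT.
 rewrite ler_pdivlMr ?mulr_gt0// => H; rewrite ler_pdivlMr//; apply: le_trans H.
 by rewrite le_eqVlt; apply/orP; left; apply/eqP; ring.
have e3 : K * (C * e) <= 8^-1 by apply: le_trans e2 _; rewrite ler_pdivrMr// mulVf// ge_min lexx.
have e4 : K * (C * e) <= d / 8 by apply: le_trans e2 _; rewrite ler_pM2r ?invr_gt0// ge_min lexx orbT.
have contr k t v v' : `|v| <= d -> `|v'| <= d -> `|t| <= e -> `|step k t v - step k t v'| <= 2^-1 ^+ 2 * `|v - v'|.
 move=> vd vd' te; rewrite /step opprD addrACA subrr add0r.
 rewrite (_ : _ - _ = \matrix_i ((g i t v - g i t v' - (F i (row i v) - F i (row i v') - (row i v - row i v') *m A i)) *m pinvmx (A i))); last first.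
  apply/row_matrixP => i; rewrite [row i (_ - _)]linearB /= !rowK -mulmxBl; congr (_ *m _).
  rewrite mulmxBl; move: (g i t v) (g i t v') (F i (row i v)) (F i (row i v')) (row i v *m A i) (row i v' *m A i).
  by move=> g1 g2 f1 f2 a1 a2; apply/rowP => j; rewrite !mxE; ring.
 apply: normr_rows => [|i]; first by rewrite mulr_ge0.
 have H1 : `|g i t v - g i t v'| <= C * e * `|v - v'|.
  apply: le_trans (gL i t _ _) _; [exact: le_lt_trans dd0|exact: le_lt_trans dd0|].
  by rewrite ler_wpM2r// ler_wpM2l// ltW.
 have H2 : `|F i (row i v) - F i (row i v') - (row i v - row i v') *m A i| <= (8 * K)^-1 * `|v - v'|.
  apply: le_trans (Fd i _ _ _ _) _; [apply: le_lt_trans dd1; exact: le_trans (normr_row _ _) _..|].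
  by have := normr_row (v - v') i; rewrite [row i (_ - _)]linearB /= => H; apply: ler_wpM2l H; exact: ltW.
 apply: le_trans (KP i _) _; apply: le_trans (_ : K * (C * e * `|v - v'| + (8 * K)^-1 * `|v - v'|) <= _).
  by apply: ler_wpM2l; [exact: ltW|apply: le_trans (ler_normB _ _) _; exact: lerD].
 rewrite mulrDr !mulrA -[K * C * e]mulrA.
 have -> : K * (8 * K)^-1 = 8^-1 by field; rewrite gt_eqF.
 rewrite -mulrDl ler_wpM2r//; move: e3; rewrite expr2; lra.
have small k t v : `|v| <= d -> `|k| <= e -> `|t| <= e -> `|step k t v| <= 3 / 8 * d.
 move=> vd ke te; apply: le_trans (ler_normD _ _) _.
 suff H : `|\matrix_i ((g i t v - (F i (row i v) - row i v *m A i)) *m pinvmx (A i))| <= d / 8 + d / 8 by lra.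
 apply: normr_rows => [|i]; first by lra.
 apply: le_trans (KP i _) _.
 have H1 : `|g i t v| <= C * e.
  apply: le_trans (gC i t _) _; first exact: le_lt_trans dd0.
  by rewrite ler_wpM2l// ltW.
 have H2 : `|F i (row i v) - row i v *m A i| <= (8 * K)^-1 * d.
  have := Fd i (row i v) 0 (le_lt_trans (le_trans (normr_row _ _) vd) dd1); rewrite normr0 F0 !subr0 => /(_ d10) H.
  by apply: le_trans H _; apply: ler_wpM2l; [exact: ltW|exact: le_trans (normr_row _ _) vd].
 apply: le_trans (_ : K * (C * e + (8 * K)^-1 * d) <= _).
  by apply: ler_wpM2l; [exact: ltW|apply: le_trans (ler_normB _ _) _; exact: lerD].
 rewrite mulrDr [K * (_ * d)]mulrA.
 have -> : K * (8 * K)^-1 = 8^-1 by field; rewrite gt_eqF.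
 by move: e4; lra.
have slv_step v t : `|v| <= d -> (forall i, F i (row i v) = g i t v) -> v = step (kap v) t v.
 move=> vd sol; apply/row_matrixP => i; rewrite [row i (step _ _ _)]linearD /= !rowK sol.
 by rewrite opprB addrCA subrr addr0 subrK.
exists d, e; split; first by rewrite dpos.
- exact: epos.
- move=> k t kA ke te.
 pose U : set 'M[R]_(n, m) := [set v | `|v| <= d].
 have stepU : set_fun U U (step k t).
  by move=> v vd; apply: le_trans (small k t v vd ke te) _; lra.
 have [||| l lU lE] := @banach_fixed_point R 'M[R]_(n, m) U (mkfun_fun stepU).
 - exists (2^-1 ^+ 2)%:nng; split=> [|[v v'] [vd vd']]; last exact: contr.
  by rewrite /= expr2; lra.
 - by apply: (@preimage_closed _ _ (fun v : 'M[R]_(n, m) => `|v|) [set x | x <= d]); [move=> v _; exact: norm_continuous|exact: closed_le].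
 - by exists 0; rewrite /U /= normr0 ltW.
 have fix_l : step k t l = l := esym lE.
 have ld : `|l| < d by rewrite -fix_l; apply: le_lt_trans (small k t l lU ke te) _; lra.
 have ld0 : `|l| < d0 by exact: lt_trans dd0.
 have rowl i : `|row i l| < d0 by exact: le_lt_trans (normr_row _ _) ld0.
 have eqi i : row i l *m A i = g i t l - (F i (row i l) - row i l *m A i).
  rewrite -{1}fix_l [row i (step _ _ _)]linearD /= rowK mulmxDl kA add0r mulmxKpV//.
  by rewrite !(addmx_sub, eqmx_opp) ?gim ?Fim ?submxMl.
 exists l; split=> // [i|].
  have := eqi i; rewrite opprB addrA [g i t l + _]addrC -addrA => /eqP; rewrite -subr_eq0.
  by rewrite opprD addrA subrr add0r oppr_eq0 subr_eq0 => /eqP.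
 apply/row_matrixP => i; rewrite rowK eqi.
 have E : row i l = row i k + (g i t l - (F i (row i l) - row i l *m A i)) *m pinvmx (A i).
  by rewrite -{1}fix_l [row i (step _ _ _)]linearD /= rowK.
 by rewrite [X in X - _]E addrK.
- move=> v v' t vd vd' te sol sol' kk.
 have := slv_step v t vd sol; have := slv_step v' t vd' sol'; rewrite -kk => e' e''.
 have := contr (kap v) t v v' vd vd' te; rewrite -e' -e'' => H.
 apply/eqP; rewrite -subr_eq0 -normr_le0; move: H; rewrite expr2; have := normr_ge0 (v - v'); lra.
Qed.

End Fixed.

Lemma closed_cts (T U : topologicalType) (A : set T) (f : T -> U) (C : set U) :
 closed A -> cts A f -> closed C -> closed (A `&` f @^-1` C).
Proof.
move=> cA fA cC x xcl; have Ax : A x by apply: cA => W /xcl[y [[Ay _] Wy]]; exists y.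
split=> //; apply: contrapT => nC.
have := cts_open fA (closed_openC cC) Ax nC => /xcl[y [[Ay Cy] H]].
exact: H.
Qed.

Lemma cts_lip (R : realType) (T : topologicalType) (V W : normedModType R) (A : set T) (f : T -> V) (h : V -> W) (C : R) :
 cts A f -> (forall u v, `|h u - h v| <= C * `|u - v|) -> cts A (fun x => h (f x)).
Proof.
move=> fA hC; apply: cts_op => // x _; apply: (@lip_cts R V W h (f x) (`|C| + 1) 1) => // y z _ _.
by apply: le_trans (hC _ _) _; rewrite ler_wpM2r// ler_wpDr// ler_norm.
Qed.

Section MinEntry.
Context (R : realType) (N : nat).
Implicit Types t : 'rV[R]_N.+1.

Definition minr t : R := t ord0 [arg min_(i < ord0) t ord0 i]%O.

Lemma minr_le t i : minr t <= t ord0 i.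
Proof. by rewrite /minr; case: arg_minP => // j _; apply. Qed.
Lemma minr_ex t : exists i, minr t = t ord0 i.
Proof. by rewrite /minr; eexists. Qed.

Lemma minr_lip t t' : `|minr t - minr t'| <= `|t - t'|.
Proof.
have h (u v : 'rV[R]_N.+1) : minr u - minr v <= `|u - v|.
 have [i ->] := minr_ex v; apply: le_trans (entry_le _ ord0 i); rewrite !mxE.
 by apply: le_trans (ler_norm _); rewrite lerD2r minr_le.
by rewrite ler_norml h andbT lerNl opprB distrC h.
Qed.

Lemma minrD t (s : R) : minr (t + const_mx s) = minr t + s.
Proof.
apply/eqP; rewrite eq_le; apply/andP; split.
 by have [i ->] := minr_ex t; apply: le_trans (minr_le _ i) _; rewrite !mxE.
by have [i ->] := minr_ex (t + const_mx s); rewrite !mxE lerD2r minr_le.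
Qed.

Lemma normr_const (s : R) : `|const_mx s : 'rV[R]_N.+1| = `|s|.
Proof.
apply/eqP; rewrite eq_le; apply/andP; split; first by apply: mxn_le => // i j; rewrite mxE.
by have := entry_le (const_mx s : 'rV[R]_N.+1) ord0 ord0; rewrite mxE.
Qed.

End MinEntry.

(** In the coordinates (ka, ta) the space is locally a product with an orthant, and B is where some
    entry of ta vanishes. The diagonal direction (1, ..., 1) points inwards at all faces at once:
    subtracting the least entry [mu] from all entries gives the base point, and [mu] divided by r is
    the depth. *)
Lemma chart_clr (R : realType) (T : topologicalType) (X B N0 : set T) (n m N : nat) (Ker : set 'M[R]_(n, m))
  (ka : T -> 'M[R]_(n, m)) (ta : T -> 'rV[R]_N.+1) (e : R) (x0 : T) :
 hausdorff_space T -> compact X -> closed B -> B `<=` X -> 0 < e -> closed N0 -> N0 `<=` X ->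
 cts N0 ka -> cts N0 ta ->
 (forall x i, N0 x -> 0 <= ta x ord0 i) ->
 (forall x, N0 x -> B x <-> exists i, ta x ord0 i = 0) ->
 (forall x, N0 x -> Ker (ka x)) ->
 (forall (k : 'M[R]_(n, m)) (t : 'rV[R]_N.+1), Ker k -> `|k| <= e -> `|t| <= e -> (forall i, 0 <= t ord0 i) -> exists x, [/\ N0 x, ka x = k & ta x = t]) ->
 (forall x y, N0 x -> N0 y -> `|ka x| <= e -> `|ta x| <= e -> ka x = ka y -> ta x = ta y -> x = y) ->
 (forall x, N0 x -> `|ka x| <= e -> `|ta x| <= e -> \forall y \near x, X y -> N0 y) ->
 [/\ N0 x0, ka x0 = 0 & ta x0 = 0] ->
 exists L : lcollar R X B, \forall y \near x0, B y -> lc_dom L y /\ bump L y = 1.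
Proof.
move=> T_hausdorff X_cpt B_closed BX e0 cN0 NX kac tac ta0 taB kaK onto inj nb [Nx0 kx0 tx0].
(* With base part and least entry both bounded by e / 2, the norm of [ta] is at most e, the range in
   which (ka, ta) is injective. *)
pose r := e / 2; have r0 : 0 < r by rewrite divr_gt0.
pose mu x := minr (ta x).
have mu0 x : N0 x -> 0 <= mu x by move=> Nx; rewrite /mu; have [i ->] := minr_ex (ta x); exact: ta0.
pose rest x := ta x - const_mx (mu x).
have muc : cts N0 mu.
 by apply: (@cts_lip R T 'rV[R]_N.+1 R N0 ta (@minr R N) 1) => // u v; rewrite mul1r minr_lip.
have restc : cts N0 rest.
 apply: (@cts_lip R T 'rV[R]_N.+1 'rV[R]_N.+1 N0 ta (fun t => t - const_mx (minr t)) 2) => // u v.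
 rewrite (_ : _ - _ = (u - v) - const_mx (minr u - minr v)); last by apply/rowP => j; rewrite !mxE; ring.
 by apply: le_trans (ler_normB _ _) _; rewrite normr_const mulr_natl mulr2n lerD2l minr_lip.
have kanc : cts N0 (fun x => `|ka x|).
 apply: (@cts_lip R T 'M[R]_(n, m) R N0 ka (fun k => `|k|) 1) => // u v.
 by rewrite mul1r; exact: ler_dist_dist.
have nrmc (f : T -> 'rV[R]_N.+1) : cts N0 f -> cts N0 (fun x => `|f x|).
 move=> fc; apply: (@cts_lip R T 'rV[R]_N.+1 R N0 f (fun k => `|k|) 1) => // u v.
 by rewrite mul1r; exact: ler_dist_dist.
pose N1 := [set x | [/\ N0 x, `|ka x| <= e & `|ta x| <= e]].
pose D := [set x | [/\ N0 x, `|ka x| <= e, `|rest x| <= r & mu x <= r]].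
have closed_le_on (f : T -> R) (A : set T) (c : R) : closed A -> cts A f -> closed (A `&` [set x | f x <= c]).
 by move=> cA fA; apply: (closed_cts cA fA (@closed_le R c)).
have taE x : ta x = rest x + const_mx (mu x) by rewrite /rest subrK.
have DN1 : D `<=` N1.
 move=> x [Nx k1 r1 m1]; split=> //; rewrite taE; apply: le_trans (ler_normD _ _) _.
 by rewrite normr_const ger0_norm ?mu0//; move: r1 m1; rewrite /r; qlra.
have cN1 : closed N1.
 have -> : N1 = (N0 `&` [set x | `|ka x| <= e]) `&` [set x | `|ta x| <= e].
  by apply/seteqP; split=> x; [case|move=> [[]]].
 apply: (closed_le_on _ _ _); first exact: (closed_le_on _ _ _).
 by apply: (@cts_sub _ _ _ N0) => [x []//|]; exact: nrmc.
have cD : closed D.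
 have -> : D = ((N0 `&` [set x | `|ka x| <= e]) `&` [set x | `|rest x| <= r]) `&` [set x | mu x <= r].
  by apply/seteqP; split=> x; [case|move=> [[[]]]].
 apply: (closed_le_on _ _ _); first (apply: (closed_le_on _ _ _); first exact: (closed_le_on _ _ _)).
  by apply: (@cts_sub _ _ _ N0) => [x []//|]; exact: nrmc.
 by apply: (@cts_sub _ _ _ N0) => [x [[]]|].
pose Q x := (ka x, ta x).
pose Qi (kt : 'M[R]_(n, m) * 'rV[R]_N.+1) : T := xget x0 [set x | N1 x /\ Q x = kt].
have QiK x : N1 x -> Qi (Q x) = x.
 move=> N1x; rewrite /Qi; case: xgetP => [y -> [[Ny k1 t1] [ek et]]|/(_ x)[]//].
 by have [Nx _ _] := N1x; exact: inj.
have QK (k : 'M[R]_(n, m)) (t : 'rV[R]_N.+1) : Ker k -> `|k| <= e -> `|t| <= e -> (forall i, 0 <= t ord0 i) ->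
  N1 (Qi (k, t)) /\ (ka (Qi (k, t)) = k /\ ta (Qi (k, t)) = t).
 move=> Kk ke te t0; have [x [Nx kx tx]] := onto k t Kk ke te t0.
 by rewrite -kx -tx -[(_, _)]/(Q x) QiK//; split; rewrite ?kx ?tx//; split; rewrite ?kx ?tx.
have Qic : cts (Q @` N1) Qi.
 apply: (@inv_cts _ _ N1 Q Qi) => //.
 - by apply: subclosed_compact cN1 X_cpt _ => x [/NX].
 - by apply: cts_pair; [apply: cts_sub kac|apply: cts_sub tac] => x [].
have D_r x : D x -> [/\ Ker (ka x), `|ka x| <= e, `|rest x| <= e, (forall i, 0 <= rest x ord0 i) & exists i, rest x ord0 i = 0].
 move=> [Nx k1 r1 m1]; split=> //; [exact: kaK|by move: r1; rewrite /r; qlra|move=> i; by rewrite !mxE subr_ge0 minr_le|].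
 by have [i mi] := minr_ex (ta x); exists i; rewrite !mxE /mu mi subrr.
pose bs x := Qi (ka x, rest x).
have bsP x : D x -> [/\ D (bs x), B (bs x), ka (bs x) = ka x & rest (bs x) = rest x /\ (ta (bs x) = rest x /\ mu (bs x) = 0)].
 move=> Dx; have [K1 k1 r1 rr [i ri]] := D_r x Dx; have [N1b [kb tb]] := QK _ _ K1 k1 r1 rr.
 have Nb : N0 (bs x) by case: N1b.
 have mb : mu (bs x) = 0.
  apply/eqP; rewrite eq_le mu0// andbT; apply: le_trans (minr_le _ i) _.
  by rewrite /bs tb ri.
 have rb : rest (bs x) = rest x.
  by rewrite /rest mb [ta _]tb; apply/rowP => j; rewrite !mxE subr0.
 split=> //; [|by apply/taB => //; exists i; rewrite /bs tb].
 have [_ _ r2 _] := Dx.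
 by split; rewrite ?mb ?rb ?[ka _]kb// ltW.
have rest_B v : D v -> B v -> mu v = 0 /\ rest v = ta v.
 move=> [Nv _ _ _] /(taB _ Nv)[i ti]; have m0 : mu v = 0.
  by apply/eqP; rewrite eq_le mu0// andbT -ti minr_le.
 by split=> //; rewrite /rest m0; apply/rowP => j; rewrite !mxE subr0.
pose ps v (s : R) := Qi (ka v, rest v + const_mx (s * r)).
have psP v (s : R) : D v -> 0 <= s <= 1 -> [/\ N1 (ps v s), ka (ps v s) = ka v, rest (ps v s) = rest v & mu (ps v s) = s * r].
 move=> Dv /andP[s0 s1]; have [K1 k1 r1 rr [i ri]] := D_r v Dv; have [_ _ r2 _] := Dv.
 have sr : 0 <= s * r by rewrite mulr_ge0// ltW.
 have sr1 : s * r <= r by rewrite ler_piMl// ltW.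
 have [||N1b [kb tb]] := QK (ka v) (rest v + const_mx (s * r)) K1 k1.
 - apply: le_trans (ler_normD _ _) _; rewrite normr_const ger0_norm//; move: r2 sr1; rewrite /r; qlra.
 - by move=> j; rewrite mxE addr_ge0// mxE.
 have mb : mu (ps v s) = s * r.
  rewrite /mu [ta _]tb minrD; suff -> : minr (rest v) = 0 by rewrite add0r.
  by apply/eqP; rewrite eq_le -{1}ri minr_le/=; have [j ->] := minr_ex (rest v); exact: rr.
 by split=> //; rewrite /rest mb [ta _]tb addrK.
have psD v (s : R) : D v -> 0 <= s <= 1 -> D (ps v s).
 move=> Dv s01; have [[Np _ _] kb rb mb] := psP v s Dv s01; have [_ k1 r2 _] := Dv.
 by split=> //; rewrite ?kb ?rb ?mb//; have /andP[s0 s1] := s01; rewrite ler_piMl// ltW.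
have QD x : D x -> N1 x by exact: DN1.
have bsc : cts D bs.
 refine (cts_comp (_ : cts D (fun x => (ka x, rest x))) _ Qic).
  by apply: cts_pair; [apply: cts_sub kac|apply: cts_sub restc] => x [].
 move=> x Dx; have [D1 _ kb [_ [tb _]]] := bsP x Dx; exists (bs x); first exact: DN1.
 by rewrite /Q kb tb.
have psc : cts [set vs : T * R | (D `&` B) vs.1 /\ 0 <= vs.2 <= 1] (fun vs => ps vs.1 vs.2).
 set A := [set vs : T * R | _].
 have c1 : cts A (fun xe : T * R => xe.1) by apply: (@ctsT _ _ A fst) => ?; exact: cvg_fst.
 have c2 : cts A (fun xe : T * R => xe.2) by apply: (@ctsT _ _ A snd) => ?; exact: cvg_snd.
 have A1 vs : A vs -> N0 vs.1 by move=> [[[]]].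
 refine (cts_comp (_ : cts A (fun vs => (ka vs.1, rest vs.1 + const_mx (vs.2 * r)))) _ Qic).
  apply: cts_pair; first exact: (cts_comp c1 A1 kac).
  have p1 : cts A (fun vs => (rest vs.1, vs.2)) by apply: cts_pair => //; exact: (cts_comp c1 A1 restc).
  apply: (@cts_op _ _ _ A _ (fun p : 'rV[R]_N.+1 * R => p.1 + const_mx (p.2 * r)) p1) => vs _.
  apply: (@continuousD _ _ _ (fun p : 'rV[R]_N.+1 * R => p.1) (fun p => const_mx (p.2 * r))); first exact: cvg_fst.
  apply: (ccomp snd (fun s : R => const_mx (s * r) : 'rV[R]_N.+1)); first exact: cvg_snd.
  apply: (@lip_cts R R _ _ _ r 1) => // y z _ _.
  rewrite (_ : _ - _ = const_mx (y * r - z * r)); last by apply/rowP => j; rewrite !mxE.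
  by rewrite normr_const -mulrBl normrM (gtr0_norm r0) mulrC.
 move=> [v s] [/= [Dv Bv] s01]; have [N1p kb rb mb] := psP v s Dv s01.
 by exists (ps v s) => //; rewrite /Q kb [ta _]taE rb mb.
(* This is 1 when |ka x| <= e / 2 and |ta x| <= r / 2, and 0 as soon as |ka x| >= e or |ta x| >=
   r. *)
pose bp x : R := Num.max 0 (Num.min (2 - 2 / e * `|ka x|) (Num.min 1 (2 - 2 / r * `|ta x|))).
have bpc : cts N0 bp.
 apply: cts_max; first exact: cts_cst.
 apply: cts_min; last (apply: cts_min; first exact: cts_cst).
  by apply: ctsB; [exact: cts_cst|apply: ctsM => //; exact: cts_cst].
 by apply: ctsB; [exact: cts_cst|apply: ctsM; [exact: cts_cst|exact: nrmc]].
have bp01 x : 0 <= bp x <= 1 by rewrite le_max lexx ge_max ler01 !ge_min lexx orbT.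
have psbs x : D x -> ps (bs x) (mu x / r) = x.
 move=> Dx; have [D1 B1 kb [rb [tb m1]]] := bsP x Dx.
 rewrite /ps kb rb divfK ?gt_eqF// -taE.
 exact: (QiK x (DN1 x Dx)).
unshelve eexists (@LocalCollar R T X B D bs (fun x => mu x / r) ps bp cD _ bsc _ _ _ psc _ _ _ _ _ _ _ _).
- by move=> x [/NX].
- apply: ctsM; [by apply: cts_sub muc => x []|exact: cts_cst].
- by move=> x Dx; have [? ? _ _] := bsP x Dx.
- move=> x [Nx _ _ m1]; rewrite divr_ge0 ?mu0 ?(ltW r0)//= ler_pdivrMr// mul1r //.
- by move=> v s [Dv _]; exact: psD.
- move=> v s [Dv Bv] s01; have [N1p kb rb mb] := psP v s Dv s01.
 by rewrite /bs kb rb (rest_B v Dv Bv).2; exact: (QiK v (DN1 v Dv)).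
- move=> v s [Dv Bv] s01; have [N1p kb rb mb] := psP v s Dv s01.
 by rewrite mb mulfK// gt_eqF.
- exact: psbs.
- move=> v [Dv Bv]; rewrite /ps mul0r (rest_B v Dv Bv).2.
 by rewrite (_ : _ + _ = ta v) ?(QiK v (DN1 v Dv))//; apply/rowP => j; rewrite !mxE addr0.
- by apply: cts_sub bpc => x [[]].
- by move=> v _; exact: bp01.
- move=> x Dx b0 d1; have [[Nb _ _ _] _ kb [rb [tb _]]] := bsP x Dx.
 have [Nx k1 r1 m1] := Dx.
 have {}d1 : mu x < r by move: d1; rewrite ltr_pdivrMr// mul1r.
 have [k2 r2] : `|ka x| < e /\ `|rest x| < r.
  move: b0; rewrite /bp kb tb lt_max ltxx /= !lt_min => /and3P[h1 _ h2]; split.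
   by move: h1; rewrite subr_gt0 mulrAC ltr_pdivrMr// ltr_pM2l.
  by move: h2; rewrite subr_gt0 mulrAC ltr_pdivrMr// ltr_pM2l.
 have [_ ke te] := DN1 x Dx.
 have n0 := nb x Nx ke te.
 have n1 := cts_open kanc (@open_lt R e) Nx k2.
 have n2 := cts_open (nrmc _ restc) (@open_lt R r) Nx r2.
 have n3 := cts_open muc (@open_lt R r) Nx d1.
 near=> y => Xy; have Ny : N0 y by move: Xy; near: y.
 by split=> //; apply/ltW; move: Ny; near: y.
have n0 : \forall y \near x0, X y -> N0 y by apply: nb; rewrite ?kx0 ?tx0 ?normr0 ?ltW.
have e2 : 0 < e / 2 by []. have r2 : 0 < r / 2 by rewrite divr_gt0.
have n1 : \forall y \near x0, N0 y -> `|ka y| < e / 2.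
 by apply: (cts_open kanc (@open_lt R (e / 2)) Nx0); rewrite /= kx0 normr0.
have n2 : \forall y \near x0, N0 y -> `|ta y| < r / 2.
 by apply: (cts_open (nrmc _ tac) (@open_lt R (r / 2)) Nx0); rewrite /= tx0 normr0.
near=> y => By; have Ny : N0 y by move: (BX y By); near: y.
have ky : `|ka y| < e / 2 by move: Ny; near: y.
have ty : `|ta y| < r / 2 by move: Ny; near: y.
have [i ti] := (taB y Ny).1 By.
have my : mu y = 0 by apply/eqP; rewrite eq_le mu0// andbT -ti minr_le.
have ry : rest y = ta y by rewrite /rest my; apply/rowP => j; rewrite !mxE subr0.
split; first by split=> //; rewrite ?ry ?my; move: ky ty e0 r0; qlra.
rewrite /= /bp [Num.min 1 _]min_l; last first.
 by rewrite lerBrDl -lerBrDr mulrAC ler_pdivrMr//; move: ty; qlra.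
rewrite min_r ?max_r//; rewrite lerBrDl -lerBrDr mulrAC ler_pdivrMr//; move: ky; qlra.
Unshelve. all: by end_near. Qed.

(** * Lines as chains of orbits *)

Section Chains.
Context (R : realType) (M : topologicalType) (hM : hausdorff_space M) (cM : compact [set: M]) (G : gradlike R M).
Notation omg := (omg cM G).
Notation alf := (alf cM G).
Notation f := (hgt G).
Notation line := (line cM G).

Lemma hgt_omg x : ~ crit G x -> f (omg x) < f x.
Proof. by move=> xc; have := @hgt_omg_lt _ _ cM G x 0 xc; rewrite gfl0. Qed.
Lemma hgt_alf x : ~ crit G x -> f x < f (alf x).
Proof. by move=> xc; have := @hgt_alf_gt _ _ cM G x 0 xc; rewrite gfl0. Qed.

(** The closure of the orbit of a regular point x as a line, constant beyond its ends; [xget]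
    returns the only orbit point at height h. *)
Definition orbc (x : M) (h : R) : M :=
 if h <= f (omg x) then omg x else if f (alf x) <= h then alf x else
 xget x [set y | f y = h /\ exists t, y = gfl G t x].

Lemma orbcE x t : ~ crit G x -> orbc x (f (gfl G t x)) = gfl G t x.
Proof.
move=> xc; rewrite /orbc leNgt hgt_omg_lt//= leNgt hgt_alf_gt//=.
case: xgetP => [y -> [yt [s ys]]|/(_ (gfl G t x)) []]; last by split=> //; exists t.
by rewrite ys (@gfl_inj_hgt _ _ G x s t xc)// -ys.
Qed.

Lemma orbc_cases x h : ~ crit G x ->
 [\/ orbc x h = omg x /\ h <= f (omg x), orbc x h = alf x /\ f (alf x) <= h |
   exists2 t, orbc x h = gfl G t x & f (gfl G t x) = h].
Proof.
move=> xc; rewrite /orbc; case: leP => [hw|wh]; first by constructor 1.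
case: leP => [ah|ha]; first by constructor 2.
constructor 3; case: xgetP => [y -> [yh [t yt]]|no]; first by exists t; rewrite -yt.
have [|t ht] := @hits_hgt _ _ cM G x h; first by rewrite wh.
by have [] := no (gfl G t x); split=> //; exists t.
Qed.

Lemma orbit_line x : ~ crit G x -> line (alf x) (omg x) (orbc x) /\ orbc x (f x) = x.
Proof.
move=> xc; have wa := lt_trans (hgt_omg xc) (hgt_alf xc).
have e0 : orbc x (f x) = x by have := orbcE 0 xc; rewrite gfl0.
have cw : crit G (omg x) by exact: omg_crit.
have ca : crit G (alf x) by exact: alf_crit.
have ew : orbc x (f (omg x)) = omg x by rewrite /orbc lexx.
have ea : orbc x (f (alf x)) = alf x by rewrite /orbc leNgt wa /= lexx.
split=> //; split.
- by move=> h hw; rewrite /orbc hw.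
- by move=> h ah; rewrite /orbc leNgt (lt_le_trans wa ah)/= ah.
- move=> h /andP[h1 h2]; have [[-> hw]|[-> ah]|[t -> //]] := orbc_cases h xc.
  by apply/eqP; rewrite eq_le h1 hw.
 by apply/eqP; rewrite eq_le h2 ah.
- move=> h t; have [[-> _]|[-> _]|[s -> _]] := orbc_cases h xc.
 + by rewrite gfl_crit.
 + by rewrite gfl_crit.
 + by rewrite -gflowD orbcE.
- move=> h; have [[-> _]|[-> _]|[s -> _]] := orbc_cases h xc.
 + by rewrite omg_of_crit.
 + by rewrite omg_of_crit.
 + by rewrite omgE.
- move=> h; have [[-> _]|[-> _]|[s -> _]] := orbc_cases h xc.
 + by rewrite alf_of_crit.
 + by rewrite alf_of_crit.
 + by rewrite alphaE.
Qed.

Lemma line_orbit p q g b h : line p q g -> ~ crit G (g b) ->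
 f (omg (g b)) <= h <= f (alf (g b)) -> g h = orbc (g b) h.
Proof.
move=> gl gc /andP[h1 h2]; have [ol oe] := orbit_line gc.
move: h1; rewrite le_eqVlt => /orP[/eqP<-|h1]; first by rewrite (line_omg gl) (line0 ol).
move: h2; rewrite le_eqVlt => /orP[/eqP->|h2]; first by rewrite (line_alpha gl) (line1 ol).
have [|t -> <-] := @line_hit _ _ cM G p q g b h gl gc; first by rewrite h1.
by rewrite orbcE.
Qed.

Lemma line_ge p q g h : line p q g -> f q <= f (g h) <= f p.
Proof. by move=> gl; rewrite (line_hgt_clamp h gl); apply: hclamp_rg; exact: line_le gl. Qed.

(* Breaks of g strictly between heights h and f r do not occur, so r is the
 limit point of the orbit of g h. *)
Lemma line_alf_of p q g r h : line p q g -> crit G r -> g (f r) = r -> f q <= h < f r -> f r <= f p ->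
 (forall s, crit G s -> h < f s <= f r -> f s = f r) -> ~ crit G (g h) -> alf (g h) = r.
Proof.
move=> gl rc gr /andP[qh hr] rp iso nc.
have gh : f (g h) = h by rewrite (line_hgt gl)// qh ltW// (lt_le_trans hr).
have ha : h < f (alf (g h)) by rewrite -{1}gh; exact: hgt_alf.
suff E : f (alf (g h)) = f r by rewrite -(line_alpha gl) E.
have [ar|ra] := leP (f (alf (g h))) (f r); first by apply: iso; [exact: alf_crit|rewrite ha].
have [|t E _] := @line_hit _ _ cM G p q g h (f r) gl nc.
 by rewrite ra andbT; apply: lt_trans hr; rewrite -{2}gh; exact: hgt_omg.
by exfalso; apply: nc; apply/(crit_gfl G t); rewrite -E gr.
Qed.

Ltac slra := first [revert_cmp; clear -R M hM cM G; lra | lra].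

(** Just below a break r the line follows one orbit, and the forward limit of this orbit is the next
    break. The descent ends because fewer critical points are lower than the new break; [count]
    measures this. *)
Lemma break_chain p q g : line p q g -> crit G p -> crit G q -> f q < f p ->
 exists (n : nat) (c : nat -> M), [/\ c 0%N = p, c n.+1 = q, forall i, (i <= n.+1)%N -> crit G (c i) /\ g (f (c i)) = c i &
  forall i, (i <= n)%N -> f (c i.+1) < f (c i) /\
   forall h, f (c i.+1) < h < f (c i) -> [/\ ~ crit G (g h), alf (g h) = c i & omg (g h) = c i.+1]].
Proof.
move=> gl pc qc qp; have gq : g (f q) = q := line0 gl (lexx _).
have [s sE] := (finite_seqP _).1 (@crit_finite _ _ hM cM G).
suff H : forall (k : nat) (r : M), (count (fun u => (f u < f r)%R) s <= k)%N -> crit G r -> g (f r) = r -> f q < f r <= f p ->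
 exists (n : nat) (c : nat -> M), [/\ c 0%N = r, c n.+1 = q, forall i, (i <= n.+1)%N -> crit G (c i) /\ g (f (c i)) = c i &
  forall i, (i <= n)%N -> f (c i.+1) < f (c i) /\
   forall h, f (c i.+1) < h < f (c i) -> [/\ ~ crit G (g h), alf (g h) = c i & omg (g h) = c i.+1]].
 by apply: (H _ p (leqnn _)) => //; [exact: (line1 gl)|rewrite qp lexx].
elim=> [|k IH] r cnt rc gr /andP[qr rp].
 exfalso; move: cnt; rewrite leqn0 => /eqP cnt.
 have : (0 < count (fun u => (f u < f r)%R) s)%N.
  by rewrite -has_count; apply/hasP; exists q => //; have : crit G q by []; rewrite sE.
 by rewrite cnt.
have [e e0 iso] := isolated_value hM cM G r.
(* A height between f q and f r that is closer to f r than any other critical value. *)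
pose h0 := (f r + Num.max (f q) (f r - e)) / 2.
have [qh eh hr] : [/\ f q < h0, f r - e < h0 & h0 < f r].
 have m1 : Num.max (f q) (f r - e) < f r by rewrite gt_max qr /=; lra.
 have m2 : f q <= Num.max (f q) (f r - e) by rewrite le_max lexx.
 have m3 : f r - e <= Num.max (f q) (f r - e) by rewrite le_max lexx orbT.
 by rewrite /h0; move: m1 m2 m3; set m := Num.max _ _ => *; split; slra.
have gh : f (g h0) = h0 by rewrite (line_hgt gl)// ltW//= (le_trans (ltW hr)).
have iso' u : crit G u -> h0 <= f u <= f r -> f u = f r.
 by move=> uc /andP[u1 u2]; apply: iso => //; rewrite ler0_norm; slra.
have nc : ~ crit G (g h0).
 by move=> c; have := iso' _ c; rewrite gh lexx (ltW hr) => /(_ erefl) E; move: hr; rewrite -E ltxx.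
have aE : alf (g h0) = r.
 apply: (line_alf_of gl rc gr) => //; first by rewrite ltW.
 by move=> u uc /andP[u1 u2]; apply: iso' => //; rewrite ltW.
set w := omg (g h0); have wc : crit G w by exact: omg_crit.
have wh : f w < h0 by rewrite -gh; exact: hgt_omg.
have gw : g (f w) = w by exact: (line_omg gl).
have qw : f q <= f w by rewrite -gw; have /andP[] := line_ge (f w) gl.
have seg h : f w < h < f r -> [/\ ~ crit G (g h), alf (g h) = r & omg (g h) = w].
 move=> hw; have [|t -> _] := @line_hit _ _ cM G p q g h0 h gl nc; first by rewrite aE.
 by rewrite alphaE// omgE// aE; split=> // /crit_gfl.
have [wq|] := eqVneq (f w) (f q).
 have wqE : w = q by rewrite -gw wq gq.
 exists 0%N, (fun i => if i is _.+1 then q else r); split=> //.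
  by move=> [|[|//]] _.
 by move=> [|//] _; split=> //; rewrite -wqE.
rewrite neq_lt ltNge qw /= => qw'.
have [||n [c [c0 cn cc cs]]] := IH w _ wc gw; last 1 first.
- exists n.+1, (fun i => if i is i'.+1 then c i' else r); split=> //.
  by move=> [|i] // /cc.
 move=> [|i] ilt; last exact: (cs i).
 by rewrite c0; split=> //; exact: lt_trans wh hr.
- have ws : (0 < count (pred1 w) s)%N.
  by rewrite -has_count has_pred1; have : crit G w by []; rewrite sE.
 rewrite -ltnS; apply: leq_trans cnt; rewrite -addn1.
 apply: leq_trans (_ : count (fun u => (f u < f w)%R) s + count (pred1 w) s <= _)%N; first by rewrite leq_add2l.
 rewrite -count_predUI (@eq_count _ (predI _ _) pred0) ?count_pred0 ?addn0.
  by apply: sub_count => u /orP[/lt_trans->//|/eqP->]; exact: lt_trans wh hr.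
 by move=> u /=; have [->|] := eqVneq u w; rewrite ?ltxx ?andbF.
- by rewrite qw' (le_trans (ltW (lt_trans wh hr))).
Qed.

(** If the next point is on the same orbit, the line built so far already contains it; if the two
    are linked at a critical point, the orbit of the next point is joined there. *)
Lemma build_line (n : nat) (z : nat -> M) (p q : M) : (forall i, (i <= n)%N -> ~ crit G (z i)) -> alf (z 0%N) = p -> omg (z n) = q ->
 (forall i, (i < n)%N -> (exists2 t, 0 <= t & z i.+1 = gfl G t (z i)) \/ omg (z i) = alf (z i.+1)) ->
 exists2 g, line p q g & forall i, (i <= n)%N -> g (f (z i)) = z i.
Proof.
move=> zc zp zq zz.
suff H j : (j <= n)%N -> exists2 g, line p (omg (z j)) g & forall i, (i <= j)%N -> g (f (z i)) = z i /\ f (z j) <= f (z i).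
 by have [g gl gz] := H n (leqnn n); exists g; rewrite -?zq// => i /gz[].
elim: j => [_|j IH jn].
 have [ol oe] := orbit_line (zc 0%N (leq0n n)); exists (orbc (z 0%N)); first by rewrite -zp.
 by move=> i; rewrite leqn0 => /eqP->.
have [g gl gz] := IH (ltnW jn); have zjc := zc j (ltnW jn); have zj1c := zc j.+1 jn.
have [[t t0 zt]|wa] := zz j jn.
 exists g; first by rewrite zt omgE.
 have h1 : f (z j.+1) <= f (z j) by rewrite zt -{2}(gfl0 G (z j)); exact: hgt_nincr.
 move=> i; rewrite leq_eqVlt => /orP[/eqP->|ij]; last by have [gi zi] := gz i ij; split=> //; exact: le_trans zi.
 by split=> //; have [gj _] := gz j (leqnn j); rewrite zt -{1}gj (line_flow gl) gj.
have [ol oe] := orbit_line zj1c; rewrite -wa in ol.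
have h1 : f (omg (z j)) < f (z j) by exact: hgt_omg.
have h2 : f (z j.+1) < f (omg (z j)) by rewrite wa; exact: hgt_alf.
exists (join G (omg (z j)) g (orbc (z j.+1))); first exact: (@line_join _ _ cM).
move=> i; rewrite leq_eqVlt => /orP[/eqP->|ij].
 by rewrite /join leNgt h2.
have [gi zi] := gz i ij; have := lt_le_trans h1 zi => h3; rewrite /join ltW//; split=> //.
exact/ltW/(lt_trans h2).
Qed.

(** Each z i determines the line between the heights of the two limits of its orbit, and by the last
    hypothesis these intervals leave no gap. *)
Lemma line_determined (n : nat) (z : nat -> M) (p q : M) g k : line p q g -> line p q k ->
 (forall i, (i <= n)%N -> [/\ ~ crit G (z i), g (f (z i)) = z i & k (f (z i)) = z i]) ->
 alf (z 0%N) = p -> omg (z n) = q ->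
 (forall i, (i < n)%N -> f (omg (z i)) <= f (alf (z i.+1))) -> g = k.
Proof.
move=> gl kl zz zp zq za.
suff H j : (j <= n)%N -> forall h, f (omg (z j)) <= h -> g h = k h.
 apply/funext => h; have [qh|/ltW hq] := leP (f q) h; first by apply: (H n (leqnn n)); rewrite zq.
 by rewrite (line0 gl)// (line0 kl).
have agree i h : (i <= n)%N -> f (omg (z i)) <= h <= f (alf (z i)) -> g h = k h.
 move=> /zz[zc gz kz] hh.
 by rewrite (line_orbit (b := f (z i)) gl) ?gz// (line_orbit (b := f (z i)) kl) ?kz.
elim: j => [_ h h1|j IH jn h h1].
 have [h2|/ltW h2] := leP h (f p); first by apply: (agree 0%N); rewrite ?zp ?h1.
 by rewrite (line1 gl)// (line1 kl).
have [h2|h2] := leP (f (omg (z j))) h; first exact: (IH (ltnW jn)).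
by apply: (agree j.+1) => //; rewrite h1 (le_trans (ltW h2))// za.
Qed.

Notation crv := (prod_topology (fun _ : R => M)).

Definition brk (p q : M) : set crv :=
 [set g : crv | line p q g /\ exists r, [/\ crit G r, f q < f r, f r < f p & g (f r) = r]].

(** A finite union of closed conditions, one for each critical point with height strictly between
    those of the ends. *)
Lemma brk_closed p q : closed (brk p q).
Proof.
have [s sE] := (finite_seqP _).1 (@crit_finite _ _ hM cM G).
pose S := [seq r <- s | f q < f r < f p].
have -> : brk p q = (line p q : set crv) `&` \big[setU/set0]_(r <- S) [set g : crv | g (f r) = r].
 apply/seteqP; split=> g [gl].
  move=> [r [rc qr rp gr]]; split=> //; rewrite -bigcup_seq; exists r => //=.
  by rewrite mem_filter qr rp; have : crit G r by []; rewrite sE.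
 rewrite -bigcup_seq => -[r /=]; rewrite mem_filter => /andP[/andP[qr rp] rs] gr; split=> //.
 by exists r; split=> //; rewrite sE.
apply: closedI; first exact: line_closed.
apply: closed_bigsetU => r _.
apply: (@preimage_closed _ _ (fun g : crv => g (f r)) [set r]).
- by move=> g _; exact: curve_eval.
- by apply: accessible_closed_set1; exact: hausdorff_accessible.
Qed.

End Chains.

Section RowMx.
Context (R : realType).

Lemma normr_row_mx (m n p : nat) (u : 'M[R]_(p, m)) (v : 'M[R]_(p, n)) (c : R) : 0 <= c -> `|u| <= c -> `|v| <= c ->
 `|row_mx u v| <= c.
Proof.
move=> c0 uc vc; apply: mxn_le => // i j; rewrite mxE.
by case: (fintype.split j) => k; apply: le_trans (entry_le _ _ _) _.
Qed.

Lemma sdf_row_mx (V : normedModType R) (p m n : nat) (h : V -> 'M[R]_(p, m)) (k : V -> 'M[R]_(p, n)) x D E :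
 sdf h x D -> sdf k x E -> sdf (fun y => row_mx (h y) (k y)) x (fun v => row_mx (D v) (E v)).
Proof.
move=> [lD [C1 bD] eD] [lE [C2 bE] eE]; split.
- by move=> a u v; rewrite lD lE scale_row_mx add_row_mx.
- exists (`|C1| + `|C2|) => v; apply: normr_row_mx; first by rewrite mulr_ge0// addr_ge0.
  apply: le_trans (bD v) _; rewrite ler_wpM2r//; apply: le_trans (ler_norm _) _; by rewrite lerDl.
 apply: le_trans (bE v) _; rewrite ler_wpM2r//; apply: le_trans (ler_norm _) _; by rewrite lerDr.
- move=> e e0; have [d1 d10 H1] := eD e e0; have [d2 d20 H2] := eE e e0.
 exists (Num.min d1 d2); first by rewrite lt_min d10.
 move=> y z; rewrite !lt_min => /andP[y1 y2] /andP[z1 z2].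
 rewrite opp_row_mx add_row_mx opp_row_mx add_row_mx; apply: normr_row_mx; first by rewrite mulr_ge0// ltW.
  exact: H1.
 exact: H2.
Qed.

Definition dmx (m w : nat) (D : 'rV[R]_m -> 'rV[R]_w) : 'M[R]_(m, w) := \matrix_(i, j) D (delta_mx ord0 i) ord0 j.

Lemma dmxE (m w : nat) (D : 'rV[R]_m -> 'rV[R]_w) v : linear D -> v *m dmx D = D v.
Proof.
move=> lD.
have D0 : D 0 = 0 by have := lD (-1) 0 0; rewrite scaleN1r oppr0 add0r scaleN1r addNr.
have DD u u' : D (u + u') = D u + D u' by have := lD 1 u u'; rewrite !scale1r.
have DZ a u : D (a *: u) = a *: D u by have := lD a u 0; rewrite !addr0 D0 addr0.
apply/rowP => j; rewrite mxE {2}(row_sum_delta v).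
have Dsum (s : seq 'I_m) (F : 'I_m -> 'rV[R]_m) : D (\sum_(i <- s) F i) = \sum_(i <- s) D (F i).
 by elim: s => [|i s IH]; rewrite ?big_nil// !big_cons DD IH.
by rewrite Dsum summxE; apply: eq_bigr => i _; rewrite DZ !mxE.
Qed.

Lemma sdf_uniq (V W : normedModType R) (h : V -> W) x D E : sdf h x D -> sdf h x E -> D =1 E.
Proof. by move=> /sdf_diff[_ hD] /sdf_diff[_ hE] v; rewrite -hD hE. Qed.
Lemma sdf_id (V : normedModType R) (x : V) : sdf id x id.
Proof. by apply: (@sdf_linear R V V id x 1) => v; rewrite ?mul1r. Qed.

End RowMx.

(** * One segment between two critical points: transversality in standard charts *)

Section Projectors.
Context (R : realType) (m k : nat).
Notation V := 'rV[R]_m.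

(** Projections to the unstable coordinates, those of index below k, and to the stable ones. [Jmx]
    is the quadratic form by which f differs from its critical value in a standard chart. *)
Definition Xmx : 'M[R]_m := diag_mx (\row_i (i < k)%N%:R).
Definition Ymx : 'M[R]_m := diag_mx (\row_i (k <= i)%N%:R).
Definition Jmx : 'M[R]_m := Ymx - Xmx.
Definition quad (z : V) : 'M[R]_1 := z *m Jmx *m z^T.

Lemma mul_diag_row (d z : V) i : (z *m diag_mx d) ord0 i = z ord0 i * d ord0 i.
Proof.
rewrite mxE (bigD1 i)//= !mxE eqxx mulr1n big1 ?addr0// => j ji.
by rewrite !mxE (negbTE ji) mulr0n mulr0.
Qed.

Lemma XmxE (z : V) i : (z *m Xmx) ord0 i = if (i < k)%N then z ord0 i else 0.
Proof. by rewrite mul_diag_row mxE; case: ltnP; rewrite ?mulr1 ?mulr0. Qed.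
Lemma YmxE (z : V) i : (z *m Ymx) ord0 i = if (i < k)%N then 0 else z ord0 i.
Proof. by rewrite mul_diag_row mxE leqNgt; case: ltnP; rewrite ?mulr1 ?mulr0. Qed.
Lemma XY (z : V) : z = z *m Xmx + z *m Ymx.
Proof. by apply/rowP => i; rewrite mxE XmxE YmxE; case: ifP; rewrite ?addr0 ?add0r. Qed.

Lemma qx_eq0 (z : V) : qx k z = 0 <-> z *m Xmx = 0.
Proof.
split=> [/eqP|E].
 rewrite /qx psumr_eq0 => [/allP H|i _]; last exact: sqr_ge0.
 apply/rowP => i; rewrite XmxE mxE; case: ifP => // ik.
 by have := H i (mem_index_enum _); rewrite ik /= sqrf_eq0 => /eqP.
rewrite /qx big1// => i ik; have /rowP/(_ i) := E; rewrite XmxE ik mxE => ->.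
by rewrite expr0n.
Qed.

Lemma qy_eq0 (z : V) : qy k z = 0 <-> z *m Ymx = 0.
Proof.
split=> [/eqP|E].
 rewrite /qy psumr_eq0 => [/allP H|i _]; last exact: sqr_ge0.
 apply/rowP => i; rewrite YmxE mxE; case: ltnP => // ik.
 by have := H i (mem_index_enum _); rewrite ik /= sqrf_eq0 => /eqP.
rewrite /qy big1// => i ik; have /rowP/(_ i) := E; rewrite YmxE ltnNge ik /= mxE => ->.
by rewrite expr0n.
Qed.

Lemma quadE (z : V) : quad z ord0 ord0 = qy k z - qx k z.
Proof.
rewrite /quad mulmxBr mulmxBl [LHS]mxE [X in _ + X]mxE; congr (_ - _).
 rewrite mxE /qy [RHS]big_mkcond; apply: eq_bigr => i _; rewrite YmxE mxE.
 by case: (ltnP i k) => _; rewrite ?mul0r// -expr2.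
rewrite mxE /qx [RHS]big_mkcond; apply: eq_bigr => i _; rewrite XmxE mxE.
by case: (ltnP i k) => _; rewrite ?mul0r// -expr2.
Qed.

Lemma Jmx_sym : Jmx^T = Jmx.
Proof. by rewrite /Jmx linearB /= !tr_diag_mx. Qed.

Lemma sdf_quad (z : V) : sdf quad z (fun v => v *m (2 *: (Jmx *m z^T))).
Proof.
have s1 : sdf (fun y : V => y *m Jmx) z (fun v => v *m Jmx) by exact: sdf_mulmxr.
have s2 : sdf (fun y : V => y^T) z (fun v => v^T).
 apply: (@sdf_linear R V 'cV[R]_m (fun y : V => y^T) z 1) => [a u v|v]; first by rewrite linearP.
 by rewrite mul1r; apply: mxn_le => // i j; rewrite mxE entry_le.
have := sdf_mulmx s1 s2; congr sdf; apply/funext => v.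
rewrite -scalemxAr scaler_nat mulr2n mulmxA; congr (_ + _).
have tr1 (B : 'M[R]_1) : B^T = B by apply/matrixP => i j; rewrite mxE !ord1.
by rewrite -[LHS]tr1 !trmx_mul trmxK Jmx_sym mulmxA.
Qed.

Lemma hypv_quad (z : V) : z *m Ymx = 0 -> hypv k z = 2 *: z.
Proof.
move=> zY; apply/rowP => i; rewrite !mxE; case: ifP => // ik.
by have /rowP/(_ i) := zY; rewrite YmxE ik mxE => ->; rewrite !mulr0.
Qed.

Lemma hyp_X (t : R) (z : V) : hyp k t z *m Xmx = expR (2 * t) *: (z *m Xmx).
Proof. by apply/rowP => i; rewrite XmxE [RHS]mxE XmxE mxE; case: ifP => ik; rewrite ?ik ?mulr0. Qed.
Lemma hyp_Y (t : R) (z : V) : hyp k t z *m Ymx = expR (- (2 * t)) *: (z *m Ymx).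
Proof. by apply/rowP => i; rewrite YmxE [RHS]mxE YmxE mxE; case: ifP => ik; rewrite ?ik ?mulr0. Qed.

End Projectors.

Section Passage.
Context (R : realType) (m : nat) (M : riemannian_manifold R m) (f : M -> R) (fS : smooth_function f)
 (cM : compact [set: M]).
Notation flow := (flow fS cM).

Definition psg (a b : chart R m M) (S : R) (z : 'rV[R]_m) : 'rV[R]_m := crd b (flow S (par a z)).

Context (r r' : M) (k k' : nat) (a b : chart R m M) (Sa : standard_chart f r k a) (Sb : standard_chart f r' k' b).

Lemma psg_sdf x0 S : dom a x0 -> dom b (flow S x0) -> exists D, sdf (psg a b S) (crd a x0) D.
Proof.
move=> x0_a y0_b; pose z0 := crd a x0; have [c ac dc] := atlas_cover x0; have [d ad dd] := atlas_cover (flow S x0).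
have [_ /(_ c d ac ad dc dd)[D Ds]] := flow_msdf fS cM S x0.
have sa : compatible a c := std_cmp Sa ac.
have sd : compatible d b by have [h1 h2] := std_cmp Sb ad.
have s1 := trans_sdf sa x0_a dc.
have s3 := trans_sdf sd dd y0_b.
have e1 : transition a c z0 = crd c x0 by rewrite /transition /= crdK.
rewrite -e1 in Ds.
have s12 := sdf_comp s1 Ds.
have e2 : (crd d \o flow S \o par c) (transition a c z0) = crd d (flow S x0) by rewrite e1 /= crdK.
have s3' : sdf (transition d b) ((crd d \o flow S \o par c \o transition a c) z0) ('d (transition d b) (crd d (flow S x0))).
 by rewrite /= -/(transition a c z0) [X in sdf _ X]e2.
exists ('d (transition d b) (crd d (flow S x0)) \o (D \o 'd (transition a c) z0)).
apply: sdf_near_eq (sdf_comp s12 s3').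
have fc : {for z0, continuous (fun z => flow S (par a z))}.
 apply: (ccomp (par a) (flow S)); first exact/par_continuous/crd_cod.
 rewrite crdK//; by have [] := flow_msdf fS cM S x0.
have n1 := nbhs_ovl (ovl_crd x0_a dc).
have n2 : \forall z \near z0, dom d (flow S (par a z)).
 by apply: fc; rewrite crdK//; exact: nbhs_dom.
apply: filterS2 n1 n2 => z [_ /= d1] d2.
by rewrite /psg /transition /= (crdK d1) crdK.
Qed.

End Passage.

Section Segment.
Context (R : realType) (m : nat) (M : riemannian_manifold R m) (f : M -> R) (fS : smooth_function f)
 (cM : compact [set: M]) (fN : standard_near_critical f).
Notation flow := (flow fS cM).
Notation G := (mgrad fS cM fN).
Notation omg := (omg cM G).
Notation alf := (alf cM G).
Let hM := @carrier_hausdorff R m M.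

Lemma Wu_alf p x : Wu f p x <-> alf x = p.
Proof.
split=> [[g [gl g0 gp]]|<-].
 apply: (alf_uniq hM); rewrite (_ : (fun t => _) = g)//.
 by apply/funext => t; rewrite (flow_lineE fS cM t gl) g0.
exists (flow^~ x); split; [exact: flowP|exact: flow0|exact: (@alf_cvg _ _ cM G x)].
Qed.

Lemma Ws_omg p x : Ws f p x <-> omg x = p.
Proof.
split=> [[g [gl g0 gp]]|<-].
 apply: (omg_uniq hM); rewrite (_ : (fun t => _) = g)//.
 by apply/funext => t; rewrite (flow_lineE fS cM t gl) g0.
exists (flow^~ x); split; [exact: flowP|exact: flow0|exact: (@omg_cvg _ _ cM G x)].
Qed.

Context (r r' : M) (k k' : nat) (a b : chart R m M) (e e' : R) (Sa : standard_chart f r k a)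
 (Sb : standard_chart f r' k' b) (e0 : 0 < e) (e'0 : 0 < e') (cod_a : cod a = [set z | \sum_i z ord0 i ^+ 2 < e ^+ 2])
 (cod_b : cod b = [set z | \sum_i z ord0 i ^+ 2 < e' ^+ 2]).

Let Sadd := std_sdl fS cM Sa e0 cod_a.
Let Sadd' := std_sdl fS cM Sb e'0 cod_b.

Lemma std_unstable x : dom a x -> qx k (crd a x) < e ^+ 2 / 2 -> qy k (crd a x) < e ^+ 2 / 2 ->
 alf x = r <-> crd a x *m Ymx R m k = 0.
Proof.
move=> dx xx xy; rewrite -qy_eq0.
exact: (@sbox_unstable R M hM cM G r Sadd x).
Qed.

Lemma std_stable x : dom a x -> qx k (crd a x) < e ^+ 2 / 2 -> qy k (crd a x) < e ^+ 2 / 2 ->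
 omg x = r <-> crd a x *m Xmx R m k = 0.
Proof.
move=> dx xx xy; rewrite -qx_eq0.
exact: (@sbox_stable R M hM cM G r Sadd x).
Qed.

Lemma std_box_near x : dom a x -> qx k (crd a x) < e ^+ 2 / 2 -> qy k (crd a x) < e ^+ 2 / 2 ->
 \forall y \near x, [/\ dom a y, qx k (crd a y) < e ^+ 2 / 2 & qy k (crd a y) < e ^+ 2 / 2].
Proof.
move=> dx xx xy; have cc := crd_continuous dx.
have h1 : \forall y \near x, qx k (crd a y) < e ^+ 2 / 2.
 have : {for x, continuous (qx k \o crd a)} by apply: continuous_comp => //; exact: qx_cts.
 by move=> /(_ [set u | u < e ^+ 2 / 2]); apply; apply: open_nbhs_nbhs; split; [exact: open_lt|].
have h2 : \forall y \near x, qy k (crd a y) < e ^+ 2 / 2.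
 have : {for x, continuous (qy k \o crd a)} by apply: continuous_comp => //; exact: qy_cts.
 by move=> /(_ [set u | u < e ^+ 2 / 2]); apply; apply: open_nbhs_nbhs; split; [exact: open_lt|].
by apply: filterS3 h1 h2 (nbhs_dom dx) => y ? ? ?; split.
Qed.

Context (x0 : M) (S : R) (x0_crit : ~ critical f x0) (x0_a : dom a x0) (x0_x : qx k (crd a x0) < e ^+ 2 / 2)
 (x0_alf : crd a x0 *m Ymx R m k = 0) (y0_b : dom b (flow S x0)) (y0_y : qy k' (crd b (flow S x0)) < e' ^+ 2 / 2)
 (y0_omg : crd b (flow S x0) *m Xmx R m k' = 0) (trans : Defs.transversal (Ws f r') (Wu f r)).

Let z0 := crd a x0.
Notation psg := (psg fS cM a b S).

Lemma alf_x0 : alf x0 = r.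
Proof.
apply/std_unstable => //; first by rewrite (qy_eq0 k (crd a x0)).2// (std_rho e0).
Qed.

Lemma omg_x0 : omg x0 = r'.
Proof.
rewrite -(@omgE _ _ hM cM G S x0).
have st := @sbox_stable R M hM cM G r' Sadd' (flow S x0).
apply/st; last exact/qx_eq0.
split => //=; by rewrite (qx_eq0 k' _).2// (std_rho e'0).
Qed.

Lemma exit_box : nbhs (flow S x0) (sbox Sadd' (e' ^+ 2 / 2)).
Proof.
have x0x : qx k' (crd b (flow S x0)) < e' ^+ 2 / 2 by rewrite (qx_eq0 k' _).2// (std_rho e'0).
have cc := crd_continuous y0_b.
have h1 : \forall y \near flow S x0, qx k' (crd b y) < e' ^+ 2 / 2.
 have : {for flow S x0, continuous (qx k' \o crd b)} by apply: continuous_comp => //; exact: qx_cts.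
 by move=> /(_ [set u | u < e' ^+ 2 / 2]); apply; apply: open_nbhs_nbhs; split; [exact: open_lt|].
have h2 : \forall y \near flow S x0, qy k' (crd b y) < e' ^+ 2 / 2.
 have : {for flow S x0, continuous (qy k' \o crd b)} by apply: continuous_comp => //; exact: qy_cts.
 by move=> /(_ [set u | u < e' ^+ 2 / 2]); apply; apply: open_nbhs_nbhs; split; [exact: open_lt|].
by apply: filterS3 h1 h2 (nbhs_dom y0_b) => y ? ? ?; split.
Qed.

Lemma drv_vanish (h : R -> 'rV[R]_m) (t : R) dh : is_derive t 1 h dh -> (\forall s \near t, h s = 0) -> dh = 0.
Proof.
move=> hd h0; have d0 : is_derive t 1 h 0.
 by apply: (@near_eq_is_derive _ _ _ (cst 0)); apply: filterS h0 => s ->.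
by rewrite -(@derive_val _ _ _ _ _ _ _ hd) (@derive_val _ _ _ _ _ _ _ d0).
Qed.

Lemma tangent_curve (A : set M) c v : atlas c -> dom c x0 -> tangent A x0 c v ->
 exists g : R -> M, [/\ {for 0, continuous g}, g 0 = x0, \forall t \near (0 : R), A (g t) &
  is_derive (0 : R) 1 (crd a \o g) (v *m 'J (transition c a) (crd c x0))].
Proof.
move=> ac dc [g [d d0 [gA gs g0 gv]]]; exists g.
have n0 : \forall t \near (0 : R), `|t| < d.
 by apply: (nbhs_normP _ _).2; exists d => // t /=; rewrite sub0r normrN.
have D0 : is_derive (0 : R) 1 (crd c \o g) v.
 have [/(_ 0) df _] := gs 1%N; rewrite -gv; apply: DeriveDef => //.
 by apply/derivable1_diffP; apply: df; rewrite /= normr0.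
have gc : {for 0, continuous g}.
 have : {for 0, continuous (par c \o (crd c \o g))}.
  apply: continuous_comp; first exact: drv_cts D0.
  by apply: par_continuous; apply: crd_cod; rewrite g0.
 rewrite /prop_for /continuous_at /= g0 crdK//; apply: cvg_trans; apply: near_eq_cvg.
 by apply: filterS n0 => t td; rewrite /= crdK//; have [] := gA t td.
split=> //; first by apply: filterS n0 => t /gA[].
rewrite -{1}g0; apply: chart_change_drv => //; rewrite ?g0//.
by have [h1 h2] := std_cmp Sa ac.
Qed.

(** In the box the unstable manifold is where the stable coordinates vanish, and they stay 0 along a
    curve in it. *)
Lemma tangent_unstable c w : atlas c -> dom c x0 -> tangent (Wu f r) x0 c w ->
 w *m 'J (transition c a) (crd c x0) *m Ymx R m k = 0.
Proof.
move=> ac dc /(tangent_curve ac dc)[g [gc g0 gW gd]].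
have x0y : qy k (crd a x0) < e ^+ 2 / 2 by rewrite (qy_eq0 k _).2// (std_rho e0).
have gd' := sdf_deriv gd (sdf_mulmxr (Ymx R m k) (crd a (g 0))).
apply: (drv_vanish gd').
have n1 : \forall t \near (0 : R), [/\ dom a (g t), qx k (crd a (g t)) < e ^+ 2 / 2 & qy k (crd a (g t)) < e ^+ 2 / 2].
 have h : nbhs (g 0) [set y | [/\ dom a y, qx k (crd a y) < e ^+ 2 / 2 & qy k (crd a y) < e ^+ 2 / 2]].
  by rewrite g0; exact: std_box_near.
 exact: (gc _ h).
by apply: filterS2 n1 gW => t [t1 t2 t3] /Wu_alf/std_unstable; exact.
Qed.

Lemma tangent_stable D c w : sdf psg z0 D -> atlas c -> dom c x0 -> tangent (Ws f r') x0 c w ->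
 D (w *m 'J (transition c a) (crd c x0)) *m Xmx R m k' = 0.
Proof.
move=> Ds ac dc /(tangent_curve ac dc)[g [gc g0 gW gd]].
have Ds' : sdf psg ((crd a \o g) 0) D by rewrite /= g0.
have gd' := sdf_deriv (sdf_deriv gd Ds') (sdf_mulmxr (Xmx R m k') (psg ((crd a \o g) 0))).
apply: (drv_vanish gd').
have n1 : \forall t \near (0 : R), dom a (g t) by apply: gc; rewrite g0; exact: nbhs_dom.
have n2 : \forall t \near (0 : R), sbox Sadd' (e' ^+ 2 / 2) (flow S (g t)).
 have fc : {for 0, continuous (fun t => flow S (g t))}.
  apply: (ccomp g (flow S)) => //; exact: (@gfl_cts_x _ _ G S).
 have h : nbhs (flow S (g 0)) (sbox Sadd' (e' ^+ 2 / 2)) by rewrite g0; exact: exit_box.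
 exact: (fc _ h).
apply: filterS3 n1 n2 gW => t t1 t2 /Ws_omg wt.
rewrite /= /psg crdK//; apply/qx_eq0.
have st := @sbox_stable R M hM cM G r' Sadd' (flow S (g t)) t2.
by apply/st; rewrite -wt; exact: (@omgE _ _ hM cM G S (g t)).
Qed.

(** The passage for time - S in the opposite direction is inverse to it near the base point. *)
Lemma psg_inj D : sdf psg z0 D -> dmx D \in unitmx.
Proof.
move=> Ds; have p0 : psg z0 = crd b (flow S x0) by rewrite /psg crdK.
have xa : dom a (flow (- S) (flow S x0)) by rewrite -flowD addNr flow0.
have [E Es] := psg_sdf Sb Sa y0_b xa.
rewrite -p0 in Es; have [lD _ _] := Ds; have [lE _ _] := Es.
have ED : E \o D =1 id.
 apply: (@sdf_uniq R _ _ id z0) => [|]; last exact: sdf_id.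
 apply: sdf_near_eq (sdf_comp Ds Es).
 have fc : {for z0, continuous (fun z => flow S (par a z))}.
  apply: (ccomp (par a) (flow S)); first exact/par_continuous/crd_cod.
  by rewrite crdK//; have [] := flow_msdf fS cM S x0.
 have n1 : \forall z \near z0, dom b (flow S (par a z)) by apply: fc; rewrite crdK//; exact: nbhs_dom.
 apply: filterS2 n1 (nbhs_cod (crd_cod x0_a)) => z z1 z2.
 change (crd a (flow (- S) (par b (crd b (flow S (par a z))))) = z).
 by rewrite crdK// -flowD addNr flow0 parK.
suff /mulmx1_unit[] : dmx D *m dmx E = 1%:M by [].
by apply/row_matrixP => i; rewrite row_mul dmxE// !rowE dmxE// mulmx1; exact: ED.
Qed.

(** On the unstable manifold the velocity at [z0] is 2 *: z0, and moving along the orbit does not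
    leave the stable manifold of r'. *)
Lemma psg_flow_dir D : sdf psg z0 D -> D z0 *m Xmx R m k' = 0.
Proof.
move=> Ds.
have hd := is_drv_hyp k 0 z0; rewrite hyp0 in hd.
have Ds' : sdf psg ((hyp k)^~ z0 0) D by rewrite hyp0.
have gd := sdf_deriv (sdf_deriv hd Ds') (sdf_mulmxr (Xmx R m k') (psg ((hyp k)^~ z0 0))).
have h0 : D (hypv k z0) *m Xmx R m k' = 0.
 apply: (drv_vanish gd).
 have n1 : \forall t \near (0 : R), qx k (hyp k t z0) < e ^+ 2 / 2.
  have cq : {for 0, continuous (qx k \o hyp k ^~ z0)}.
   by apply: continuous_comp; [exact: hyp_cts|exact: qx_cts].
  have h : nbhs ((qx k \o hyp k ^~ z0) 0) [set u | u < e ^+ 2 / 2].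
   by apply: open_nbhs_nbhs; split; [exact: open_lt|rewrite /= hyp0].
  exact: (cq _ h).
 have n2 : \forall t \near (0 : R), sbox Sadd' (e' ^+ 2 / 2) (flow t (flow S x0)).
  have h : nbhs (flow 0 (flow S x0)) (sbox Sadd' (e' ^+ 2 / 2)) by rewrite flow0; exact: exit_box.
  exact: (@gfl_cts_t _ _ G (flow S x0) 0 _ h).
 apply: filterS2 n1 n2 => t t1 t2; rewrite /= /psg.
 have y0 : qy k z0 = 0 by exact/qy_eq0.
 have [||||_ <-] := @std_flow_box R m M f fS cM r k a Sa e cod_a z0 t => //.
 - by rewrite y0 (std_rho e0).
 - by rewrite -qx_hyp.
 - by rewrite y0 mulr0 (std_rho e0).
 rewrite crdK// -flowD addrC flowD; apply/qx_eq0.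
 have st := @sbox_stable R M hM cM G r' Sadd' (flow t (flow S x0)) t2.
 apply/st; rewrite -omg_x0 -flowD; exact: (@omgE _ _ hM cM G (t + S) x0).
have [lD _ _] := Ds.
have : D (hypv k z0) = 2 *: D z0 by rewrite hypv_quad// -!(dmxE _ lD) scalemxAl.
move=> E; rewrite E -scalemxAl in h0; apply/eqP; move/eqP: h0; rewrite scaler_eq0 => /orP[|//].
by rewrite pnatr_eq0.
Qed.

(** Transversality in coordinates. To prescribe the stable part of v1 at the start and the unstable
    part of the image of v2 at the end, v1 - v2 is split as u + w with u tangent to the stable and w
    to the unstable manifold; then v1 - w = v2 + u has both. The height component is corrected by a
    multiple of [z0], the direction of the flow, on which the other two components vanish. *)
Lemma segment_submersion : exists A : 'M[R]_(m, m + (m + 1)),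
 (forall e1 : R, 0 < e1 -> exists2 d : R, 0 < d & forall y z : 'rV[R]_m, `|y| < d -> `|z| < d ->
  `|row_mx ((z0 + y) *m Ymx R m k) (row_mx (psg (z0 + y) *m Xmx R m k') (quad k (z0 + y) - quad k z0))
   - row_mx ((z0 + z) *m Ymx R m k) (row_mx (psg (z0 + z) *m Xmx R m k') (quad k (z0 + z) - quad k z0))
   - (y - z) *m A| <= e1 * `|y - z|) /\
 forall (al be : 'rV[R]_m) (ga : 'M[R]_1), (row_mx (al *m Ymx R m k) (row_mx (be *m Xmx R m k') ga) <= A)%MS.
Proof.
have [D Ds] := psg_sdf Sa Sb x0_a y0_b; have [lD _ _] := Ds.
pose A3 := 2 *: (Jmx R m k *m z0^T).
exists (row_mx (Ymx R m k) (row_mx (dmx D *m Xmx R m k') A3)); split=> [e1 e10|al be ga].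
 have s1 := sdf_mulmxr (Ymx R m k) z0.
 have s2 := sdf_comp Ds (sdf_mulmxr (Xmx R m k') (psg z0)).
 have s3 := sdf_quad k z0.
 have [_ _ H] := sdf_row_mx s1 (sdf_row_mx s2 s3).
 have [d d0 dH] := H e1 e10; exists d => // y z yd zd.
 have := dH (z0 + y) (z0 + z); rewrite ![z0 + _]addrC !addrK => /(_ yd zd).
 rewrite (_ : y + z0 - (z + z0) = y - z); last by rewrite opprD addrACA subrr addr0.
 rewrite /= -(dmxE (y - z) lD) -mulmxA -!mul_mx_row.
 rewrite !opp_row_mx !add_row_mx (_ : quad k (y + z0) - quad k z0 - _ = quad k (y + z0) - quad k (z + z0))//.
 by rewrite opprB addrA subrK.
have [c ac dc] := atlas_cover x0.
have sa : compatible a c := std_cmp Sa ac.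
have sc : compatible c a by case: sa.
pose J := 'J (transition c a) (crd c x0).
have Wx : (Ws f r' `&` Wu f r) x0 by split; [apply/Ws_omg; exact: omg_x0|apply/Wu_alf; exact: alf_x0].
pose v1 := al; pose v2 := be *m invmx (dmx D).
have [u [w [tu tw uw]]] := trans Wx ac dc ((v1 - v2) *m 'J (transition a c) (crd a x0)).
have uw' : v1 - v2 = u *m J + w *m J.
 by rewrite -mulmxDl -uw -mulmxA transition_inv// mulmx1.
have wY := tangent_unstable ac dc tw; have uX := tangent_stable Ds ac dc tu.
rewrite -(dmxE _ lD) in uX.
have [v vdef] : exists v, v = v1 - w *m J by eexists.
have vE : v = v2 + u *m J by rewrite vdef -[v1](subrK v2) uw' addrAC addrK addrC.
(* The derivative of the quadratic form in the direction [z0] is twice its value there, which is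
   nonzero because x0 is not r. *)
have qz : (z0 *m A3) ord0 ord0 != 0.
 have -> : z0 *m A3 = 2 *: quad k z0 by rewrite /A3 -scalemxAr /quad mulmxA.
 rewrite mxE quadE (qy_eq0 k z0).2// sub0r mulrN oppr_eq0 mulf_neq0 ?pnatr_eq0//.
 apply: contra_notN x0_crit => /eqP/qx_eq0 zX.
 have : z0 = 0 by rewrite (XY k z0) zX x0_alf addr0.
 rewrite /z0 => E; have [dr cr] := std_center Sa e0 cod_a.
 have : x0 = r by rewrite -(crdK x0_a) E -cr crdK.
 by move=> ->; rewrite -alf_x0; exact: (@alf_crit _ _ cM G).
pose t := (ga - v *m A3) ord0 ord0 / (z0 *m A3) ord0 ord0.
apply/submxP; exists (v + t *: z0).
rewrite !mul_mx_row; congr (row_mx _ (row_mx _ _)).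
- by rewrite mulmxDl -scalemxAl x0_alf scaler0 addr0 vdef mulmxBl wY subr0.
- have zD : z0 *m dmx D *m Xmx R m k' = 0 by rewrite dmxE// psg_flow_dir.
 rewrite mulmxA !mulmxDl -!scalemxAl zD scaler0 addr0.
 by rewrite vE mulmxDl mulmxDl uX addr0 /v2 mulmxKV// psg_inj.
- rewrite mulmxDl -scalemxAl [ga]mx11_scalar [v *m A3]mx11_scalar [z0 *m A3]mx11_scalar.
 apply/matrixP => i j; rewrite !ord1 /t; move: qz.
 move: (ga) (v *m A3) (z0 *m A3) => g1 g2 g3 qz; rewrite !mxE /= !mulr1n; field; exact: qz.
Qed.

End Segment.

(** * Passing a saddle: the gluing parameter *)

Section Break.
Context (R : realType) (m : nat) (M : riemannian_manifold R m) (f : M -> R) (fS : smooth_function f)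
 (cM : compact [set: M]) (fN : standard_near_critical f).
Notation flow := (flow fS cM).
Notation G := (mgrad fS cM fN).
Notation omg := (omg cM G).
Notation alf := (alf cM G).
Let hM := @carrier_hausdorff R m M.

Context (c : M) (k : nat) (a : chart R m M) (e : R) (Sa : standard_chart f c k a) (e0 : 0 < e)
 (cod_a : cod a = [set z | \sum_i z ord0 i ^+ 2 < e ^+ 2]) (c_crit : critical f c).
Notation rho := (e ^+ 2 / 2).
Notation X := (Xmx R m k).
Notation Y := (Ymx R m k).

(** In time s the flow multiplies unstable coordinates by expR (2 * s) and stable ones by its
    inverse. So for t > 0 the two equations say that z is reached from w at the time s with expR (-
    (2 * s)) = t. At t = 0 they put w on the stable and z on the unstable manifold, which is a
    break. *)
Lemma sdl_out (w z : M) (t : R) : dom a w -> dom a z -> qx k (crd a w) < rho -> qy k (crd a w) < rho ->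
 qx k (crd a z) < rho -> qy k (crd a z) < rho -> 0 <= t <= 1 ->
 crd a w *m X = t *: (crd a z *m X) -> crd a z *m Y = t *: (crd a w *m Y) ->
 (0 < t /\ exists2 s, 0 <= s & z = flow s w) \/ (t = 0 /\ omg w = c /\ alf z = c).
Proof.
move=> dw dz wx wy zx zy /andP[t0 t1] wX zY.
have [t00|tn0] := eqVneq t 0.
 right; split=> //; rewrite t00 scale0r in wX; rewrite t00 scale0r in zY; split.
  exact: (std_stable fS cM fN Sa e0 cod_a dw wx wy).2.
 exact: (std_unstable fS cM fN Sa e0 cod_a dz zx zy).2.
have tp : 0 < t by rewrite lt_neqAle eq_sym tn0.
left; split=> //; pose s := - ln t / 2.
have e2 : expR (- (2 * s)) = t by rewrite /s mulrC divfK// opprK lnK.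
have e2' : expR (2 * s) = t^-1 by rewrite -e2 -expRN opprK.
have s0 : 0 <= s by rewrite divr_ge0// oppr_ge0 ln_le0.
have hz : hyp k s (crd a w) = crd a z.
 rewrite (XY k (hyp k s (crd a w))) hyp_X hyp_Y e2 e2' wX scalerA mulVf// scale1r -zY.
 by rewrite -XY.
have [|d E] := std_fwd fS cM Sa cod_a dw wy s0; first by rewrite -qx_hyp hz.
by exists s => //; rewrite -(crdK dz) -(crdK d) E hz.
Qed.

Context (eta : R) (eta0 : 0 < eta) (eta_rho : 4 * eta < rho).

(** Converse of [sdl_out] for two points of one line: t is expR (- (2 * T)) for the time T that the
    orbit takes from w down to height f c - eta, or 0 if the line goes through c. *)
Lemma sdl_in p q g (w : M) : line cM G p q g -> g (f w) = w -> ~ critical f w ->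
 f q <= f c - eta -> f c <= f p ->
 (forall s, critical f s -> f c - eta <= f s <= f c -> f s = f c) ->
 dom a w -> qx k (crd a w) < eta / 2 -> eta / 2 < qy k (crd a w) < 2 * eta ->
 let z := g (f c - eta) in dom a z -> qx k (crd a z) < rho -> qy k (crd a z) < rho ->
 exists t : R, [/\ 0 <= t <= 1, crd a w *m X = t *: (crd a z *m X), crd a z *m Y = t *: (crd a w *m Y) & t = 0 <-> g (f c) = c].
Proof.
move=> gl gw wc qb cp iso dw wx /andP[wy1 wy2] z dz zx zy.
have fw : f w = f c - qx k (crd a w) + qy k (crd a w) by exact: (std_hgt Sa).
have cw : f c < f w by rewrite fw; lra.
have wr : qx k (crd a w) < rho by move: eta_rho wx; lra.
have wyr : qy k (crd a w) < rho by move: eta_rho wy2; lra.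
have [/qx_eq0 wX|wXn0] := eqVneq (qx k (crd a w)) 0.
 have ow : omg w = c by exact: (std_stable fS cM fN Sa e0 cod_a dw wr wyr).2.
 have gc : g (f c) = c by rewrite -ow -[in RHS]gw -(line_omg gl) gw.
 exists 0; split=> //; [by rewrite lexx ler01|by rewrite scale0r|].
 rewrite scale0r; apply: (std_unstable fS cM fN Sa e0 cod_a dz zx zy).1.
 have fb : f c - eta < f c by lra.
 have fz : f z = f c - eta.
  by apply: (line_hgt gl) => /=; rewrite qb /= (le_trans (ltW fb)).
 apply: (@line_alf_of R M cM G p q g c (f c - eta) gl c_crit gc) => //=.
 - by rewrite qb.
 - by move=> s sc /andP[s1 s2]; apply: iso => //; rewrite ltW.
 - by move=> zc; have := iso _ zc; rewrite fz lexx (ltW fb) => /(_ erefl); lra.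
have xp : 0 < qx k (crd a w) by rewrite lt_neqAle eq_sym wXn0 qx_ge0.
(* At this time the unstable part is 2 * eta and the stable part below eta / 2, so the height is
   already under f c - eta; as 2 * eta is less than the size of the box, the linear formulas hold
   until then. *)
pose T1 := ln (2 * eta / qx k (crd a w)) / 4.
have r1 : 1 <= 2 * eta / qx k (crd a w) by rewrite ler_pdivlMr// mul1r; move: wx eta0; lra.
have T10 : 0 <= T1 by rewrite divr_ge0// ln_ge0.
have eT1 : expR (4 * T1) = 2 * eta / qx k (crd a w).
 by rewrite /T1 mulrC divfK// lnK// posrE; exact: lt_le_trans r1.
have fl t : 0 <= t <= T1 -> dom a (flow t w) /\ crd a (flow t w) = hyp k t (crd a w).
 move=> /andP[t0 t1]; apply: (std_fwd fS cM Sa cod_a) => //.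
 apply: (@le_lt_trans _ _ (2 * eta)); last by move: eta_rho eta0; lra.
 apply: (@le_trans _ _ (expR (4 * T1) * qx k (crd a w))).
  by rewrite ler_wpM2r ?qx_ge0// ler_expR ler_pM2l.
 by rewrite eT1 divfK// gt_eqF.
have hT1 : f (flow T1 w) < f c - eta.
 have [|d1 E1] := fl T1; first by rewrite T10 lexx.
 rewrite (std_hgt Sa d1) E1 qx_hyp qy_hyp eT1 divfK ?gt_eqF// expRN eT1 invf_div.
 have : qx k (crd a w) / (2 * eta) * qy k (crd a w) < eta / 2 ; last by lra.
 rewrite mulrAC ltr_pdivrMr ?mulr_gt0//.
 have h1 : qx k (crd a w) * qy k (crd a w) < eta / 2 * (2 * eta).
  by apply: ltr_pM => //; [exact: qx_ge0|exact: qy_ge0].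
 apply: lt_le_trans h1 _; lra.
have [T [/andP[T0 TT1] fT]] : exists T, 0 <= T <= T1 /\ f (flow T w) = f c - eta.
 have fc : continuous (fun t => f (flow t w)).
  move=> t; apply: (ccomp (flow^~ w) f); last exact: f_continuous.
  exact: (@gfl_cts_t _ _ G w).
 have [||T Ti <-] := @IVT _ (fun t => f (flow t w)) 0 T1 (f c - eta) T10.
 - exact: continuous_subspaceT.
 - by rewrite flow0 ge_min (ltW hT1) orbT le_max; apply/orP; left; lra.
 - by exists T; split.
have zE : z = flow T w.
 by rewrite /z -fT -{1}gw (line_flow gl (f w) T) gw.
have [|dT ET] := fl T; first by rewrite T0 TT1.
exists (expR (- (2 * T))); split; first by rewrite expR_ge0 -expR0 ler_expR oppr_le0 mulr_ge0.
- by rewrite zE ET hyp_X scalerA -expRD addNr expR0 scale1r.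
- by rewrite zE ET hyp_Y.
- split=> [E|gc]; first by have := expR_gt0 (- (2 * T)); rewrite E ltxx.
 exfalso; apply: wc.
 have fc : continuous (fun t => f (flow t w)).
  move=> t; apply: (ccomp (flow^~ w) f); last exact: f_continuous.
  exact: (@gfl_cts_t _ _ G w).
 have [||t Ti ft] := @IVT _ (fun t => f (flow t w)) 0 T (f c) T0.
 - exact: continuous_subspaceT.
 - rewrite flow0 fT ge_min le_max; apply/andP; split; apply/orP; [right|left]; lra.
 - have E : flow t w = c by rewrite -gc -ft -gw (line_flow gl (f w) t).
  by apply/(crit_gfl G t); rewrite /= E.
Qed.

End Break.

Lemma near_lt (R : realType) (T : topologicalType) (h : T -> R) (x : T) (c : R) :
 {for x, continuous h} -> h x < c -> \forall y \near x, h y < c.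
Proof. by move=> hc; exact: (cvgr_lt _ hc). Qed.
Lemma near_gt (R : realType) (T : topologicalType) (h : T -> R) (x : T) (c : R) :
 {for x, continuous h} -> c < h x -> \forall y \near x, c < h y.
Proof. by move=> hc; exact: (cvgr_gt _ hc). Qed.

Section LineOmega.
Context (R : realType) (M : topologicalType) (cM : compact [set: M]) (G : gradlike R M).
Notation omg := (omg cM G).
Notation f := (hgt G).

Lemma line_omg_of p q g r h : line cM G p q g -> crit G r -> g (f r) = r -> f r < h <= f p -> f q <= f r ->
 (forall s, crit G s -> f r <= f s < h -> f s = f r) -> ~ crit G (g h) -> omg (g h) = r.
Proof.
move=> gl rc gr /andP[rh hp] qr iso nc.
have gh : f (g h) = h by rewrite (line_hgt gl)// hp andbT (le_trans qr)// ltW.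
have ha : f (omg (g h)) < h by rewrite -{2}gh; exact: hgt_omg.
suff E : f (omg (g h)) = f r by rewrite -(line_omg gl) E.
have [ra|ar] := leP (f r) (f (omg (g h))); first by apply: iso; [exact: omg_crit|rewrite ra].
have [|t E _] := @line_hit _ _ cM G p q g h (f r) gl nc.
 by rewrite ar /=; apply: lt_trans rh _; rewrite -{1}gh; exact: hgt_alf.
by exfalso; apply: nc; apply/(crit_gfl G t); rewrite -E gr.
Qed.

End LineOmega.

Lemma closed_ball_cpt (R : realType) (m : nat) (z : 'rV[R]_m) (r : R) : compact [set u : 'rV[R]_m | `|u - z| <= r].
Proof.
apply: bounded_closed_compact.
 exists (r + `|z|); split; first exact: num_real.
 move=> x rx u /= uz; apply/ltW; apply: le_lt_trans rx.
 by rewrite -[u](subrK z); apply: le_trans (ler_normD _ _) _; rewrite lerD2r.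
have c : continuous (fun u : 'rV[R]_m => `|u - z|).
 by move=> u; exact: (cvg_norm (cvgB (@cvg_id _ (nbhs u)) (cvg_cst z))).
by apply: (@preimage_closed _ _ (fun u : 'rV[R]_m => `|u - z|) [set x | x <= r]) => [u _|]; [exact: c|exact: closed_le].
Qed.

Lemma cts_mx (R : realType) (T : topologicalType) (m n : nat) (A : set T) (h : T -> 'M[R]_(m, n)) :
 (forall i j, cts A (fun x => h x i j : R)) -> cts A h.
Proof.
move=> hc x W Ax /nbhs_mxP[e e0 eW].
have H : \forall y \near x, forall i j, A y -> `|h x i j - h y i j| < e / 2.
 apply: (@filter_forall _ _ (fun i y => forall j, A y -> `|h x i j - h y i j| < e / 2) (nbhs x) _) => i.
 apply: (@filter_forall _ _ (fun j y => A y -> `|h x i j - h y i j| < e / 2) (nbhs x) _) => j.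
 apply: (hc i j x [set u : R | `|h x i j - u| < e / 2] Ax).
 by apply/(@nbhs_normP R R); exists (e / 2) => //=; rewrite divr_gt0.
apply: filterS H => y H Ay; apply: eW; apply: (@le_lt_trans _ _ (e / 2)); last by lra.
by apply: mxn_le => [|i j]; [lra|rewrite !mxE; exact/ltW/H].
Qed.

(** * Gluing along all breaks of a line *)

Section Gluing.
Context (R : realType) (m : nat) (M : riemannian_manifold R m) (f : M -> R) (fS : smooth_function f)
 (cM : compact [set: M]) (fN : standard_near_critical f).
Notation flow := (flow fS cM).
Notation G := (mgrad fS cM fN).
Notation omg := (omg cM G).
Notation alf := (alf cM G).
Notation line := (line cM G).
Let hM := @carrier_hausdorff R m M.

Context (sa : M -> chart R m M) (sk : M -> nat) (se : M -> R)
 (std : forall p, critical f p -> [/\ standard_chart f p (sk p) (sa p), 0 < se p &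
 cod (sa p) = [set z | \sum_i z ord0 i ^+ 2 < se p ^+ 2]])
 (trans : forall p q, critical f p -> critical f q -> Defs.transversal (Ws f q) (Wu f p)).
Notation rho p := (se p ^+ 2 / 2).

Variables (N : nat) (c : nat -> M) (eta : R) (z : nat -> M) (S : nat -> R).
Notation mat := 'M[R]_(N.+2, m).
Notation inN i := (i <= N.+1)%N.
Context (c_crit : forall i, (i <= N.+2)%N -> critical f (c i)) (eta0 : 0 < eta)
 (eta_rho : forall i, (i <= N.+2)%N -> 4 * eta < rho (c i))
 (c_gap : forall i, inN i -> 2 * eta < f (c i) - f (c i.+1))
 (c_iso : forall i s, (i <= N.+2)%N -> critical f s -> `|f s - f (c i)| <= 2 * eta -> f s = f (c i)).

Notation a i := (sa (c i)).
Notation k i := (sk (c i)).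
Notation X i := (Xmx R m (k i)).
Notation Y i := (Ymx R m (k i)).

Context (z_dom : forall i, inN i -> dom (a i) (z i)) (z_Y : forall i, inN i -> crd (a i) (z i) *m Y i = 0)
 (z_x : forall i, inN i -> qx (k i) (crd (a i) (z i)) = eta) (S0 : forall i, inN i -> 0 <= S i)
 (w_dom : forall i, inN i -> dom (a i.+1) (flow (S i) (z i)))
 (w_X : forall i, inN i -> crd (a i.+1) (flow (S i) (z i)) *m X i.+1 = 0)
 (w_y : forall i, inN i -> qy (k i.+1) (crd (a i.+1) (flow (S i) (z i))) = eta).

Notation z0 i := (crd (a i) (z i)).
Notation pass i := (psg fS cM (a i) (a i.+1) (S i)).

Lemma z_crit i : inN i -> ~ critical f (z i).
Proof.
move=> iN zc; have [Sa e0 ca] := std (c_crit (leqW iN)).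
have zb : sbox (std_sdl fS cM Sa e0 ca) (rho (c i)) (z i).
 split; [exact: z_dom| |].
  by rewrite /= z_x//; have := eta_rho (leqW iN); move: eta0; lra.
 by rewrite /= (qy_eq0 _ _).2 ?z_Y// (std_rho e0).
have := @sbox_crit R M hM G (c i) _ (z i) zb zc => zE.
have [dc cr] := std_center Sa e0 ca; have := z_x iN.
by rewrite zE cr qx0 => E; move: eta0; rewrite -E ltxx.
Qed.

Lemma coord_ex i : inN i -> exists j : 'I_m, (j < k i)%N /\ z0 i ord0 j != 0.
Proof.
move=> iN; apply: contrapT => no; have := z_x iN; rewrite (qx_eq0 _ _).2 => [E|].
 by move: eta0; rewrite -E ltxx.
apply/rowP => j; rewrite XmxE mxE; case: ifP => // jk.
by apply/eqP; apply: contra_notT no => n0; exists j.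
Qed.

(** Dividing by an unstable coordinate that does not vanish near z i recovers the gluing parameter
    continuously from a line; this is the quotient [ta] in [gluing_clr]. *)
Lemma jj_ex : exists jj : nat -> 'I_m, forall i, inN i -> (jj i < k i)%N /\ z0 i ord0 (jj i) != 0.
Proof.
have [j0 _] := coord_ex (leq0n _).
have ch i : exists j : 'I_m, inN i -> (j < k i)%N /\ z0 i ord0 j != 0.
 by have [iN|iN] := boolP (inN i); [have [j ?] := coord_ex iN; exists j|exists j0].
by have [jj H] := choice ch; exists jj.
Qed.

Context (jj : nat -> 'I_m) (jjP : forall i, inN i -> (jj i < k i)%N /\ z0 i ord0 (jj i) != 0).

(** Open conditions around z i under which [sdl_in] and [sdl_out] apply at both ends of segment
    i. *)
Definition good i (u : 'rV[R]_m) : Prop :=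
 [/\ cod (a i) u, qx (k i) u < rho (c i) /\ qy (k i) u < rho (c i), 0 < qx (k i) u /\ u ord0 (jj i) != 0,
   dom (a i.+1) (flow (S i) (par (a i) u)) &
   qx (k i.+1) (pass i u) < eta / 2 /\ eta / 2 < qy (k i.+1) (pass i u) < 2 * eta].

Lemma good_near i : inN i -> exists2 d : R, 0 < d & forall v : 'rV[R]_m, `|v| < d -> good i (z0 i + v).
Proof.
move=> iN; have [Sa e0 ca] := std (c_crit (leqW iN)).
have [Sb e'0 cb] := std (c_crit (iN : (i.+1 <= N.+2)%N)).
have zd := z_dom iN; have er := eta_rho (leqW iN); have [_ jn0] := jjP iN.
have pc : {for z0 i, continuous (fun u => flow (S i) (par (a i) u))}.
 apply: (ccomp (par (a i)) (flow (S i))); first exact/par_continuous/crd_cod.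
 by rewrite crdK//; exact: (@gfl_cts_x _ _ G (S i)).
have p0 : pass i (z0 i) = crd (a i.+1) (flow (S i) (z i)) by rewrite /psg crdK.
have ppc : {for z0 i, continuous (pass i)}.
 apply: (ccomp (fun u => flow (S i) (par (a i) u)) (crd (a i.+1))) => //.
 by rewrite crdK//; apply: crd_continuous; exact: w_dom.
have H : \forall u \near z0 i, good i u.
 have n1 : \forall u \near z0 i, cod (a i) u by exact/nbhs_cod/crd_cod.
 have n2 : \forall u \near z0 i, qx (k i) u < rho (c i).
  by apply: near_lt; [exact: qx_cts|rewrite z_x//; move: eta0 er; lra].
 have n3 : \forall u \near z0 i, qy (k i) u < rho (c i).
  by apply: near_lt; [exact: qy_cts|rewrite (qy_eq0 _ _).2 ?z_Y//; exact: (std_rho e0)].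
 have n4 : \forall u \near z0 i, 0 < qx (k i) u.
  by apply: near_gt; [exact: qx_cts|rewrite z_x].
 have n5 : \forall u \near z0 i, (u : 'rV[R]_m) ord0 (jj i) != 0.
  have o : nbhs (z0 i ord0 (jj i)) [set x : R | x != 0].
   by apply: open_nbhs_nbhs; split=> //; exact: open_neq.
  exact: (@coord_continuous _ _ _ ord0 (jj i) (z0 i) _ o).
 have n6 : \forall u \near z0 i, dom (a i.+1) (flow (S i) (par (a i) u)).
  by apply: pc; rewrite crdK//; apply: nbhs_dom; exact: w_dom.
 have n7 : \forall u \near z0 i, qx (k i.+1) (pass i u) < eta / 2.
  apply: (@near_lt _ _ (qx (k i.+1) \o pass i)); first by apply: continuous_comp => //; exact: qx_cts.
  by rewrite /= p0 (qx_eq0 _ _).2 ?w_X// divr_gt0.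
 have qyc : {for z0 i, continuous (qy (k i.+1) \o pass i)} by apply: continuous_comp => //; exact: qy_cts.
 have n8 : \forall u \near z0 i, eta / 2 < qy (k i.+1) (pass i u).
  by apply: (near_gt qyc); rewrite /= p0 w_y//; move: eta0; lra.
 have n9 : \forall u \near z0 i, qy (k i.+1) (pass i u) < 2 * eta.
  by apply: (near_lt qyc); rewrite /= p0 w_y//; move: eta0; lra.
 near=> u; split; try split; try (apply/andP; split); near: u => //.
have [d d0 dH] := (nbhs_mxP _ _).1 H; exists d => // v vd; apply: dH.
by rewrite opprD addrA subrr add0r normrN.
Unshelve. all: by end_near. Qed.

(** Gluing parameters indexed by the critical points c 0, ..., c N.+2, whence the shift by one. They
    are 0 at the two ends, where the line must leave on the unstable and arrive on the stable
    manifold. *)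
Definition tau (t : 'rV[R]_N.+1) (i : nat) : R := if (0 < i <= N.+1)%N then t ord0 (inord i.-1) else 0.

Notation rw i v := (row (inord i : 'I_N.+2) v).

(** The unknown v displaces the point z i of each segment in its chart. The components are the
    stable coordinates at c i, the unstable ones at c i.+1 after the passage, and the change of f,
    which is to be 0. *)
Definition Fseg i (v : 'rV[R]_m) : 'rV[R]_(m + (m + 1)) :=
 row_mx ((z0 i + v) *m Y i) (row_mx (pass i (z0 i + v) *m X i.+1) (quad (k i) (z0 i + v) - quad (k i) (z0 i))).

(** The right-hand sides of the two equations of [sdl_out], at c i and at c i.+1. Neighbouring
    segments are coupled only through factors [tau], so the coupling vanishes with t. For i = 0 the
    factor tau t 0 = 0 removes the term with i.-1. *)
Definition gseg i (t : 'rV[R]_N.+1) (v : mat) : 'rV[R]_(m + (m + 1)) :=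
 row_mx (tau t i *: (pass i.-1 (z0 i.-1 + rw i.-1 v) *m Y i))
  (row_mx (tau t i.+1 *: ((z0 i.+1 + rw i.+1 v) *m X i.+1)) 0).

Notation b i := (f (c i) - eta).

Section Radius.
Context (d0 : R) (d00 : 0 < d0) (d0P : forall i (v : 'rV[R]_m), inN i -> `|v| < d0 -> good i (z0 i + v)).

Lemma c_mono i j : (i <= j <= N.+2)%N -> f (c j) <= f (c i).
Proof.
elim: j => [|j IH]; first by rewrite leqn0 => /andP[/eqP->].
rewrite leq_eqVlt => /andP[/orP[/eqP->//|ij] jN].
apply: le_trans (IH _); last by rewrite -ltnS ij ltnW.
have := @c_gap j jN; move: eta0; lra.
Qed.

Lemma good_crit i u : inN i -> good i u -> ~ critical f (par (a i) u).
Proof.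
move=> iN [cu [ux uy] [u0 _] _ _] zc; have [Sa e0 ca] := std (c_crit (leqW iN)).
have zb : sbox (std_sdl fS cM Sa e0 ca) (rho (c i)) (par (a i) u).
 by split; [exact: par_dom|rewrite /= parK..].
have := @sbox_crit R M hM G (c i) _ _ zb zc => zE.
have [dc cr] := std_center Sa e0 ca.
by move: u0; rewrite -(parK cu) zE cr qx0 ltxx.
Qed.

Lemma good_hgt i u : inN i -> good i u -> quad (k i) u - quad (k i) (z0 i) = 0 <-> f (par (a i) u) = b i.
Proof.
move=> iN [cu _ _ _ _]; have [Sa e0 ca] := std (c_crit (leqW iN)).
rewrite (std_hgt Sa (par_dom cu)) parK//.
have E : (quad (k i) u - quad (k i) (z0 i)) ord0 ord0 = qy (k i) u - qx (k i) u + eta.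
 have E0 (A B : 'M[R]_1) : (A - B) ord0 ord0 = A ord0 ord0 - B ord0 ord0 by rewrite !mxE.
 by rewrite E0 !quadE z_x// (qy_eq0 _ (z0 i)).2 ?z_Y//; ring.
split=> [H|H]; first by move: E; rewrite H mxE; lra.
by apply/matrixP => i1 j1; rewrite !ord1 E mxE; move: H; lra.
Qed.

Lemma norm_rw (v : mat) i : `|v| < d0 -> `|rw i v| < d0.
Proof. by apply: le_lt_trans; exact: normr_row. Qed.

Section Solution.
Context (v : mat) (vd : `|v| < d0).
Let u i := z0 i + rw i v.
Let y i := par (a i) (u i).

Let ug i : inN i -> good i (u i).
Proof. by move=> iN; apply: d0P => //; exact: norm_rw. Qed.
Let yc i : inN i -> ~ critical f (y i).
Proof. by move=> iN; apply: good_crit => //; exact: ug. Qed.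
Let yu i : inN i -> dom (a i) (y i) /\ crd (a i) (y i) = u i.
Proof. by move=> /ug[cu _ _ _ _]; rewrite /y parK//; split=> //; exact: par_dom. Qed.
Let wc i : inN i -> ~ critical f (flow (S i) (y i)).
Proof. by move=> iN; move/(crit_gfl G (S i)); exact: yc. Qed.

(** At the inner critical points the parameters and equations come from [sdl_in]. The equations at
    the ends express that the first orbit leaves c 0 and the last one tends to c N.+2, by
    [line_alf_of] and [line_omg_of]. *)
Lemma line_equations g : line (c 0%N) (c N.+2) g -> (forall i, inN i -> g (b i) = y i) ->
 exists t : 'rV[R]_N.+1, [/\ forall j, 0 <= t ord0 j <= 1,
  forall j : 'I_N.+1, t ord0 j = 0 <-> g (f (c j.+1)) = c j.+1 &
  forall i, inN i -> Fseg i (rw i v) = gseg i t v].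
Proof.
move=> gl gy.
have gw i : inN i -> g (f (flow (S i) (y i))) = flow (S i) (y i).
 by move=> iN; have := line_flow gl (b i) (S i); rewrite gy.
have qb i : inN i -> f (c N.+2) <= b i.
 move=> iN; have := c_gap iN; have := @c_mono i.+1 N.+2; rewrite leqnn andbT => /(_ iN).
 by move: eta0; lra.
have cp i : (i <= N.+2)%N -> f (c i) <= f (c 0%N) by move=> iN; apply: c_mono.
have ex j : exists t : R, (j < N.+1)%N -> [/\ 0 <= t <= 1, pass j (u j) *m X j.+1 = t *: (u j.+1 *m X j.+1),
  u j.+1 *m Y j.+1 = t *: (pass j (u j) *m Y j.+1) & t = 0 <-> g (f (c j.+1)) = c j.+1].
 have [jN|jN] := boolP (j < N.+1)%N; last by exists 0.
 have jN1 : inN j := ltnW jN; have jN2 : (j.+1 <= N.+2)%N := jN1.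
 have [Sb e0 cb] := std (c_crit jN2); have [_ _ _ dw [wx wy]] := ug jN1.
 have [dy cy] := yu (jN : (j.+1 <= N.+1)%N); have [_ [uxr uyr] _ _ _] := ug (jN : (j.+1 <= N.+1)%N).
 have iso' s : critical f s -> f (c j.+1) - eta <= f s <= f (c j.+1) -> f s = f (c j.+1).
  by move=> sc /andP[s1 s2]; apply: (c_iso jN2 sc); rewrite ler0_norm; move: s1 s2 eta0; lra.
 have := @sdl_in R m M f fS cM fN (c j.+1) (k j.+1) (a j.+1) (se (c j.+1))
  Sb e0 cb (c_crit jN2) eta eta0 (eta_rho jN2) (c 0%N) (c N.+2) g (flow (S j) (y j)) gl (gw j jN1) (wc jN1) (qb j.+1 jN)
  (cp j.+1 jN2) iso' dw wx wy.
 by rewrite /= gy// cy => /(_ dy uxr uyr)[t H]; exists t.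
have [t tP] := choice ex; exists (\row_j t j).
have tE i : tau (\row_j t j) i = if (0 < i <= N.+1)%N then t i.-1 else 0.
 rewrite /tau; case: ifP => // /andP[i0 iN]; rewrite mxE inordK//.
 by rewrite prednK.
split=> [j|j|i iN]; [by rewrite mxE; have [] := tP j (ltn_ord j)|by rewrite mxE; have [] := tP j (ltn_ord j)|].
rewrite /Fseg /gseg -!/(u _) !tE; congr (row_mx _ (row_mx _ _)).
- case: i iN => [_|i iN]; last by rewrite /= iN; have [_ _ ->] := tP i iN.
 rewrite /= scale0r; have [Sa e0 ca] := std (c_crit (leq0n _)); have [dy cy] := yu (leq0n _).
 have [_ [uxr uyr] _ _ _] := ug (leq0n _).
 rewrite -cy; apply: (std_unstable fS cM fN Sa e0 ca dy _ _).1; rewrite ?cy//.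
 rewrite -gy//; apply: (@line_alf_of R M cM G (c 0%N) (c N.+2) g (c 0%N) (b 0%N) gl).
 + exact: c_crit.
 + exact: (line1 gl).
 + by rewrite qb//=; move: eta0; lra.
 + exact: lexx.
 + move=> s sc /andP[s1 s2]; have {}s1 : b 0%N < f s := s1; have {}s2 : f s <= f (c 0%N) := s2.
  apply: (c_iso (leq0n _) sc); rewrite ler0_norm; move: s1 s2 eta0; lra.
 + by rewrite gy//; exact: yc.
- move: iN; rewrite leq_eqVlt => /orP[/eqP iE|iN]; last by rewrite /= iN; have [_ -> _ _] := tP i iN.
 rewrite iE ltnn andbF scale0r; have [Sb e0 cb] := std (c_crit (leqnn N.+2)).
 have [_ _ _ dw [wx /andP[wy1 wy2]]] := ug (leqnn N.+1); have er := eta_rho (leqnn N.+2).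
 apply: (std_stable fS cM fN Sb e0 cb dw _ _).1.
 + by move: wx er eta0; rewrite /psg -/(y _); lra.
 + by move: wy2 er eta0; rewrite /psg -/(y _); lra.
 have fw := std_hgt Sb dw; have cq := @c_mono N.+1 N.+2; rewrite !leqnn leqnSn /= in cq.
 have gap := c_gap (leqnn N.+1); have cp1 := cp N.+1 (leqnSn _).
 have w1 : f (c N.+2) < f (flow (S N.+1) (y N.+1)).
  by rewrite fw; move: wx wy1; rewrite /psg -/(y _); lra.
 have w2 : f (flow (S N.+1) (y N.+1)) <= f (c N.+2) + 2 * eta.
  have := qx_ge0 (k N.+2) (crd (a N.+2) (flow (S N.+1) (y N.+1))).
  by rewrite fw; move: wx wy2; rewrite /psg -/(y _); lra.
 rewrite -gw//; apply: (@line_omg_of R M cM G (c 0%N) (c N.+2) g (c N.+2) _ gl).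
 + exact: c_crit.
 + exact: (line0 gl).
 + by apply/andP; split; [exact: w1|apply: (le_trans w2); apply: (le_trans _ cp1); move: gap; lra].
 + exact: lexx.
 + move=> s sc /andP[s1 s2]; have {}s1 : f (c N.+2) <= f s := s1.
  have {}s2 : f s < f (flow (S N.+1) (y N.+1)) := s2.
  apply: (c_iso (leqnn _) sc); rewrite ger0_norm; move: s1 s2 w2; lra.
 + by rewrite gw//; exact: wc.
- apply/good_hgt => //; first exact: ug.
 rewrite -/(y i) -gy//; apply: (line_hgt gl); rewrite qb//=.
 by have := cp i (leqW iN); move: eta0; lra.
Qed.

Context (t : 'rV[R]_N.+1) (t01 : forall j, 0 <= t ord0 j <= 1) (eqs : forall i, inN i -> Fseg i (rw i v) = gseg i t v).

Lemma tau01 i : 0 <= tau t i <= 1.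
Proof. by rewrite /tau; case: ifP => // _; rewrite lexx ler01. Qed.

(** The equations of neighbouring segments are together the hypotheses of [sdl_out] at the critical
    point between them. *)
Lemma solution_links : [/\ forall i, inN i -> ~ critical f (y i) /\ f (y i) = b i,
 alf (y 0%N) = c 0%N, omg (y N.+1) = c N.+2 &
 forall i, (i < N.+1)%N -> (0 < tau t i.+1 /\ exists2 s, 0 <= s & y i.+1 = flow s (y i)) \/
  (tau t i.+1 = 0 /\ omg (y i) = c i.+1 /\ alf (y i.+1) = c i.+1)].
Proof.
have E i : inN i -> [/\ u i *m Y i = tau t i *: (pass i.-1 (u i.-1) *m Y i),
  pass i (u i) *m X i.+1 = tau t i.+1 *: (u i.+1 *m X i.+1) & quad (k i) (u i) - quad (k i) (z0 i) = 0].
 by move=> iN; have := eqs iN; rewrite /Fseg /gseg => /eq_row_mx[-> /eq_row_mx[-> ->]].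
split.
- move=> i iN; split; first exact: yc.
 by apply/(good_hgt iN (ug iN)); have [] := E i iN.
- have [Sa e0 ca] := std (c_crit (leq0n _)); have [dy cy] := yu (leq0n _).
 have [_ [uxr uyr] _ _ _] := ug (leq0n _).
 apply: (std_unstable fS cM fN Sa e0 ca dy _ _).2; rewrite ?cy//.
 by have [-> _ _] := E 0%N (leq0n _); rewrite /tau /= scale0r.
- have [Sb e0 cb] := std (c_crit (leqnn N.+2)); have er := eta_rho (leqnn N.+2).
 have [_ _ _ dw [wx /andP[wy1 wy2]]] := ug (leqnn N.+1).
 have <- : omg (flow (S N.+1) (y N.+1)) = omg (y N.+1) by exact: (@omgE _ _ hM cM G).
 apply: (std_stable fS cM fN Sb e0 cb dw _ _).2.
 + by move: wx er eta0; rewrite /psg -/(y _); lra.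
 + by move: wy2 er eta0; rewrite /psg -/(y _); lra.
 by have [_ + _] := E N.+1 (leqnn _); rewrite /tau ltnn andbF scale0r.
- move=> i iN; have iN1 : inN i := ltnW iN; have iN2 : (i.+1 <= N.+2)%N := iN1.
 have [Sb e0 cb] := std (c_crit iN2); have er := eta_rho iN2.
 have [_ _ _ dw [wx /andP[wy1 wy2]]] := ug iN1.
 have [dy cy] := yu (iN : (i.+1 <= N.+1)%N); have [_ [uxr uyr] _ _ _] := ug (iN : (i.+1 <= N.+1)%N).
 have [_ wX _] := E i iN1; have [zY _ _] := E i.+1 iN.
 have oE : omg (flow (S i) (y i)) = omg (y i) by exact: (@omgE _ _ hM cM G).
 have [|||||||[tp [s s0 ys]]|[tp [ow az]]] := @sdl_out R m M f fS cM fN (c i.+1) (k i.+1) (a i.+1)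
   (se (c i.+1)) Sb e0 cb (flow (S i) (y i)) (y i.+1) (tau t i.+1) dw dy; rewrite ?cy//.
 + by move: wx er eta0; rewrite /psg -/(y _); lra.
 + by move: wy2 er eta0; rewrite /psg -/(y _); lra.
 + exact: tau01.
 + left; split=> //; exists (s + S i); first by rewrite addr_ge0// S0.
  by rewrite ys flowD.
 + by right; rewrite -oE.
Qed.

Lemma solution_line : exists2 g, line (c 0%N) (c N.+2) g & forall i, inN i -> g (b i) = y i.
Proof.
have [yb y0 yN ll] := solution_links.
have [||||g gl gy] := @build_line R M hM cM G N.+1 y (c 0%N) (c N.+2) => //.
- move=> i iN; have [[_ [s s0 ys]]|[_ [h1 h2]]] := ll i iN; first by left; exists s.
 by right; rewrite h1 h2.
exists g => // i iN; have [_ <-] := yb i iN; exact: gy.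
Qed.

Lemma solution_uniq g g' : line (c 0%N) (c N.+2) g -> line (c 0%N) (c N.+2) g' ->
 (forall i, inN i -> g (b i) = y i) -> (forall i, inN i -> g' (b i) = y i) -> g = g'.
Proof.
move=> gl gl' gy gy'; have [yb y0 yN ll] := solution_links.
have H := @line_determined R M hM cM G N.+1 y _ _ g g' gl gl'; apply: H => //.
 by move=> i iN; have [h1 h2] := yb i iN; split=> //; rewrite [hgt G _]h2 ?gy ?gy'.
move=> i iN; have [[_ [s s0 ys]]|[_ [-> ->]]//] := ll i iN.
have oE : omg (y i.+1) = omg (y i) by rewrite ys; exact: (@omgE _ _ hM cM G).
have [yc1 _] := yb i.+1 iN; rewrite -oE.
exact: (ltW (lt_trans (@hgt_omg R M cM G _ yc1) (@hgt_alf R M cM G _ yc1))).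
Qed.

(** If no parameter vanishes, all points y i lie on a single orbit with limits c 0 and c N.+2, and a
    critical r strictly between would lie on that orbit. *)
Lemma solution_brk g : line (c 0%N) (c N.+2) g -> (forall i, inN i -> g (b i) = y i) ->
 (exists r, [/\ critical f r, f (c N.+2) < f r, f r < f (c 0%N) & g (f r) = r]) -> exists j, t ord0 j = 0.
Proof.
move=> gl gy [r [rc qr rp gr]]; apply: contrapT => no; have [yb y0 yN ll] := solution_links.
have same i : inN i -> alf (y i) = c 0%N.
 elim: i => // i IH iN; have [[_ [s s0 ->]]|[t0 _]] := ll i iN.
  by rewrite -(IH (ltnW iN)); exact: (@alphaE _ _ hM cM G).
 by exfalso; apply: no; move: t0; rewrite /tau /= iN => t0; exists (inord i).
have [ync ynb] := yb N.+1 (leqnn _).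
have [||s gs _] := @line_hit _ _ cM G (c 0%N) (c N.+2) g (b N.+1) (f r) gl; rewrite ?gy//.
 by rewrite yN same// qr.
by apply: ync; apply/(crit_gfl G s); have := gs; rewrite gy// gr => <-.
Qed.

End Solution.

End Radius.

Lemma good_radius : exists2 d0 : R, 0 < d0 & forall i (v : 'rV[R]_m), inN i -> `|v| < d0 -> good i (z0 i + v).
Proof.
have [d d0 dP] := @fin_radius R N.+2 (fun i d => forall v : 'rV[R]_m, `|v| < d -> good i (z0 i + v))
 (fun i => good_near (ltn_ord i : inN i))
 (fun i d d' _ dd H v vd => H v (lt_le_trans vd dd)).
exists d => // i v iN vd.
by have := dP (inord i) v vd; rewrite inordK.
Qed.

Lemma pass_bounds : exists2 d : R, 0 < d & exists2 C : R, 0 < C & forall i, inN i ->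
 forall v v' : 'rV[R]_m, `|v| < d -> `|v'| < d -> `|pass i (z0 i + v)| <= C /\
  `|pass i (z0 i + v) - pass i (z0 i + v')| <= C * `|v - v'|.
Proof.
have ex i : exists Cd : R * R, [/\ 0 < Cd.1, 0 < Cd.2 & inN i -> forall v v' : 'rV[R]_m, `|v| < Cd.2 -> `|v'| < Cd.2 ->
  `|pass i (z0 i + v) - pass i (z0 i + v')| <= Cd.1 * `|v - v'|].
 have [iN|iN] := boolP (inN i); last by exists (1, 1).
 have [Sa e0 ca] := std (c_crit (leqW iN)).
 have [Sb e'0 cb] := std (c_crit (iN : (i.+1 <= N.+2)%N)).
 have [D /sdf_lip[C C0 [d d0 H]]] := psg_sdf Sa Sb (z_dom iN) (w_dom iN).
 exists (C, d); split=> // _ v v' vd vd'.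
 have := H (z0 i + v) (z0 i + v'); rewrite ![z0 i + _]addrC !addrK => /(_ vd vd').
 by rewrite opprD addrACA subrr addr0.
have [Cd CdP] := choice ex.
have [d d0 dP] : exists2 d : R, 0 < d & forall i : 'I_N.+2, d <= (Cd i).2 /\ d <= 1.
 apply: (@fin_radius R N.+2 (fun i d => d <= (Cd i).2 /\ d <= 1)) => [i|i d d' _ dd [h1 h2]].
  exists (Num.min (Cd i).2 1); first by rewrite lt_min ltr01 andbT; have [] := CdP i.
  by split; rewrite ge_min lexx ?orbT.
 by split; exact: le_trans dd _.
exists d => //.
pose C := \sum_(i < N.+2) ((Cd i).1 + `|pass i (z0 i)|).
have CP i : inN i -> (Cd i).1 + `|pass i (z0 i)| <= C.
 move=> iN; rewrite /C (bigD1 (Ordinal (iN : (i < N.+2)%N)))//= lerDl sumr_ge0// => j _.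
 by rewrite addr_ge0//; have [/ltW] := CdP j.
have C0 : 0 < C by apply: lt_le_trans (CP 0%N (leq0n _)); rewrite ltr_wpDr//; have [] := CdP 0%N.
exists C => // i iN v v' vd vd'.
have [C1 C2 H] := CdP i; have [d1 d2] := dP (inord i); rewrite inordK// in d1.
have Ci := CP i iN.
split.
 have h0 := H iN v 0 (lt_le_trans vd d1); rewrite normr0 subr0 addr0 in h0.
 have {}h0 := h0 (lt_le_trans d0 d1).
 rewrite -[pass i _](subrK (pass i (z0 i))); apply: le_trans (ler_normD _ _) _.
 apply: le_trans Ci; rewrite lerD2r; apply: le_trans h0 _.
 by rewrite ler_piMr ?ltW//; apply: lt_le_trans vd d2.
apply: le_trans (H iN v v' (lt_le_trans vd d1) (lt_le_trans vd' d1)) _.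
by rewrite ler_wpM2r//; apply: le_trans Ci; rewrite lerDl.
Qed.

Lemma norm_mulY i (u : 'rV[R]_m) : `|u *m Y i| <= `|u|.
Proof.
apply: mxn_le => // i1 j; rewrite ord1 YmxE; case: ifP => _; rewrite ?normr0//.
exact: entry_le.
Qed.

Lemma norm_mulX i (u : 'rV[R]_m) : `|u *m X i| <= `|u|.
Proof.
apply: mxn_le => // i1 j; rewrite ord1 XmxE; case: ifP => _; rewrite ?normr0//.
exact: entry_le.
Qed.

Lemma norm_tau t i : `|tau t i| <= `|t|.
Proof. by rewrite /tau; case: ifP => _; [exact: entry_le|rewrite normr0]. Qed.

Lemma gseg_bounds : exists2 d : R, 0 < d & exists2 C : R, 0 < C & forall i t (v v' : mat), inN i ->
 `|v| < d -> `|v'| < d -> `|gseg i t v| <= C * `|t| /\ `|gseg i t v - gseg i t v'| <= C * `|t| * `|v - v'|.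
Proof.
have [d d0 [C C0 H]] := pass_bounds.
pose Z := \sum_(i < N.+3) `|z0 i|.
have ZP i : (i <= N.+2)%N -> `|z0 i| <= Z.
 by move=> iN; rewrite /Z (bigD1 (Ordinal (iN : (i < N.+3)%N)))//= lerDl sumr_ge0.
have Z0 : 0 <= Z by apply: sumr_ge0.
exists d => //; exists (C + Z + d + 1); first by lra.
move=> i t v v' iN vd vd'; have iN' : (i.-1 <= N.+1)%N by exact: leq_trans (leq_pred i) iN.
have rwd (u : mat) j : `|u| < d -> `|rw j u| < d by apply: le_lt_trans; exact: normr_row.
have [P1 P2] := H i.-1 iN' _ _ (rwd v i.-1 vd) (rwd v' i.-1 vd').
have t0 := normr_ge0 t; have vv0 := normr_ge0 (v - v').
have K0 : 0 <= C + Z + d + 1 by lra.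
have scale_le j (w : 'rV[R]_m) (c1 : R) : 0 <= c1 -> `|w| <= c1 -> `|tau t j *: w| <= c1 * `|t|.
 by move=> c10 wc; rewrite normrZ mulrC; apply: ler_pM => //; exact: norm_tau.
have dv j : `|rw j v - rw j v'| <= `|v - v'| by rewrite -linearB; exact: normr_row.
split.
 rewrite /gseg; apply: normr_row_mx; [by rewrite mulr_ge0| |apply: normr_row_mx; [by rewrite mulr_ge0| |by rewrite normr0 mulr_ge0]].
  by apply: scale_le => //; apply: le_trans (norm_mulY _ _) _; apply: le_trans P1 _; lra.
 apply: scale_le => //; apply: le_trans (norm_mulX _ _) _; apply: le_trans (ler_normD _ _) _.
 by have := ZP i.+1 iN; have := ltW (rwd v i.+1 vd); lra.
rewrite /gseg opp_row_mx add_row_mx opp_row_mx add_row_mx subr0 -!scalerBr -!mulmxBl.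
have K1 : 0 <= (C + Z + d + 1) * `|v - v'| by rewrite mulr_ge0.
rewrite -mulrA [`|t| * _]mulrC mulrA.
apply: normr_row_mx; [by rewrite mulr_ge0| |apply: normr_row_mx; [by rewrite mulr_ge0| |by rewrite normr0 mulr_ge0]].
 apply: scale_le => //; apply: le_trans (norm_mulY _ _) _; apply: le_trans P2 _.
 by apply: ler_pM => //; [exact: ltW|lra].
apply: scale_le => //; apply: le_trans (norm_mulX _ _) _; rewrite opprD addrACA subrr add0r.
by apply: le_trans (dv _) _; rewrite ler_peMl//; lra.
Qed.

Lemma seg_matrix : exists A : 'I_N.+2 -> 'M[R]_(m, m + (m + 1)), forall i : 'I_N.+2,
 (forall e1 : R, 0 < e1 -> exists2 d : R, 0 < d & forall y z : 'rV[R]_m, `|y| < d -> `|z| < d ->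
  `|Fseg i y - Fseg i z - (y - z) *m A i| <= e1 * `|y - z|) /\
 forall (al be : 'rV[R]_m) (ga : 'M[R]_1), (row_mx (al *m Y i) (row_mx (be *m X i.+1) ga) <= A i)%MS.
Proof.
suff ch (i : 'I_N.+2) : exists A : 'M[R]_(m, m + (m + 1)),
  (forall e1 : R, 0 < e1 -> exists2 d : R, 0 < d & forall y z : 'rV[R]_m, `|y| < d -> `|z| < d ->
   `|Fseg i y - Fseg i z - (y - z) *m A| <= e1 * `|y - z|) /\
  forall (al be : 'rV[R]_m) (ga : 'M[R]_1), (row_mx (al *m Y i) (row_mx (be *m X i.+1) ga) <= A)%MS.
 by have [A AP] := choice ch; exists A.
have iN : inN i := ltn_ord i.
have [Sa e0 ca] := std (c_crit (leqW iN)).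
have [Sb e'0 cb] := std (c_crit (iN : (i.+1 <= N.+2)%N)).
have er := eta_rho (leqW iN); have er' := eta_rho (iN : (i.+1 <= N.+2)%N).
apply: (@segment_submersion R m M f fS cM fN (c i) (c i.+1) (k i) (k i.+1) (a i) (a i.+1)
 (se (c i)) (se (c i.+1)) Sa Sb e0 e'0 ca cb (z i) (S i)).
- exact: z_crit.
- exact: z_dom.
- by rewrite z_x//; move: eta0 er; lra.
- exact: z_Y.
- exact: w_dom.
- by rewrite w_y//; move: eta0 er'; lra.
- exact: w_X.
- by apply: trans; apply: c_crit; [exact: leqW|exact: (ltn_ord i)].
Qed.

Notation crv := (prod_topology (fun _ : R => M)).
Notation L := (line (c 0%N) (c N.+2)).

(** Lines near g0 correspond to solutions of the equations, hence by [glue_fixed] to pairs of a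
    kernel part and gluing parameters t >= 0, and the broken ones are those with some t_j = 0. So
    [chart_clr] applies. *)
Lemma gluing_clr (g0 : crv) : L g0 -> (forall i, inN i -> g0 (b i) = z i) ->
 (forall j : 'I_N.+1, g0 (f (c j.+1)) = c j.+1) ->
 exists LC : lcollar R (L : set crv) (brk cM G (c 0%N) (c N.+2)),
  \forall g \near g0, brk cM G (c 0%N) (c N.+2) g -> lc_dom LC g /\ bump LC g = 1.
Proof.
move=> gl0 gz0 gb0.
have [d0 d00 d0P] := good_radius; have [d1 d10 [C C0 gB]] := gseg_bounds.
have [A AP] := seg_matrix.
pose D := Num.min d0 d1; have D0 : 0 < D by rewrite lt_min d00.
have Dd0 : D <= d0 by rewrite ge_min lexx.
have Dd1 : D <= d1 by rewrite ge_min lexx orbT.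
have F0 (i : 'I_N.+2) : Fseg i 0 = 0.
 have iN : inN i := ltn_ord i.
 by rewrite /Fseg addr0 subrr (z_Y iN) /psg (crdK (z_dom iN)) (w_X iN) !row_mx0.
have gC (i : 'I_N.+2) (t : 'rV[R]_N.+1) (v : mat) : `|v| < D -> `|gseg i t v| <= C * `|t|.
 by move=> vD; have [] := gB i t v v (ltn_ord i) (lt_le_trans vD Dd1) (lt_le_trans vD Dd1).
have gL (i : 'I_N.+2) (t : 'rV[R]_N.+1) (v v' : mat) : `|v| < D -> `|v'| < D ->
  `|gseg i t v - gseg i t v'| <= C * `|t| * `|v - v'|.
 by move=> vD vD'; have [] := gB i t v v' (ltn_ord i) (lt_le_trans vD Dd1) (lt_le_trans vD' Dd1).
have Fim (i : 'I_N.+2) (v : 'rV[R]_m) : `|v| < D -> (Fseg i v <= A i)%MS.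
 by move=> _; have [_ H] := AP i; exact: H.
have gim (i : 'I_N.+2) (t : 'rV[R]_N.+1) (v : mat) : `|v| < D -> (gseg i t v <= A i)%MS.
 by move=> _; have [_ H] := AP i; rewrite /gseg !scalemxAl; exact: H.
have [d [e1 [/andP[dp dD] e10 sol_ex sol_uniq]]] := @glue_fixed R N.+2 m _ N.+1 (fun i => Fseg i) A (fun i => gseg i)
 F0 (fun i => (AP i).1) C D C0 D0 gC gL Fim gim D D0.
(* Gluing parameters must also be at most 1, being of the form expR (- (2 * s)) with s >= 0. *)
pose e := Num.min e1 1; have e0 : 0 < e by rewrite lt_min e10 ltr01.
have ee1 : e <= e1 by rewrite ge_min lexx.
have e1' : e <= 1 by rewrite ge_min lexx orbT.
have dd0 : d < d0 by exact: lt_le_trans Dd0.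
have rwE (v : mat) (i : 'I_N.+2) : rw i v = row i v by rewrite inord_val.
have eqsE (v : mat) t : (forall i : 'I_N.+2, Fseg i (row i v) = gseg i t v) <->
  (forall i, inN i -> Fseg i (rw i v) = gseg i t v).
 split=> H i => [iN|]; first by have := H (inord i); rewrite inordK.
 by rewrite -rwE; apply: H; exact: (ltn_ord i).
pose vv (g : crv) : mat := \matrix_i (crd (a i) (g (b i)) - z0 i).
(* Closed balls are compact, so their images under the charts are closed in [M]; this makes [N0]
   closed. *)
pose N0 : set crv := [set g | L g /\ forall i : 'I_N.+2, (par (a i) @` [set u | `|u - z0 i| <= d]) (g (b i))].
have goodd i (u : 'rV[R]_m) : inN i -> `|u - z0 i| <= d -> good i u.
 by move=> iN ud; rewrite -(subrK (z0 i) u) addrC; apply: d0P => //; exact: le_lt_trans dd0.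
have N0v g : N0 g -> `|vv g| <= d /\ forall i, inN i -> dom (a i) (g (b i)) /\ g (b i) = par (a i) (z0 i + rw i (vv g)).
 move=> [gl H]; have Hi i : inN i -> exists2 u, `|u - z0 i| <= d & par (a i) u = g (b i).
  by move=> iN; have := H (inord i); rewrite inordK.
 split.
  apply: normr_rows => [|i]; first exact: ltW.
  have [u ud <-] := Hi i (ltn_ord i); rewrite parK//.
  by have [] := goodd i u (ltn_ord i) ud.
 move=> i iN; rewrite /vv rowK inordK//; have [u ud <-] := Hi i iN.
 have [cu _ _ _ _] := goodd i u iN ud.
 by rewrite parK// addrC subrK; split=> //; exact: par_dom.
have vN0 g (v : mat) : L g -> `|v| <= d -> (forall i, inN i -> g (b i) = par (a i) (z0 i + rw i v)) ->
  N0 g /\ vv g = v.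
 move=> gl vd gv; have gu i : inN i -> `|z0 i + rw i v - z0 i| <= d.
  by move=> iN; rewrite addrC addKr; apply: le_trans vd; exact: normr_row.
 split; first split=> // i.
  have iN : inN i := ltn_ord i.
  by exists (z0 i + rw i v); [exact: gu|rewrite gv].
 apply/row_matrixP => i; rewrite rowK gv ?parK; first by rewrite addrC addKr rwE.
  by have [] := goodd i _ (ltn_ord i) (gu i (ltn_ord i)).
 exact: (ltn_ord i).
pose ta (g : crv) : 'rV[R]_N.+1 := \row_j (crd (a j.+1) (flow (S j) (g (b j))) ord0 (jj j.+1) / crd (a j.+1) (g (b j.+1)) ord0 (jj j.+1)).
have ratio (g : crv) (v : mat) t : `|v| <= d -> (forall i, inN i -> g (b i) = par (a i) (z0 i + rw i v)) ->
  (forall i, inN i -> Fseg i (rw i v) = gseg i t v) -> ta g = t.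
 move=> vd gv eqs; apply/rowP => j; rewrite mxE.
 have jN : (j.+1 <= N.+1)%N := ltn_ord j; have jN' : inN j := ltnW jN.
 have := eqs j jN'; rewrite /Fseg /gseg => /eq_row_mx[_ /eq_row_mx[E _]].
 have gu i : inN i -> good i (z0 i + rw i v).
  by move=> iN; apply: d0P => //; apply: le_lt_trans dd0; apply: le_trans vd; exact: normr_row.
 have [cu _ [_ un0] _ _] := gu _ jN; have [jk _] := jjP jN.
 rewrite !gv// parK//; have /rowP/(_ (jj j.+1)) := E; rewrite XmxE jk [RHS]mxE XmxE jk.
 rewrite /tau /= jN /= inord_val /psg => ->; by rewrite mulfK.
have N0eq g : N0 g -> [/\ forall j, 0 <= ta g ord0 j <= 1, forall j : 'I_N.+1, ta g ord0 j = 0 <-> g (f (c j.+1)) = c j.+1 &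
  forall i, inN i -> Fseg i (rw i (vv g)) = gseg i (ta g) (vv g)].
 move=> Ng; have [vd gv] := N0v g Ng; have gv' i iN := (gv i iN).2.
 have [t [t1 t2 t3]] := line_equations d0P (le_lt_trans vd dd0) Ng.1 gv'.
 by rewrite (ratio g (vv g) t vd gv' t3).
have Ldom g i : N0 g -> inN i -> dom (a i.+1) (flow (S i) (g (b i))).
 move=> Ng iN; have [vd gv] := N0v g Ng; have [_ ->] := gv i iN.
 by have [] := d0P i (rw i (vv g)) iN (le_lt_trans (le_trans (normr_row _ _) vd) dd0).
have evc i : continuous (fun g : crv => g (b i)) by exact: curve_eval.
have crdc (i : 'I_N.+2) : cts N0 (fun g : crv => crd (a i) (g (b i))).
 apply: (@cts_op _ _ _ N0 (fun g : crv => g (b i)) (crd (a i))) => [|g Ng].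
  by apply: ctsT; exact: evc.
 by apply: crd_continuous; have [_ gv] := N0v g Ng; have [] := gv i (ltn_ord i).
have entryc (n' : nat) (h : crv -> 'rV[R]_n') j : cts N0 h -> cts N0 (fun g => h g ord0 j : R).
 by move=> hc; apply: (@cts_op _ _ _ N0 h (fun u : 'rV[R]_n' => u ord0 j) hc) => g _; exact: coord_continuous.
have vvc : cts N0 vv.
 apply: cts_mx => i j; apply: (@cts_eq _ _ _ (fun g : crv => crd (a i) (g (b i)) ord0 j - z0 i ord0 j)).
  by move=> g _; rewrite !mxE.
 by apply: ctsB; [exact: entryc|exact: cts_cst].
have tac : cts N0 ta.
 apply: cts_mx => i j; rewrite ord1.
 apply: (@cts_eq _ _ _ (fun g : crv => crd (a j.+1) (flow (S j) (g (b j))) ord0 (jj j.+1) / crd (a j.+1) (g (b j.+1)) ord0 (jj j.+1))).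
  by move=> g _; rewrite mxE.
 have jN : (j.+1 <= N.+1)%N := ltn_ord j.
 apply: ctsM.
  apply: entryc; apply: (@cts_op _ _ _ N0 (fun g : crv => g (b j)) (fun x => crd (a j.+1) (flow (S j) x))) => [|g Ng].
   by apply: ctsT; exact: evc.
  apply: (ccomp (flow (S j)) (crd (a j.+1))); first exact: (@gfl_cts_x _ _ G (S j)).
  by apply: crd_continuous; apply: Ldom => //; exact: ltnW.
 apply: ctsV; first by apply: entryc; exact: (crdc (Ordinal (jN : (j.+1 < N.+2)%N))).
 move=> g Ng; have [vd gv] := N0v g Ng; have [_ ->] := gv j.+1 jN.
 have [cu _ [_ un0] _ _] := d0P j.+1 (rw j.+1 (vv g)) jN (le_lt_trans (le_trans (normr_row _ _) vd) dd0).
 by rewrite parK.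
pose ka g := kap A (vv g).
have kac : cts N0 ka.
 pose K := \sum_i (1 + (m + (m + 1))%:R * (m%:R * `|A i|) * `|pinvmx (A i)|).
 have K0 i : 1 + (m + (m + 1))%:R * (m%:R * `|A i|) * `|pinvmx (A i)| <= K.
  by rewrite /K (bigD1 i)//= lerDl sumr_ge0// => j _; rewrite addr_ge0// !mulr_ge0.
 have Kp : 0 <= K by rewrite /K sumr_ge0// => j _; rewrite addr_ge0// !mulr_ge0.
 apply: (@cts_lip R crv mat mat N0 vv (kap A) K) => // u v.
 have -> : kap A u - kap A v = \matrix_i ((row i u - row i v) - (row i u - row i v) *m A i *m pinvmx (A i)).
  apply/row_matrixP => i; rewrite [row i (_ - _)]linearB /= !rowK !mulmxBl.
  move: (row i u) (row i v) (row i u *m A i *m _) (row i v *m A i *m _) => u1 u2 u3 u4.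
  by apply/rowP => j; rewrite !mxE; ring.
 apply: normr_rows => [|i]; first by rewrite mulr_ge0.
 have h1 : `|row i u - row i v| <= `|u - v| by rewrite -linearB; exact: normr_row.
 apply: le_trans (ler_normB _ _) _.
 apply: (@le_trans _ _ ((1 + (m + (m + 1))%:R * (m%:R * `|A i|) * `|pinvmx (A i)|) * `|u - v|)); last exact: ler_wpM2r.
 rewrite mulrDl mul1r; apply: lerD => //; apply: le_trans (mulmxn _ _) _.
 apply: (@le_trans _ _ ((m + (m + 1))%:R * (m%:R * `|u - v| * `|A i|) * `|pinvmx (A i)|)); last first.
  by rewrite le_eqVlt; apply/orP; left; apply/eqP; ring.
 apply: ler_wpM2r => //; apply: ler_wpM2l => //; apply: le_trans (mulmxn _ _) _.
 by apply: ler_wpM2r => //; apply: ler_wpM2l.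
have closedN0 : closed N0.
 have -> : N0 = (L : set crv) `&` \bigcap_(i : 'I_N.+2) [set g : crv | (par (a i) @` [set u | `|u - z0 i| <= d]) (g (b i))].
  by apply/seteqP; split=> g [gl H]; split=> // i *; exact: H.
 apply: closedI; first exact: line_closed.
 apply: closed_bigI => i _.
 apply: (@preimage_closed _ _ (fun g : crv => g (b i)) (par (a i) @` [set u | `|u - z0 i| <= d])) => [g _|]; first exact: evc.
 apply: compact_closed => //; apply: continuous_compact; last exact: closed_ball_cpt.
 apply: continuous_in_subspaceT => u; rewrite inE => ud; apply: par_continuous.
 by have [] := goodd i u (ltn_ord i) ud.
have N00 : N0 g0 /\ vv g0 = 0.
 apply: vN0 => //; first by rewrite normr0 ltW.
 move=> i iN; rewrite gz0// (_ : rw i 0 = 0); last by apply/rowP => j; rewrite !mxE.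
 by rewrite addr0 crdK//; exact: z_dom.
apply: (@chart_clr R crv (L : set crv) (brk cM G (c 0%N) (c N.+2)) N0 N.+2 m N
 [set w | forall i, row i w *m A i = 0] ka ta e g0) => //.
- exact: hausdorff_product.
- exact: line_cpt.
- exact: brk_closed.
- by move=> g [].
- by move=> g [].
- by move=> g j /N0eq[/(_ j)/andP[]].
- move=> g Ng; have [t1 t2 t3] := N0eq g Ng; have [vd gv] := N0v g Ng; have gv' i iN := (gv i iN).2.
 split=> [[_ br]|[j tj]]; last first.
  split; first exact: Ng.1.
  have jN : (j.+1 <= N.+1)%N := ltn_ord j.
  have lt1 : f (c j.+2) < f (c j.+1) by have := c_gap jN; move: eta0; lra.
  have lt2 : f (c j.+1) < f (c j) by have := c_gap (ltnW jN); move: eta0; lra.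
  have le1 : f (c N.+2) <= f (c j.+2) by apply: c_mono; rewrite ltnS jN leqnn.
  have le2 : f (c j) <= f (c 0%N) by apply: c_mono; rewrite leq0n /= (leq_trans (ltnW jN)).
  by exists (c j.+1); split; [exact: (c_crit (leqW jN))|exact: le_lt_trans le1 lt1|exact: lt_le_trans lt2 le2|apply/t2].
 exact: (solution_brk d0P (le_lt_trans vd dd0) t1 t3 Ng.1 gv' br).
- by move=> g _ i; exact: kap_ker.
- move=> w t wA we te t0; have [v [vd eqs kv]] := sol_ex w t wA (le_trans we ee1) (le_trans te ee1).
 have eqs' := (eqsE v t).1 eqs.
 have t01 j : 0 <= t ord0 j <= 1.
  by rewrite t0 /=; apply: le_trans e1'; apply: le_trans te; apply: le_trans (ler_norm _) (entry_le _ _ _).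
 have [g gl gv] := solution_line d0P (lt_trans vd dd0) t01 eqs'.
 have [Ng vg] := vN0 g v gl (ltW vd) gv.
 by exists g; split=> //; [rewrite /ka vg|exact: (ratio g v t (ltW vd) gv eqs')].
- move=> g g' Ng Ng' ke te kk tt; have [t1 t2 t3] := N0eq g Ng; have [t1' t2' t3'] := N0eq g' Ng'.
 have [vd gv] := N0v g Ng; have [vd' gv'] := N0v g' Ng'.
 have E : vv g = vv g'.
  by apply: (sol_uniq _ _ (ta g)) => //; [exact: le_trans ee1|exact/eqsE|rewrite tt; exact/eqsE].
 apply: (solution_uniq d0P (le_lt_trans vd dd0) t1 t3 Ng.1 Ng'.1) => i iN; first exact: (gv i iN).2.
 by rewrite E; exact: (gv' i iN).2.
- move=> g Ng ke te; have [t1 t2 t3] := N0eq g Ng; have [vd gv] := N0v g Ng.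
 have [v [vd2 eqs kv]] := sol_ex (ka g) (ta g) (kap_ker A (vv g)) (le_trans ke ee1) (le_trans te ee1).
 have E : vv g = v.
  by apply: (sol_uniq _ _ (ta g)) => //; [exact: ltW|exact: le_trans ee1|exact/eqsE].
 have H : nbhs g [set y : crv | forall i : 'I_N.+2, dom (a i) (y (b i)) /\ `|crd (a i) (y (b i)) - z0 i| < d].
  suff H : \forall y \near nbhs g, forall i : 'I_N.+2, [set y : crv | dom (a i) (y (b i)) /\ `|crd (a i) (y (b i)) - z0 i| < d] y by [].
  apply: filter_forall => i.
  have di := (gv i (ltn_ord i)).1.
  have n1 : \forall y \near g, dom (a i) ((y : crv) (b i)) by apply: evc; exact: nbhs_dom.
  have n2 : \forall y \near g, `|crd (a i) ((y : crv) (b i)) - z0 i| < d.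
   apply: (@near_lt R crv (fun y : crv => `|crd (a i) (y (b i)) - z0 i|)).
    apply: (ccomp (fun y : crv => crd (a i) (y (b i))) (fun u : 'rV[R]_m => `|u - z0 i|)).
     by apply: (ccomp (fun y : crv => y (b i)) (crd (a i))); [exact: evc|exact: crd_continuous].
    apply: (@lip_cts R 'rV[R]_m R _ _ 1 1) => // y y' _ _.
    by rewrite mul1r; apply: le_trans (ler_dist_dist _ _) _; rewrite opprB addrA subrK.
   apply: le_lt_trans vd2; rewrite -E; apply: le_trans (normr_row (vv g) i); by rewrite rowK.
  by apply: filterS2 n1 n2 => y ? ?; split.
 apply: filterS H => y H yl; split=> // i; have [di ci] := H i.
 by exists (crd (a i) (y (b i))); [exact: ltW|rewrite crdK].
- split; first exact: N00.1.
  rewrite /ka N00.2; apply/row_matrixP => i; rewrite rowK (_ : row i 0 = 0) ?mul0mx ?subr0//.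
  by apply/rowP => j; rewrite !mxE.
 apply/rowP => j; have [_ t2 _] := N0eq g0 N00.1; rewrite [RHS]mxE; exact/t2.
Qed.

End Gluing.

(** The conclusion of [clr] for the space of lines from p to q and its broken part. *)
Definition retraction (R : realType) (M : topologicalType) (cM : compact [set: M]) (G : gradlike R M)
  (p q : M) (mv : prod_topology (fun _ : R => M) -> R -> prod_topology (fun _ : R => M)) : Prop :=
 [/\ cts [set xe : prod_topology (fun _ : R => M) * R | line cM G p q xe.1 /\ 0 <= xe.2 <= 1] (fun xe => mv xe.1 xe.2),
   (forall x (e : R), line cM G p q x -> 0 <= e <= 1 -> line cM G p q (mv x e)),
   (forall x, line cM G p q x -> mv x 0 = x),
   (forall x (e : R), line cM G p q x -> 0 < e < 1 -> ~ brk cM G p q (mv x e)) &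
   (forall x x' (e e' : R), line cM G p q x -> line cM G p q x' -> 0 <= e -> e <= e' -> e' < 1 ->
    brk cM G p q x \/ e = e' -> mv x e = mv x' e' -> x = x' /\ e = e') /\
   (forall y (e : R), line cM G p q y -> 0 <= e -> e < 1 -> (exists2 x, line cM G p q x & y = mv x e) \/
    (exists b (e' : R), [/\ brk cM G p q b, 0 <= e', e' < e & y = mv b e']))].

(** * The collar of the broken lines *)

Section Collars.
Context (R : realType) (m : nat) (M : riemannian_manifold R m) (f : M -> R) (fS : smooth_function f)
 (cM : compact [set: M]) (fN : standard_near_critical f)
 (trans : forall p q, critical f p -> critical f q -> Defs.transversal (Ws f q) (Wu f p)).
Notation flow := (flow fS cM).
Notation G := (mgrad fS cM fN).
Notation omg := (omg cM G).
Notation alf := (alf cM G).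
Notation line := (line cM G).
Notation crv := (prod_topology (fun _ : R => M)).
Let hM := @carrier_hausdorff R m M.

Lemma std_choice : exists (sa : M -> chart R m M) (sk : M -> nat) (se : M -> R), forall p, critical f p ->
 [/\ standard_chart f p (sk p) (sa p), 0 < se p & cod (sa p) = [set z | \sum_i z ord0 i ^+ 2 < se p ^+ 2]].
Proof.
have ch p : exists d : chart R m M * nat * R, critical f p ->
  [/\ standard_chart f p d.1.2 d.1.1, 0 < d.2 & cod d.1.1 = [set z | \sum_i z ord0 i ^+ 2 < d.2 ^+ 2]].
 have [pc|pc] := pselect (critical f p); last by have [c _ _] := atlas_cover p; exists (c, 0%N, 1).
 have [k _ [a Sa]] := fN pc; have [_ [e e0 ce] _ _ _] := Sa.
 by exists (a, k, e).
have [d dP] := choice ch.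
by exists (fun p => (d p).1.1), (fun p => (d p).1.2), (fun p => (d p).2).
Qed.

Ltac slra := first [revert_cmp; clear -R m M f fS cM fN trans hM; lra | lra].

(** The data of [gluing_clr] are read off g0: z i is its point at height eta below the break c i,
    and S i is the time from there to height eta above the next break. One [eta] has to suit the
    boxes, the isolation of critical values and the gaps between breaks. *)
Lemma break_clr p q (g0 : crv) : critical f p -> critical f q -> brk cM G p q g0 ->
 exists LC : lcollar R (line p q : set crv) (brk cM G p q),
  \forall g \near g0, brk cM G p q g -> lc_dom LC g /\ bump LC g = 1.
Proof.
move=> pc qc [gl [r [rc qr rp gr]]].
have [sa [sk [se std]]] := std_choice.
have [n [c [c0 cn cc cs]]] := @break_chain R M hM cM G p q g0 gl pc qc (lt_trans qr rp).
(* A chain with a single segment has no critical point inside, contrary to the break r. *)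
case: n cn cc cs => [|N] cn cc cs.
 have [_ /(_ (f r))[]] := cs 0%N (leq0n _); first by rewrite c0 cn qr.
 by have : g0 (f r) = r := gr; move=> ->.
have {}cs i : (i <= N.+1)%N -> f (c i.+1) < f (c i) /\ forall h, f (c i.+1) < h < f (c i) ->
  [/\ ~ critical f (g0 h), alf (g0 h) = c i & omg (g0 h) = c i.+1] := cs i.
have c_crit i : (i <= N.+2)%N -> critical f (c i) by move=> /cc[].
have gc i : (i <= N.+2)%N -> g0 (f (c i)) = c i by move=> /cc[].
have c_range i : (i <= N.+2)%N -> f q <= f (c i) <= f p.
 by move=> iN; rewrite -(gc i iN); exact: (line_ge (f (c i)) gl).
have [eta eta0 etaP] : exists2 eta : R, 0 < eta & forall i : 'I_N.+3, [/\ 4 * eta < se (c i) ^+ 2 / 2,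
  forall s, critical f s -> `|f s - f (c i)| <= 2 * eta -> f s = f (c i),
  forall h : R, `|f (c i) - h| <= eta -> [/\ dom (sa (c i)) (g0 h), qx (sk (c i)) (crd (sa (c i)) (g0 h)) < se (c i) ^+ 2 / 2 &
   qy (sk (c i)) (crd (sa (c i)) (g0 h)) < se (c i) ^+ 2 / 2] &
  (i <= N.+1)%N -> 2 * eta < f (c i) - f (c i.+1)].
 apply: (@fin_radius R N.+3 (fun i eta => [/\ 4 * eta < se (c i) ^+ 2 / 2,
  forall s, critical f s -> `|f s - f (c i)| <= 2 * eta -> f s = f (c i),
  forall h : R, `|f (c i) - h| <= eta -> [/\ dom (sa (c i)) (g0 h), qx (sk (c i)) (crd (sa (c i)) (g0 h)) < se (c i) ^+ 2 / 2 &
   qy (sk (c i)) (crd (sa (c i)) (g0 h)) < se (c i) ^+ 2 / 2] &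
  (i <= N.+1)%N -> 2 * eta < f (c i) - f (c i.+1)])); last first.
  move=> i d d' d'0 dd [h1 h2 h3 h4]; split.
  - by move: h1 dd; slra.
  - by move=> s sc sd; apply: h2 => //; apply: le_trans sd _; rewrite ler_pM2l.
  - by move=> h hd; apply: h3; exact: le_trans dd.
  - by move=> /h4; move: dd; slra.
 move=> i; have iN : (i <= N.+2)%N := ltn_ord i; have [Sa e0 ca] := std _ (c_crit i iN).
 have [e1 e10 iso] := isolated_value hM cM G (c i).
 have {}iso s : critical f s -> `|f s - f (c i)| < e1 -> f s = f (c i) := iso s.
 have bx := std_nbhs Sa e0 ca (std_rho e0).
 have [V cV [e2 e20 near]] := @line_near R M hM cM G _ _ bx.
 have [e3 e30 gap] : exists2 e3 : R, 0 < e3 & (i <= N.+1)%N -> e3 < f (c i) - f (c i.+1).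
  have [iN1|iN1] := boolP (i <= N.+1)%N; last by exists 1.
  have [lt _] := cs i iN1; exists ((f (c i) - f (c i.+1)) / 2); first by rewrite divr_gt0// subr_gt0.
  by move=> _; move: lt; slra.
 pose w := Num.min (Num.min (se (c i) ^+ 2 / 2) e1) (Num.min e2 e3).
 have w0 : 0 < w by rewrite !lt_min (std_rho e0) e10 e20 e30.
 have [w1 w2 w3 w4] : [/\ w <= se (c i) ^+ 2 / 2, w <= e1, w <= e2 & w <= e3].
  by split; rewrite /w !ge_min lexx ?orbT.
 (* The factor leaves room for the multiples 2 * eta and 4 * eta in the conditions. *)
 exists (w / 8); first by rewrite divr_gt0.
 split.
 - by move: w0 w1; slra.
 - by move=> s sc sd; apply: iso => //; apply: le_lt_trans sd _; move: w0 w2; slra.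
 - move=> h hd; apply: (near p q g0 (f (c i)) h gl).
   by rewrite gc//; exact: nbhs_singleton.
  by apply: le_lt_trans hd _; move: w0 w3; slra.
 - by move=> iN1; have := gap iN1; move: w0 w4; slra.
pose z i := g0 (f (c i) - eta).
have eP i : (i <= N.+2)%N -> [/\ 4 * eta < se (c i) ^+ 2 / 2,
  forall s, critical f s -> `|f s - f (c i)| <= 2 * eta -> f s = f (c i),
  forall h : R, `|f (c i) - h| <= eta -> [/\ dom (sa (c i)) (g0 h), qx (sk (c i)) (crd (sa (c i)) (g0 h)) < se (c i) ^+ 2 / 2 &
   qy (sk (c i)) (crd (sa (c i)) (g0 h)) < se (c i) ^+ 2 / 2] &
  (i <= N.+1)%N -> 2 * eta < f (c i) - f (c i.+1)].
 by move=> iN; have := etaP (Ordinal (iN : (i < N.+3)%N)).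
have c_gap i : (i <= N.+1)%N -> 2 * eta < f (c i) - f (c i.+1).
 by move=> iN; have [_ _ _ H] := eP i (leqW iN); exact: H.
have seg i h : (i <= N.+1)%N -> f (c i.+1) < h < f (c i) -> [/\ ~ critical f (g0 h), alf (g0 h) = c i, omg (g0 h) = c i.+1 & f (g0 h) = h].
 move=> iN hh; have [_ H] := cs i iN; have [h1 h2 h3] := H h hh; split=> //.
 apply: (line_hgt gl); have /andP[a1 _] := c_range i.+1 iN; have /andP[_ a2] := c_range i (leqW iN).
 by have /andP[b1 b2] := hh; rewrite (le_trans a1 (ltW b1)) (le_trans (ltW b2) a2).
have zP i : (i <= N.+1)%N -> [/\ dom (sa (c i)) (z i), crd (sa (c i)) (z i) *m Ymx R m (sk (c i)) = 0 &
  qx (sk (c i)) (crd (sa (c i)) (z i)) = eta].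
 move=> iN; have iN2 := leqW iN; have [Sa e0 ca] := std _ (c_crit i iN2); have gap := c_gap i iN.
 have [_ _ bx _] := eP i iN2.
 have [|dz zx zy] := bx (f (c i) - eta); first by rewrite opprB addrC subrK gtr0_norm.
 have [|h1 h2 h3 h4] := seg i (f (c i) - eta) iN; first by apply/andP; split; move: gap eta0; slra.
 have zY : crd (sa (c i)) (z i) *m Ymx R m (sk (c i)) = 0.
  exact: (std_unstable fS cM fN Sa e0 ca dz zx zy).1.
 split=> //; have := std_hgt Sa dz; rewrite h4 (qy_eq0 _ _).2// => E; move: E; rewrite -/(z i); slra.
have wP i : (i <= N.+1)%N -> let w := g0 (f (c i.+1) + eta) in [/\ dom (sa (c i.+1)) w, crd (sa (c i.+1)) w *m Xmx R m (sk (c i.+1)) = 0 &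
  qy (sk (c i.+1)) (crd (sa (c i.+1)) w) = eta] /\ exists2 t, 0 <= t & w = flow t (z i).
 move=> iN w; have iN2 : (i.+1 <= N.+2)%N := iN; have [Sa e0 ca] := std _ (c_crit i.+1 iN2); have gap := c_gap i iN.
 have [_ _ bx _] := eP i.+1 iN2.
 have [|dw wx wy] := bx (f (c i.+1) + eta); first by rewrite opprD addrA subrr add0r normrN gtr0_norm.
 have [|h1 h2 h3 h4] := seg i (f (c i.+1) + eta) iN; first by apply/andP; split; move: gap eta0; slra.
 have [|k1 k2 k3 k4] := seg i (f (c i) - eta) iN; first by apply/andP; split; move: gap eta0; slra.
 have wX : crd (sa (c i.+1)) w *m Xmx R m (sk (c i.+1)) = 0.
  exact: (std_stable fS cM fN Sa e0 ca dw wx wy).1.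
 split.
  split=> //; have := std_hgt Sa dw; rewrite h4 (qx_eq0 _ _).2// => E; move: E; rewrite -/w; slra.
 have [|t Et ft] := @line_hit _ _ cM G p q g0 (f (c i) - eta) (f (c i.+1) + eta) gl k1.
  rewrite k2 k3; change (f (c i.+1) < f (c i.+1) + eta < f (c i)); apply/andP; split; move: gap eta0; slra.
 exists t => //; rewrite leNgt; apply/negP => t0.
 have := @hgt_nincr _ _ G (z i) t 0 (ltW t0); rewrite ft gfl0.
 change (f (z i) <= f (c i.+1) + eta -> False); rewrite k4; move: gap; slra.
have chS i : exists t : R, (i <= N.+1)%N -> 0 <= t /\ g0 (f (c i.+1) + eta) = flow t (z i).
 have [iN|iN] := boolP (i <= N.+1)%N; last by exists 0.
 by have [_ [t t0 E]] := wP i iN; exists t.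
have [S SP] := choice chS.
have z_x i : (i <= N.+1)%N -> qx (sk (c i)) (crd (sa (c i)) (z i)) = eta by move=> iN; have [] := zP i iN.
have [jj jjP] : exists jj : nat -> 'I_m, forall i, (i <= N.+1)%N -> (jj i < sk (c i))%N /\ crd (sa (c i)) (z i) ord0 (jj i) != 0.
 exact: (jj_ex eta0 z_x).
have := @gluing_clr R m M f fS cM fN sa sk se std trans N c eta z S c_crit eta0.
rewrite c0 cn; apply => //.
- by move=> i iN; have [] := eP i iN.
- by move=> i s iN; have [_ H _ _] := eP i iN; exact: H.
- by move=> i iN; have [] := zP i iN.
- by move=> i iN; have [] := zP i iN.
- by move=> i iN; have [] := SP i iN.
- by move=> i iN; have [_ <-] := SP i iN; have [[]] := wP i iN.
- by move=> i iN; have [_ <-] := SP i iN; have [[]] := wP i iN.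
- by move=> i iN; have [_ <-] := SP i iN; have [[]] := wP i iN.
- exact: jjP.
- by move=> j; apply: gc; apply: ltnW; exact: (ltn_ord j).
Qed.

Lemma retreat_ex p q : critical f p -> critical f q -> exists mv, retraction cM G p q mv.
Proof.
move=> pc qc; apply: (@clr R crv (line p q : set crv) (brk cM G p q)).
- exact: hausdorff_product.
- exact: line_cpt.
- exact: brk_closed.
- by move=> g [].
- by move=> g; exact: break_clr.
Qed.

End Collars.

Lemma seq_argmax (R : realType) (I : eqType) (F : I -> R) (s : seq I) x : x \in s -> exists2 y, y \in s & forall z, z \in s -> F z <= F y.
Proof.
elim: s x => // a s IH x _; have [s0|[b bs]] : s = [::] \/ exists b, b \in s.
 by case: (s) => [|b s']; [left|right; exists b; rewrite mem_head].
 by exists a; rewrite ?mem_head// s0 => z; rewrite inE => /eqP->.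
have [y ys ym] := IH b bs; have [h|/ltW h] := leP (F a) (F y).
 by exists y => [|z]; rewrite inE ?ys ?orbT// => /orP[/eqP->|/ym].
exists a => [|z]; rewrite inE ?eqxx// => /orP[/eqP->//|/ym /le_trans]; exact.
Qed.

Lemma cts_prod (I : Type) (T : topologicalType) (K : I -> topologicalType) (A : set T)
  (e : T -> prod_topology K) : (forall i, cts A (fun x => e x i)) -> cts A e.
Proof.
move=> ec x W Ax xW; suff h : e y @[y --> within A (nbhs x)] --> e x by exact: h.
apply/cvg_sup => i B [_ [[C oC <-] Cx] CB].
have := ec i x C Ax (open_nbhs_nbhs (conj oC Cx)); apply: filterS => y H /H; exact: CB.
Qed.

Lemma cts_paste_seq (I : eqType) (T U : topologicalType) (s : seq I) (E : I -> set T) (A : set T) (f : T -> U) :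
 (forall x, A x -> exists2 i, i \in s & E i x) ->
 (forall i x, A x -> ~ E i x -> \forall y \near x, A y -> ~ E i y) ->
 (forall i, cts (A `&` E i) f) -> cts A f.
Proof.
move=> AE cE fE x W Ax fW.
have h : \forall y \near x, forall i, i \in s -> A y -> E i y -> W (f y).
 elim: (s) => [|j s' IH]; first exact: nearW.
 have hj : \forall y \near x, A y -> E j y -> W (f y).
  have [Ex|nEx] := pselect (E j x).
   by apply: filterS (fE j x W (conj Ax Ex) fW) => y H Ay Ey; exact: H.
  by apply: filterS (cE j x Ax nEx) => y H Ay Ey; case: (H Ay).
 by apply: filterS2 hj IH => y H1 H2 i; rewrite inE => /orP[/eqP->//|]; exact: H2.
by apply: filterS h => y H Ay; have [i si Ei] := AE y Ay; exact: H Ei.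
Qed.

(** * Smoothing breaks according to weights *)

Section Theta.
Context (R : realType) (M : topologicalType) (hM : hausdorff_space M) (cM : compact [set: M]) (G : gradlike R M).
Notation line := (line cM G).
Notation brk := (brk cM G).
Notation f := (hgt G).
Notation abv := (above G).
Notation blw := (below G).
Notation jnG := (join G).
Notation crv := (prod_topology (fun _ : R => M)).
Context (cs : seq M) (csE : crit G = [set` cs]) (mv : M -> M -> crv -> R -> crv)
 (mvP : forall p q, crit G p -> crit G q -> retraction cM G p q (mv p q)).

Let mv_cont p q (pc : crit G p) (qc : crit G q) := let: And5 h _ _ _ _ := mvP pc qc in h.
Let mv_line p q x (e : R) (pc : crit G p) (qc : crit G q) := let: And5 _ h _ _ _ := mvP pc qc in h x e.
Let mv0 p q x (pc : crit G p) (qc : crit G q) := let: And5 _ _ h _ _ := mvP pc qc in h x.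
Let mv_brk p q x (e : R) (pc : crit G p) (qc : crit G q) := let: And5 _ _ _ h _ := mvP pc qc in h x e.
Let mv_inj p q x x' (e e' : R) (pc : crit G p) (qc : crit G q) := let: And5 _ _ _ _ h := mvP pc qc in h.1 x x' e e'.
Let mv_onto p q y (e : R) (pc : crit G p) (qc : crit G q) := let: And5 _ _ _ _ h := mvP pc qc in h.2 y e.

Lemma csP c : crit G c <-> c \in cs.
Proof. by rewrite csE. Qed.

Definition inner (p q c : M) : Prop := crit G c /\ f q < f c < f p.

(** Cutting a line at an inner critical point gives two parts of smaller rank, so the rank is enough
    fuel for [tht_rec]. *)
Definition rank (p q : M) : nat := count (fun c => (f q < f c < f p)%R) cs.

Lemma rank_sub p q r s c : f q <= f s -> f r <= f p -> inner p q c -> ~ (f s < f c < f r) -> (rank r s < rank p q)%N.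
Proof.
move=> qs rp [cc cpq] crs; rewrite /rank -addn1.
apply: leq_trans (_ : count (fun c => (f s < f c < f r)%R) cs + count (pred1 c) cs <= _)%N.
 by rewrite leq_add2l -has_count has_pred1; exact/csP.
rewrite -count_predUI (@eq_count _ (predI _ _) pred0) ?count_pred0 ?addn0.
 apply: sub_count => x /orP[/andP[x1 x2]|/eqP->//].
 by rewrite (le_lt_trans qs x1) (lt_le_trans x2 rp).
by move=> x /=; apply/negbTE/andP => -[x1 /eqP xc]; apply: crs; rewrite -xc.
Qed.

Lemma rank_above p q r : inner p q r -> (rank p r < rank p q)%N.
Proof.
move=> ri; have [rc /andP[qr rp]] := ri; apply: (rank_sub (ltW qr) (lexx _) ri).
by rewrite ltxx.
Qed.

Lemma rank_below p q r : inner p q r -> (rank r q < rank p q)%N.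
Proof.
move=> ri; have [rc /andP[qr rp]] := ri; apply: (rank_sub (lexx _) (ltW rp) ri).
by rewrite ltxx andbF.
Qed.

Lemma rank_aboveS k p q r : (rank p q <= k.+1)%N -> inner p q r -> (rank p r <= k)%N.
Proof. by move=> rk ri; rewrite -ltnS; apply: leq_trans rk; exact: rank_above. Qed.
Lemma rank_belowS k p q r : (rank p q <= k.+1)%N -> inner p q r -> (rank r q <= k)%N.
Proof. by move=> rk ri; rewrite -ltnS; apply: leq_trans rk; exact: rank_below. Qed.

Definition tbrk (p q : M) (w : M -> R) (r : M) : Prop :=
 inner p q r /\ 0 < w r /\ forall c, inner p q c -> w c <= w r.

(** The line is cut at a break of largest weight and both parts are treated with the threshold sg
    lowered to that weight. Their join is broken, and the motion for time (sg - w r) / 2 removes its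
    breaks unless w r = sg. The division by 2 keeps all times at most 1/2, in the range below 1
    where the motion is injective. *)
Fixpoint tht_rec (n : nat) (p q : M) (g : crv) (w : M -> R) (sg : R) : crv :=
 if n is n'.+1 then
  let r := xget p [set r | tbrk p q w r] in
  if pselect (tbrk p q w r) then
   mv p q (jnG r (tht_rec n' p r (abv r g) w (w r)) (tht_rec n' r q (blw r g) w (w r))) ((sg - w r) / 2)
  else mv p q g (sg / 2)
 else mv p q g (sg / 2).

Definition tht (p q : M) := tht_rec (rank p q) p q.

Lemma tht_fuel n p q g w sg : (rank p q <= n)%N -> tht_rec n p q g w sg = tht p q g w sg.
Proof.
suff H k n1 n2 : (k <= n1)%N -> (k <= n2)%N -> forall p q g w sg, (rank p q <= k)%N ->
  tht_rec n1 p q g w sg = tht_rec n2 p q g w sg.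
 by move=> rn; apply: (H (rank p q)).
elim: k n1 n2 => [|k IH] n1 n2 k1 k2 {}p {}q {}g {}w {}sg rk.
 have no r : ~ tbrk p q w r by move=> [/rank_above]; move: rk; rewrite leqn0 => /eqP->.
 by case: n1 k1 => [|n1] _; case: n2 k2 => [|n2] _ //=; case: pselect => [/no//|].
case: n1 k1 => // n1 k1; case: n2 k2 => // n2 k2 /=.
case: pselect => //= -[ri _]; congr mv; congr jnG; apply: IH => //.
 exact: (rank_aboveS rk).
exact: (rank_belowS rk).
Qed.

Lemma tbrk_ex p q w : (exists2 c, inner p q c & 0 < w c) -> exists r, tbrk p q w r.
Proof.
move=> [c ci wc].
pose s := [seq c <- cs | f q < f c < f p].
have sP x : x \in s <-> inner p q x.
 by rewrite mem_filter /inner csP; split=> [/andP[]|[? ->]].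
have cS : c \in s by exact/sP.
have [r rs rmax] := seq_argmax w cS.
exists r; split; first exact/sP.
split=> [|x /sP/rmax//]; exact: lt_le_trans wc (rmax c cS).
Qed.

Lemma tht0 p q g w sg : (forall c, inner p q c -> w c <= 0) -> tht p q g w sg = mv p q g (sg / 2).
Proof.
move=> w0; rewrite /tht; case: (rank p q) => //= n; case: pselect => // t.
by have [ri [r0 _]] := t; have := le_lt_trans (w0 _ ri) r0; rewrite ltxx.
Qed.

Lemma tht_top p q w : (exists2 c, inner p q c & 0 < w c) -> exists2 r, tbrk p q w r &
 forall g sg, tht p q g w sg = mv p q (jnG r (tht p r (abv r g) w (w r)) (tht r q (blw r g) w (w r))) ((sg - w r) / 2).
Proof.
move=> /tbrk_ex[r0 r0t]; have rt := @xgetI _ p [set r | tbrk p q w r] r0 r0t.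
exists (xget p [set r | tbrk p q w r]) => // g sg.
have [ri _] := rt; rewrite {1}/tht; have := rank_above ri; have := rank_below ri.
case: (rank p q) => //= n n1 n2; case: pselect => [t|/(_ rt)//]; congr mv; congr jnG; exact: tht_fuel.
Qed.

Lemma tht_congr p q g w w' sg : (forall c, inner p q c -> w c = w' c) -> tht p q g w sg = tht p q g w' sg.
Proof.
suff H k p0 q0 g0 w0 w1 sg0 : (rank p0 q0 <= k)%N -> (forall c, inner p0 q0 c -> w0 c = w1 c) ->
  tht_rec k p0 q0 g0 w0 sg0 = tht_rec k p0 q0 g0 w1 sg0 by exact: H.
elim: k p0 q0 g0 w0 w1 sg0 => //= k IH p0 q0 g0 w0 w1 sg0 rk ww.
have tE r : tbrk p0 q0 w0 r <-> tbrk p0 q0 w1 r.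
 split=> -[ri [r0 rm]]; (split=> //; split=> [|c ci]); rewrite ?ri//.
 - by rewrite -(ww _ ri).
 - by rewrite -(ww _ ri) -(ww _ ci); exact: rm.
 - by rewrite (ww _ ri).
 - by rewrite (ww _ ri) (ww _ ci); exact: rm.
have -> : [set r | tbrk p0 q0 w0 r] = [set r | tbrk p0 q0 w1 r] by apply/seteqP; split=> r /tE.
case: pselect => [t0|t0]; case: pselect => [t1|t1] //=; [|by case: t1; exact/tE|by case: t0; exact/tE].
have [ri _] := t0; have [rc /andP[r1 r2]] := ri; rewrite ww//; congr mv; congr jnG; apply: IH.
- exact: (rank_aboveS rk).
- by move=> c [cc /andP[c1 c2]]; apply: ww; split=> //; rewrite c2 (lt_trans r1 c1).
- exact: (rank_belowS rk).
- by move=> c [cc /andP[c1 c2]]; apply: ww; split=> //; rewrite c1 (lt_trans c2 r2).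
Qed.

Definition thd (p q : M) (g : crv) (w : M -> R) (sg : R) : Prop :=
 [/\ crit G p, crit G q, line p q g, 0 <= sg <= 1 & forall c, inner p q c -> 0 <= w c <= sg /\ (w c != 0 -> g (f c) = c)].

Lemma inner_above p q r c : inner p q r -> inner p r c -> inner p q c.
Proof. by move=> [rc /andP[r1 r2]] [cc /andP[c1 c2]]; split=> //; rewrite c2 (lt_trans r1 c1). Qed.
Lemma inner_below p q r c : inner p q r -> inner r q c -> inner p q c.
Proof. by move=> [rc /andP[r1 r2]] [cc /andP[c1 c2]]; split=> //; rewrite c1 (lt_trans c2 r2). Qed.

Lemma thd_above p q r g w sg : thd p q g w sg -> inner p q r -> g (f r) = r ->
 (forall c, inner p q c -> w c <= w r) -> thd p r (abv r g) w (w r).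
Proof.
move=> [pc qc gl /andP[s0 s1] wD] ri gr wr; have [rc /andP[r1 r2]] := ri; have [/andP[w0 w1] _] := wD r ri.
split=> //; first by apply: (line_above hM rc gl) => //; rewrite !ltW.
 by rewrite w0 (le_trans w1).
move=> c ci; have ci' := inner_above ri ci; have [/andP[c0 c1] cb] := wD c ci'.
rewrite c0 wr//; split=> // /cb gc; rewrite /above max_l//; have [_ /andP[h1 _]] := ci; exact: ltW.
Qed.

Lemma thd_below p q r g w sg : thd p q g w sg -> inner p q r -> g (f r) = r ->
 (forall c, inner p q c -> w c <= w r) -> thd r q (blw r g) w (w r).
Proof.
move=> [pc qc gl /andP[s0 s1] wD] ri gr wr; have [rc /andP[r1 r2]] := ri; have [/andP[w0 w1] _] := wD r ri.
split=> //; first by apply: (line_below hM rc gl) => //; rewrite !ltW.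
 by rewrite w0 (le_trans w1).
move=> c ci; have ci' := inner_below ri ci; have [/andP[c0 c1] cb] := wD c ci'.
rewrite c0 wr//; split=> // /cb gc; rewrite /below min_l//; have [_ /andP[_ h2]] := ci; exact: ltW.
Qed.

Lemma half_rg (sg w : R) : 0 <= w -> w <= sg -> sg <= 1 -> 0 <= (sg - w) / 2 < 1.
Proof. by move=> *; apply/andP; split; lra. Qed.

Lemma tht_line p q g w sg : thd p q g w sg -> line p q (tht p q g w sg).
Proof.
move: {2}(rank p q) (leqnn (rank p q)) => k; elim: k p q g sg => [|k IH] p q g sg rk gD; have [pc qc gl /andP[s0 s1] wD] := gD.
 rewrite tht0 => [|c]; first by apply: mv_line => //; apply/andP; split; lra.
 by move=> /rank_above; move: rk; rewrite leqn0 => /eqP->.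
have [ex|no] := pselect (exists2 c, inner p q c & 0 < w c); last first.
 rewrite tht0 => [|c ci]; first by apply: mv_line => //; apply/andP; split; lra.
 by rewrite leNgt; apply/negP => c0; apply: no; exists c.
have [r [ri [r0 rm]] ->] := tht_top ex; have [/andP[w0 w1] rb] := wD r ri.
have gr := rb (lt0r_neq0 r0).
have /andP[h1 h2] := half_rg w0 w1 s1; apply: mv_line => //; last by rewrite h1 ltW.
apply: line_join.
 apply: IH (thd_above gD ri gr rm); exact: (rank_aboveS rk).
apply: IH (thd_below gD ri gr rm); exact: (rank_belowS rk).
Qed.

Lemma join_assoc r0 r A B C : f r <= f r0 -> jnG r0 A (jnG r B C) = jnG r (jnG r0 A B) C.
Proof.
move=> rr; apply/funext => h; rewrite /join.
by have [h1|h1] := leP (f r0) h; have [h2|h2] := leP (f r) h => //; have := le_lt_trans (le_trans rr h1) h2; rewrite ltxx.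
Qed.

Lemma above_above r0 r g : f r <= f r0 -> abv r0 (abv r g) = abv r0 g.
Proof.
move=> rr; apply/funext => h; rewrite /above; congr g.
by rewrite max_l// le_max rr orbT.
Qed.

Lemma below_below r0 r g : f r <= f r0 -> blw r (blw r0 g) = blw r g.
Proof.
move=> rr; apply/funext => h; rewrite /below; congr g.
by rewrite min_l// ge_min rr orbT.
Qed.

Lemma above_below r0 r g : f r <= f r0 -> abv r (blw r0 g) = blw r0 (abv r g).
Proof.
move=> rr; apply/funext => h; rewrite /below /above; congr g.
have [h1|h1] := leP h (f r0); first by rewrite min_l// ge_max h1.
by rewrite [RHS]max_l// min_r// le_max ltW.
Qed.

(** The break picked by [tht_rec] may be replaced by any other break r of largest weight: if two
    weights are equal, cutting at one break and then at the other only involves motions for time 0,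
    so both orders give the same join. *)
Lemma tht_split p q g w sg r : thd p q g w sg -> inner p q r -> g (f r) = r ->
 (forall c, inner p q c -> w c <= w r) ->
 tht p q g w sg = mv p q (jnG r (tht p r (abv r g) w (w r)) (tht r q (blw r g) w (w r))) ((sg - w r) / 2).
Proof.
move: {2}(rank p q) (leqnn (rank p q)) => k; elim: k p q g sg r => [|k IH] p q g sg r rk gD ri gr rm.
 by have := rank_above ri; move: rk; rewrite leqn0 => /eqP->.
have [pc qc gl /andP[s0 s1] wD] := gD; have [rc /andP[qr rp]] := ri; have [/andP[w0 w1] _] := wD r ri.
have Da := thd_above gD ri gr rm; have Db := thd_below gD ri gr rm.
have [wr0|wrn0] := eqVneq (w r) 0.
 have z c : inner p q c -> w c <= 0 by rewrite -wr0; exact: rm.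
 rewrite wr0 subr0 !tht0 ?mul0r//; last 2 first.
 - by move=> c ci; apply: z; exact: inner_below ci.
 - by move=> c ci; apply: z; exact: inner_above ci.
 have [_ _ al _ _] := Da; have [_ _ bl _ _] := Db.
 by rewrite !mv0// join_above_below.
have wrp : 0 < w r by rewrite lt_neqAle eq_sym wrn0.
have [|r0 [r0i [r00 r0m]] E] := @tht_top p q w; first by exists r.
rewrite E; have wE : w r0 = w r by apply/eqP; rewrite eq_le rm//= r0m.
have [_ gr0] := wD r0 r0i; have {}gr0 := gr0 (lt0r_neq0 r00).
have [r0c /andP[qr0 r0p]] := r0i.
rewrite wE.
have swap r1 r2 : inner p q r1 -> inner p q r2 -> g (f r1) = r1 -> g (f r2) = r2 -> w r1 = w r -> w r2 = w r -> f r1 < f r2 ->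
  jnG r2 (tht p r2 (abv r2 g) w (w r)) (tht r2 q (blw r2 g) w (w r)) =
  jnG r1 (tht p r1 (abv r1 g) w (w r)) (tht r1 q (blw r1 g) w (w r)).
 move=> ri1 ri2 gr1 gr2 w1E w2E rr; have [r1c /andP[qr1 _]] := ri1; have [r2c /andP[_ r2p]] := ri2.
 have m1 c : inner p q c -> w c <= w r1 by rewrite w1E; exact: rm.
 have m2 c : inner p q c -> w c <= w r2 by rewrite w2E; exact: rm.
 have Da1 := thd_above gD ri1 gr1 m1; have Db2 := thd_below gD ri2 gr2 m2.
 have i1 : inner r2 q r1 by split=> //; rewrite qr1.
 have i2 : inner p r1 r2 by split=> //; rewrite rr.
 have b1 : blw r2 g (f r1) = r1 by rewrite /below min_l// ltW.
 have b2 : abv r1 g (f r2) = r2 by rewrite /above max_l// ltW.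
 have n1 c : inner r2 q c -> w c <= w r1 by move=> ci; apply: m1; exact: inner_below ci.
 have n2 c : inner p r1 c -> w c <= w r2 by move=> ci; apply: m2; exact: inner_above ci.
 have := IH _ _ _ _ _ (rank_belowS rk ri2) Db2 i1 b1 n1; have := IH _ _ _ _ _ (rank_aboveS rk ri1) Da1 i2 b2 n2.
 have l1 := line_join (tht_line (thd_above Db2 i1 b1 n1)) (tht_line (thd_below Db2 i1 b1 n1)).
 have l2 := line_join (tht_line (thd_above Da1 i2 b2 n2)) (tht_line (thd_below Da1 i2 b2 n2)).
 rewrite w1E w2E in l1 l2 *; rewrite subrr mul0r !mv0// => -> ->.
 by rewrite (join_assoc _ _ _ (ltW rr)) (above_above _ (ltW rr)) (below_below _ (ltW rr)) (above_below _ (ltW rr)).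
congr mv; have [rr|rr|rr] := ltgtP (f r) (f r0); [exact: swap|exact/esym/swap|].
by have -> : r0 = r by rewrite -gr0 -rr gr.
Qed.

Notation wts := (prod_topology (fun _ : M => R)).
Notation tdata := (crv * wts * R)%type.
Definition tht_set (p q : M) : set tdata := [set z | thd p q z.1.1 z.1.2 z.2].

Lemma tdata_curve h : continuous (fun z : tdata => z.1.1 h).
Proof.
move=> z; apply: (ccomp (fun z : tdata => z.1.1) (fun g : crv => g h)); last exact: curve_eval.
by apply: (ccomp fst fst); exact: cvg_fst.
Qed.

Lemma tdata_weight c : continuous (fun z : tdata => z.1.2 c).
Proof.
move=> z; apply: (ccomp (fun z : tdata => z.1.2) (fun w : wts => w c)); last exact: (@proj_continuous _ (fun _ : M => R) c).
by apply: (ccomp fst snd); [exact: cvg_fst|exact: cvg_snd].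
Qed.

(** Finitely many closed pieces according to the position of a largest weight, with [None] for the
    absence of positive weights. On each piece [tht_split] gives a single formula, which makes [tht]
    continuous there by induction. *)
Definition tht_piece (p q : M) (o : option M) : set tdata :=
 if o is Some r then [set z | [/\ inner p q r, z.1.1 (f r) = r & forall c, inner p q c -> z.1.2 c <= z.1.2 r]]
 else [set z | forall c, inner p q c -> z.1.2 c <= 0].

Lemma tht_piece_cover p q z : tht_set p q z -> exists2 o, o \in None :: map Some cs & tht_piece p q o z.
Proof.
case: z => [[g w] sg] [/= pc qc gl _ wD].
have [ex|no] := pselect (exists2 c, inner p q c & 0 < w c); last first.
 by exists None => // c ci /=; rewrite leNgt; apply/negP => c0; apply: no; exists c.
have [r [ri [r0 rm]]] := tbrk_ex ex; exists (Some r).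
 by rewrite inE mem_map; [exact/csP/ri.1|move=> ? ? []].
by split=> //=; have [_ H] := wD r ri; exact/H/lt0r_neq0.
Qed.

Lemma tht_piece_closed p q o z : ~ tht_piece p q o z -> \forall y \near z, ~ tht_piece p q o y.
Proof.
have lt_near (u v : tdata -> R) : continuous u -> continuous v -> u z < v z -> \forall y \near z, u y < v y.
 move=> uc vc uv; have : \forall y \near z, 0 < v y - u y.
  apply: (@cvgr_gt _ _ (nbhs z) _ (fun y => v y - u y) (v z - u z)); last by rewrite subr_gt0.
  exact: (@cvgB _ _ _ _ _ v u _ _ (vc z) (uc z)).
 by move=> H; apply: (@filterS _ (nbhs z) _ _ _ _ H) => y; rewrite subr_gt0.
case: o => [r|] nE.
 have [ri|] := pselect (inner p q r); last first.
  by move=> nri; apply: (@filterS _ (nbhs z) _ setT); [move=> y _ [] | exact: filterT].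
 have [gr|gr] := pselect (z.1.1 (f r) = r); last first.
  have oC : open (~` [set r]) by apply: closed_openC; exact: (compact_closed hM (@compact_set1 M r)).
  have H0 : nbhs z [set y : tdata | y.1.1 (f r) <> r] := @tdata_curve (f r) z (~` [set r]) (open_nbhs_nbhs (conj oC gr)).
  by apply: (@filterS _ (nbhs z) _ _ _ _ H0) => y H [_ yr _]; exact: (H yr).
 have [c ci wc] : exists2 c, inner p q c & z.1.2 r < z.1.2 c.
  apply: contrapT => H; apply: nE; split=> // c ci; rewrite leNgt; apply/negP => ?; apply: H; by exists c.
 have := lt_near _ _ (@tdata_weight r) (@tdata_weight c) wc.
 by move=> H; apply: (@filterS _ (nbhs z) _ _ _ _ H) => y yc [_ _ /(_ c ci)]; rewrite leNgt yc.
have [c ci wc] : exists2 c, inner p q c & 0 < z.1.2 c.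
 apply: contrapT => H; apply: nE => c ci; rewrite leNgt; apply/negP => ?; apply: H; by exists c.
have := lt_near (fun _ => 0) _ (fun z => @cst_continuous _ _ 0 z) (@tdata_weight c) wc.
by move=> H; apply: (@filterS _ (nbhs z) _ _ _ _ H) => y yc /(_ c ci); rewrite leNgt yc.
Qed.

Ltac slra := first [revert_cmp; clear -R M hM cM G cs csE mv mvP mv_cont mv_line mv0 mv_brk mv_inj mv_onto; lra | lra].

Lemma tht_cts p q : crit G p -> crit G q ->
 cts (tht_set p q) (fun z => tht p q z.1.1 z.1.2 z.2 : crv).
Proof.
move: {2}(rank p q) (leqnn (rank p q)) => k; elim: k p q => [|k IH] p q rk pc qc.
all: have z0c : cts (tht_set p q) (fun z : tdata => mv p q z.1.1 (z.2 / 2)).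
1,3: apply: (@cts_comp _ _ _ _ _ (fun z : tdata => (z.1.1, z.2 / 2)) (fun xe : crv * R => mv p q xe.1 xe.2) _ _ (mv_cont pc qc)).
1,3: apply: cts_pair; first by apply: ctsT => z; apply: (ccomp fst fst); exact: cvg_fst.
1,2: by apply: ctsM; [apply: ctsT => z; exact: cvg_snd|exact: cts_cst].
1,2: by move=> z [_ _ gl /andP[s0 s1] _]; split=> //=; apply/andP; split; slra.
 have ri r : ~ inner p q r by move=> /rank_above; move: rk; rewrite leqn0 => /eqP->.
 by apply: cts_eq (cts_sub (fun z zD => zD) z0c) => z _; rewrite tht0 // => c /ri.
apply: (@cts_paste_seq _ _ _ (None :: map Some cs) (tht_piece p q)).
- by move=> z; exact: tht_piece_cover.
- by move=> o z _ /tht_piece_closed; apply: filterS => y H _.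
case=> [r|]; last first.
 apply: (cts_eq (f := fun z : tdata => mv p q z.1.1 (z.2 / 2))) => [z [_ z0]|]; first by rewrite tht0.
 by apply: cts_sub z0c => z [].
have [ri|nri] := pselect (inner p q r); last by move=> z W [_ [/nri]].
have [rc _] := ri; have ra : (rank p r <= k)%N by exact: (rank_aboveS rk).
have rb : (rank r q <= k)%N by exact: (rank_belowS rk).
apply: (cts_eq (f := fun z : tdata => mv p q (jnG r (tht p r (abv r z.1.1) z.1.2 (z.1.2 r)) (tht r q (blw r z.1.1) z.1.2 (z.1.2 r))) ((z.2 - z.1.2 r) / 2))).
 by move=> z [zD [_ gr rm]]; rewrite -tht_split.
apply: (@cts_comp _ _ _ _ _ (fun z : tdata => (jnG r (tht p r (abv r z.1.1) z.1.2 (z.1.2 r)) (tht r q (blw r z.1.1) z.1.2 (z.1.2 r)), (z.2 - z.1.2 r) / 2) : crv * R) (fun xe : crv * R => mv p q xe.1 xe.2) _ _ (mv_cont pc qc)); last first.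
 move=> z [zD [_ gr rm]]; have [_ _ _ /andP[s0 s1] wD] := zD; have [/andP[w0 w1] _] := wD r ri.
 split=> /=; last by have /andP[-> /ltW] := half_rg w0 w1 s1.
 by apply: line_join; apply: tht_line; [exact: thd_above zD _ _ _|exact: thd_below zD _ _ _].
apply: cts_pair; last first.
 apply: ctsM; last exact: cts_cst.
 by apply: ctsB; apply: ctsT; [move=> z; exact: cvg_snd|exact: tdata_weight].
have wc : cts (tht_set p q `&` tht_piece p q (Some r)) (fun z : tdata => z.1.2).
 by apply: ctsT => z; apply: (ccomp fst snd); [exact: cvg_fst|exact: cvg_snd].
apply: (@cts_prod R _ (fun _ => M)) => h; rewrite /join; case: (f r <= h).
 apply: (@cts_op _ _ _ _ (fun z : tdata => tht p r (abv r z.1.1) z.1.2 (z.1.2 r) : crv) (fun g : crv => g h)) => [|z _]; last exact: curve_eval.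
 apply: (@cts_comp _ _ _ _ _ (fun z : tdata => (abv r z.1.1, z.1.2, z.1.2 r) : tdata) _ _ _ (IH _ _ ra pc rc)).
  apply: cts_pair; last by apply: ctsT; exact: tdata_weight.
  apply: cts_pair wc; apply: (@cts_prod R _ (fun _ => M)) => h'; apply: ctsT; exact: tdata_curve.
 by move=> z [zD [_ gr rm]]; exact: thd_above zD _ _ _.
apply: (@cts_op _ _ _ _ (fun z : tdata => tht r q (blw r z.1.1) z.1.2 (z.1.2 r) : crv) (fun g : crv => g h)) => [|z _]; last exact: curve_eval.
apply: (@cts_comp _ _ _ _ _ (fun z : tdata => (blw r z.1.1, z.1.2, z.1.2 r) : tdata) _ _ _ (IH _ _ rb rc qc)).
 apply: cts_pair; last by apply: ctsT; exact: tdata_weight.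
 apply: cts_pair wc; apply: (@cts_prod R _ (fun _ => M)) => h'; apply: ctsT; exact: tdata_curve.
by move=> z [zD [_ gr rm]]; exact: thd_below zD _ _ _.
Qed.

Lemma tht_join p q g w sg r : thd p q g w sg -> inner p q r -> g (f r) = r -> w r = sg ->
 tht p q g w sg = jnG r (tht p r (abv r g) w sg) (tht r q (blw r g) w sg).
Proof.
move=> gD ri gr wr; have [pc qc gl _ wD] := gD.
have rm c : inner p q c -> w c <= w r by move=> /wD[/andP[_]]; rewrite wr.
rewrite (tht_split gD ri gr rm) wr subrr mul0r mv0// -{1 2}wr.
by apply: line_join; apply: tht_line; [exact: thd_above gD _ _ _|exact: thd_below gD _ _ _].
Qed.

Lemma line_crit_break p q r0 g : line p q g -> inner p q r0 -> g (f r0) = r0 -> brk p q g.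
Proof. by move=> gl [rc /andP[r1 r2]] gr; split=> //; exists r0. Qed.

(** A motion for a positive time leaves no break, so a break at r forces the largest weight to be
    sg. Then the line is a join, and induction applies to the part that contains r. *)
Lemma tht_break p q g w sg r : thd p q g w sg -> 0 < sg -> inner p q r ->
 tht p q g w sg (f r) = r <-> w r = sg.
Proof.
move=> gD s0 ri; split; last first.
 move=> wr; have [_ _ _ _ wD] := gD; have [_] := wD r ri; rewrite wr => /(_ (lt0r_neq0 s0)) gr.
 have [_ _ _ _ _] := gD; rewrite (tht_join gD ri gr wr); apply: join_break; apply: tht_line; rewrite -wr.
 by apply: (thd_above gD ri gr) => c /wD[/andP[_]]; rewrite wr.
move: {2}(rank p q) (leqnn (rank p q)) => k; elim: k p q g gD ri => [|k IH] p q g gD ri rk.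
 by have := rank_above ri; move: rk; rewrite leqn0 => /eqP->.
have [pc qc gl /andP[_ s1] wD] := gD => tr; have tb := line_crit_break (tht_line gD) ri tr.
have [ex|no] := pselect (exists2 c, inner p q c & 0 < w c); last first.
 move: tb; rewrite tht0 => [|c ci]; first by move/mv_brk => []//; apply/andP; split; lra.
 by rewrite leNgt; apply/negP => c0; apply: no; exists c.
have [r0 [r0i [r00 r0m]] E] := tht_top ex; have [/andP[w0 w1] gr] := wD r0 r0i.
have {}gr := gr (lt0r_neq0 r00).
have Da := thd_above gD r0i gr r0m; have Db := thd_below gD r0i gr r0m.
have w0E : w r0 = sg.
 apply/eqP; rewrite eq_le w1 leNgt; apply/negP => lt; move: tb; rewrite E => /mv_brk[]//; last by apply/andP; split; slra.
 by apply: line_join; exact: tht_line.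
rewrite w0E in Da Db; move: tr; rewrite (tht_join gD r0i gr w0E).
have [_ /andP[qr rp]] := ri; rewrite /join; case: (ltgtP (f r0) (f r)) => [lt|lt|<-].
- move=> tr; apply: IH Da _ _ tr; first by split=> //; [exact: ri.1|rewrite lt].
 exact: (rank_aboveS rk).
- move=> tr; apply: IH Db _ _ tr; first by split=> //; [exact: ri.1|rewrite qr].
 exact: (rank_belowS rk).
- by rewrite (line0 (tht_line Da))// => <-.
Qed.

Lemma thd_low p q g w sg om : thd p q g w sg -> (exists2 r, inner p q r & w r = om) ->
 (forall c, inner p q c -> w c <= om) -> thd p q g w om.
Proof.
move=> [pc qc gl /andP[s0 s1] wD] [r ri wr] wm; split=> //.
 by have [/andP[h1 h2] _] := wD r ri; rewrite -wr h1 (le_trans h2).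
by move=> c ci; have [/andP[h1 h2] h3] := wD c ci; rewrite h1 wm.
Qed.

Lemma tht_form p q g w sg : thd p q g w sg -> 0 < sg ->
 ((forall c, inner p q c -> w c = 0) /\ tht p q g w sg = mv p q g (sg / 2)) \/
 exists r, [/\ tbrk p q w r, thd p q g w (w r), g (f r) = r, brk p q (tht p q g w (w r)) &
  tht p q g w sg = mv p q (tht p q g w (w r)) ((sg - w r) / 2)].
Proof.
move=> gD s0; have [pc qc gl s1 wD] := gD.
have [ex|no] := pselect (exists2 c, inner p q c & 0 < w c); last first.
 have w0 c : inner p q c -> w c <= 0 by move=> ci; rewrite leNgt; apply/negP => c0; apply: no; exists c.
 left; split; last exact: tht0.
 by move=> c ci; apply/eqP; rewrite eq_le w0//=; have [/andP[]] := wD c ci.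
right; have [r rt] := tbrk_ex ex; have [ri [r0 rm]] := rt; exists r.
have [/andP[w0 w1] gr] := wD r ri; have {}gr := gr (lt0r_neq0 r0).
have D' : thd p q g w (w r) by apply: thd_low gD _ rm; exists r.
split=> //; last by rewrite (tht_split gD ri gr rm) (tht_join D' ri gr erefl).
by apply: (line_crit_break (tht_line D') ri); apply/tht_break.
Qed.

Lemma inner_split p q r c : inner p q r -> inner p q c -> [\/ inner p r c, inner r q c | f c = f r].
Proof.
move=> [rc /andP[r1 r2]] [cc /andP[c1 c2]]; case: (ltgtP (f c) (f r)) => [h|h|h]; last by constructor 3.
 by constructor 2; split=> //; rewrite c1.
by constructor 1; split=> //; rewrite h.
Qed.

(** The time of motion of a broken line can be read off the result, and it gives the largest weight.
    Before the motion there are two equal broken lines, in which the breaks of largest weight agree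
    by [tht_break]; their parts are compared by induction. *)
Lemma tht_inj p q g g' w w' sg : thd p q g w sg -> thd p q g' w' sg -> 0 < sg ->
 tht p q g w sg = tht p q g' w' sg -> g = g' /\ forall c, inner p q c -> w c = w' c.
Proof.
move: {2}(rank p q) (leqnn (rank p q)) => k; elim: k p q g g' w w' sg => [|k IH] p q g g' w w' sg rk gD gD' s0.
 have z c : ~ inner p q c by move=> /rank_above; move: rk; rewrite leqn0 => /eqP->.
 have [pc qc gl /andP[_ s1] _] := gD; have [_ _ gl' _ _] := gD'.
 rewrite !tht0; try by move=> c /z.
 move=> /(mv_inj pc qc gl gl') []; [slra|slra|slra|by right|by move=> -> _; split=> // c /z].
have [pc qc gl /andP[_ s1] wD] := gD; have [_ _ gl' _ wD'] := gD'.
(* A line moved for the full time sg / 2 never equals a broken line moved for the shorter time (sg -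
   w2 r) / 2. *)
have zt w1 w2 g1 g2 r : thd p q g1 w1 sg -> thd p q g2 w2 sg ->
  tht p q g1 w1 sg = mv p q g1 (sg / 2) -> inner p q r -> 0 < w2 r -> thd p q g2 w2 (w2 r) ->
  brk p q (tht p q g2 w2 (w2 r)) -> tht p q g2 w2 sg = mv p q (tht p q g2 w2 (w2 r)) ((sg - w2 r) / 2) ->
  tht p q g1 w1 sg = tht p q g2 w2 sg -> False.
 move=> [_ _ l1 _ _] [_ _ l2 _ W2] -> ri wr D2 B2 -> /esym.
 have [/andP[_ ws] _] := W2 r ri.
 move=> /(mv_inj pc qc (tht_line D2) l1) []; [slra|slra|slra|by left|move=> _; slra].
have [[w0 E]|[r [rt D gr B E]]] := tht_form gD s0; have [[w0' E']|[r' [rt' D' gr' B' E']]] := tht_form gD' s0.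
- rewrite E E' => /(mv_inj pc qc gl gl') []; [slra|slra|slra|by right|move=> -> _; split=> // c ci].
 by rewrite w0// w0'.
- by move=> /(zt _ _ _ _ _ gD gD' E rt'.1 rt'.2.1 D' B' E').
- by move=> /esym/(zt _ _ _ _ _ gD' gD E' rt.1 rt.2.1 D B E).
have [ri [r0 rm]] := rt; have [ri' [r0' rm']] := rt'.
have [/andP[_ ws] _] := wD r ri; have [/andP[_ ws'] _] := wD' r' ri'.
have tl := tht_line D; have tl' := tht_line D'.
rewrite E E' => EE.
have [TE ee] : tht p q g w (w r) = tht p q g' w' (w' r') /\ (sg - w r) / 2 = (sg - w' r') / 2.
 have [h|h] := leP ((sg - w r) / 2) ((sg - w' r') / 2).
  by move: EE => /(mv_inj pc qc tl tl') []; [slra|done|slra|by left|].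
 by move: EE => /esym /(mv_inj pc qc tl' tl) []; [slra|exact: ltW|slra|by left|].
have wE : w r = w' r' by slra.
clear E E' EE ee; rewrite -wE in D' TE; have wr' : w r' = w r.
 by apply/(tht_break D r0 ri'); rewrite TE; apply/(tht_break D' r0 ri').
have gr2 : g (f r') = r' by have [_] := wD r' ri'; apply; rewrite wr' lt0r_neq0.
move: TE; rewrite (tht_join D ri' gr2 wr') (tht_join D' ri' gr' (esym wE)) => JE.
have Da : thd p r' (abv r' g) w (w r) by rewrite -wr'; apply: (thd_above D) => // c /rm; rewrite wr'.
have Db : thd r' q (blw r' g) w (w r) by rewrite -wr'; apply: (thd_below D) => // c /rm; rewrite wr'.
have Da' : thd p r' (abv r' g') w' (w r) by rewrite wE; rewrite wE in D'; exact: (thd_above D').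
have Db' : thd r' q (blw r' g') w' (w r) by rewrite wE; rewrite wE in D'; exact: (thd_below D').
have [||ga wa] := IH _ _ _ _ _ _ _ _ Da Da' r0.
- exact: (rank_aboveS rk).
- have := congr1 (abv r') JE; by rewrite (above_join _ (tht_line Da)) (above_join _ (tht_line Da')).
have [||gb wb] := IH _ _ _ _ _ _ _ _ Db Db' r0.
- exact: (rank_belowS rk).
- have := congr1 (blw r') JE; by rewrite (below_join (tht_line Da) (tht_line Db)) (below_join (tht_line Da') (tht_line Db')).
split; first by rewrite -(join_above_below G r' g) ga gb join_above_below.
move=> c ci; have [/wa//|/wb//|fc] := inner_split ri' ci.
have [->|cr] := pselect (c = r'); first by rewrite wr'.
(* Another critical point at the height of r' has weight 0, because the line is at r' there. *)
have z u (v : M -> R) : u (f r') = r' -> (v c != 0 -> u (f c) = c) -> v c = 0.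
 by move=> ur vc; apply/eqP/negPn/negP => /vc; rewrite fc ur => /esym.
have [_ h] := wD c ci; have [_ h'] := wD' c ci.
by rewrite (z g w)// (z g' w').
Qed.

(** Either y is the position of some x at the full time sg / 2, with all weights 0, or it is the
    position of a broken b at an earlier time e. Then b is cut at a break r, which gets the weight
    sg - 2 * e, and its two parts are reached by induction with this number as threshold. *)
Lemma tht_onto p q y sg : crit G p -> crit G q -> line p q y -> 0 < sg <= 1 ->
 exists g w, thd p q g w sg /\ tht p q g w sg = y.
Proof.
move: {2}(rank p q) (leqnn (rank p q)) => k; elim: k p q y sg => [|k IH] p q y sg rk pc qc yl /andP[s0 s1].
all: have [||[x xl ye]|[b [e [[bl [r [rc qr rp br]]] e0 e1 ye]]]] := @mv_onto p q y (sg / 2) pc qc yl; [slra|slra|..].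
- exists x, (fun _ => 0); split; last by rewrite tht0.
 by split=> //; [rewrite ltW|move=> c _; rewrite lexx ltW// eqxx].
- have ri : inner p q r by split=> //; rewrite qr.
 by have := rank_above ri; move: rk; rewrite leqn0 => /eqP->.
- exists x, (fun _ => 0); split; last by rewrite tht0.
 by split=> //; [rewrite ltW|move=> c _; rewrite lexx ltW// eqxx].
have ri : inner p q r by split=> //; rewrite qr.
have [om omE] : exists om : R, om = sg - 2 * e by eexists.
have o0 : 0 < om by slra.
have os : om <= sg by slra.
have oi : 0 < om <= 1 by rewrite o0 (le_trans os).
have [||g1 [w1 [D1 E1]]] := IH p r (abv r b) om _ pc rc _ oi.
- exact: (rank_aboveS rk).
- by apply: (line_above hM rc bl) => //; rewrite !ltW.
have [||g2 [w2 [D2 E2]]] := IH r q (blw r b) om _ rc qc _ oi.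
- exact: (rank_belowS rk).
- by apply: (line_below hM rc bl) => //; rewrite !ltW.
have [_ _ l1 _ W1] := D1; have [_ _ l2 _ W2] := D2.
(* The weights of the two parts are combined; critical points at the height of r other than r fall
   under the last case and get 0. *)
have [w wE] : exists w : M -> R, w = fun c => if `[< c = r >] then om else if `[< inner p r c >] then w1 c
  else if `[< inner r q c >] then w2 c else 0 by eexists.
have wr : w r = om by rewrite wE; case: asboolP.
have wa c : inner p r c -> w c = w1 c.
 move=> ci; rewrite wE; case: asboolP => [cr|_]; last by case: asboolP.
 by case: ci => _; rewrite cr ltxx.
have wb c : inner r q c -> w c = w2 c.
 move=> ci; rewrite wE; case: asboolP => [cr|_]; first by case: ci => _; rewrite cr ltxx andbF.
 case: asboolP => [[_ /andP[h1 _]]|_]; last by case: asboolP.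
 by case: ci => _ /andP[_ h2]; have := lt_trans h1 h2; rewrite ltxx.
have w0 c : c <> r -> f c = f r -> w c = 0.
 move=> cr fc; rewrite wE; case: asboolP => // _.
 case: asboolP => [[_]|_]; first by rewrite fc ltxx.
 by case: asboolP => // -[_]; rewrite fc ltxx andbF.
have gl : line p q (jnG r g1 g2) by exact: line_join l1 l2.
have gr : jnG r g1 g2 (f r) = r by exact: join_break l1.
have D : thd p q (jnG r g1 g2) w sg.
 split=> //; first by rewrite ltW.
 move=> c ci; have [ca|cb|cr] := inner_split ri ci.
 - have [/andP[h1 h2] h3] := W1 c ca; rewrite wa// h1 (le_trans h2)//; split=> // /h3 gc.
  by rewrite /join; case: ca => _ /andP[/ltW -> _].
 - have [/andP[h1 h2] h3] := W2 c cb; rewrite wb// h1 (le_trans h2)//; split=> // /h3 gc.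
  by rewrite /join; case: cb => _ /andP[_]; rewrite leNgt => ->.
 - have [->|nr] := pselect (c = r); first by rewrite wr (ltW o0) os.
  by rewrite w0// lexx ltW// eqxx.
exists (jnG r g1 g2), w; split=> //; rewrite (tht_split D ri gr) wr; last first.
 move=> c ci; have [ca|cb|cr] := inner_split ri ci.
 - by have [/andP[_ h2] _] := W1 c ca; rewrite wa.
 - by have [/andP[_ h2] _] := W2 c cb; rewrite wb.
 - by have [->|nr] := pselect (c = r); rewrite ?wr// w0// ltW.
rewrite (above_join _ l1) (below_join l1 l2) (tht_congr _ _ wa) (tht_congr _ _ wb) E1 E2 join_above_below ye.
by congr mv; slra.
Qed.

(** The interface through which the smoothing construction is used from here on. *)
Record blending (th : M -> M -> crv -> (M -> R) -> R -> crv) : Prop := Blending {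
 blend_line : forall p q g w sg, thd p q g w sg -> line p q (th p q g w sg);
 blend_cont : forall p q, crit G p -> crit G q ->
  cts (tht_set p q) (fun z => th p q z.1.1 z.1.2 z.2 : crv);
 blend_join : forall p q g w sg r, thd p q g w sg -> inner p q r -> g (f r) = r -> w r = sg ->
  th p q g w sg = jnG r (th p r (abv r g) w sg) (th r q (blw r g) w sg);
 blend_break : forall p q g w sg r, thd p q g w sg -> 0 < sg -> inner p q r ->
  th p q g w sg (f r) = r <-> w r = sg;
 blend_inj : forall p q g g' w w' sg, thd p q g w sg -> thd p q g' w' sg -> 0 < sg ->
  th p q g w sg = th p q g' w' sg -> g = g' /\ forall c, inner p q c -> w c = w' c;
 blend_onto : forall p q y sg, crit G p -> crit G q -> line p q y -> 0 < sg <= 1 ->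
  exists g w, thd p q g w sg /\ th p q g w sg = y;
 blend_congr : forall p q g w w' sg, (forall c, inner p q c -> w c = w' c) -> th p q g w sg = th p q g w' sg }.

Lemma tht_blending : blending tht.
Proof.
split; [exact: tht_line|exact: tht_cts|exact: tht_join|exact: tht_break|exact: tht_inj|exact: tht_onto|exact: tht_congr].
Qed.

End Theta.

(** * Masses determined by weights and mean height *)

Section MassProfile.
Context (R : realType) (I : choiceType) (F s : I -> R) (q : I).

(* If A is the mass above r and s_r = t_r / (t_r + A B), B the mass below r, then A + t_r = step s_r A. *)
Definition step (sg A : R) : R := A / (1 - sg * (1 - A)).

Lemma step_den (sg A : R) : 0 <= sg < 1 -> 0 <= A <= 1 -> 0 < 1 - sg * (1 - A).
Proof. by move=> /andP[s0 s1] /andP[A0 A1]; nra. Qed.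

Lemma step_ge (sg A : R) : 0 <= sg < 1 -> 0 <= A <= 1 -> A <= step sg A.
Proof.
move=> si Ai; have d := step_den si Ai; rewrite /step ler_pdivlMr//.
by move: si Ai => /andP[s0 s1] /andP[A0 A1]; rewrite ler_piMr//; nra.
Qed.

Lemma step_le1 (sg A : R) : 0 <= sg < 1 -> 0 <= A <= 1 -> step sg A <= 1.
Proof.
move=> si Ai; have d := step_den si Ai; rewrite /step ler_pdivrMr// mul1r.
by move: si Ai => /andP[s0 s1] /andP[A0 A1]; nra.
Qed.

Lemma step_lt1 (sg A : R) : 0 <= sg < 1 -> 0 <= A -> A < 1 -> step sg A < 1.
Proof.
move=> si A0 A1; have d : 0 < 1 - sg * (1 - A) by apply: step_den => //; rewrite A0 ltW.
by rewrite /step ltr_pdivrMr// mul1r; move: si => /andP[s0 s1]; nra.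
Qed.

Lemma step_rg (sg A : R) : 0 <= sg < 1 -> 0 <= A <= 1 -> 0 <= step sg A <= 1.
Proof.
move=> si Ai; have /andP[A0 _] := Ai; rewrite step_le1// andbT; exact: le_trans A0 (step_ge si Ai).
Qed.

Lemma step_mono (sg A A' : R) : 0 <= sg < 1 -> 0 <= A -> A < A' -> A' <= 1 -> step sg A < step sg A'.
Proof.
move=> si A0 AA A1; have /andP[s0 s1] := si.
have d : 0 < 1 - sg * (1 - A) by apply: step_den => //; rewrite A0 ltW// (lt_le_trans AA).
have d' : 0 < 1 - sg * (1 - A') by apply: step_den => //; rewrite A1 (le_trans A0) ?ltW.
by rewrite /step ltr_pdivrMr// mulrAC ltr_pdivlMr//; nra.
Qed.

Lemma step_cts (sg : R) : 0 <= sg < 1 -> cts [set A : R | 0 <= A <= 1] (step sg : R -> R).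
Proof.
move=> si; rewrite /step; apply: ctsM; first exact: cts_id.
apply: ctsV => [|A Ai]; last by rewrite gt_eqF// step_den.
apply: ctsB; first exact: cts_cst.
apply: ctsM; first exact: cts_cst.
by apply: ctsB; [exact: cts_cst|exact: cts_id].
Qed.

(** The system for the masses t when the weights s and the mass A at the top are given: at each r
    the cumulated mass above r jumps to its image under [step], and the total is 1. For a descending
    list it is solved from the top down, by [prof_cons]. *)
Definition prof (A : R) (rs : seq I) (t : I -> R) : Prop :=
 (forall r, r \in rs -> A + \sum_(c <- rs | F r < F c) t c + t r = step (s r) (A + \sum_(c <- rs | F r < F c) t c)) /\
 A + \sum_(c <- rs) t c + t q = 1.

Fixpoint desc (rs : seq I) : Prop :=
 if rs is r :: rs' then (forall c, c \in rs' -> F c < F r) /\ desc rs' else True.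

Lemma prof_cons A r rs t : (forall c, c \in rs -> F c < F r) ->
 prof A (r :: rs) t <-> A + t r = step (s r) A /\ prof (step (s r) A) rs t.
Proof.
move=> dr.
have hd : \sum_(c <- r :: rs | F r < F c) t c = 0.
 by rewrite big_cons ltxx big1_seq// => c /andP[rc /dr]; rewrite ltNge (ltW rc).
have tl c : c \in rs -> \sum_(c0 <- r :: rs | F c < F c0) t c0 = t r + \sum_(c0 <- rs | F c < F c0) t c0.
 by move=> /dr cr; rewrite big_cons cr.
split=> [[eqs tot]|[e [eqs tot]]].
 have e := eqs r (mem_head _ _); rewrite hd addr0 in e; split=> //; split=> [c crs|].
  have := eqs c; rewrite inE crs orbT => /(_ isT).
  by rewrite tl// !addrA e.
 by rewrite -e -tot big_cons !addrA.
split=> [c|]; last by rewrite -tot big_cons -e !addrA.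
by rewrite inE => /orP[/eqP->|crs]; rewrite ?hd ?addr0// tl// !addrA e eqs.
Qed.

(** A larger mass at the top gives larger cumulated masses at all heights, since [step] is
    increasing. The total being 1, mass has moved upwards, so the mean height grows. *)
Lemma prof_mono A A' (phi : R) rs t t' : desc rs -> (forall c, c \in rs -> 0 <= s c < 1) ->
 (forall c, c \in rs -> F c < phi) -> (forall c, c \in rs -> F q < F c) -> F q < phi ->
 0 <= A -> A < A' -> A' <= 1 -> prof A rs t -> prof A' rs t' ->
 A * phi + \sum_(c <- rs) t c * F c + t q * F q < A' * phi + \sum_(c <- rs) t' c * F c + t' q * F q.
Proof.
elim: rs A A' phi => [|r rs IH] A A' phi.
 move=> _ _ _ _ qp A0 AA A1 [_]; rewrite !big_nil addr0 => e [_]; rewrite !big_nil !addr0 => e'; nra.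
move=> [dr drs] sr lp gq qp A0 AA A1 /(prof_cons _ _ dr)[e P] /(prof_cons _ _ dr)[e' P'].
have si := sr r (mem_head _ _).
have sr' c : c \in rs -> 0 <= s c < 1 by move=> ci; apply: sr; rewrite inE ci orbT.
have gq' c : c \in rs -> F q < F c by move=> ci; apply: gq; rewrite inE ci orbT.
have A0' : 0 <= step (s r) A by apply: (le_trans A0); apply: step_ge => //; rewrite A0 (le_trans (ltW AA)).
have A1' : step (s r) A' <= 1 by apply: step_le1 => //; rewrite A1 (le_trans A0 (ltW AA)).
have := IH _ _ (F r) drs sr' dr gq' (gq r (mem_head _ _)) A0' (step_mono si A0 AA A1) A1' P P'.
have rp := lp r (mem_head _ _).
have : A * (phi - F r) < A' * (phi - F r) by rewrite ltr_pM2r ?subr_gt0.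
by rewrite !big_cons -e -e' !mulrDl !mulrBr; clear; lra.
Qed.

Lemma prof_uniq A rs t t' : desc rs -> prof A rs t -> prof A rs t' -> t q = t' q /\ forall c, c \in rs -> t c = t' c.
Proof.
elim: rs A => [|r rs IH] A; first by move=> _ [_]; rewrite !big_nil => e [_]; rewrite !big_nil => e'; split=> //; lra.
move=> [dr drs] /(prof_cons _ _ dr)[e P] /(prof_cons _ _ dr)[e' P'].
have [tq tr] := IH _ drs P P'; split=> // c; rewrite inE => /orP[/eqP->|/tr//].
by apply: (addrI A); rewrite e e'.
Qed.

(** Solving from the top down expresses all masses through iterated [step] functions of A, so the
    mean height is continuous in A. *)
Lemma prof_ex rs : desc rs -> uniq rs -> q \notin rs -> (forall c, c \in rs -> 0 <= s c < 1) ->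
 exists T : R -> I -> R, [/\ (forall A : R, 0 <= A <= 1 -> prof A rs (T A)),
  (forall (A : R) c, 0 <= A <= 1 -> 0 <= T A c), (forall (A : R) c, c != q -> c \notin rs -> T A c = 0),
  (forall A : R, 0 <= A -> A < 1 -> 0 < T A q) &
  cts [set A : R | 0 <= A <= 1] (fun A => \sum_(c <- rs) T A c * F c + T A q * F q)].
Proof.
elim: rs => [|r rs IH] /=.
 move=> _ _ _ _; exists (fun A c => if c == q then 1 - A else 0); rewrite eqxx; split=> //.
 - by move=> A Ai; split=> //; rewrite big_nil eqxx; lra.
 - by move=> A c /andP[A0 A1]; case: eqP => // _; lra.
 - by move=> A c /negbTE ->.
 - by move=> A A0 A1; lra.
 - apply: (cts_eq (f := fun A : R => (1 - A) * F q)); first by move=> A _; rewrite big_nil add0r.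
  by apply: ctsM; [apply: ctsB; [exact: cts_cst|exact: cts_id]|exact: cts_cst].
move=> [dr drs] /andP[rrs urs]; rewrite inE negb_or => /andP[qr qrs] sr.
have si := sr r (mem_head _ _).
have [|T [T1 T2 T3 T4 T5]] := IH drs urs qrs; first by move=> c ci; apply: sr; rewrite inE ci orbT.
pose T' (A : R) c := if c == r then step (s r) A - A else T (step (s r) A) c.
have TE A c : c \in rs -> T' A c = T (step (s r) A) c.
 by move=> crs; rewrite /T'; case: eqP => // cr; move: rrs; rewrite -cr crs.
have TQ A : T' A q = T (step (s r) A) q by rewrite /T' (negbTE qr).
have SE A P : \sum_(c <- rs | P c) T' A c = \sum_(c <- rs | P c) T (step (s r) A) c.
 by rewrite big_seq_cond [RHS]big_seq_cond; apply: eq_bigr => c /andP[/(TE A)].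
exists T'; split.
- move=> A Ai; apply/prof_cons => //; split; first by rewrite /T' eqxx; qlra.
 have [P1 P2] := T1 _ (step_rg si Ai); split=> [c crs|].
  rewrite TE// SE; exact: P1.
 by rewrite TQ SE.
- move=> A c Ai; rewrite /T'; case: eqP => _; first by rewrite subr_ge0 step_ge.
 exact/T2/step_rg.
- move=> A c cq; rewrite inE negb_or => /andP[/negbTE cr crs]; rewrite /T' cr; exact: T3.
- move=> A A0 A1; rewrite TQ; apply: T4; last exact: step_lt1.
 by apply: (le_trans A0); apply: step_ge => //; rewrite A0 ltW.
- apply: (cts_eq (f := fun A : R => (step (s r) A - A) * F r + (\sum_(c <- rs) T (step (s r) A) c * F c + T (step (s r) A) q * F q))).
  move=> A _; rewrite TQ big_cons {1}/T' eqxx -addrA; congr (_ + (_ + _)).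
  by apply: eq_big_seq => c /(TE A) ->.
 apply: ctsD.
  apply: ctsM; last exact: cts_cst.
  by apply: ctsB; [exact: step_cts|exact: cts_id].
 apply: (@cts_comp _ _ _ _ [set A : R | 0 <= A <= 1] (step (s r)) (fun A => \sum_(c <- rs) T A c * F c + T A q * F q)).
 - exact: step_cts.
 - by move=> A; exact: step_rg.
 - exact: T5.
Qed.

(** The mean height is F q for A = 0, when all mass is at the bottom, and phi for A = 1; the
    intermediate value theorem provides the mass at the top. *)
Lemma prof_hgt rs (phi h : R) : desc rs -> uniq rs -> q \notin rs -> (forall c, c \in rs -> 0 <= s c < 1) ->
 F q < h -> h < phi ->
 exists A t, 0 < A < 1 /\ [/\ prof A rs t, (forall c, 0 <= t c), (forall c, c != q -> c \notin rs -> t c = 0), 0 < t q &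
  A * phi + \sum_(c <- rs) t c * F c + t q * F q = h].
Proof.
move=> drs urs qrs sr qh hp; have [T [T1 T2 T3 T4 T5]] := prof_ex drs urs qrs sr.
pose H (A : R) : R := A * phi + (\sum_(c <- rs) T A c * F c + T A q * F q).
have Hc : {within `[0, 1], continuous H}.
 apply/subspace_continuousP => A; rewrite /= in_itv/= => Ai.
 have Hc : cts [set A : R | 0 <= A <= 1] H.
  by apply: ctsD => //; apply: ctsM; [exact: cts_id|exact: cts_cst].
 by move=> W HW; have := Hc A W Ai HW; apply: filterS => B K; rewrite /= in_itv/=; exact: K.
have H1 : H 1 = phi.
 have [|P1 P2] := T1 1; first by rewrite ler01 lexx.
 have T0 c : 0 <= T 1 c by apply: T2; rewrite ler01 lexx.
 have sum0 : \sum_(c <- rs) T 1 c = 0.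
  have : 0 <= \sum_(c <- rs) T 1 c by apply: sumr_ge0 => c _; exact: T0.
  by have := T0 q; qlra.
 have Tq0 : T 1 q = 0 by move: P2; rewrite sum0; qlra.
 rewrite /H Tq0 mul0r addr0 mul1r big1_seq ?addr0// => c /andP[_ crs].
 have := sum0; rewrite (big_rem c crs)/= => e.
 have e2 : 0 <= \sum_(y <- rem c rs) T 1 y by apply: sumr_ge0 => y _; exact: T0.
 have -> : T 1 c = 0 by have := T0 c; qlra.
 by rewrite mul0r.
have H0 : H 0 = F q.
 have [|P1 P2] := T1 0; first by rewrite ler01 lexx.
 have Z c : c \in rs -> T 0 c = 0.
  have : forall rs', desc rs' -> (forall t, prof 0 rs' t -> forall c, c \in rs' -> t c = 0).
   elim=> // r rs' IH [dr drs'] t /(prof_cons _ _ dr)[e]; rewrite /step mul0r in e *.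
   by rewrite add0r in e; move=> P c'; rewrite inE => /orP[/eqP->//|]; exact: IH.
  by move=> K; apply: K.
 have sum0 : \sum_(c <- rs) T 0 c = 0 by apply: big1_seq => c /andP[_ /Z].
 rewrite /H mul0r add0r big1_seq ?add0r => [|c /andP[_ /Z ->]]; last by rewrite mul0r.
 by move: P2; rewrite sum0 !add0r => ->; rewrite mul1r.
have [|A Ai HA] := @IVT _ H 0 1 h ler01 Hc.
 by rewrite H0 H1 ge_min le_max (ltW qh) (ltW hp) orbT.
move: Ai; rewrite in_itv/= => Ai; have /andP[A0 A1] := Ai.
have {}A0 : 0 < A by rewrite lt_neqAle A0 andbT; apply/eqP => e; move: HA; rewrite -e H0 => e'; move: qh; rewrite e' ltxx.
have {}A1 : A < 1 by rewrite lt_neqAle A1 andbT; apply/eqP => e; move: HA; rewrite e H1 => e'; move: hp; rewrite e' ltxx.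
exists A, (T A); split; first by rewrite A0.
split=> //; [exact: T1|by move=> c; exact: T2|by move=> c; exact: T3|exact/T4/A1/ltW|].
by rewrite -HA /H addrA.
Qed.

Lemma desc_sort (l : seq I) : uniq l -> {in l &, injective F} ->
 exists rs, [/\ perm_eq rs l, uniq rs & desc rs].
Proof.
move=> ul Finj; pose le := [rel a b | F b <= F a].
have let_ : transitive le by move=> a b c /= ba ac; exact: le_trans ac ba.
have letot : total le by move=> a b; exact: le_total.
exists (sort le l); have us : uniq (sort le l) by rewrite sort_uniq.
split=> //; first by rewrite perm_sort.
have : {subset sort le l <= l} by move=> c; rewrite mem_sort.
elim: (sort le l) (sort_sorted letot l) us => //= r rs IH so /andP[rrs urs] sl.
have sl' : {subset rs <= l} by move=> c ci; apply: sl; rewrite inE ci orbT.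
split; last exact: IH (path_sorted so) urs sl'.
move=> c ci; have := allP (order_path_min let_ so) c ci; rewrite /= lt_neqAle => ->; rewrite andbT.
by apply: contraNneq rrs => /(Finj _ _ (sl' c ci) (sl r (mem_head _ _))) <-.
Qed.

End MassProfile.

(** * From lines with masses to points of [M] *)

Section Evaluation.
Context (R : realType) (M : topologicalType) (hM : hausdorff_space M) (cM : compact [set: M]) (G : gradlike R M).
Notation line := (line cM G).
Notation f := (hgt G).
Notation abv := (above G).
Notation blw := (below G).
Notation jnG := (join G).
Notation alf := (alf cM G).
Notation omg := (omg cM G).
Notation inner := (inner G).
Notation thd := (thd cM G).
Notation crv := (prod_topology (fun _ : R => M)).
Context (cs : seq M) (csE : crit G = [set` cs]) (cs_uniq : uniq cs) (th : M -> M -> crv -> (M -> R) -> R -> crv)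
 (thB : blending cM G th).

Definition up (t : M -> R) (r : M) : R := \sum_(c <- cs | f r < f c) t c.
Definition rest (t : M -> R) (r : M) : R := 1 - up t r - t r.
(** Division by zero makes this 0 where r has no mass and one of the masses above and below
    vanishes. The form without quotient, [shr_rel], stays valid there. *)
Definition shr (t : M -> R) (r : M) : R := t r / (t r + up t r * rest t r).
Definition level (t : M -> R) : R := \sum_(c <- cs) t c * f c.

Record mass (g : R -> M) (t : M -> R) : Prop := Mass {
 mass_ge0 : forall c, 0 <= t c;
 mass1 : \sum_(c <- cs) t c = 1;
 mass_supp : forall c, t c != 0 -> crit G c /\ g (f c) = c }.

(** Both ends carry mass. Any line with masses is brought into this form by cutting it at its
    extreme points with mass, see [span_weighted]. *)
Definition wtd (P Q : M) (g : R -> M) (t : M -> R) : Prop :=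
 [/\ crit G P, crit G Q, line P Q g, mass g t & 0 < t P /\ 0 < t Q].

Definition Phi (P Q : M) (g : R -> M) (t : M -> R) : M := th P Q g (shr t) 1 (level t).

Lemma cs_crit c : crit G c -> c \in cs. Proof. by rewrite csE. Qed.

Lemma up_ge0 g t r : mass g t -> 0 <= up t r.
Proof. by move=> tm; apply: sumr_ge0 => c _; exact: mass_ge0 tm c. Qed.

Lemma restE g t r : mass g t -> rest t r = \sum_(c <- cs | ~~ (f r < f c)) t c - t r.
Proof.
move=> tm; rewrite /rest /up -(mass1 tm) (bigID (fun c => f r < f c))/=; congr (_ - _).
by rewrite addrAC subrr add0r.
Qed.

Lemma rest_ge0 g t r : mass g t -> 0 <= rest t r.
Proof.
move=> tm; rewrite (restE r tm) subr_ge0.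
have [rcs|rcs] := boolP (r \in cs); last first.
 have -> : t r = 0 by apply/eqP/negPn/negP => /(mass_supp tm)[/cs_crit]; rewrite (negbTE rcs).
 by apply: sumr_ge0 => c _; exact: mass_ge0 tm c.
rewrite (big_rem r)//= ltxx/= lerDl; apply: sumr_ge0 => c _; exact: mass_ge0 tm c.
Qed.

Lemma up_gt0 g t r c : mass g t -> 0 < t c -> f r < f c -> 0 < up t r.
Proof.
move=> tm tc rc; have [|cc _] := mass_supp tm (c := c); first by rewrite gt_eqF.
rewrite /up (big_rem c) ?cs_crit//= rc ltr_pwDl//; apply: sumr_ge0 => ? _; exact: mass_ge0 tm _.
Qed.

Lemma rest_gt0 g t r c : mass g t -> 0 < t c -> f c < f r -> crit G r -> 0 < rest t r.
Proof.
move=> tm tc cr rc; have [|cc _] := mass_supp tm (c := c); first by rewrite gt_eqF.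
rewrite (restE r tm) subr_gt0.
rewrite (big_rem r) ?cs_crit//= ltxx/= ltrDl (big_rem c)/=; last first.
 by rewrite mem_rem_uniq// inE cs_crit// andbT; apply/eqP => e; move: cr; rewrite e ltxx.
rewrite -leNgt (ltW cr) ltr_pwDl//; apply: sumr_ge0 => ? _; exact: mass_ge0 tm _.
Qed.

Lemma shr_rg g t r : mass g t -> 0 <= shr t r <= 1.
Proof.
move=> tm; have t0 := mass_ge0 tm r; have ur := mulr_ge0 (up_ge0 r tm) (rest_ge0 r tm).
have d0 : 0 <= t r + up t r * rest t r by exact: addr_ge0.
rewrite /shr divr_ge0//=; have [e|ne] := eqVneq (t r + up t r * rest t r) 0.
 by rewrite e invr0 mulr0.
by rewrite ler_pdivrMr ?mul1r ?lerDl// lt_neqAle eq_sym ne.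
Qed.

Lemma shr_rel g t r : mass g t -> shr t r * (t r + up t r * rest t r) = t r.
Proof.
move=> tm; have t0 := mass_ge0 tm r; have ur := mulr_ge0 (up_ge0 r tm) (rest_ge0 r tm).
have [e|ne] := eqVneq (t r + up t r * rest t r) 0; last by rewrite divfK.
by rewrite e mulr0; apply/eqP; rewrite eq_le t0 -e lerDl ur.
Qed.

Lemma shr_uniq t r (s : R) : 0 < t r + up t r * rest t r -> s * (t r + up t r * rest t r) = t r -> s = shr t r.
Proof. by move=> d0 e; rewrite /shr -{1}e mulfK// gt_eqF. Qed.

Lemma shr_dom P Q g t : wtd P Q g t -> thd P Q g (shr t) 1.
Proof.
move=> [Pc Qc gl tm _]; split=> //; first by rewrite lexx ler01.
move=> c _; rewrite (shr_rg c tm); split=> // sc.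
have [] // := mass_supp tm (c := c); apply: contraNneq sc => e; by rewrite /shr e mul0r.
Qed.

Lemma brk_list P Q g : exists rs : seq M, [/\ uniq rs, desc f rs & forall c, c \in rs <-> inner P Q c /\ g (f c) = c].
Proof.
pose l := [seq c <- cs | `[< inner P Q c /\ g (f c) = c >]].
have lP c : c \in l <-> inner P Q c /\ g (f c) = c.
 rewrite mem_filter; split=> [/andP[/asboolP]//|H].
 by apply/andP; split; [exact/asboolP|exact/cs_crit/H.1.1].
have [||rs [rsl urs drs]] := @desc_sort R M f l; [by rewrite filter_uniq|by move=> c d /lP[_ gc] /lP[_ gd] e; rewrite -gc e gd|].
 by exists rs; split=> // c; rewrite (perm_mem rsl).
Qed.

Lemma supp_sum (t : M -> R) (L : seq M) (F : M -> R) : uniq L -> (forall c, c \in L -> crit G c) ->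
 (forall c, c \notin L -> t c = 0) -> \sum_(c <- cs) t c * F c = \sum_(c <- L) t c * F c.
Proof.
move=> uL Lc t0; transitivity (\sum_(c <- cs | c \in L) t c * F c).
 by rewrite [RHS]big_mkcond; apply: eq_bigr => c _; case: ifPn => // /t0 ->; rewrite mul0r.
rewrite -big_filter; apply: perm_big; apply: uniq_perm; rewrite ?filter_uniq// => c.
by rewrite mem_filter; apply/andP/idP => [[]//|cL]; split=> //; exact/cs_crit/Lc.
Qed.

Lemma wtd_sum P Q g t rs (F : M -> R) : wtd P Q g t -> f Q < f P -> uniq rs ->
 (forall c, c \in rs <-> inner P Q c /\ g (f c) = c) ->
 \sum_(c <- cs) t c * F c = t P * F P + \sum_(c <- rs) t c * F c + t Q * F Q.
Proof.
move=> [Pc Qc gl tm [tP tQ]] QP urs rsP.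
have Prs : P \notin rs by apply/negP => /rsP[[_]]; rewrite ltxx andbF.
have Qrs : Q \notin rs by apply/negP => /rsP[[_]]; rewrite ltxx.
pose L := P :: Q :: rs.
have uL : uniq L by rewrite /= inE negb_or Prs Qrs urs !andbT; apply/eqP => e; move: QP; rewrite e ltxx.
rewrite (supp_sum F uL) => [|c|c]; first by rewrite !big_cons -[RHS]addrA; congr (_ + _); rewrite addrC.
 by rewrite !inE => /or3P[/eqP->|/eqP->|/rsP[[]]].
rewrite !inE !negb_or => /and3P[/eqP cP /eqP cQ /negP crs]; apply/eqP/negPn/negP => tc; apply: crs.
have [cc gc] := mass_supp tm tc; have := line_ge (f c) gl; rewrite gc => /andP[Qf fP].
apply/rsP; split=> //; split=> //; rewrite !lt_neqAle Qf fP !andbT; apply/andP; split; apply/eqP => e.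
 by apply: cQ; rewrite -gc -e (line0 gl).
by apply: cP; rewrite -gc e (line1 gl).
Qed.

Lemma wtd_total P Q g t rs : wtd P Q g t -> f Q < f P -> uniq rs ->
 (forall c, c \in rs <-> inner P Q c /\ g (f c) = c) -> t P + \sum_(c <- rs) t c + t Q = 1.
Proof.
move=> tw QP urs rsP; have := wtd_sum (fun=> 1) tw QP urs rsP; have [_ _ _ tm _] := tw.
by under eq_bigr do rewrite mulr1; under [in RHS]eq_bigr do rewrite mulr1; rewrite (mass1 tm) !mulr1.
Qed.

Lemma step_iff (s A t : R) : 0 <= s < 1 -> 0 <= A <= 1 ->
 A + t = step s A <-> s * (t + A * (1 - A - t)) = t.
Proof.
move=> si Ai; have d := step_den si Ai; rewrite /step; split=> [e|e].
 have {}e : (A + t) * (1 - s * (1 - A)) = A by rewrite e divfK// gt_eqF.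
 by lra.
by apply: (canRL (mulfK _)); [rewrite gt_eqF|lra].
Qed.

(** Both ends carry mass, so the denominator of [shr] is positive at an inner break, and there the
    formula for the weight and the [step] equation are equivalent. *)
Lemma wtd_prof P Q g t rs s : wtd P Q g t -> f Q < f P -> uniq rs ->
 (forall c, c \in rs <-> inner P Q c /\ g (f c) = c) ->
 (forall r, r \in rs -> 0 <= s r < 1) ->
 (forall r, r \in rs -> s r = shr t r) <-> prof f s Q (t P) rs t.
Proof.
move=> tw QP urs rsP si; have [Pc Qc gl tm [tP tQ]] := tw.
have upE r : r \in rs -> up t r = t P + \sum_(c <- rs | f r < f c) t c.
 move=> /rsP[[rc /andP[Qr rP]] gr].
 have := wtd_sum (fun c => if f r < f c then 1 else 0) tw QP urs rsP.
 have ind l : \sum_(c <- l) t c * (if f r < f c then 1 else 0) = \sum_(c <- l | f r < f c) t c.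
  by rewrite [RHS]big_mkcond; apply: eq_bigr => c _; case: (f r < f c); rewrite ?mulr1 ?mulr0.
 by rewrite !ind rP [f r < f Q]ltNge (ltW Qr)/= mulr1 mulr0 addr0.
have uprange r : r \in rs -> 0 <= up t r <= 1.
 move=> rr; rewrite (up_ge0 r tm)/=; have := rest_ge0 r tm; have := mass_ge0 tm r; rewrite /rest; lra.
have den r : r \in rs -> 0 < t r + up t r * rest t r.
 move=> /rsP[[rc /andP[Qr rP]] gr]; apply: ltr_wpDl; first exact: mass_ge0 tm r.
 by apply: mulr_gt0; [exact: up_gt0 tm tP rP|exact: rest_gt0 tm tQ Qr rc].
have tot := wtd_total tw QP urs rsP.
split=> [sE|[pE _] r rr].
 split=> // r rr; rewrite -upE//; apply/step_iff; [exact: si|exact: uprange|].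
 by rewrite sE// (shr_rel r tm).
apply: shr_uniq; first exact: den.
by have := pE r rr; rewrite -upE// => /step_iff; apply; [exact: si|exact: uprange].
Qed.

Lemma shr_lt1 P Q g t r : wtd P Q g t -> inner P Q r -> 0 <= shr t r < 1.
Proof.
move=> [Pc Qc gl tm [tP tQ]] [rc /andP[Qr rP]]; have /andP[-> _] := shr_rg r tm.
have ur : 0 < up t r * rest t r by apply: mulr_gt0; [exact: up_gt0 tm tP rP|exact: rest_gt0 tm tQ Qr rc].
have t0 := mass_ge0 tm r.
by rewrite /shr ltr_pdivrMr ?mul1r ?ltrDl// ltr_wpDl.
Qed.

Lemma level_rg P Q g t : wtd P Q g t -> f Q < f P -> f Q < level t < f P.
Proof.
move=> tw QP; have [rs [urs drs rsP]] := brk_list P Q g; have [Pc Qc gl tm [tP tQ]] := tw.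
have tot := wtd_total tw QP urs rsP.
rewrite /level (wtd_sum f tw QP urs rsP).
have lo : (\sum_(c <- rs) t c) * f Q <= \sum_(c <- rs) t c * f c.
 rewrite mulr_suml big_seq [X in _ <= X]big_seq; apply: ler_sum => c /rsP[[_ /andP[Qc' _]] _].
 by apply: ler_wpM2l; [exact: mass_ge0 tm c|exact: ltW].
have hi : \sum_(c <- rs) t c * f c <= (\sum_(c <- rs) t c) * f P.
 rewrite mulr_suml big_seq [X in _ <= X]big_seq; apply: ler_sum => c /rsP[[_ /andP[_ cP]] _].
 by apply: ler_wpM2l; [exact: mass_ge0 tm c|exact: ltW].
have e1 : t P * f Q < t P * f P by rewrite ltr_pM2l.
have e2 : t Q * f Q < t Q * f P by rewrite ltr_pM2l.
have eQ : f Q = (t P + \sum_(c <- rs) t c + t Q) * f Q by rewrite tot mul1r.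
have eP : f P = (t P + \sum_(c <- rs) t c + t Q) * f P by rewrite tot mul1r.
by apply/andP; split; [rewrite {1}eQ|rewrite [X in _ < X]eP]; rewrite !mulrDl; lra.
Qed.

Lemma unbroken_orbit P Q (c : R -> M) h : line P Q c -> (forall r, inner P Q r -> c (f r) <> r) -> f Q < h < f P ->
 [/\ f (c h) = h, ~ crit G (c h), alf (c h) = P, omg (c h) = Q & c = orbc cM G (c h)].
Proof.
move=> cl nb /andP[Qh hP]; have fh : f (c h) = h by rewrite (line_hgt cl)// !ltW.
have nc : ~ crit G (c h) by move=> k; apply: (nb (c h)); rewrite ?fh//; split=> //; rewrite fh Qh.
have aP : alf (c h) = P.
 have := line_ge (f (alf (c h))) cl; rewrite (line_alpha cl) => /andP[_].
 rewrite le_eqVlt => /orP[/eqP e|lt]; first by rewrite -(line_alpha cl) e (line1 cl).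
 case: (nb (alf (c h))); last exact: line_alpha cl h.
 split; first exact: alf_crit.
 by rewrite lt andbT (lt_trans Qh)// -{1}fh; exact: hgt_alf.
have oQ : omg (c h) = Q.
 have := line_ge (f (omg (c h))) cl; rewrite (line_omg cl) => /andP[+ _].
 rewrite le_eqVlt => /orP[/eqP e|lt]; first by rewrite -(line_omg cl) -e (line0 cl).
 case: (nb (omg (c h))); last exact: line_omg cl h.
 split; first exact: omg_crit.
 by rewrite lt/= (lt_trans _ hP)// -{2}fh; exact: hgt_omg.
split=> //; apply/funext => k; have [ol _] := orbit_line hM cM nc; rewrite aP oQ in ol.
have [kQ|Qk] := leP k (f Q); first by rewrite (line0 cl)// (line0 ol).
have [Pk|kP] := leP (f P) k; first by rewrite (line1 cl)// (line1 ol).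
by apply: (line_orbit hM cl nc); rewrite oQ aP !ltW.
Qed.

Lemma Phi_top P g t : wtd P P g t -> Phi P P g t = P.
Proof.
move=> tw; have tl := blend_line thB (shr_dom tw); rewrite /Phi.
by have [h|/ltW h] := leP (level t) (f P); [exact: line0 tl _ h|exact: line1 tl _ h].
Qed.

(** Mass at both ends makes all inner weights less than 1, so the smoothed line has no break: it is
    the closure of one orbit, and the point lies on this orbit. *)
Lemma Phi_orbit P Q g t : wtd P Q g t -> f Q < f P ->
 [/\ f (Phi P Q g t) = level t, ~ crit G (Phi P Q g t), alf (Phi P Q g t) = P, omg (Phi P Q g t) = Q &
  th P Q g (shr t) 1 = orbc cM G (Phi P Q g t)].
Proof.
move=> tw QP; apply: unbroken_orbit (blend_line thB (shr_dom tw)) _ (level_rg tw QP) => r ri.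
move/(blend_break thB (shr_dom tw) ltr01 ri) => e.
by have := shr_lt1 tw ri; rewrite e ltxx andbF.
Qed.

Lemma wtd_cases P Q g t : wtd P Q g t -> P = Q \/ f Q < f P.
Proof.
move=> [Pc Qc gl tm [tP tQ]]; have := line_le gl; rewrite le_eqVlt => /orP[/eqP e|]; last by right.
left; have [|_ gP] := mass_supp tm (c := P); first by rewrite gt_eqF.
by rewrite -gP -e (line0 gl).
Qed.

(** The orbit of the image returns all data. Its limits are P and Q; its closure is the smoothed
    line, from which [blend_inj] recovers g and the weights. Two mass profiles with the same weights
    and the same mean height have equal mass at the top by [prof_mono], hence coincide. *)
Lemma Phi_inj P Q g t P' Q' g' t' : wtd P Q g t -> wtd P' Q' g' t' -> Phi P Q g t = Phi P' Q' g' t' ->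
 [/\ P = P', Q = Q', g = g' & t = t'].
Proof.
(* When the ends coincide, the line is constant and all mass sits at one point. *)
have trivial A B g1 t1 : wtd A B g1 t1 -> A = B -> g1 = (fun=> A) /\ t1 = fun c => if c == A then 1 else 0.
 move=> [Ac Bc gl tm _] AB; rewrite -AB in gl.
 have gE h : g1 h = A by have [h1|/ltW h1] := leP h (f A); [exact: line0 gl _ h1|exact: line1 gl _ h1].
 split; first exact/funext.
 have t0 c : c != A -> t1 c = 0 by move=> cA; apply/eqP/negPn/negP => /(mass_supp tm)[_]; rewrite gE => /esym/eqP; rewrite (negbTE cA).
 apply/funext => c; case: eqP => [->|/eqP/t0//].
 have := mass1 tm; rewrite (big_rem A) ?cs_crit//= big1_seq ?addr0// => c' /andP[_].
 by rewrite mem_rem_uniq// inE => /andP[/t0].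
move=> tw tw'; have [e|QP] := wtd_cases tw; have [e'|QP'] := wtd_cases tw'.
- move: (tw) (tw'); rewrite -e -e' => /Phi_top -> /Phi_top -> PP; rewrite -PP.
 by have [-> ->] := trivial _ _ _ _ tw e; have [-> ->] := trivial _ _ _ _ tw' e'; rewrite PP.
- move: (tw); rewrite -e => /Phi_top -> E; have [_ nc _ _ _] := Phi_orbit tw' QP'.
 by case: nc; rewrite -E; have [] := tw.
- move: (tw'); rewrite -e' => /Phi_top -> E; have [_ nc _ _ _] := Phi_orbit tw QP.
 by case: nc; rewrite E; have [] := tw'.
move=> E; have [l1 _ a1 o1 c1] := Phi_orbit tw QP; have [l2 _ a2 o2 c2] := Phi_orbit tw' QP'.
rewrite E a2 in a1; rewrite E o2 in o1; rewrite E l2 in l1; rewrite E -c2 in c1; rewrite -a1 -o1 in tw QP c1 *.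
clear P Q a1 o1 E a2 o2 c2 l2.
have [ge se] := blend_inj thB (shr_dom tw) (shr_dom tw') ltr01 c1; rewrite ge in tw c1 *; clear g ge c1.
split=> //; have [rs [urs drs rsP]] := brk_list P' Q' g'.
have [Pc Qc gl tm [tP tQ]] := tw; have [_ _ _ tm' [tP' tQ']] := tw'.
have sh r : r \in rs -> 0 <= shr t r < 1 by move=> /rsP[ri _]; exact: shr_lt1 tw ri.
have sh' r : r \in rs -> 0 <= shr t' r < 1 by move=> /rsP[ri _]; exact: shr_lt1 tw' ri.
have /(wtd_prof tw QP urs rsP sh) p1 : forall r, r \in rs -> shr t r = shr t r by [].
have /(wtd_prof tw' QP urs rsP sh) p2 : forall r, r \in rs -> shr t r = shr t' r by move=> r /rsP[ri _]; exact: se.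
have lP c : c \in rs -> f c < f P' by move=> /rsP[[_ /andP[]]].
have lQ c : c \in rs -> f Q' < f c by move=> /rsP[[_ /andP[]]].
have le1 t1 : wtd P' Q' g' t1 -> t1 P' <= 1.
 move=> [_ _ _ m1 _]; rewrite -(mass1 m1) (big_rem P') ?cs_crit//= lerDl; apply: sumr_ge0 => c _; exact: mass_ge0 m1 c.
have hE := wtd_sum f tw QP urs rsP; have hE' := wtd_sum f tw' QP urs rsP.
have {}hE' : level t = t' P' * f P' + \sum_(c <- rs) t' c * f c + t' Q' * f Q' by rewrite -l1 -hE'.
have {}hE : level t = t P' * f P' + \sum_(c <- rs) t c * f c + t Q' * f Q' by exact: hE.
have tPE : t P' = t' P'.
 case: (ltgtP (t P') (t' P')) => // lt.
  by have := prof_mono drs sh lP lQ QP (ltW tP) lt (le1 _ tw') p1 p2; rewrite -hE -hE' ltxx.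
 by have := prof_mono drs sh lP lQ QP (ltW tP') lt (le1 _ tw) p2 p1; rewrite -hE -hE' ltxx.
rewrite -tPE in p2; have [tQE trE] := prof_uniq drs p1 p2.
apply/funext => c; have [->//|cP] := eqVneq c P'; have [->//|cQ] := eqVneq c Q'.
have [/trE//|crs] := boolP (c \in rs).
have z t1 : wtd P' Q' g' t1 -> t1 c = 0.
 move=> [_ _ l m _]; apply/eqP/negPn/negP => /(mass_supp m)[cc gc]; move/negP: crs; apply; apply/rsP; split=> //.
 split=> //; have := line_ge (f c) l; rewrite gc => /andP[Qf fP].
 rewrite !lt_neqAle Qf fP !andbT; apply/andP; split; apply/eqP => e.
  by move/eqP: cQ; apply; rewrite -gc -e (line0 l).
 by move/eqP: cP; apply; rewrite -gc e (line1 l).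
by rewrite (z t)// (z t').
Qed.

Lemma line_constant p : crit G p -> line p p (fun=> p).
Proof.
move=> pc; split=> //.
- by move=> h; rewrite -eq_le => /eqP.
- by move=> h t; rewrite gfl_crit.
- by move=> h; rewrite omg_of_crit.
- by move=> h; rewrite alf_of_crit.
Qed.

(** The closure of the orbit of a regular x is smoothed from some g with weights w by [blend_onto].
    It has no break, so the weights are less than 1, and [prof_hgt] finds masses with these weights
    and mean height f x. *)
Lemma Phi_onto x : exists P Q g t, wtd P Q g t /\ Phi P Q g t = x.
Proof.
have [xc|nc] := pselect (crit G x).
 suff tw : wtd x x (fun=> x) (fun c => if c == x then 1 else 0).
  by exists x, x, (fun=> x), (fun c => if c == x then 1 else 0); split=> //; exact: Phi_top.
 split=> //; [exact: line_constant| |by rewrite eqxx].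
 split=> [c||c]; first by case: eqP.
  rewrite (big_rem x) ?cs_crit//= eqxx big1_seq ?addr0// => c /andP[_].
  by rewrite mem_rem_uniq// inE => /andP[/negbTE ->].
 by case: (eqVneq c x) => [->//|_]; rewrite eqxx.
have [gl gx] := orbit_line hM cM nc.
set P := alf x in gl; set Q := omg x in gl.
have Pc : crit G P := alf_crit _ _ _; have Qc : crit G Q := omg_crit _ _ _.
have Qx : f Q < f x := hgt_omg cM nc; have xP : f x < f P := hgt_alf cM nc.
have QP := lt_trans Qx xP.
have [|g [w [wD wE]]] := blend_onto thB (sg := 1) Pc Qc gl; first by rewrite ltr01 lexx.
have nb r : inner P Q r -> orbc cM G x (f r) <> r.
 move=> [rc /andP[Qr rP]] e; have [[_ h]|[_ h]|[t e' _]] := orbc_cases cM (f r) nc.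
 - by move: h; rewrite leNgt Qr.
 - by move: h; rewrite leNgt rP.
 - by apply: nc; apply/(crit_gfl G t); rewrite -e' e.
have [_ _ gl' _ W] := wD; have w1 r : inner P Q r -> 0 <= w r < 1.
 move=> ri; have [/andP[-> h] _] := W r ri; rewrite lt_neqAle h andbT; apply/eqP => e.
 by apply: (nb r ri); rewrite -wE; apply/(blend_break thB wD ltr01 ri).
have [rs [urs drs rsP]] := brk_list P Q g.
have Qrs : Q \notin rs by apply/negP => /rsP[[_]]; rewrite ltxx.
have Prs : P \notin rs by apply/negP => /rsP[[_]]; rewrite ltxx andbF.
have PQ : P != Q by apply/eqP => e; move: QP; rewrite e ltxx.
have wr r : r \in rs -> 0 <= w r < 1 by move=> /rsP[/w1].
have [A [t [/andP[A0 A1] [[pE pT] t0 ts tQ lev]]]] := prof_hgt drs urs Qrs wr Qx xP.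
have tP : t P = 0 by exact: ts.
pose t' c := if c == P then A else t c.
have tE c : c \in rs -> t' c = t c by rewrite /t'; case: eqP => // ->; rewrite (negbTE Prs).
have tQE : t' Q = t Q by rewrite /t' eq_sym (negbTE PQ).
have SE p : \sum_(c <- rs | p c) t' c = \sum_(c <- rs | p c) t c.
 by rewrite big_seq_cond [RHS]big_seq_cond; apply: eq_bigr => c /andP[/tE].
have sumE (F : M -> R) : \sum_(c <- cs) t' c * F c = A * F P + \sum_(c <- rs) t c * F c + t Q * F Q.
 have uL : uniq (P :: Q :: rs) by rewrite /= inE negb_or Prs Qrs urs PQ.
 rewrite (supp_sum F uL) => [|c|c].
 - rewrite !big_cons -[RHS]addrA tQE {1}/t' eqxx; congr (_ + _); rewrite addrC; congr (_ + _).
  by apply: eq_big_seq => c /tE ->.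
 - by rewrite !inE => /or3P[/eqP->|/eqP->|/rsP[[]]].
 - by rewrite !inE !negb_or /t' => /and3P[/negbTE -> cQ crs]; exact: ts.
have tw : wtd P Q g t'.
 split=> //; last by rewrite tQE /t' eqxx.
 split.
 - by move=> c; rewrite /t'; case: eqP => _ //; exact: ltW.
 - have := sumE (fun=> 1); under eq_bigr do rewrite mulr1; move=> ->; rewrite !mulr1.
  by under eq_bigr do rewrite mulr1.
 - move=> c; have [->|cP] := eqVneq c P; first by rewrite (line1 gl').
  have [->|cQ] := eqVneq c Q; first by rewrite (line0 gl').
  have [/rsP[[cc _] gc]//|crs] := boolP (c \in rs).
  by rewrite /t' (negbTE cP) ts// eqxx.
have levE : level t' = f x by rewrite /level sumE.
exists P, Q, g, t'; split=> //; rewrite /Phi levE; transitivity (th P Q g w 1 (f x)); last by rewrite wE.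
congr (_ (f x)).
have /(wtd_prof tw QP urs rsP wr) sh : prof f w Q (t' P) rs t'.
 rewrite /t' eqxx; split=> [r rr|]; last by rewrite -/(t' Q) SE tQE.
 by rewrite -/(t' r) SE tE// pE.
apply: (blend_congr thB) => c ci.
have [gc|gc] := pselect (g (f c) = c); first by rewrite sh//; exact/rsP.
have -> : w c = 0 by have [_ h] := W c ci; apply/eqP/negPn/negP => /h.
have -> : shr t' c = 0; last by [].
rewrite /shr; have -> : t' c = 0; last by rewrite mul0r.
have [_ _ _ tm _] := tw; by apply/eqP/negPn/negP => /(mass_supp tm)[].
Qed.

Lemma line_end p q g r : line p q g -> g (f r) = r -> crit G r -> [\/ inner p q r, r = p | r = q].
Proof.
move=> gl gr rc; have := line_ge (f r) gl; rewrite gr => /andP[].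
rewrite le_eqVlt => /orP[/eqP e _|qr]; first by constructor 3; rewrite -gr -e (line0 gl).
rewrite le_eqVlt => /orP[/eqP e|rp]; first by constructor 2; rewrite -gr e (line1 gl).
by constructor 1; split=> //; rewrite qr.
Qed.

Definition span (P Q : M) (t : M -> R) : Prop :=
 [/\ 0 < t P, 0 < t Q & forall c, t c != 0 -> f Q <= f c <= f P].

Lemma span_up P Q g t : mass g t -> span P Q t -> up t P = 0.
Proof.
move=> tm [_ _ sp]; rewrite /up big1// => c Pc; apply/eqP/negPn/negP => /sp /andP[_].
by rewrite leNgt Pc.
Qed.

Lemma span_rest P Q g t : mass g t -> span P Q t -> rest t Q = 0.
Proof.
move=> tm [tP tQ sp]; have [|Qc gQ] := mass_supp tm (c := Q); first by rewrite gt_eqF.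
rewrite (restE _ tm) (big_rem Q) ?cs_crit//= ltxx/= big1_seq ?addr0 ?subrr// => c /andP[Qc'].
rewrite mem_rem_uniq// inE => /andP[/eqP cQ _]; apply/eqP/negPn/negP => tc.
have /andP[h _] := sp _ tc; have e : f c = f Q by apply/eqP; rewrite eq_le h leNgt Qc'.
by have [_ gc] := mass_supp tm tc; apply: cQ; rewrite -gc e gQ.
Qed.

Lemma span_weighted p q g t P Q : line p q g -> mass g t -> span P Q t -> wtd P Q (blw P (abv Q g)) t.
Proof.
move=> gl tm [tP tQ sp].
have [|Pc gP] := mass_supp tm (c := P); first by rewrite gt_eqF.
have [|Qc gQ] := mass_supp tm (c := Q); first by rewrite gt_eqF.
have QP : f Q <= f P by have /andP[] := sp P (lt0r_neq0 tP).
have Qr := line_ge (f Q) gl; rewrite gQ in Qr; have Pr := line_ge (f P) gl; rewrite gP in Pr.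
have /andP[_ Pp] := Pr.
split=> //.
 apply: (line_below hM Pc (line_above hM Qc gl gQ Qr)); last by rewrite QP Pp.
 by rewrite /above max_l.
split; [exact: mass_ge0 tm|exact: mass1 tm|move=> c tc].
have [cc gc] := mass_supp tm tc; have /andP[Qc' cP] := sp c tc; split=> //.
by rewrite /below /above min_l// max_l.
Qed.

(** No mass lies above P, so the relation at an inner P reads s P * t P = t P and gives s P = 1. The
    smoothed line therefore breaks at P, and what is above P does not influence the value. The same
    happens at Q. *)
Lemma Phi_span p q g t P Q s : thd p q g s 1 -> mass g t -> span P Q t ->
 (forall r, inner p q r -> s r * (t r + up t r * rest t r) = t r) ->
 th p q g s 1 (level t) = Phi P Q (blw P (abv Q g)) t.
Proof.
move=> gD tm ts sE; have [pc qc gl _ W] := gD; have [tP tQ sp] := ts.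
have tw := span_weighted gl tm ts.
have [|Pc gP] := mass_supp tm (c := P); first by rewrite gt_eqF.
have [|Qc gQ] := mass_supp tm (c := Q); first by rewrite gt_eqF.
have s1P : inner p q P -> s P = 1.
 by move=> /sE; rewrite (span_up tm ts) mul0r addr0 => e; apply: (mulIf (lt0r_neq0 tP)); rewrite mul1r.
have s1Q : inner p q Q -> s Q = 1.
 by move=> /sE; rewrite (span_rest tm ts) mulr0 addr0 => e; apply: (mulIf (lt0r_neq0 tQ)); rewrite mul1r.
have [e|QP] := wtd_cases tw.
 have lE : level t = f P.
  rewrite /level (eq_bigr (fun c => t c * f P)) => [|c _]; first by rewrite -mulr_suml (mass1 tm) mul1r.
  have [->|/sp] := eqVneq (t c) 0; first by rewrite !mul0r.
  by rewrite -e -eq_le => /eqP ->.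
 move: tw; rewrite -e => tw; rewrite (Phi_top tw) lE.
 have tl := blend_line thB gD.
 have [Pi|->|->] := line_end gl gP Pc; [by apply/(blend_break thB gD ltr01 Pi); exact: s1P|exact: line1 tl _ (lexx _)|exact: line0 tl _ (lexx _)].
have /andP[Ql lP] := level_rg tw QP.
have le1 r : inner p q r -> s r <= 1 by move=> /W[/andP[]].
have [D1 E1] : thd P q (blw P g) s 1 /\ th p q g s 1 (level t) = th P q (blw P g) s 1 (level t).
 have [Pi|PE|PE] := line_end gl gP Pc.
 - have s1 := s1P Pi; split; last by rewrite (blend_join thB gD Pi gP s1) /join leNgt lP.
  by rewrite -s1; apply: (thd_below hM gD Pi gP) => c /le1; rewrite s1.
 - have gE : blw P g = g.
   apply/funext => h; rewrite /below; have [//|/ltW h2] := leP h (f P).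
   by rewrite PE in h2 *; rewrite !(line1 gl).
  by rewrite gE PE.
 - have := line_ge (f Q) gl; rewrite gQ => /andP[]; rewrite -PE leNgt QP.
  by [].
have [D2 E2] : thd P Q (abv Q (blw P g)) s 1 /\ th P q (blw P g) s 1 (level t) = th P Q (abv Q (blw P g)) s 1 (level t).
 have gl1 : line P q (blw P g) by have [] := D1.
 have gQ1 : blw P g (f Q) = Q by rewrite /below min_l// ltW.
 have [Qi|QE|QE] := line_end gl1 gQ1 Qc.
 - have Qi' : inner p q Q.
   by case: (Qi) => _ /andP[h1 h2]; split=> //; rewrite h1 (lt_le_trans h2)//; have := line_ge (f P) gl; rewrite gP => /andP[].
  have s1 := s1Q Qi'; split; last by rewrite (blend_join thB D1 Qi gQ1 s1) /join (ltW Ql).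
  have [_ _ _ _ W1] := D1.
  by rewrite -s1; apply: (thd_above hM D1 Qi gQ1) => c /W1[/andP[_]]; rewrite s1.
 - by move: QP; rewrite QE ltxx.
 - have gE : abv Q (blw P g) = blw P g.
   apply/funext => h; rewrite {1}/above; have [//|/ltW h2] := leP (f Q) h.
   by rewrite QE in h2 *; rewrite !(line0 gl1).
  by rewrite gE QE.
rewrite E1 E2 (above_below _ (ltW QP)) /Phi; congr (_ (level t)); apply: (blend_congr thB) => c ci.
have [cc /andP[Qc' cP]] := ci; have [_ _ _ tm' _] := tw.
apply: shr_uniq; first by apply: ltr_wpDl; [exact: mass_ge0 tm c|apply: mulr_gt0; [exact: up_gt0 tm tP cP|exact: rest_gt0 tm tQ Qc' cc]].
apply: sE; split=> //; have := line_ge (f Q) gl; rewrite gQ => /andP[h1 _]; have := line_ge (f P) gl; rewrite gP => /andP[_ h2].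
by rewrite (le_lt_trans h1 Qc') (lt_le_trans cP h2).
Qed.

Lemma span_ex g t : mass g t -> exists P Q, span P Q t.
Proof.
move=> tm; have [c0 c0s tc0] : exists2 c, c \in cs & 0 < t c.
 apply: contrapT => H; have := mass1 tm; rewrite big1_seq ?(negPf (oner_neq0 _)) => [/eqP|c /andP[_ ccs]]; first by rewrite eq_sym oner_eq0.
 by apply/eqP; rewrite eq_le (mass_ge0 tm) andbT leNgt; apply/negP => ?; apply: H; exists c.
have c0l : c0 \in [seq c <- cs | 0 < t c] by rewrite mem_filter tc0.
have [P] := seq_argmax f c0l; rewrite mem_filter => /andP[tP _] Pm.
have [Q] := seq_argmax (fun c => - f c) c0l; rewrite mem_filter => /andP[tQ _] Qm.
exists P, Q; split=> // c tc; have cl : c \in [seq c <- cs | 0 < t c].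
 by rewrite mem_filter lt_neqAle eq_sym tc (mass_ge0 tm)/=; apply: cs_crit; have [] := mass_supp tm tc.
by rewrite (Pm _ cl) andbT -lerN2 Qm.
Qed.

(** The value for masses on a line with arbitrary ends, cut at the extreme points with mass. When a
    line carries t these points are determined by t, and the default of [xget] does not occur. *)
Definition evl (g : crv) (t : M -> R) : M :=
 let PQ := xget (g 0, g 0) [set PQ | span PQ.1 PQ.2 t] in Phi PQ.1 PQ.2 (blw PQ.1 (abv PQ.2 g)) t.

Lemma evlP g t : mass g t -> exists P Q, span P Q t /\ forall k : crv, mass k t -> evl k t = Phi P Q (blw P (abv Q k)) t.
Proof.
move=> tm; have [P [Q s0]] := span_ex tm; exists P, Q; split=> // k km; rewrite /evl.
have := @xgetI _ (k 0, k 0) [set PQ | span PQ.1 PQ.2 t] (P, Q) s0; case: xget => P' Q' /= s'.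
have uniq_end A B C D : span A B t -> span C D t -> A = C /\ B = D.
 move=> [tA tB sA] [tC tD sC]; have nz c : 0 < t c -> t c != 0 by move=> /lt0r_neq0.
 have gg c : 0 < t c -> k (f c) = c by move=> /nz /(mass_supp km)[].
 have /andP[a1 a2] := sA _ (nz _ tC); have /andP[a3 a4] := sA _ (nz _ tD).
 have /andP[c1 c2] := sC _ (nz _ tA); have /andP[c3 c4] := sC _ (nz _ tB).
 split; first by rewrite -(gg _ tA) -(gg _ tC); congr k; apply/eqP; rewrite eq_le c2.
 by rewrite -(gg _ tB) -(gg _ tD); congr k; apply/eqP; rewrite eq_le a3.
by have [-> ->] := uniq_end _ _ _ _ s0 s'.
Qed.

(** Where the relation leaves a weight undetermined, its choice does not change the value. *)
Lemma evl_tht p q g t s : thd p q g s 1 -> mass g t ->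
 (forall r, inner p q r -> s r * (t r + up t r * rest t r) = t r) -> th p q g s 1 (level t) = evl g t.
Proof. by move=> gD tm sE; have [P [Q [ts E]]] := evlP tm; rewrite (Phi_span gD tm ts sE) E. Qed.

(** The extreme points with mass are inside the retained part, so cutting there in one step or in
    two gives the same line. *)
Lemma evl_sub g t a b : mass g t -> (forall c, t c != 0 -> f b <= f c <= f a) ->
 mass (blw a (abv b g)) t /\ evl (blw a (abv b g)) t = evl g t.
Proof.
move=> tm ab; have tm' : mass (blw a (abv b g)) t.
 split; [exact: mass_ge0 tm|exact: mass1 tm|move=> c tc]; have /andP[h1 h2] := ab c tc.
 by have [cc gc] := mass_supp tm tc; rewrite /below /above min_l// max_l.
split=> //; have [P [Q [[tP tQ sp] E]]] := evlP tm; rewrite !E//; congr (Phi P Q _ t).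
have /andP[b1 _] := ab Q (lt0r_neq0 tQ); have /andP[_ a2] := ab P (lt0r_neq0 tP); have /andP[QP _] := sp P (lt0r_neq0 tP).
apply/funext => h; rewrite /below /above; congr g.
have [h1|h1] := leP h (f P); have [h2|h2] := leP _ (f Q).
- by rewrite min_l ?(le_trans QP)// max_l.
- by rewrite min_l ?(le_trans h1)// max_l// (le_trans b1 (ltW h2)).
- by rewrite min_l ?(le_trans QP)// max_l.
- by rewrite min_l// max_l// (le_trans b1 QP).
Qed.

Notation wts := (prod_topology (fun _ : M => R)).

Lemma sum_cts (A : set (crv * wts)) (p : pred M) (k : M -> R) :
 cts A (fun x => \sum_(c <- cs | p c) x.2 c * k c).
Proof.
apply: ctsT.
apply: (@continuous_big R M +%R 0 p (@add_continuous R) _ cs (fun c (x : crv * wts) => x.2 c * k c)) => c _ y.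
apply: (ccomp snd (fun w : wts => w c * k c)); first exact: cvg_snd.
exact: (@continuous_comp wts _ _ (fun w : wts => w c) ( *%R^~ (k c)) y.2 (@proj_continuous _ (fun _ : M => R) c y.2) (@mulrr_continuous R (k c) _)).
Qed.

Notation sdata := (wts * (crv * wts))%type.

(** The weights [shr] jump where their denominator vanishes, so continuity is shown for all weights
    at once. The relation Z between data and weights is closed, every s that satisfies it computes
    [evl] by [evl_tht], and compactness of the cube K gives one neighbourhood of x0 that works for
    all s. *)
Lemma evl_cts p q : crit G p -> crit G q ->
 cts [set x : crv * wts | line p q x.1 /\ mass x.1 x.2] (fun x => evl x.1 x.2).
Proof.
move=> pc qc x0 W D0 xW.
pose K : set wts := [set s | forall c, 0 <= s c <= 1].
have Kc : compact K.
 rewrite (_ : K = [set s | forall c, `[0, 1]%classic (s c)]).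
  by apply: (@tychonoff M (fun=> R) (fun=> `[0, 1]%classic)) => c; exact: segment_compact.
 by apply/seteqP; split=> s sK c; have := sK c; rewrite /= in_itv.
pose Z (x : crv * wts) (s : wts) := forall r, inner p q r ->
 s r * (x.2 r + up x.2 r * rest x.2 r) = x.2 r /\ (s r <> 0 -> x.1 (f r) = r).
pose D : set (crv * wts) := [set x | line p q x.1 /\ mass x.1 x.2].
have ZE x s : D x -> K s -> Z x s -> thd p q x.1 s 1 /\ th p q x.1 s 1 (level x.2) = evl x.1 x.2.
 move=> [gl tm] sK zz; have gD : thd p q x.1 s 1.
  split=> //; first by rewrite lexx ler01.
  by move=> c ci; split; [exact: sK|move/eqP; exact: (zz c ci).2].
 by split=> //; apply: evl_tht => // r /zz[].
have Zex x : D x -> exists2 s, K s & Z x s.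
 move=> [gl tm]; exists (shr x.2) => [c|r ri]; first exact: shr_rg tm.
 split; first exact: shr_rel tm.
 move=> sc; have [] // := mass_supp tm (c := r); apply/eqP => e; apply: sc; by rewrite /shr e mul0r.
suff : \forall x \near x0, K `<=` [set s | K s -> D x -> Z x s -> W (evl x.1 x.2)].
 apply: filterS => x H Dx; have [s sK sZ] := Zex x Dx; exact: (H s sK sK Dx sZ).
move/compact_near_coveringP : Kc => Kc.
apply: (Kc _ (nbhs x0) (fun x s => K s -> D x -> Z x s -> W (evl x.1 x.2))) => s sK.
suff H : nbhs ((s, x0) : sdata) [set z | K z.1 -> D z.2 -> Z z.2 z.1 -> W (evl z.2.1 z.2.2)].
 by case: H => -[A B] /= [sA xB] AB; exists (A, B) => // -[s' x] /= [sA' xB'] K' Dx Zx; exact: (AB (s', x)).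
have ev_s r : cts setT (fun z : sdata => z.1 r).
 apply: ctsT => z; apply: (ccomp fst (fun w : wts => w r)); first exact: cvg_fst.
 exact: (@proj_continuous _ (fun _ : M => R) r).
have ev_g r : cts setT (fun z : sdata => z.2.1 r).
 apply: ctsT => z; apply: (ccomp (fun z : sdata => z.2.1) (fun g : crv => g r)); last exact: curve_eval.
 by apply: (ccomp snd fst); [exact: cvg_snd|exact: cvg_fst].
have ev_sum (pr : pred M) (k : M -> R) : cts setT (fun z : sdata => \sum_(c <- cs | pr c) z.2.2 c * k c).
 apply: (@cts_comp _ _ _ _ setT snd (fun x : crv * wts => \sum_(c <- cs | pr c) x.2 c * k c)) => //.
  by apply: ctsT => z; exact: cvg_snd.
 exact: sum_cts.
have ev_t r : cts setT (fun z : sdata => z.2.2 r).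
 apply: ctsT => z; apply: (ccomp (fun z : sdata => z.2.2) (fun g : wts => g r)).
  by apply: (ccomp snd snd); exact: cvg_snd.
 exact: (@proj_continuous _ (fun _ : M => R) r).
have nz_near (u : sdata -> R) : cts setT u -> u (s, x0) <> 0 -> nbhs (s, x0) [set z | u z <> 0].
 move=> uc u0; have oC : open (~` [set (0 : R)]) by apply: closed_openC; exact: closed_eq.
 by have := cts_open uc oC I u0; apply: filterS => z; exact.
(* Either s is admissible at x0, and continuity of [th] and of evaluation on lines applies, or one
   of the closed conditions in Z fails at (s, x0), hence also nearby. *)
have [zz|nz] := pselect (Z x0 s).
 have [dom0 E0] := ZE _ _ D0 sK zz.
 pose A : set (sdata) := [set z | [/\ K z.1, D z.2 & Z z.2 z.1]].
 have thc : cts A (fun z => th p q z.2.1 z.1 1 : crv).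
  apply: (@cts_comp _ _ _ _ (tht_set cM G p q) (fun z => (z.2.1, z.1, 1) : crv * wts * R) (fun y => th p q y.1.1 y.1.2 y.2 : crv)).
  - apply: cts_pair; last exact: cts_cst.
   apply: cts_pair; apply: ctsT => z; last exact: cvg_fst.
   by apply: (ccomp snd fst); [exact: cvg_snd|exact: cvg_fst].
  - by move=> z [h1 h2 h3]; have [] := ZE _ _ h2 h1 h3.
  - exact: blend_cont.
 have lc : cts A (fun z => level z.2.2) by apply: cts_sub (ev_sum predT f).
 have ec : cts [set y : crv * R | line p q y.1] (fun y => y.1 y.2).
  by move=> [k h] U kl /= kU; have := @line_eval_cts R M hM cM G p q k h U kU; apply: filterS => y.
 have c1 : cts A (fun z => th p q z.2.1 z.1 1 (level z.2.2)).
  pose E : sdata -> crv * R := fun z => (th p q z.2.1 z.1 1, level z.2.2).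
  have Ec : cts A E by exact: cts_pair.
  apply: (cts_comp Ec _ ec).
  by move=> z [h1 h2 h3] /=; apply: (blend_line thB); have [] := ZE _ _ h2 h1 h3.
 have xW' : nbhs (th p q x0.1 s 1 (level x0.2)) W by rewrite E0.
 have := c1 (s, x0) W (And3 sK D0 zz) xW'; apply: filterS => z H h1 h2 h3.
 by have [_ <-] := ZE _ _ h2 h1 h3; exact: H.
have [r [ri nr]] : exists r, inner p q r /\ (s r * (x0.2 r + up x0.2 r * rest x0.2 r) - x0.2 r <> 0 \/ (s r <> 0 /\ x0.1 (f r) <> r)).
 apply: contrapT => H; apply: nz => r ri; split.
  by apply/eqP; rewrite -subr_eq0; apply/eqP; apply: contrapT => h; apply: H; exists r; split=> //; left.
 by move=> sr; apply: contrapT => h; apply: H; exists r; split=> //; right.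
have upc : cts setT (fun z : sdata => up z.2.2 r).
 apply: (cts_eq (f := fun z : sdata => \sum_(c <- cs | f r < f c) z.2.2 c * 1)); last exact: ev_sum.
 by move=> z _; apply: eq_bigr => c _; rewrite mulr1.
case: nr => [ne|[sn gn]].
 have uc : cts setT (fun z : sdata => z.1 r * (z.2.2 r + up z.2.2 r * rest z.2.2 r) - z.2.2 r).
  apply: ctsB => //; apply: ctsM => //; apply: ctsD => //; apply: ctsM => //.
  by apply: ctsB => //; apply: ctsB => //; exact: cts_cst.
 by have := nz_near _ uc ne; apply: filterS => z H _ _ /(_ r ri)[/eqP]; rewrite -subr_eq0 => /eqP.
have oC : open (~` [set r]) by apply: closed_openC; exact: (compact_closed hM (@compact_set1 M r)).
have N1 := nz_near _ (ev_s r) sn; have N2 := cts_open (ev_g (f r)) oC (x := (s, x0)) I gn.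
by apply: filterS2 N1 N2 => z H1 H2 _ _ /(_ r ri)[_ /(_ H1) e]; case: (H2 I e).
Qed.

End Evaluation.

(** * Morphism spaces as spaces of lines *)

Section BrokenLines.
Context (R : realType) (m : nat) (M : riemannian_manifold R m) (f : M -> R) (fS : smooth_function f)
 (cM : compact [set: M]) (fN : standard_near_critical f) (bowl_order : forall p q, critical f p -> critical f q ->
 Wu f q `&` closure (Wu f p) = set0 \/ Wu f q `<=` closure (Wu f p))
 (a : R -> R -> R) (a_level : level_choice f a).
Notation flow := (flow fS cM).
Notation G := (mgrad fS cM fN).
Notation omg := (omg cM G).
Notation alf := (alf cM G).
Notation line := (line cM G).
Notation orbc := (orbc cM G).
Notation crv := (prod_topology (fun _ : R => M)).
Let hM := @carrier_hausdorff R m M.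

Lemma translates_shift (h : R -> M) s : translates (fun t => h (t + s)) = translates h.
Proof.
apply/seteqP; split=> _ [u _ <-].
 by exists (u + s) => //; apply/funext => t; rewrite addrA.
by exists (u - s) => //; apply/funext => t; rewrite addrA subrK.
Qed.

Definition mpt p r (g : moduli f p r) : M := xget p [set x | (val g : set (R -> M)) (flow^~ x)].

Lemma mptP p r (g : moduli f p r) : crit_gt f p r ->
 [/\ ~ critical f (mpt g), alf (mpt g) = p, omg (mpt g) = r &
  val g = translates (flow^~ (mpt g)) :> set (R -> M)].
Proof.
case: g => L LP pr; rewrite /mpt /=; have [h0 [h0f h0p h0r] Lh0] := set_mem LP.
have h0E : h0 = flow^~ (h0 0) by apply/funext => t; rewrite (flow_lineE fS cM t h0f).
have ex : L (flow^~ (h0 0)) by rewrite -Lh0; exists 0 => //; apply/funext => t; rewrite addr0 {1}h0E.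
have := @xgetI _ p [set x | L (flow^~ x)] _ ex; set x := xget _ _; move=> /= Lx.
have [s xs] : exists s, flow^~ x = fun t => h0 (t + s) by move: Lx; rewrite -Lh0 => -[s _ <-]; exists s.
have xE : x = h0 s by have := congr1 (fun k : R -> M => k 0) xs; rewrite flow0 add0r.
have aE : alf x = p by rewrite xE; apply/(Wu_alf fS cM fN); exists (fun t => h0 (t + s)); split;
 [exact: flow_shift_line|by rewrite add0r|exact: cvg_comp (cvg_addrr_Ny s) h0p].
have oE : omg x = r by rewrite xE; apply/(Ws_omg fS cM fN); exists (fun t => h0 (t + s)); split;
 [exact: flow_shift_line|by rewrite add0r|exact: cvg_comp (cvg_addrr s) h0r].
split=> //; last by rewrite xs translates_shift -Lh0.
move=> xc; case: pr => _; apply; rewrite -aE -oE; apply/esym.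
by rewrite (omg_of_crit hM cM (G := G) xc) (alf_of_crit hM cM (G := G) xc).
Qed.

Lemma mod_orb p r (g : moduli f p r) : crit_gt f p r ->
 ~ critical f (mpt g) /\ line p r (orbc (mpt g)).
Proof.
move=> pr; have [nc aE oE _] := mptP g pr; split=> //.
by have [ol _] := @orbit_line R M hM cM G _ nc; rewrite aE oE in ol.
Qed.

(** The height parametrization of a broken flow line. It identifies a morphism space with a compact
    space of lines, by [bl_inj], [bl_onto] and [bl_cts]. *)
Fixpoint bl p q (B : broken (f := f) p q) : R -> M :=
 match B with
 | broken_nil p => fun=> val p
 | broken_cons p r q _ g B' => join G (val r) (orbc (mpt g)) (bl B')
 end.

Lemma cri_crit (p : cri f) : critical f (val p). Proof. exact: set_valP. Qed.

Lemma bl_line p q (B : broken p q) : line (val p) (val q) (bl B).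
Proof.
elim: B => [{}p|{}p r {}q pr g B IH] /=; first exact: (@line_constant R M hM cM G _ (@cri_crit p)).
by apply: line_join IH; have [] := mod_orb g pr.
Qed.

Lemma moduli_less p r (g : moduli f p r) : crit_gt f p r -> f r < f p.
Proof. exact: moduli_lt. Qed.

Lemma bl_cat p r q (B : broken p r) (B' : broken r q) : bl (broken_cat B B') = join G (val r) (bl B) (bl B').
Proof.
elim: B B' => [{}p B'|{}p s {}r ps g B IH B'] /=.
 apply/funext => h; rewrite /join; case: ifP => // ph.
 by rewrite (line1 (bl_line B') ph).
by rewrite IH join_assoc//; exact: (broken_le fS B).
Qed.

Lemma orbc_nc x h : ~ critical f x -> f (omg x) < h < f (alf x) ->
 exists2 t, orbc x h = flow t x & f (flow t x) = h.
Proof.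
move=> nc /andP[h1 h2]; have [[_ h3]|[_ h3]|[t e1 e2]] := @orbc_cases R M cM G x h nc; last by exists t.
 by move: h3; rewrite leNgt h1.
by move: h3; rewrite leNgt h2.
Qed.

(** The ends of the two broken lines are kept apart for the sake of the dependent induction. Once
    the first breaks agree, cutting there separates the first orbit from the rest. *)
Lemma bl_inj_sig p q (B : broken p q) p' q' (B' : broken p' q') : p = p' -> q = q' -> bl B = bl B' ->
 existT (fun pq : cri f * cri f => broken (f := f) pq.1 pq.2) (p, q) B = existT _ (p', q') B'.
Proof.
elim: B p' q' B' => [{}p|{}p r {}q pr g B IH] p' q' B'.
 case: B' => [{}p' -> //|{}p' s {}q' ps g B' e e']; have lt := le_lt_trans (broken_le fS B') (moduli_less g ps).
 by exfalso; move: lt; rewrite -e -e' ltxx.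
case: B' => [{}p' e e'|{}p' s {}q' ps k B' e e' /= E].
 have lt := le_lt_trans (broken_le fS B) (moduli_less g pr).
 by exfalso; move: lt; rewrite e e' ltxx.
subst p' q'; have [ncg gl] := mod_orb g pr; have [nck kl] := mod_orb k ps.
have [_ ag og gE] := mptP g pr; have [_ ak ok kE] := mptP k ps.
have rp := moduli_less g pr; have sp := moduli_less k ps.
(* If the first break r1 were lower than r2, the line would be at the critical point r2 while still
   on its first orbit. *)
have contra (r1 r2 : cri f) (g1 : moduli f (val p) (val r1)) (B1 : R -> M) (c : R -> M) : ~ critical f (mpt g1) ->
  alf (mpt g1) = val p -> omg (mpt g1) = val r1 -> f (val r2) < f (val p) ->
  c = join G (val r1) (orbc (mpt g1)) B1 -> c (f (val r2)) = val r2 -> ~ f (val r1) < f (val r2).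
 move=> nc aE oE r2p -> ; rewrite /join => c2 r12; move: c2; rewrite (ltW r12) => c2.
 have [|t e1 _] := @orbc_nc (mpt g1) (f (val r2)) nc; first by rewrite aE oE r12.
 by apply: nc; apply/(crit_gfl G t); rewrite /= -e1 c2; exact: cri_crit.
have c2 : join G (val s) (orbc (mpt k)) (bl B') (f (val s)) = val s by exact: join_break kl.
have c1 : join G (val r) (orbc (mpt g)) (bl B) (f (val r)) = val r by exact: join_break gl.
have rsE : f (val r) = f (val s).
 apply/eqP; rewrite eq_le !leNgt; apply/andP; split; apply/negP => lt.
  apply: (@contra s r k (bl B') _ nck ak ok rp erefl) lt; by rewrite -E c1.
 apply: (@contra r s g (bl B) _ ncg ag og sp erefl) lt; by rewrite E c2.
have rs : r = s by apply: val_inj; rewrite -c1 E rsE c2.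
subst s; have oE : orbc (mpt g) = orbc (mpt k).
 by rewrite -(above_join (bl B) gl) E (above_join _ kl).
have bE : bl B = bl B' by rewrite -(below_join gl (bl_line B)) E (below_join kl (bl_line B')).
have gk : g = k.
 apply: val_inj; rewrite gE kE; have [_ e0] := @orbit_line R M hM cM G _ nck.
 have hw := @hgt_omg R M cM G _ nck; have ha := @hgt_alf R M cM G _ nck.
 have [|t e1 _] := @orbc_nc (mpt g) (f (mpt k)) ncg.
  by rewrite ak ok in ha hw; rewrite ag og; apply/andP.
 rewrite -[mpt k]e0 -oE e1 -[LHS](translates_shift _ t); congr translates; apply/funext => u.
 exact: flowD.
have := IH _ _ B' erefl erefl bE => /(@eq_from_Tagged _ _ _ _ _) /= BB.
by rewrite gk BB (Prop_irrelevance pr ps).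
Qed.

Lemma bl_inj p q : injective (@bl p q).
Proof. by move=> B B' /(bl_inj_sig (erefl p) (erefl q)) /(@eq_from_Tagged _ _ _ _ _). Qed.

(** The forward limit lies in its own unstable manifold and in the closure of that of the backward
    limit, because the orbit does. This excludes the disjoint alternative in the bowl condition. *)
Lemma orbit_crit_ge x : crit_ge f (alf x) (omg x).
Proof.
have ac : critical f (alf x) := alf_crit cM G x; have oc : critical f (omg x) := omg_crit cM G x.
have [e|//] := bowl_order ac oc; exfalso.
suff : (Wu f (omg x) `&` closure (Wu f (alf x))) (omg x) by rewrite e.
split; first by apply/(Wu_alf fS cM fN); exact: alf_of_crit.
move=> W oW; have H : \forall t \near +oo, W (flow t x) := @omg_cvg R M cM G x W oW.
have [t tW] := filter_ex H.
exists (flow t x); split=> //; apply/(Wu_alf fS cM fN).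
exact: (@alphaE R M hM cM G t x).
Qed.

(** The breaks are listed by [break_chain] and the broken line is assembled from the bottom up. By
    [orbit_crit_ge], the orbit between two consecutive breaks connects comparable critical points,
    as [broken_cons] demands. *)
Lemma bl_onto (p q : cri f) (g : R -> M) : line (val p) (val q) g -> exists B : broken p q, bl B = g.
Proof.
move=> gl; have := line_le gl; rewrite le_eqVlt => /orP[/eqP e|qp].
 have pq : p = q by apply: val_inj; rewrite -(line0 gl (lexx _)) e (line1 gl).
 subst q; exists (broken_nil p); apply/funext => h /=.
 by have [h1|/ltW h1] := leP h (f (val p)); [rewrite (line0 gl)|rewrite (line1 gl)].
have [n [c [c0 cn cc cl]]] := @break_chain R M hM cM G _ _ g gl (@cri_crit p) (@cri_crit q) qp.
have desc k i : (i + k <= n.+1)%N -> f (c (i + k)%N) <= f (c i).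
 elim: k => [|k IH] ik; first by rewrite addn0.
 rewrite addnS in ik *; have [/ltW h _] := cl (i + k)%N ik; apply: le_trans h (IH _); exact: ltnW.
have sub i : (i <= n.+1)%N -> line (c i) (val q) (below G (c i) g).
 move=> iN; have [ci gi] := cc i iN; apply: (line_below hM ci gl gi); apply/andP; split.
  by have := desc (n.+1 - i)%N i; rewrite subnKC// cn; apply.
 by have := desc i 0%N; rewrite add0n c0; apply.
suff H k i (p' : cri f) : (i + k = n.+1)%N -> val p' = c i -> exists B : broken p' q, bl B = below G (c i) g.
 have [|B BE] := H n.+1 0%N p erefl; first by rewrite c0.
 exists B; rewrite BE c0; apply/funext => h; rewrite /below; have [//|/ltW h1] := leP h (f (val p)).
 by rewrite !(line1 gl).
elim: k i p' => [|k IH] i p' ik pE.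
 have iE : i = n.+1 by rewrite -ik addn0.
 have pq : p' = q by apply: val_inj; rewrite pE iE cn.
 subst p'; exists (broken_nil q); apply/funext => h /=; rewrite -pE /below.
 by rewrite (line0 gl)// ge_min lexx orbT.
have iN : (i <= n)%N by rewrite -ltnS -ik addnS ltnS leq_addr.
have [ci gi] := cc i (leqW iN); have [ci1 gi1] := cc i.+1 iN; have [lt noc] := cl i iN.
pose r : cri f := exist _ (c i.+1) (mem_set ci1).
have [||B BE] := IH i.+1 r; [by rewrite addSnnS|by []|].
have lt' : f (c i.+1) < f (c i) := lt.
have [h h1 h2] : exists2 h : R, f (c i.+1) < h & h < f (c i) by exists ((f (c i) + f (c i.+1)) / 2); lra.
have [|nc ag og] := noc h; first by rewrite h1.
have ge : crit_gt f (val p') (val r).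
 by split; [rewrite pE /= -ag -og; exact: orbit_crit_ge|rewrite pE => /= e; move: lt; rewrite e ltxx].
have tP : translates (flow^~ (g h)) \in [set translates g | g in flow_from_to f (val p') (val r)].
 apply: mem_set; exists (flow^~ (g h)) => //; split; first exact: flowP.
  by rewrite pE -ag; exact: (@alf_cvg R M cM G).
 by rewrite /= -og; exact: (@omg_cvg R M cM G).
pose mo : moduli f (val p') (val r) := exist (fun L => L \in [set translates g | g in flow_from_to f (val p') (val r)]) _ tP.
exists (broken_cons ge mo B) => /=; rewrite BE -(join_above_below G (c i.+1) (below G (c i) g)).
have bE : below G (c i.+1) (below G (c i) g) = below G (c i.+1) g by exact/below_below/ltW.
rewrite bE; apply/funext => k'; rewrite /join; case: ifP => // k1.
have [ncx ax ox xE] := mptP mo ge; have [_ ol] := mod_orb mo ge.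
have [t tE] : exists t, mpt mo = flow t (g h).
 have : translates (flow^~ (g h)) (flow^~ (mpt mo)) by rewrite [X in X _]xE; exists 0 => //; apply/funext => u; rewrite addr0.
 move=> [t _ /(congr1 (fun k : R -> M => k 0))]; rewrite add0r flow0 => <-; by exists t.
have bl1 : line (c i) (val r) (above G (c i.+1) (below G (c i) g)).
 apply: (line_above hM ci1 (sub i (leqW iN))); first by rewrite /below min_l// ltW.
 by rewrite (ltW lt) andbT; have := desc (n.+1 - i.+1)%N i.+1; rewrite subnKC// cn; apply.
have k2E := pE; rewrite -{1}pE in bl1; have [k2|k2] := leP (f (val p')) k'; first by rewrite (line1 ol k2) [RHS](line1 bl1 k2).
rewrite /above /below max_l// min_l; last by rewrite -pE ltW.
have gb : g (f (flow t (g h))) = mpt mo by rewrite tE; exact: (line_flow gl).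
rewrite -gb; apply/esym/(@line_orbit R M hM cM G _ _ g _ k' gl); first by rewrite gb.
by rewrite gb ax ox k1 ltW.
Qed.

Lemma points_bl p q (B : broken p q) x : points B x -> bl B (f x) = x.
Proof.
elim: B x => [{}p x /= ->//|{}p r {}q pr g B IH x] /=.
have [nc gl] := mod_orb g pr; have [_ aE oE gE] := mptP g pr; have rp := moduli_less g pr.
have low y : f y = f (val r) -> points B y -> join G (val r) (orbc (mpt g)) (bl B) (f y) = y.
 move=> e yB; rewrite /join e lexx (line0 gl)// -(IH y yB) e; apply/esym; exact: (line1 (bl_line B)).
move=> [->|[[h hg [t <-]]|xB]]; rewrite /join.
- by rewrite ltW// (line1 gl).
- have [s hs] : exists s, h = fun u => flow (u + s) (mpt g) by move: hg; rewrite gE => -[s _ <-]; exists s.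
 rewrite hs (@orbcE R M cM G _ (t + s) nc).
 case: ifPn => //; rewrite -ltNge => lt; have := line_ge (f (flow (t + s) (mpt g))) gl.
 by rewrite (@orbcE R M cM G _ (t + s) nc) leNgt lt.
- case: ifPn => [rx|_]; last exact: IH.
 have e : f x = f (val r) by apply/eqP; rewrite eq_le rx andbT; have /andP[] := points_bound fS xB.
 by have := low x e xB; rewrite /join rx.
Qed.

Lemma evaluation_bl p q (B : broken p q) cc : evaluation a B cc = bl B (a (val cc).1 (val cc).2).
Proof.
case: cc => -[c c'] ccP /=; have [/= cs qc c'p] := set_mem ccP; have [_ _ _ gap] := cs.
have /andP[ca ac'] := a_level cs.
have [|x xB fx] := points_meet_level fS (b := a c c') B _ (le_lt_trans qc ca) (lt_le_trans ac' c'p).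
 by apply: gap; rewrite ca.
rewrite /evaluation /=; have := @xgetI _ (val p) (points B `&` f @^-1` [set a c c']) x (conj xB fx).
by set y := xget _ _ => -[yB fy]; rewrite -(points_bl yB) fy.
Qed.

Definition levels (p q : cri f) (g : crv) : prod_topology (fun _ : gaps f (val p) (val q) => M : topologicalType) :=
 fun cc => g (a (val cc).1 (val cc).2).

Lemma levels_cts p q : continuous (levels (p := p) (q := q)).
Proof. by apply: prod_continuous => cc; exact: curve_eval. Qed.

(** Between two consecutive critical values a line follows one orbit, and its point at the chosen
    level determines this orbit. *)
Lemma levels_inj (p q : cri f) (g g' : crv) : line (val p) (val q) g -> line (val p) (val q) g' ->
 @levels p q g = @levels p q g' -> g = g'.
Proof.
move=> gl gl' E; apply/funext => h.
have [h1|qh] := leP h (f (val q)); first by rewrite (line0 gl)// (line0 gl').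
have [h2|hp] := leP (f (val p)) h; first by rewrite (line1 gl)// (line1 gl').
have [s sE] := (finite_seqP _).1 (@crit_finite R M hM cM G).
have sP c : critical f c <-> c \in s by have : critical f c <-> [set` s] c by rewrite -sE.
pose lo := [seq c <- s | f c <= h]; pose hi := [seq c <- s | h < f c].
have [|c] := @seq_argmax R M f lo (val q); first by rewrite mem_filter (ltW qh)/=; apply/sP; exact: cri_crit.
rewrite mem_filter => /andP[ch /sP cc] cm.
have [|c'] := @seq_argmax R M (fun c => - f c) hi (val p); first by rewrite mem_filter hp/=; apply/sP; exact: cri_crit.
rewrite mem_filter => /andP[hc' /sP cc'] cm'.
have nv b : f c < b < f c' -> ~ critical_value f b.
 move=> /andP[b1 b2] [d dc db]; have [dh|hd] := leP (f d) h.
  have : d \in lo by rewrite mem_filter dh/=; exact/sP.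
  by move=> /cm; rewrite db leNgt b1.
 have : d \in hi by rewrite mem_filter hd/=; exact/sP.
 by move=> /cm'; rewrite db lerN2 leNgt b2.
have con : consecutive f (f c) (f c').
 by split; [exists c|exists c'|exact: le_lt_trans hc'|exact: nv].
have qc : f (val q) <= f c by apply: cm; rewrite mem_filter (ltW qh)/=; apply/sP; exact: cri_crit.
have c'p : f c' <= f (val p) by rewrite -lerN2; apply: cm'; rewrite mem_filter hp/=; apply/sP; exact: cri_crit.
have inG : (f c, f c') \in gaps f (val p) (val q) by apply: mem_set; split.
have := congr1 (fun k => k (exist _ (f c, f c') inG)) E; rewrite /levels /= => gb.
have /andP[b1 b2] := a_level con; set b := a _ _ in gb b1 b2.
have fb : f (g b) = b by apply: (line_hgt gl); rewrite (ltW (le_lt_trans qc b1)) ltW// (lt_le_trans b2).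
have nc : ~ critical f (g b) by move=> k; apply: (nv b); [rewrite b1|exists (g b)].
have inO : f (omg (g b)) <= h <= f (alf (g b)).
 have ow := @hgt_omg R M cM G _ nc; have oa := @hgt_alf R M cM G _ nc.
 apply/andP; split.
  apply: le_trans ch; rewrite leNgt; apply/negP => lt; apply: (nv (f (omg (g b)))).
   by rewrite lt /= (lt_trans ow)//= fb.
  by exists (omg (g b)) => //; exact: (omg_crit cM G).
 apply: (le_trans (ltW hc')); rewrite leNgt; apply/negP => lt; apply: (nv (f (alf (g b)))).
  by rewrite lt andbT (lt_trans _ oa)//= fb.
 by exists (alf (g b)) => //; exact: (alf_crit cM G).
rewrite (@line_orbit R M hM cM G _ _ g b h gl nc inO).
by rewrite gb in nc inO *; rewrite (@line_orbit R M hM cM G _ _ g' b h gl' nc inO).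
Qed.

(** The topology of the morphism space is induced by the points on the chosen levels. These
    determine the line, and on the compact space of lines the inverse of [levels] is continuous by
    [inv_cts]. *)
Lemma bl_cts (p q : cri f) : continuous (fun B : moduli_bar a p q => bl (B : broken p q) : crv).
Proof.
pose inv (x : prod_topology (fun _ : gaps f (val p) (val q) => M : topologicalType)) : crv :=
 xget (fun=> val p) [set g : crv | line (val p) (val q) g /\ @levels p q g = x].
have ivK g : line (val p) (val q) g -> inv (@levels p q g) = g.
 move=> gl; rewrite /inv; have := @xgetI _ (fun=> val p) [set k : crv | line (val p) (val q) k /\ @levels p q k = @levels p q g] g (conj gl erefl).
 by set k := xget _ _ => -[kl kE]; exact: levels_inj kl gl kE.
have Kc : compact (line (val p) (val q) : set crv) by exact: line_cpt.
have hP : hausdorff_space (prod_topology (fun _ : gaps f (val p) (val q) => M : topologicalType)).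
 by apply: hausdorff_product => _; exact: hM.
have ic := inv_cts hP Kc (ctsT (@levels_cts p q)) ivK.
have blE (B : broken p q) : bl B = inv (evaluation a B).
 rewrite -[LHS]ivK; last exact: bl_line.
 by congr inv; apply/funext => cc; rewrite evaluation_bl.
move=> B W BW; have {}BW : nbhs (bl (B : broken p q) : crv) W := BW.
have Ec : continuous (fun B : moduli_bar a p q => evaluation a (B : broken p q)) by exact: initial_continuous.
have ev_in (B1 : broken p q) : (@levels p q @` (line (val p) (val q) : set crv)) (evaluation a B1).
 by exists (bl B1); [exact: bl_line|apply/funext => cc; rewrite evaluation_bl].
rewrite blE in BW; have H := Ec B _ (ic (evaluation a (B : broken p q)) W (ev_in B) BW).
have {}H : \forall B' \near B, (@levels p q @` (line (val p) (val q) : set crv)) (evaluation a (B' : broken p q)) -> W (inv (evaluation a (B' : broken p q))) := H.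
by apply: (@filterS _ (nbhs B) _ _ _ _ H) => B' H'; rewrite /= blE; apply: H'; exact: ev_in.
Qed.

End BrokenLines.

Lemma cts_initial (T : topologicalType) (S : choiceType) (U : topologicalType) (e : S -> U) (A : set T) (h : T -> initial_topology e) :
 cts A (fun x => e (h x)) -> cts A h.
Proof.
move=> ec x W Ax [_ [[V oV <-] Vx] VW].
by have := ec x V Ax (open_nbhs_nbhs (conj oV Vx)); apply: filterS => y H /H; exact: VW.
Qed.

Lemma cpt_cts_image (T U : topologicalType) (A : set T) (h : T -> U) : compact A -> cts A h -> compact (h @` A).
Proof.
by move=> Ac hc; apply: continuous_compact => //; apply/subspace_continuousP => x Ax W; exact: hc.
Qed.

(** * The classifying space *)

Section Classifying.
Context (R : realType) (m : nat) (M : riemannian_manifold R m) (cM : compact [set: M]) (f : M -> R) (f_bowl : bowl f)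
 (fN : standard_near_critical f) (a : R -> R -> R) (a_level : level_choice f a).
Let fS := bowl_smooth f_bowl.
Let bowl_order : forall p q, critical f p -> critical f q ->
 Wu f q `&` closure (Wu f p) = set0 \/ Wu f q `<=` closure (Wu f p).
Proof. by case: f_bowl. Qed.
Notation G := (mgrad fS cM fN).
Notation line := (line cM G).
Notation bl := (bl fS cM fN).
Notation crv := (prod_topology (fun _ : R => M)).
Notation wts := (prod_topology (fun _ : M => R)).
Let hM := @carrier_hausdorff R m M.
Context (csr : seq (cri f)) (csrP : forall c, c \in csr) (csr_uniq : uniq csr).
Notation cs := (map val csr).
Context (th : M -> M -> crv -> (M -> R) -> R -> crv) (thB : blending cM G th).
Notation C := (flow_category f_bowl a_level).
Notation fct k v := (@functors C k v).
Notation spx k := (std_simplex R k).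
Notation fam k := (existT (fun v => fct k v)).
Notation mass := (mass G cs).
Notation evl := (evl G cs th).
Notation wtd := (wtd cM G cs).
Notation sub g p q := (below G p (above G q g)).

Lemma csE : crit G = [set` cs].
Proof.
apply/seteqP; split=> c /=.
 by move=> cc; apply/mapP; exists (exist _ c (mem_set cc)).
by move=> /mapP[d _ ->]; exact: cri_crit.
Qed.

Lemma cs_uniq : uniq cs. Proof. by rewrite map_inj_uniq//; exact: val_inj. Qed.

Lemma ends n : (@ord0 n <= @ord_max n)%N. Proof. exact: leq0n. Qed.

Definition mor n (v : 'I_n.+1 -> cri f) (F : fct n v) (i j : 'I_n.+1) (ij : (i <= j)%N) : broken (f := f) (v i) (v j) :=
 (val F : forall e : arrow n, broken (v (val e).1) (v (val e).2)) (arr ij).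

(** By [bl_mor] every other morphism of the functor is cut out of this line, so the line and the
    vertices determine the functor. *)
Definition total n (v : 'I_n.+1 -> cri f) (F : fct n v) : crv := bl (mor F (ends n)).

Lemma mor_cat n (v : 'I_n.+1 -> cri f) (F : fct n v) (i j k : 'I_n.+1) (ij : (i <= j)%N) (jk : (j <= k)%N) (ik : (i <= k)%N) :
 broken_cat (mor F ij) (mor F jk) = mor F ik.
Proof. have [_ H] := set_mem (valP F); exact: H. Qed.
Lemma mor_val n (v : 'I_n.+1 -> cri f) (F : fct n v) (e : arrow n) :
 mor F (valP e) = (val F : forall e : arrow n, broken (v (val e).1) (v (val e).2)) e.
Proof. by rewrite /mor; case: e (valP _) => -[i j] ij /= ij'; rewrite /arr (bool_irrelevance ij' ij). Qed.
Lemma vtx_hgt n (v : 'I_n.+1 -> cri f) (F : fct n v) (i j : 'I_n.+1) : (i <= j)%N -> f (val (v j)) <= f (val (v i)).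
Proof. by move=> ij; exact: (broken_le fS (mor F ij)). Qed.

Lemma bl_mor n (v : 'I_n.+1 -> cri f) (F : fct n v) (i j : 'I_n.+1) (ij : (i <= j)%N) :
 bl (mor F ij) = sub (total F) (val (v i)) (val (v j)).
Proof.
have i0 : (@ord0 n <= i)%N by []. have jn : (j <= @ord_max n)%N by exact: leq_ord.
have i_n : (i <= @ord_max n)%N by exact: leq_ord.
rewrite /total -(mor_cat F i0 i_n) bl_cat -above_below; last exact: vtx_hgt.
by rewrite (below_join (bl_line _ _ _ _) (bl_line _ _ _ _)) -(mor_cat F ij jn) bl_cat (above_join _ (bl_line _ _ _ _)).
Qed.

Lemma total_line n (v : 'I_n.+1 -> cri f) (F : fct n v) : line (val (v ord0)) (val (v ord_max)) (total F).
Proof. exact: bl_line. Qed.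

Lemma total_vtx n (v : 'I_n.+1 -> cri f) (F : fct n v) i : total F (f (val (v i))) = val (v i).
Proof.
have i0 : (@ord0 n <= i)%N by []. have i_n : (i <= @ord_max n)%N by exact: leq_ord.
rewrite /total -(mor_cat F i0 i_n) bl_cat; exact: (join_break _ (bl_line fS cM fN (mor F i0))).
Qed.

Lemma functors_eq n (v v' : 'I_n.+1 -> cri f) (F : fct n v) (F' : fct n v') :
 (forall i, v i = v' i) -> total F = total F' ->
 fam n v F = fam n v' F'.
Proof.
move=> vE; have {}vE : v = v' by exact/funext.
subst v' => E; congr existT; apply: val_inj; apply: functional_extensionality_dep => -[[i j] ij].
apply: (@bl_inj R m M f fS cM fN); rewrite -/(arr ij).
by have := bl_mor F ij; rewrite E -bl_mor; exact.
Qed.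

Lemma functors_exist n (v : 'I_n.+1 -> cri f) (g : R -> M) : line (val (v ord0)) (val (v ord_max)) g ->
 (forall i, g (f (val (v i))) = val (v i)) -> (forall i j : 'I_n.+1, (i <= j)%N -> f (val (v j)) <= f (val (v i))) ->
 exists F : fct n v, total F = g.
Proof.
move=> gl gv vm.
have sl (i j : 'I_n.+1) : (i <= j)%N -> line (val (v i)) (val (v j)) (sub g (val (v i)) (val (v j))).
 move=> ij; have h1 := vm _ _ ij; have h2 : f (val (v ord_max)) <= f (val (v j)) by exact/vm/leq_ord.
 have h3 : f (val (v i)) <= f (val (v ord0)) by exact: vm.
 have l1 : line (val (v ord0)) (val (v j)) (above G (val (v j)) g).
  by apply: (@line_above R M hM cM G _ _ _ _ (@cri_crit R m M f (v j)) gl (gv j)); rewrite h2 (le_trans h1 h3).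
 apply: (@line_below R M hM cM G _ _ _ _ (@cri_crit R m M f (v i)) l1); last by rewrite h1 h3.
 by rewrite /above max_l// gv.
have ch (e : arrow n) : exists B : broken (f := f) (v (val e).1) (v (val e).2), bl B = sub g (val (v (val e).1)) (val (v (val e).2)).
 exact: (bl_onto bowl_order (sl _ _ (valP e))).
pose F0 (e : arrow n) : @Defs.hom C (v (val e).1) (v (val e).2) := sval (cid (ch e)).
have F0E (e : arrow n) : bl (F0 e : broken (v (val e).1) (v (val e).2)) = sub g (val (v (val e).1)) (val (v (val e).2)) by rewrite /F0; case: cid.
have F0P : F0 \in fct n v.
 apply: mem_set; split=> [i ii|i j k ij jk ik]; first exact: (broken_refl fS).
 apply: (@bl_inj R m M f fS cM fN).
 rewrite [LHS]bl_cat (F0E (arr ij)) (F0E (arr jk)) (F0E (arr ik)) /=; apply/funext => h; rewrite /join /below /above.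
 have ji := vm _ _ ij; have kj := vm _ _ jk.
 have [h1|h1] := leP (f (val (v j))) h.
  by congr g; have [h2|h2] := leP h (f (val (v i))); rewrite ?(max_l h1) ?(max_l ji) ?max_l// ?(le_trans kj)// (le_trans kj ji).
 by congr g; rewrite (min_l (ltW (lt_le_trans h1 ji))).
exists (exist _ F0 F0P); transitivity (bl (F0 (arr (ends n)) : broken (f := f) (v ord0) (v ord_max))); first by [].
rewrite (F0E (arr (ends n))) /=; apply/funext => h; rewrite /below /above.
have [h1|/ltW h1] := leP h (f (val (v ord0))); last by rewrite max_l ?(line1 gl)//; exact/vm/leq_ord.
by have [//|/ltW h2] := leP (f (val (v ord_max))) h; rewrite !(line0 gl).
Qed.

(** Vertices repeat in degenerate simplices; the barycentric coordinates of equal vertices are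
    added. *)
Definition wt n (v : 'I_n.+1 -> cri f) (u : 'rV[R]_n.+1) (c : M) : R := \sum_(i | val (v i) == c) u ord0 i.

Lemma wt_supp n (v : 'I_n.+1 -> cri f) (u : 'rV[R]_n.+1) c : wt v u c != 0 -> exists2 i, val (v i) = c & u ord0 i != 0.
Proof.
move=> wc; apply: contrapT => H; move/eqP: wc; apply; rewrite /wt big1// => i /eqP vi.
by apply/eqP/negPn/negP => ui; apply: H; exists i.
Qed.

Lemma total_mass n (v : 'I_n.+1 -> cri f) (F : fct n v) (u : spx n) : mass (total F) (wt v (val u)).
Proof.
have [u0 u1] := set_mem (valP u); split.
- by move=> c; apply: sumr_ge0.
- rewrite /wt (exchange_big_dep xpredT)//= -u1; apply: eq_bigr => i _.
 rewrite big_mkcond (big_rem (val (v i)))/=; last by apply/mapP; exists (v i).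
 rewrite eqxx big1_seq ?addr0// => c /andP[_]; rewrite mem_rem_uniq ?cs_uniq// inE => /andP[+ _].
 by rewrite eq_sym => /negbTE ->.
- by move=> c /wt_supp[i <- _]; split; [exact: cri_crit|exact: total_vtx].
Qed.

Definition cellmap (c : cells R (nerve C)) : M :=
 evl (total (tagged (tagged c).1)) (wt (tag (tagged c).1) (val (tagged c).2)).

Lemma total_map k n (t : Defs.monotone k n) (v : 'I_n.+1 -> cri f) (F : fct n v) :
 total (tagged (nerve_map t (fam n v F))) = sub (total F) (val (v (t ord0))) (val (v (t ord_max))).
Proof.
rewrite -(bl_mor F (Defs.mfunP t (ends k))) /total /mor /= /arrow_map /=; congr (bl (_ _)).
by congr arr; exact: bool_irrelevance.
Qed.

Lemma wt_push k n (t : Defs.monotone k n) (v : 'I_n.+1 -> cri f) (u : 'rV[R]_k.+1) : wt v (push_row t u) = wt (v \o t) u.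
Proof.
apply/funext => c; rewrite /wt; under eq_bigr do rewrite mxE.
rewrite (exchange_big_dep (fun i => val (v (t i)) == c))/=; last by move=> j i vj /eqP ->.
apply: eq_bigr => i vi; rewrite (big_pred1 (t i)) => [//|j].
by rewrite /= andbC eq_sym; case: eqP => // ->.
Qed.

(** Pushing barycentric coordinates forward does not change the masses. Pulling back the simplex
    cuts its line at the images of the first and the last vertex, and no mass lies beyond these. *)
Lemma cellmap_glued c d : glued c d -> cellmap c = cellmap d.
Proof.
case=> k n t [v F] u; rewrite /cellmap /= wt_push.
have tm : mass (total F) (wt (v \o t) (val u)) by have := total_mass F (Defs.push t u); rewrite /= wt_push.
rewrite (total_map t F); have [] // := @evl_sub R M G cs csE th (total F) (wt (v \o t) (val u)) (val (v (t ord0))) (val (v (t ord_max))) tm.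
move=> c' /wt_supp[i <- _] /=; apply/andP; split; apply: (vtx_hgt F); apply: (Defs.mfunP t) => //; exact: leq_ord.
Qed.

Lemma wt_cts n (v : 'I_n.+1 -> cri f) : continuous (fun u : spx n => wt v (val u) : wts).
Proof.
move=> u; suff H : cts setT (fun u : spx n => wt v (val u) : wts).
 by move=> W uW; have := H u W I uW; apply: filterS => y; exact.
apply: cts_prod => c; apply: ctsT; rewrite /wt.
apply: (@continuous_big R _ +%R 0 _ (@add_continuous R) _ _ (fun i (u : spx n) => val u ord0 i)) => i _ y.
apply: (ccomp (fun u : spx n => val u) (fun z : 'rV[R]_n.+1 => z ord0 i)); last exact: coord_continuous.
exact: initial_continuous.
Qed.

Lemma total_cts n (v : 'I_n.+1 -> cri f) : continuous (@total n v).
Proof.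
move=> F; apply: (ccomp (fun F : fct n v => mor F (ends n) : moduli_bar a (v ord0) (v ord_max))
 (fun B : moduli_bar a (v ord0) (v ord_max) => bl (B : broken _ _) : crv)); last exact: (@bl_cts R m M f fS cM fN a a_level).
exact: (@initial_component _ _ _ (fun F : fct n v => val F) (arr (ends n))).
Qed.

Lemma cellmap_cts : continuous cellmap.
Proof.
move=> [n [[v F] u]] W cW.
have H : cts setT (fun Fu : fct n v * spx n => evl (total Fu.1) (wt v (val Fu.2))).
 apply: (@cts_comp _ _ _ _ [set x : crv * wts | line (val (v ord0)) (val (v ord_max)) x.1 /\ mass x.1 x.2]
   (fun Fu : fct n v * spx n => (total Fu.1, wt v (val Fu.2)) : crv * wts) (fun x => evl x.1 x.2)).
 - apply: cts_pair; apply: ctsT => z.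
   by apply: (ccomp fst (@total n v)); [exact: cvg_fst|exact: total_cts].
  by apply: (ccomp snd (fun u : spx n => wt v (val u) : wts)); [exact: cvg_snd|exact: wt_cts].
 - by move=> [F' u'] _; split; [exact: total_line|exact: total_mass].
 - exact: (evl_cts hM csE cs_uniq thB (@cri_crit R m M f (v ord0)) (@cri_crit R m M f (v ord_max))).
have [[A B] /= [FA uB] AB] := H (F, u) W I cW.
exists (fam n v @` A, B) => /=.
 by split=> //; exact: existT_nbhs.
by move=> [y u'] /= [[F' AF' <-] Bu']; exact: (AB (F', u')).
Qed.

Definition cover (n : nat) (v : 'I_n.+1 -> cri f) : set crv :=
 [set g : crv | line (val (v ord0)) (val (v ord_max)) g /\ forall i, g (f (val (v i))) = val (v i)].

Lemma cover_cpt n v : compact (@cover n v).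
Proof.
apply: (@subclosed_compact _ (cover v) (line (val (v ord0)) (val (v ord_max)) : set crv)); last by move=> g [].
 rewrite (_ : cover v = (line (val (v ord0)) (val (v ord_max)) : set crv) `&` \bigcap_i [set g : crv | g (f (val (v i))) = val (v i)]).
  apply: closedI; first exact: line_closed.
  apply: closed_bigI => i _; apply: (@preimage_closed _ _ (fun g : crv => g (f (val (v i)))) [set val (v i)]).
  - by move=> g _; exact: curve_eval.
  - by apply: (compact_closed hM); exact: compact_set1.
 by apply/seteqP; split=> [g [gl gv]|g [gl gv]]; (split=> //) => i; [by move=> _; exact: gv|exact: gv i I].
exact: line_cpt.
Qed.

(** A continuous image of the compact set of lines that pass through all the vertices. *)
Lemma functors_cpt n (v : 'I_n.+1 -> cri f) : (forall i j : 'I_n.+1, (i <= j)%N -> f (val (v j)) <= f (val (v i))) ->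
 compact [set: fct n v].
Proof.
move=> vm; have [[F0 _]|no] := pselect (exists F : fct n v, True); last first.
 rewrite (_ : [set: _] = set0); first exact: compact0.
 by apply/seteqP; split=> // F _; apply: no; exists F.
have ch (g : crv) : exists F : fct n v, cover v g -> total F = g.
 have [[gl gv]|ng] := pselect (cover v g); last by exists F0.
 by have [F FE] := functors_exist gl gv vm; exists F.
have [D DE] := choice ch.
have -> : [set: fct n v] = D @` cover v.
 apply/seteqP; split=> // F _; exists (total F); first by split; [exact: total_line|exact: total_vtx].
 have tE : total (D (total F)) = total F by apply: DE; split; [exact: total_line|exact: total_vtx].
 exact: eq_from_Tagged (functors_eq (fun i => erefl) tE).
apply: cpt_cts_image; first exact: cover_cpt.
apply: cts_initial; apply: cts_prod => e; apply: cts_initial; apply: cts_prod => cc.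
apply: (cts_eq (f := fun g : crv => sub g (val (v (val e).1)) (val (v (val e).2)) (a (val cc).1 (val cc).2))).
 move=> g gK; have := bl_mor (D g) (valP e); rewrite DE// => <-.
 by rewrite (evaluation_bl fS cM fN a_level) mor_val.
by apply: ctsT; exact: curve_eval.
Qed.

Lemma simplex_cpt n : compact [set: spx n].
Proof.
have Sc : compact (spx n : set 'rV[R]_n.+1).
 apply: (@subclosed_compact _ _ [set u : 'rV[R]_n.+1 | forall i, `[0, 1]%classic (u ord0 i)]).
 - rewrite (_ : spx n = (\bigcap_i [set u : 'rV[R]_n.+1 | 0 <= u ord0 i]) `&` [set u | \sum_i u ord0 i = 1]).
   apply: closedI.
    apply: closed_bigI => i _; apply: (@preimage_closed _ _ (fun u : 'rV[R]_n.+1 => u ord0 i) [set x | 0 <= x]); last exact: closed_ge.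
    by move=> u _; exact: coord_continuous.
   apply: (@preimage_closed _ _ (fun u : 'rV[R]_n.+1 => \sum_i u ord0 i) [set 1]); last exact: closed_eq.
   by move=> u _; apply: (@continuous_big _ _ _ _ _ _ _ _ (fun i (u : 'rV[R]_n.+1) => u ord0 i)); [exact: add_continuous|move=> i _; exact: coord_continuous].
  by apply/seteqP; split=> u [u0 u1]; split=> //; [move=> i _; exact: u0|move=> i; exact: u0 i I].
 - by apply: (@rV_compact R n.+1 (fun=> `[0, 1]%classic)) => i; exact: segment_compact.
 - move=> u [u0 u1] i; rewrite /= in_itv/= u0 -u1 (bigD1 i)//= lerDl; exact: sumr_ge0.
have ch (u : 'rV[R]_n.+1) : exists y : spx n, spx n u -> val y = u.
 have [uS|nS] := pselect (spx n u); first by exists (exist _ u (mem_set uS)).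
 have dS : spx n (delta_mx ord0 ord0).
  split=> [i|]; first by rewrite mxE ler0n.
  by rewrite (bigD1 ord0)//= mxE !eqxx big1 ?addr0// => i /negbTE i0; rewrite mxE i0 andbF.
 by exists (exist (fun w => w \in spx n) _ (mem_set dS)).
have [D DE] := choice ch.
have -> : [set: spx n] = D @` (spx n : set 'rV[R]_n.+1).
 by apply/seteqP; split=> // y _; exists (val y); [exact: set_valP|apply: val_inj; apply: DE; exact: set_valP].
apply: cpt_cts_image Sc _; apply: cts_initial.
by apply: (cts_eq (f := fun u : 'rV[R]_n.+1 => u)) => [u uS|]; [exact/esym/DE|exact: cts_id].
Qed.

Notation BC := (classifying_space R C).
Notation pr := (\pi_BC%qT : cells R (nerve C) -> BC).

Lemma pr_glued c d : glued c d -> pr c = pr d.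
Proof. by move=> cd; apply/eqmodP/asboolP; exact: rst_step. Qed.

Definition clps (x : BC) : M := cellmap (repr x).

Lemma cellmap_equiv c d : pr c = pr d -> cellmap c = cellmap d.
Proof.
move/eqmodP => /asboolP; elim=> // [{}c {}d|{}c {}d e _ -> _ ->//]; exact: cellmap_glued.
Qed.

Lemma clps_pr c : clps (pr c) = cellmap c.
Proof. by apply: cellmap_equiv; rewrite reprK. Qed.

Lemma clps_cts : continuous clps.
Proof.
apply/quotient_continuous; rewrite (_ : _ \o _ = cellmap); first exact: cellmap_cts.
by apply/funext => c; exact: clps_pr.
Qed.

(* The cell of the chain of critical points carrying the mass t. *)
Definition reduced (P Q : M) (g : crv) (t : M -> R) k (v : 'I_k.+1 -> cri f) (F : fct k v) (w : spx k) : Prop :=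
 [/\ (forall i j : 'I_k.+1, (i < j)%N -> f (val (v j)) < f (val (v i))),
   (forall c, t c != 0 <-> exists i, val (v i) = c), total F = g, (forall i, val w ord0 i = t (val (v i))) &
   val (v ord0) = P /\ val (v ord_max) = Q].

Lemma wtd_span P Q g t : wtd P Q g t -> span G P Q t.
Proof.
move=> [Pc Qc gl tm [tP tQ]]; split=> // c /(mass_supp tm)[cc gc].
by have := line_ge (f c) gl; rewrite gc.
Qed.

Lemma reduced_ex P Q g t : wtd P Q g t ->
 exists k (v : 'I_k.+1 -> cri f) (F : fct k v) (w : spx k), reduced P Q g t F w.
Proof.
move=> tw; have [Pc Qc gl tm [tP tQ]] := tw; have [_ _ sp] := wtd_span tw.
pose l := [seq c <- csr | t (val c) != 0].
have lg c : c \in l -> g (f (val c)) = val c by rewrite mem_filter => /andP[/(mass_supp tm)[]].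
have [||L [Ll uL dL]] := @desc_sort R _ (f \o val) l; first by rewrite filter_uniq.
 by move=> c d /lg gc /lg gd /= e; apply: val_inj; rewrite -gc -gd e.
have mL c : (c \in L) = (t (val c) != 0) by rewrite (perm_mem Ll) mem_filter csrP andbT.
pose P' : cri f := exist _ P (mem_set Pc); pose Q' : cri f := exist _ Q (mem_set Qc).
have PL : P' \in L by rewrite mL/= gt_eqF.
have QL : Q' \in L by rewrite mL/= gt_eqF.
have [k kE] : exists k, size L = k.+1 by case: (L) PL => // x s _; exists (size s).
pose v (i : 'I_k.+1) := nth P' L i.
have vL i : v i \in L by rewrite mem_nth// kE.
have dv : forall (L : seq (cri f)) i j, desc (f \o val) L -> (i < j)%N -> (j < size L)%N -> f (val (nth P' L j)) < f (val (nth P' L i)).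
 elim=> // x s IH [|i] [|j] //= [dx ds] ij js; last exact: IH.
 by apply: dx; rewrite mem_nth.
have vs (i j : 'I_k.+1) : (i < j)%N -> f (val (v j)) < f (val (v i)) by move=> ij; apply: dv => //; rewrite kE.
have vm (i j : 'I_k.+1) : (i <= j)%N -> f (val (v j)) <= f (val (v i)).
 by rewrite leq_eqVlt => /orP[/eqP/val_inj->//|/vs/ltW].
have vg i : g (f (val (v i))) = val (v i) by have := vL i; rewrite mL => /(mass_supp tm)[].
have exv c : c \in L -> exists i, v i = c.
 move=> cL; have iL : (index c L < k.+1)%N by rewrite -kE index_mem.
 by exists (Ordinal iL); rewrite /v /= nth_index.
have v0 : val (v ord0) = P.
 have [i iE] := exv _ PL; have h1 : f P <= f (val (v ord0)) by rewrite -[P]/(val P') -iE; exact: vm.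
 have /andP[_ h2] : f Q <= f (val (v ord0)) <= f P by apply: sp; rewrite -mL.
 by rewrite -vg (_ : f (val (v ord0)) = f P) ?(line1 gl)//; apply/eqP; rewrite eq_le h2.
have vn : val (v ord_max) = Q.
 have [i iE] := exv _ QL; have h1 : f (val (v ord_max)) <= f Q by rewrite -[Q]/(val Q') -iE; apply: vm; exact: leq_ord.
 have /andP[h2 _] : f Q <= f (val (v ord_max)) <= f P by apply: sp; rewrite -mL.
 by rewrite -vg (_ : f (val (v ord_max)) = f Q) ?(line0 gl)//; apply/eqP; rewrite eq_le h2 h1.
have [|F FE] := @functors_exist k v g _ vg vm; first by rewrite v0 vn.
have inj_v : injective v.
 move=> i j e; case: (ltngtP i j) => [/vs|/vs|/val_inj//]; by rewrite e ltxx.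
have wS : spx k (\row_i t (val (v i))).
 split=> [i|]; first by rewrite mxE; exact: mass_ge0 tm _.
 under eq_bigr do rewrite mxE.
 rewrite -(mass1 tm) big_map (bigID (fun c : cri f => t (val c) != 0))/= [X in _ + X]big1 ?addr0; last by move=> c /negPn/eqP.
 have -> : \sum_(c <- csr | t (val c) != 0) t (val c) = \sum_(c <- L) t (val c) by rewrite -big_filter; exact/esym/perm_big.
 by rewrite (big_nth P') kE big_mkord.
exists k, v, F, (exist (fun w => w \in spx k) _ (mem_set wS)); split=> //= [c|i]; last by rewrite mxE.
split=> [tc|[i <-]]; last by rewrite -mL.
have [cc _] := mass_supp tm tc; have [|i iE] := exv (exist _ c (mem_set cc)); first by rewrite mL.
by exists i; rewrite iE.
Qed.

(** Both cells are identified with a third one. The map [e1] fixes the vertices with nonzero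
    coordinate and sends the others to such a vertex, so it pushes u to u; [s] sends a vertex to the
    place of its image in the reduced chain, so it pushes u to w. The pullbacks of the two simplices
    along [e1] and [s] coincide. *)
Lemma cell_reduced P Q n (v : 'I_n.+1 -> cri f) (F : fct n v) (u : spx n) k (vy : 'I_k.+1 -> cri f) (Fy : fct k vy) w :
 span G P Q (wt v (val u)) -> reduced P Q (sub (total F) P Q) (wt v (val u)) Fy w ->
 pr (cell (fam n v F : nerve C n) u) = pr (cell (fam k vy Fy : nerve C k) w).
Proof.
move=> ts [vys ysupp totE wE [y0 yn]]; set t := wt v (val u) in ts ysupp totE wE.
have [tP tQ sp] := ts; have tm := total_mass F u; rewrite -/t in tm.
have [u0 u1] := set_mem (valP u).
have supp i : val u ord0 i != 0 -> t (val (v i)) != 0.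
 move=> ui; rewrite gt_eqF// /t /wt (bigD1 i)//= ltr_pwDl//; last by apply: sumr_ge0.
 by rewrite lt_neqAle eq_sym ui u0.
have exi c : t c != 0 -> exists2 i, val (v i) = c & val u ord0 i != 0 by exact: wt_supp.
(* The first vertex with nonzero coordinate. A vertex goes to the last such vertex at or before it,
   and the vertices before [i0] go to [i0]. *)
have [i0 i0u i0m] : exists2 i0 : 'I_n.+1, val u ord0 i0 != 0 & forall j, val u ord0 j != 0 -> (i0 <= j)%N.
 have [i _ iu] := exi P (lt0r_neq0 tP).
 by case: (arg_minnP (fun j : 'I_n.+1 => val j) (i0 := i) (P := fun j => val u ord0 j != 0) iu) => j ju jm; exists j.
have e1P (i : 'I_n.+1) : exists j : 'I_n.+1, [/\ val u ord0 j != 0, (j <= i)%N || (j == i0) &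
  forall j', val u ord0 j' != 0 -> (j' <= i)%N || (j' == i0) -> (j' <= j)%N].
 have h0 : (val u ord0 i0 != 0) && ((i0 <= i)%N || (i0 == i0)) by rewrite i0u eqxx orbT.
 case: (arg_maxnP (fun j : 'I_n.+1 => val j) (i0 := i0) (P := fun j => (val u ord0 j != 0) && ((j <= i)%N || (j == i0))) h0) => j /andP[ju ji] jm.
 by exists j; split=> // j' h1 h2; apply: jm; rewrite h1.
have [e1 e1E] := choice e1P.
have e1m : {homo e1 : i j / (i <= j)%N}.
 move=> i j ij; have [h1 h2 _] := e1E i; have [_ _ h3] := e1E j; apply: h3 => //.
 by move: h2 => /orP[h2|->]; rewrite ?orbT// (leq_trans h2 ij).
have e1id i : val u ord0 i != 0 -> e1 i = i.
 move=> ui; have [h1 h2 h3] := e1E i; apply: val_inj; apply/eqP; rewrite eqn_leq h3 ?leqnn// andbT.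
 by move: h2 => /orP[//|/eqP->]; exact: i0m.
pose e1t := @Monotone n n e1 e1m.
have sig (i : 'I_n.+1) : exists j, vy j = v (e1 i).
 by have [h _ _] := e1E i; have [j jE] := (ysupp _).1 (supp _ h); exists j; exact: val_inj.
have [s sE] := choice sig.
have sm : {homo s : i j / (i <= j)%N}.
 move=> i j ij; rewrite leqNgt; apply/negP => /vys; rewrite !sE.
 by rewrite ltNge (vtx_hgt F (e1m _ _ ij)).
pose st := @Monotone n k s sm.
have vyi : injective vy by move=> i j e; case: (ltngtP i j) => [/vys|/vys|/val_inj//]; rewrite e ltxx.
have p1 : Defs.push e1t u = u.
 apply: val_inj; apply/rowP => j; rewrite mxE; have [uj|/negPn/eqP uj] := boolP (val u ord0 j != 0).
  rewrite (bigD1 j)/=; last by rewrite e1id.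
  rewrite big1 ?addr0// => i /andP[/eqP ij nij]; apply/eqP/negPn/negP => /e1id ei.
  by move: nij; rewrite -ij ei eqxx.
 rewrite uj big1// => i /eqP ij; apply/eqP/negPn/negP => ui; move: (ui); have {}ij : e1 i = j := ij; rewrite -(e1id i ui) ij uj eqxx.
 by [].
have p2 : Defs.push st u = w.
 apply: val_inj; apply/rowP => j; rewrite mxE wE /t /wt.
 rewrite big_mkcond [RHS]big_mkcond; apply: eq_bigr => i _ /=.
 have [->|ui] := eqVneq (val u ord0 i) 0; first by rewrite !if_same.
 congr (if _ then _ else _); have := sE i; rewrite e1id// => <-.
 by apply/eqP/eqP => [->//|/val_inj/vyi].
have e10 : val (v (e1 ord0)) = P.
 have -> : e1 ord0 = i0.
  have [h1 h2 _] := e1E ord0; apply: val_inj; apply/eqP; rewrite eqn_leq i0m// andbT.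
  by case/orP: h2 => [h2|/eqP->//]; exact: leq_trans h2 _.
 have [i iP iu] := exi P (lt0r_neq0 tP); have /andP[_ h] := sp _ (supp _ i0u).
 have h' := vtx_hgt F (i0m _ iu); rewrite iP in h'.
 have e : f (val (v i0)) = f P by apply/eqP; rewrite eq_le h.
 by rewrite -(total_vtx F i0) e -iP total_vtx.
have e1n : val (v (e1 ord_max)) = Q.
 have [i iQ iu] := exi Q (lt0r_neq0 tQ); have [h1 _ h3] := e1E ord_max.
 have /andP[h _] := sp _ (supp _ h1).
 have h' : f (val (v (e1 ord_max))) <= f Q by rewrite -iQ; apply: (vtx_hgt F); apply: h3 => //; rewrite leq_ord.
 have e : f (val (v (e1 ord_max))) = f Q by apply/eqP; rewrite eq_le h'.
 by rewrite -(total_vtx F (e1 ord_max)) e -iQ total_vtx.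
have E1 : pr (cell (fam n v F : nerve C n) u) =
  pr (cell (smap e1t (fam n v F : nerve C n)) u).
 by rewrite -[in LHS]p1; exact: pr_glued (Glued e1t _ u).
have E2 : pr (cell (fam k vy Fy : nerve C k) w) =
  pr (cell (smap st (fam k vy Fy : nerve C k)) u).
 by rewrite -p2; exact: pr_glued (Glued st _ u).
rewrite E1 E2; congr (pr (cell _ u)); apply: functors_eq => [i|]; first by rewrite /= sE.
have := total_map e1t F; have := total_map st Fy; rewrite /= !sE e10 e1n totE => EY EF.
rewrite [LHS]EF [RHS]EY; have gl : line P Q (sub (total F) P Q).
 by rewrite -{1}totE -y0 -yn; exact: total_line.
apply/funext => h; rewrite [RHS]/below /above; set g := below _ _ _ in gl *.
have [h1|/ltW h1] := leP h (f P); last by rewrite (line1 gl)// max_l ?(line1 gl)//; exact: line_le gl.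
by have [//|/ltW h2] := leP (f Q) h; rewrite !(line0 gl).
Qed.

Lemma cell_normal c : exists P Q g t, [/\ wtd P Q g t, cellmap c = Phi G cs th P Q g t &
 forall k (v : 'I_k.+1 -> cri f) (F : fct k v) (w : spx k), reduced P Q g t F w ->
  pr c = pr (cell (fam k v F : nerve C k) w)].
Proof.
case: c => n [[v F] u]; have tm := total_mass F u; have [P [Q [ts E]]] := evlP csE th tm.
exists P, Q, (sub (total F) P Q), (wt v (val u)); split; [|exact: E|by move=> k vy Fy w; exact: cell_reduced].
exact: (span_weighted hM (total_line F) tm ts).
Qed.

(** By [Phi_inj] equal images have the same line and masses, and these determine the reduced cell up
    to gluing. *)
Lemma clps_inj : injective clps.
Proof.
move=> x y; rewrite -[x]reprK -[y]reprK !clps_pr.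
have [P [Q [g [t [tw -> N1]]]]] := cell_normal (repr x); have [P' [Q' [g' [t' [tw' -> N2]]]]] := cell_normal (repr y).
move=> /(Phi_inj hM csE cs_uniq thB tw tw')[eP eQ eg et]; subst P' Q' g' t'.
by have [k [v [F [w red]]]] := reduced_ex tw; rewrite (N1 _ _ _ _ red) (N2 _ _ _ _ red).
Qed.

Lemma clps_onto y : exists x, clps x = y.
Proof.
have [P [Q [g [t [tw <-]]]]] := Phi_onto hM csE cs_uniq thB y.
have [k [v [F [w [vs ts gE wE _]]]]] := reduced_ex tw; have [_ _ _ tm _] := tw.
exists (pr (cell (fam k v F : nerve C k) w)); rewrite clps_pr /cellmap /= gE.
have -> : wt v (val w) = t.
 apply/funext => c; rewrite /wt; have [tc|tc] := eqVneq (t c) 0.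
  by rewrite tc big1// => i /eqP vi; rewrite wE vi.
 have [i iE] := (ts c).1 tc; rewrite (big_pred1 i) ?wE ?iE// => j /=.
 apply/eqP/eqP => [|->//]; rewrite -iE => /val_inj e.
 by case: (ltngtP j i) => [/vs|/vs|/val_inj//]; rewrite e ltxx.
exact/esym/(evl_tht hM csE cs_uniq thB (shr_dom csE tw) tm (fun r _ => shr_rel csE r tm)).
Qed.

Lemma cpt_bigcup_fin (T : topologicalType) (I : finType) (A : I -> set T) : (forall i, compact (A i)) -> compact (\bigcup_i A i).
Proof.
move=> Ac; rewrite (_ : \bigcup_i A i = \big[setU/set0]_(i <- enum I) A i); first exact: bigsetU_compact.
by rewrite -bigcup_seq; apply/seteqP; split=> y [i _ Ai]; exists i => //=; rewrite mem_enum.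
Qed.

(** Reduced chains have distinct vertices, so finitely many chains cover the space, and each
    contributes the image of a compact product of functors and a simplex. *)
Lemma classifying_cpt : compact [set: BC].
Proof.
(* Chains of vertices are encoded by functions into the index set of [csr], which form a finite
   type. *)
pose V (k : nat) (s : {ffun 'I_k.+1 -> 'I_(size csr)}) (i : 'I_k.+1) : cri f := tnth (in_tuple csr) (s i).
pose A (k : nat) s : set BC := [set y | (forall i j : 'I_k.+1, (i <= j)%N -> f (val (V k s j)) <= f (val (V k s i))) /\
  exists (F : fct k (V k s)) u, y = pr (cell (fam k (V k s) F : nerve C k) u)].
have Ac k s : compact (A k s).
 have [vm|nvm] := pselect (forall i j : 'I_k.+1, (i <= j)%N -> f (val (V k s j)) <= f (val (V k s i))); last first.
  by rewrite (_ : A k s = set0); [exact: compact0|apply/seteqP; split=> y // []].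
 pose D (Fu : fct k (V k s) * spx k) : BC := pr (cell (fam k (V k s) Fu.1 : nerve C k) Fu.2).
 rewrite (_ : A k s = D @` ([set: fct k (V k s)] `*` [set: spx k])); last first.
  apply/seteqP; split=> y; first by move=> [_ [F [u ->]]]; exists (F, u).
  by move=> [[F u] _ <-]; split=> //; exists F, u.
 apply: cpt_cts_image; first by apply: compact_setX; [exact: functors_cpt|exact: simplex_cpt].
 apply: ctsT => -[F u]; apply: (ccomp (fun Fu : fct k (V k s) * spx k =>
  cell (fam k (V k s) Fu.1 : nerve C k) Fu.2) pr); last exact: pi_continuous.
 move=> W nW; have [[U1 U2] /= [FU uU] UW] : nbhs ((fam k (V k s) F : nerve C k), u)
   [set z | W (existT (fun n => (nerve C n * spx n)%type) k z)] by exact: nW.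
 by exists ((fun F => fam k (V k s) F) @^-1` U1, U2) => //= -[F' u'] [/= h1 h2]; exact: (UW (fam k (V k s) F', u') (conj h1 h2)).
rewrite (_ : [set: BC] = \bigcup_(k in [set: 'I_(size csr)]) \bigcup_s A k s).
 by apply: cpt_bigcup_fin => k; apply: cpt_bigcup_fin => s; exact: Ac.
apply/seteqP; split=> // x _; have [P [Q [g [t [tw _ N]]]]] := cell_normal (repr x).
have [k [v [F [w red]]]] := reduced_ex tw; have [vs _ _ _ _] := red.
have ksz : (k < size csr)%N.
 have vi : injective v by move=> i j e; case: (ltngtP i j) => [/vs|/vs|/val_inj//]; rewrite e ltxx.
 rewrite -[k.+1]card_ord -(size_codom v); apply: uniq_leq_size => [|c _]; last exact: csrP.
 by rewrite /codom map_inj_uniq// enum_uniq.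
have idx c : (index c csr < size csr)%N by rewrite index_mem csrP.
pose s := [ffun i => Ordinal (idx (v i))].
have vE : V k s = v by apply/funext => i; rewrite /V ffunE (tnth_nth (v i))/= nth_index.
exists (Ordinal ksz) => //; exists s => //; rewrite /A /= vE; split.
 by move=> i j ij; exact: (vtx_hgt F).
by exists F, w; rewrite -(N _ _ _ _ red) reprK.
Qed.

Lemma classifying_homeomorphic : homeomorphic BC M.
Proof.
have [k kE] := choice clps_onto; exists clps, k; split=> [x|//||].
- by apply: clps_inj; rewrite kE.
- exact: clps_cts.
have kK (x : BC) : [set: BC] x -> k (clps x) = x by move=> _; apply: clps_inj; rewrite kE.
have kc := inv_cts hM classifying_cpt (ctsT (A := setT) clps_cts) kK.
have inC y : (clps @` [set: BC]) y by exists (k y).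
by move=> y W kW; have := kc y W (inC y) kW; apply: filterS => z; exact.
Qed.

End Classifying.

Theorem theorem1 (R : realType) (m : nat) (M : riemannian_manifold R m)
  (M_closed : compact [set: M]) (f : M -> R) (f_bowl : bowl f)
  (f_standard : standard_near_critical f)
  (a : R -> R -> R) (a_level : level_choice f a) :
 homeomorphic (classifying_space R (flow_category f_bowl a_level)) M.
Proof.
have hM := @carrier_hausdorff R m M.
pose fS := bowl_smooth f_bowl; pose G := mgrad fS M_closed f_standard.
have [_ trans _] := f_bowl.
have [s0 sE] := (finite_seqP _).1 (@crit_finite R M hM M_closed G).
pose csr : seq (cri f) := undup (pmap insub s0).
have csrP c : c \in csr.
 rewrite mem_undup mem_pmap_sub; have : [set` s0] (val c) by rewrite -sE; exact: cri_crit.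
 by [].
have csE : crit G = [set` [seq val c | c <- csr]].
 apply/seteqP; split=> c /=; first by move=> cc; apply/mapP; exists (exist _ c (mem_set cc)).
 by move=> /mapP[d _ ->]; exact: cri_crit.
have ch (pq : M * M) : exists mv, critical f pq.1 -> critical f pq.2 -> retraction M_closed G pq.1 pq.2 mv.
 have [pc|pc] := pselect (critical f pq.1); last by exists (fun x _ => x).
 have [qc|qc] := pselect (critical f pq.2); last by exists (fun x _ => x).
 by have [mv mvP] := retreat_ex fS M_closed f_standard trans pc qc; exists mv.
have [mv mvP] := choice ch.
have thB := tht_blending hM csE (mv := fun p q => mv (p, q)) (fun p q => mvP (p, q)).
exact: (@classifying_homeomorphic R m M M_closed f f_bowl f_standard a a_level csr csrP (undup_uniq _) _ thB).
Qed.
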